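(* Let $L>0$, $\rho>0$, $\mu>0$, and let $\Phi$ satisfy the assumptions on $\Phi$ listed in the context (with constant $\kappa>0$). Let $\{u_{0,n}\}_n\subset H^2(0,L)$ and $\{u_{1,n}\}_n\subset L^2(0,L)$. For each $n$ let $u_n$ be a dissipative solution (in the sense defined in the context) of $$\begin{cases} \rho\,\partial_{tt}^2 u_n=-\mu\,\partial_{xxxx}^4 u_n-\Phi'(u_n), & t>0,\ 0<x<L,\\ \partial_{xx}^2 u_n(t,0)=\partial_{xx}^2 u_n(t,L)=0, & t>0,\\ \partial_{xxx}^3 u_n(t,0)=\partial_{xxx}^3 u_n(t,L)=0, & t>0,\\ u_n(0,x)=u_{0,n}(x), & 0<x<L,\\ \partial_t u_n(0,x)=u_{1,n}(x), & 0<x<L, \end{cases}$$ and let $v_n$ be the dissipative solution of the linearized problem $$\begin{cases} \rho\,\partial_{tt}^2 v_n=-\mu\,\partial_{xxxx}^4 v_n, & t>0,\ 0<x<L,\\ \partial_{xx}^2 v_n(t,0)=\partial_{xx}^2 v_n(t,L)=0, & t>0,\\ \partial_{xxx}^3 v_n(t,0)=\partial_{xxx}^3 v_n(t,L)=0, & t>0,\\ v_n(0,x)=u_{0,n}(x), & 0<x<L,\\ \partial_t v_n(0,x)=u_{1,n}(x), & 0<x<L. \end{cases}$$ If $$u_{0,n}\rightharpoonup0\ \text{weakly in }H^2(0,L),\qquad u_{1,n}\rightharpoonup0\ \text{weakly in }L^2(0,L),$$ $$\limsup_{n}\int_0^L\frac{\rho u_{1,n}^2+\mu(\partial_{xx}^2u_{0,n})^2}{2}\,dx<\frac{4\kappa\mu}{\max\{3,2\kappa\}}\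 (\le2\mu),$$ then for every $T\ge0$ $$\|\partial_t(u_n-v_n)\|_{L^\infty(0,T;L^2(0,L))}+\|\partial_{xx}^2(u_n-v_n)\|_{L^\infty(0,T;L^2(0,L))}\to0\qquad\text{as }n\to\infty.$$
   Context: Assumptions on $\Phi$: $\Phi\in C(\mathbb{R})\cap C^2(\mathbb{R}\setminus\{1,-1\})$, $\Phi\ge 0$, $\Phi$ is constant in $(-\infty,-1]$ and in $[1,\infty)$, convex in $[-1,1]$, decreasing in $[-1,0]$, increasing in $[0,1]$, and $\Phi(u)\ge\kappa u^2$ in $[-1,1]$ for some constant $\kappa>0$. Moreover $\Phi'$ has jump discontinuities at $u=\pm1$, with finite one-sided limits $\Phi'(1^-)=\lim_{u\to1^-}\Phi'(u)$ and $\Phi'(-1^+)=\lim_{u\to-1^+}\Phi'(u)$; one has $\Phi'(u)=0$ for $|u|>1$, $0<\Phi'(u)\le\Phi'(1^-)$ for $0<u<1$, and $\Phi'(-1^+)\le\Phi'(u)<0$ for $-1<u<0$. Notation $h_u\in\partial\Phi'(u)$: for $u:[0,\infty)\times[0,L]\to\mathbb{R}$ this means that $h_u:[0,\infty)\times[0,L]\to\mathbb{R}$ is a (measurable) function with $h_u(t,x)=\Phi'(u(t,x))$ if $|u(t,x)|<1$; $h_u(t,x)=0$ if $|u(t,x)|>1$; $h_u(t,x)\in[0,\Phi'(1^-)]$ if $u(t,x)=1$; $h_u(t,x)\in[\Phi'(-1^+),0]$ if $u(t,x)=-1$. For initial data $u_0\in H^2(0,L)$, $u_1\in L^2(0,L)$,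 the energy is $E[u](t)=\int_0^L\left(\frac{\rho(\partial_t u(t,x))^2+\mu(\partial_{xx}^2u(t,x))^2}{2}+\Phi(u(t,x))\right)dx$, and $E[u](0)=\int_0^L\left(\frac{\rho u_1(x)^2+\mu(\partial_{xx}^2u_0(x))^2}{2}+\Phi(u_0(x))\right)dx$. Dissipative solution of the nonlinear problem with initial data $u_0,u_1$: a function $u:[0,\infty)\times[0,L]\to\mathbb{R}$ such that (i) $u\in C([0,\infty)\times[0,L])$; (ii) $\partial_t u,\ \partial_{xx}^2u\in L^\infty(0,\infty;L^2(0,L))$; (iii) $u$ is a weak solution: for some $h_u\in\partial\Phi'(u)$ and every test function $\varphi\in C^\infty(\mathbb{R}^2)$ with compact support, $$\int_0^\infty\!\!\int_0^L\left(\rho u\,\partial_{tt}^2\varphi+\mu\,\partial_{xx}^2u\,\partial_{xx}^2\varphi+h_u\varphi\right)dx\,dt-\int_0^L\rho u_1(x)\varphi(0,x)\,dx+\int_0^L\rho u_0(x)\,\partial_t\varphi(0,x)\,dx=0;$$ (iv) $E[u](t)\le E[u](0)$ for almost every $t>0$. A dissipative solution of the linearized problem is defined in the same way with $\Phi$ replaced by $0$ and $h_u$ replaced by $0$. *)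

(* Defs.v *)
From HB Require Import structures.
From mathcomp Require Import all_boot all_order all_algebra.
From mathcomp Require Import all_classical all_reals all_analysis.

Set Implicit Arguments.
Unset Strict Implicit.
Unset Printing Implicit Defensive.

Import Order.TTheory GRing.Theory Num.Theory.
Import numFieldNormedType.Exports.

Local Open Scope ring_scope.
Local Open Scope classical_set_scope.

(* Functions on [0, oo[ x [0, L] are total functions of p = (t, x) : R * R; only
   their values on the relevant domain matter. Similarly, functions on ]0, L[
   are total functions R -> R. *)

Section test_functions.
Context {R : realType} {V : normedModType R}.

Definition iter_derive (w : seq V) (phi : V -> R) : V -> R :=
  foldr (fun v f => 'D_v f) phi w.

(* On a finite-dimensional V, having continuous iterated directional
   derivatives of every order is the same as being of class C^oo. *)
Definition smooth (phi : V -> R) : Prop :=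
  forall w : seq V, continuous (iter_derive w phi) /\
    forall p v : V, derivable (iter_derive w phi) p v.

Definition tsupport (phi : V -> R) : set V := closure [set p | phi p != 0].

Definition test_function (D : set V) (phi : V -> R) : Prop :=
  [/\ smooth phi, compact (tsupport phi) & tsupport phi `<=` D].

End test_functions.

Section one_dimensional.
Context {R : realType}.
Implicit Types (L : R) (f g : R -> R) (k : nat).
Local Notation leb := (@lebesgue_measure R).

Definition is_wderive L k f g : Prop :=
  [/\ locally_integrable `]0, L[ f, locally_integrable `]0, L[ g &
    forall phi : R -> R, test_function `]0, L[ phi ->
      \int[leb]_(x in `]0, L[) (f x * derive1n k phi x) =
      (-1) ^+ k * \int[leb]_(x in `]0, L[) (g x * phi x)].

(* Some representative of the k-th weak derivative (it is a.e. unique); junk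
   value 0 when there is none. *)
Definition wderive L k f : R -> R := xget (fun=> 0) [set g | is_wderive L k f g].

Definition L2 L : set (R -> R) :=
  [set f | f \_ `]0, L[ \in Lfun leb 2%:E].

Definition L2norm L f : R := fine ('N[leb]_2%:E[EFin \o f \_ `]0%R, L[])%E.

Definition H2 L : set (R -> R) :=
  [set f | [/\ L2 L f,
               exists2 g, is_wderive L 1 f g & L2 L g &
               exists2 g, is_wderive L 2 f g & L2 L g]].

Definition H2norm L f : R :=
  Num.sqrt (L2norm L f ^+ 2 + L2norm L (wderive L 1 f) ^+ 2
            + L2norm L (wderive L 2 f) ^+ 2).

(* Weak convergence in a space X of functions with (semi)norm N, tested against
   the whole dual: a linear form bounded by N only depends on the class of its
   argument modulo a.e. equality. *)
Definition bounded_linear_form (X : set (R -> R)) (N : (R -> R) -> R)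
    (l : (R -> R) -> R) : Prop :=
  (forall (a : R) f g, X f -> X g ->
     l (fun x => a * f x + g x) = a * l f + l g) /\
  (exists C : R, forall f, X f -> `|l f| <= C * N f).

Definition weak_cvg (X : set (R -> R)) (N : (R -> R) -> R)
    (f_ : nat -> R -> R) (f : R -> R) : Prop :=
  forall l, bounded_linear_form X N l -> l (f_ n) @[n --> \oo] --> l f.

End one_dimensional.

Section space_time.
Context {R : realType}.
Implicit Types (L : R) (w : seq (R * R)) (f g u h : R * R -> R).
Local Notation leb := (@lebesgue_measure R).
Local Notation leb2 := (leb \x leb)%E.

Definition e_t : R * R := (1, 0).
Definition e_x : R * R := (0, 1).

Definition cylinder L : set (R * R) := `]0, +oo[ `*` `]0, L[.
Definition closed_cylinder L : set (R * R) := `[0, +oo[ `*` `[0, L].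

Definition locally_integrable2 (D : set (R * R)) f : Prop :=
  measurable_fun D f /\
  forall K : set (R * R), compact K -> K `<=` D ->
    leb2.-integrable K (EFin \o f).

Definition is_wpartial L w f g : Prop :=
  [/\ locally_integrable2 (cylinder L) f,
      locally_integrable2 (cylinder L) g &
      forall phi : R * R -> R, test_function (cylinder L) phi ->
        \int[leb2]_(p in cylinder L) (f p * iter_derive w phi p) =
        (-1) ^+ size w * \int[leb2]_(p in cylinder L) (g p * phi p)].

(* Same convention as for wderive. *)
Definition wpartial L w f : R * R -> R :=
  xget (fun=> 0) [set g | is_wpartial L w f g].

Definition wdt L : (R * R -> R) -> R * R -> R := wpartial L [:: e_t].
Definition wdxx L : (R * R -> R) -> R * R -> R := wpartial L [:: e_x; e_x].

(* The norm of L^oo(J; L^2(0, L)). *)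
Definition LooL2norm (J : set R) L f : \bar R :=
  'N[leb]_+oo[(fun t => 'N[leb]_2%:E[EFin \o (fun x => f (t, x)) \_ `]0%R, L[])
              \_ J]%E.

Definition LooL2 L f : Prop :=
  measurable_fun (cylinder L) f /\ (LooL2norm `]0%R, +oo[ L f < +oo)%E.

Variables (rho mu L : R).

Definition energy (Phi : R -> R) u (t : R) : \bar R :=
  (\int[leb]_(x in `]0%R, L[)
     ((rho * wdt L u (t, x) ^+ 2 + mu * wdxx L u (t, x) ^+ 2) / 2
      + Phi (u (t, x)))%:E)%E.

Definition energy0 (Phi u0 u1 : R -> R) : \bar R :=
  (\int[leb]_(x in `]0%R, L[)
     ((rho * u1 x ^+ 2 + mu * wderive L 2 u0 x ^+ 2) / 2 + Phi (u0 x))%:E)%E.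

(* The natural boundary conditions are encoded by the test functions not being
   required to vanish at x = 0 and x = L. *)
Definition weak_equation (u0 u1 : R -> R) u h : Prop :=
  forall phi : R * R -> R, test_function setT phi ->
    \int[leb2]_(p in cylinder L)
       (rho * u p * iter_derive [:: e_t; e_t] phi p
        + mu * wdxx L u p * iter_derive [:: e_x; e_x] phi p + h p * phi p)
    - \int[leb]_(x in `]0, L[) (rho * u1 x * phi (0, x))
    + \int[leb]_(x in `]0, L[) (rho * u0 x * iter_derive [:: e_t] phi (0, x)) = 0.

(* H u is the set of admissible selections h_u of the nonlinear term. *)
Definition dissipative (Phi : R -> R) (H : (R * R -> R) -> set (R * R -> R))
    (u0 u1 : R -> R) u : Prop :=
  [/\ {within closed_cylinder L, continuous u},
      (exists g, is_wpartial L [:: e_t] u g) /\ LooL2 L (wdt L u),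
      (exists g, is_wpartial L [:: e_x; e_x] u g) /\ LooL2 L (wdxx L u),
      exists2 h, H u h & weak_equation u0 u1 u h &
      {ae leb, forall t, 0 < t -> (energy Phi u t <= energy0 Phi u0 u1)%E}].

(* h \in \partial Phi'(u), for a Phi whose derivative jumps at -1 and 1. *)
Definition selection (Phi : R -> R) u : set (R * R -> R) :=
  [set h | measurable_fun (closed_cylinder L) h /\
    forall p, closed_cylinder L p ->
      [/\ `|u p| < 1 -> h p = Phi^`() (u p),
          1 < `|u p| -> h p = 0,
          u p = 1 -> 0 <= h p <= lim (Phi^`() z @[z --> 1^'-]) &
          u p = -1 -> lim (Phi^`() z @[z --> (-1)^'+]) <= h p <= 0]].

Definition dissipative_solution (Phi u0 u1 : R -> R) u : Prop :=
  dissipative Phi (selection Phi) u0 u1 u.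

Definition linear_dissipative_solution (u0 u1 : R -> R) u : Prop :=
  dissipative (fun=> 0) (fun=> [set (fun=> 0)]) u0 u1 u.

End space_time.

Definition jump_discontinuity {R : realType} (f : R -> R) (a : R) : Prop :=
  [/\ cvg (f z @[z --> a^'-]), cvg (f z @[z --> a^'+]) &
      lim (f z @[z --> a^'-]) != lim (f z @[z --> a^'+])].

Record adhesion_potential {R : realType} (kappa : R) (Phi : R -> R) : Prop := {
  potential_continuous : continuous Phi;
  potential_C2 : forall z, z != 1 -> z != -1 ->
    [/\ derivable Phi z 1, derivable Phi^`() z 1 &
        {for z, continuous Phi^`(2)}];
  potential_ge0 : forall z, 0 <= Phi z;
  potential_cst_left : forall z, z <= -1 -> Phi z = Phi (-1);
  potential_cst_right : forall z, 1 <= z -> Phi z = Phi 1;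
  potential_convex : convex_function (E := R^o) `[-1, 1]%classic Phi;
  potential_decreasing : {in `[-1, 0] &, {homo Phi : y z / y < z >-> z < y}};
  potential_increasing : {in `[0, 1] &, {homo Phi : y z / y < z}};
  potential_kappa : 0 < kappa;
  potential_quadratic : forall z, -1 <= z <= 1 -> kappa * z ^+ 2 <= Phi z;
  potential_jumpN1 : jump_discontinuity Phi^`() (-1);
  potential_jump1 : jump_discontinuity Phi^`() 1;
  potential_derive_out : forall z, 1 < `|z| -> Phi^`() z = 0;
  potential_derive_pos : forall z, 0 < z < 1 ->
    0 < Phi^`() z <= lim (Phi^`() y @[y --> 1^'-]);
  potential_derive_neg : forall z, -1 < z < 0 ->
    lim (Phi^`() y @[y --> (-1)^'+]) <= Phi^`() z < 0
}.

(* Main.v *)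
Require Import Defs.
From HB Require Import structures.
From mathcomp Require Import all_boot all_order all_algebra.
From mathcomp Require Import all_classical all_reals all_analysis.
From mathcomp Require Import measurable_realfun ess_sup_inf ring lra.
Import Order.TTheory GRing.Theory Num.Theory.
Import numFieldNormedType.Exports.
Local Open Scope ring_scope.
Local Open Scope classical_set_scope.

Set Implicit Arguments.
Unset Strict Implicit.
Unset Printing Implicit Defensive.

(* On the difference w = u - v the source is h_u, and |h_u| <= Lam |u| because
   the selection vanishes linearly at 0 and outside [-1, 1]; so it is enough to
   show that u_n is small in L^oo(0, T; L^2), and that a beam with null initial
   data and small source has small velocity and small second space derivative.
   Energy arguments need a regularity in time that weak solutions lack, hence
   the equation is first integrated twice in time and the resulting identities
   are tested, by duality in space, with the fields themselves: backward time
   averages then give discrete energy inequalities, closed by a Gronwall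
   argument. For u_n the initial data only enter through pairings with functions
   S such that S'' is square integrable; these pairings are uniformly small since
   weakly null sequences converge strongly in the dual space, which is obtained
   by hand from the pointwise convergence of second primitives and dominated
   convergence. The energy inequality only serves to bound the second space
   derivative of u_n, uniformly because the potential is bounded. *)

(** The obstacle is that the velocity of a weak solution is not an admissible multiplier: it is
    known for almost every time only and has no time derivative. The remedy is algebraic: m
    primitives from time 0 followed by m backward difference quotients of step e equal m backward
    means ([iter_DqJ_avg]). Primitives make a relation valid at every time, difference quotients
    preserve it by linearity, and the fields so obtained are continuous in time. The bounds do not
    depend on e, and Lebesgue differentiation removes the means. The solution is estimated one time
    derivative below the natural energy, by rho times the square of u plus mu times the square of
    the time integral of u_xx: at that level the weakly null data only meet a multiplier S with S''
    bounded, and two means suffice. The difference starts from rest and is estimated at the natural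
    level, with a third mean. In both cases the closing inequality is a contraction for a norm
    weighted by exp(lam t), which forgets the a priori bound of the individual solution. *)

Section integrability.
Context d (T : measurableType d) (R : realType).
Variable m : {measure set T -> \bar R}.
Implicit Types (D : set T) (f g : T -> R).

Definition rint D f := m.-integrable D (EFin \o f).

Lemma rint_measurable D f : rint D f -> measurable_fun D f.
Proof. by move/measurable_int/measurable_EFinP. Qed.

Lemma rint_dom D f g : measurable D -> measurable_fun D f ->
  (forall x, D x -> `|f x| <= g x) -> rint D g -> rint D f.
Proof.
move=> mD mf fg ig; apply: (le_integrable mD _ _ ig).
  exact/measurable_EFinP.
move=> x Dx /=; rewrite lee_fin (le_trans (fg x Dx))//; exact: ler_norm.
Qed.

Lemma rintD D f g : measurable D -> rint D f -> rint D g ->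
  rint D (fun x => f x + g x).
Proof. by move=> mD fi gi; exact: (integrableD mD fi gi). Qed.

Lemma rintB D f g : measurable D -> rint D f -> rint D g ->
  rint D (fun x => f x - g x).
Proof. by move=> mD fi gi; exact: (integrableB mD fi gi). Qed.

Lemma rintZ D f (a : R) : measurable D -> rint D f -> rint D (fun x => a * f x).
Proof. by move=> mD fi; exact: (integrableZl mD a fi). Qed.

Lemma rint_abs D f : rint D f -> rint D (fun x => `|f x|).
Proof. by move=> fi; exact: (integrable_abse fi). Qed.

Lemma rintS D E f : measurable D -> measurable E -> E `<=` D ->
  rint D f -> rint E f.
Proof. by move=> mD mE ED; exact: integrableS. Qed.

Lemma rint_patch D f : measurable D -> rint D f -> rint setT (f \_ D).
Proof.
by move=> mD fi; rewrite /rint -restrict_EFin; apply: (integrable_mkcond _ mD).1.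
Qed.

Lemma rint_unpatch D f : measurable D -> rint setT (f \_ D) -> rint D f.
Proof.
move=> mD; rewrite /rint -restrict_EFin; exact: (integrable_mkcond _ mD).2.
Qed.

Lemma eq_rint D f g : measurable D -> (forall x, D x -> f x = g x) ->
  rint D f -> rint D g.
Proof.
move=> mD fg; apply: eq_integrable => // x; rewrite inE => Dx.
by rewrite /= fg.
Qed.

Lemma EFin_Rintegral D f : measurable D -> rint D f ->
  (\int[m]_(x in D) f x)%:E = (\int[m]_(x in D) (f x)%:E)%E.
Proof. by move=> mD fi; rewrite fineK//; exact: (integrable_fin_num mD fi). Qed.

Lemma ae_eq_Rintegral D f g : measurable D -> measurable_fun D f ->
  measurable_fun D g -> {ae m, forall x, D x -> f x = g x} ->
  \int[m]_(x in D) f x = \int[m]_(x in D) g x.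
Proof.
move=> mD mf mg fg; rewrite /Rintegral; congr fine; apply: ae_eq_integral => //.
- exact/measurable_EFinP.
- exact/measurable_EFinP.
- by apply: filterS fg => x h Dx; rewrite h.
Qed.

Lemma ae_eq_rint D f g : measurable D -> measurable_fun D g ->
  {ae m, forall x, D x -> f x = g x} -> rint D f -> rint D g.
Proof.
move=> mD mg fg /integrableP[mf fi]; apply/integrableP; split.
  exact/measurable_EFinP.
rewrite (_ : (\int[m]_(x in D) _)%E = \int[m]_(x in D) `|(EFin \o f) x|)%E//.
apply: ae_eq_integral => //.
- by apply: measurableT_comp => //; exact/measurable_EFinP.
- by apply: measurableT_comp.
- by apply: filterS fg => x h Dx /=; rewrite h.
Qed.

End integrability.

(** * Fubini's theorem for real-valued integrals *)

Section real_fubini.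
Context d1 d2 (T1 : measurableType d1) (T2 : measurableType d2) (R : realType).
Variable m1 : {sigma_finite_measure set T1 -> \bar R}.
Variable m2 : {sigma_finite_measure set T2 -> \bar R}.
Implicit Types f : T1 * T2 -> R.

(** The positive and negative parts have measurable partial integrals by Tonelli, and [fine] keeps
    measurability; sections that are not integrable are thus covered, with their default value. *)
Lemma measurable_Rintegral2 f : measurable_fun setT f ->
  measurable_fun setT (fun x => \int[m2]_y f (x, y)).
Proof.
move=> mf; have mf' : measurable_fun setT (EFin \o f) by exact/measurable_EFinP.
rewrite /Rintegral; apply: (@measurableT_comp _ _ _ _ _ _ fine) => //.
under eq_fun do rewrite integralE.
apply: emeasurable_funB.
- rewrite (_ : (fun _ => _) = fubini_F m2 (EFin \o f)^\+%E); last first.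
    by apply/funext => z; apply: eq_integral => y _; rewrite !unlock.
  exact: (measurable_fun_fubini_tonelli_F (m2 := m2) _ (measurable_funepos mf')
    (fun=> funepos_ge0 _ _)).
- rewrite (_ : (fun _ => _) = fubini_F m2 (EFin \o f)^\-%E); last first.
    by apply/funext => z; apply: eq_integral => y _; rewrite !unlock.
  exact: (measurable_fun_fubini_tonelli_F (m2 := m2) _ (measurable_funeneg mf')
    (fun=> funeneg_ge0 _ _)).
Qed.

Lemma measurable_Rintegral1 f : measurable_fun setT f ->
  measurable_fun setT (fun y => \int[m1]_x f (x, y)).
Proof.
move=> mf; have mf' : measurable_fun setT (EFin \o f) by exact/measurable_EFinP.
rewrite /Rintegral; apply: (@measurableT_comp _ _ _ _ _ _ fine) => //.
under eq_fun do rewrite integralE.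
apply: emeasurable_funB.
- rewrite (_ : (fun _ => _) = fubini_G m1 (EFin \o f)^\+%E); last first.
    by apply/funext => z; apply: eq_integral => y _; rewrite !unlock.
  exact: (measurable_fun_fubini_tonelli_G (m1 := m1) _ (measurable_funepos mf')
    (fun=> funepos_ge0 _ _)).
- rewrite (_ : (fun _ => _) = fubini_G m1 (EFin \o f)^\-%E); last first.
    by apply/funext => z; apply: eq_integral => y _; rewrite !unlock.
  exact: (measurable_fun_fubini_tonelli_G (m1 := m1) _ (measurable_funeneg mf')
    (fun=> funeneg_ge0 _ _)).
Qed.

Lemma abse_fine_le (a : \bar R) : (`|(fine a)%:E| <= `|a|)%E.
Proof. by case: a => [r| |] //=; rewrite ?normr0 ?leey. Qed.

Section integrable.
Variable f : T1 * T2 -> R.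
Hypothesis fi : rint (m1 \x m2)%E setT f.

Let mf : measurable_fun setT f. Proof. exact: rint_measurable fi. Qed.
Let mef : measurable_fun setT (fun p => `|(f p)%:E|%E).
Proof. by apply: measurableT_comp => //; exact/measurable_EFinP. Qed.

Lemma rint_fubini1 : rint m1 setT (fun x => \int[m2]_y f (x, y)).
Proof.
have mF := measurable_Rintegral2 mf.
apply/integrableP; split; first exact/measurable_EFinP.
apply: le_lt_trans ((integrable12ltyP m1 m2 (measurable_int _ fi)).1 fi).
apply: ge0_le_integral => //.
- by apply: measurableT_comp => //; exact/measurable_EFinP.
- by have := measurable_fun_fubini_tonelli_F (m2 := m2) _ mef; apply.
- move=> x _; apply: le_trans (abse_fine_le _) _.
  apply: le_abse_integral => //; apply/measurable_EFinP.
  by apply: (measurableT_comp mf); exact: pair1_measurable.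
Qed.

Lemma rint_fubini2 : rint m2 setT (fun y => \int[m1]_x f (x, y)).
Proof.
have mF := measurable_Rintegral1 mf.
apply/integrableP; split; first exact/measurable_EFinP.
apply: le_lt_trans ((integrable21ltyP m1 m2 (measurable_int _ fi)).1 fi).
apply: ge0_le_integral => //.
- by apply: measurableT_comp => //; exact/measurable_EFinP.
- exact: (measurable_fun_fubini_tonelli_G (m1 := m1) _ mef (fun=> abse_ge0 _)).
- move=> x _; apply: le_trans (abse_fine_le _) _.
  apply: le_abse_integral => //; apply/measurable_EFinP.
  by apply: (measurableT_comp mf); exact: pair2_measurable.
Qed.

Lemma Rintegral_prod1 :
  \int[(m1 \x m2)%E]_z f z = \int[m1]_x \int[m2]_y f (x, y).
Proof.
rewrite {1}/Rintegral -(integral12_prod_meas1 fi) /Rintegral; congr fine.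
(* Only almost everywhere: on the null set of non-integrable sections, [fine] replaces an infinite
   value by 0. *)
apply: ae_eq_integral => //.
- exact: measurable_fubini_F fi.
- by apply/measurable_EFinP; exact: measurable_Rintegral2.
- have := integrable_ae measurableT (integrable_fubini_F fi).
  by apply: filterS => x /(_ I) /fineK {1}<- _.
Qed.

Lemma Rintegral_prod2 :
  \int[(m1 \x m2)%E]_z f z = \int[m2]_y \int[m1]_x f (x, y).
Proof.
rewrite {1}/Rintegral -(integral21_prod_meas1 fi) /Rintegral; congr fine.
apply: ae_eq_integral => //.
- exact: measurable_fubini_G fi.
- by apply/measurable_EFinP; exact: measurable_Rintegral1.
- have : {ae m2, forall y, m1.-integrable setT (fun x => (f (x, y))%:E)}.
    exact: ae_integrable2 fi.
  apply: filterS => y /(integrable_fin_num measurableT) /fineK h _.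
  by rewrite /fubini_G -[LHS]h.
Qed.

Lemma Rintegral_swap :
  \int[m1]_x \int[m2]_y f (x, y) = \int[m2]_y \int[m1]_x f (x, y).
Proof. by rewrite -Rintegral_prod1 Rintegral_prod2. Qed.

End integrable.

Lemma rint_prod_dom (f : T1 * T2 -> R) (g : T1 -> R) (h : T2 -> R) :
  measurable_fun setT f -> rint m1 setT g -> rint m2 setT h ->
  (forall x y, `|f (x, y)| <= g x * h y) ->
  rint (m1 \x m2)%E setT f.
Proof.
move=> mf gi hi fgh; apply/(integrable12ltyP m1 m2).
  exact/measurable_EFinP.
have hfin : (\int[m2]_y `|(h y)%:E| < +oo)%E by case/integrableP : hi.
pose H := fine (\int[m2]_y `|(h y)%:E|)%E.
have HE : H%:E = (\int[m2]_y `|(h y)%:E|)%E.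
  by rewrite fineK// ge0_fin_numE// integral_ge0.
apply: (@le_lt_trans _ _ (\int[m1]_x (`|(g x)%:E| * H%:E))%E).
  apply: ge0_le_integral => //.
  - by move=> x _; exact: integral_ge0.
  - have := measurable_fun_fubini_tonelli_F (m2 := m2) (fun p => `|(f p)%:E|)%E.
    by apply => //; apply: measurableT_comp => //; exact/measurable_EFinP.
  - apply: emeasurable_funM => //; apply: measurableT_comp => //.
    exact: measurable_int gi.
  move=> x _; rewrite HE -ge0_integralZl//; last first.
    by apply: measurableT_comp => //; exact: measurable_int hi.
  apply: ge0_le_integral => //.
  - apply: measurableT_comp => //; apply/measurable_EFinP.
    by apply: (measurableT_comp mf); exact: pair1_measurable.
  - apply: emeasurable_funM => //; apply: measurableT_comp => //.
    exact: measurable_int hi.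
  move=> y _; rewrite -EFinM lee_fin -normrM (le_trans (fgh x y))//.
  exact: ler_norm.
have H0 : 0 <= H by rewrite -lee_fin HE integral_ge0.
under eq_integral do rewrite muleC.
rewrite ge0_integralZl//; last first.
  by apply: measurableT_comp => //; exact: measurable_int gi.
by rewrite lte_mul_pinfty// ; case/integrableP : gi.
Qed.

End real_fubini.

(* Every interchange of integrals below is an instance of this one. *)
Lemma Rintegral_kernel_swap d1 d2 (T1 : measurableType d1)
    (T2 : measurableType d2) (R : realType)
    (m1 : {sigma_finite_measure set T1 -> \bar R})
    (m2 : {sigma_finite_measure set T2 -> \bar R})
    (K : T1 * T2 -> R) (f : T1 -> R) (g : T2 -> R) (C : R) :
  measurable_fun setT K -> rint m1 setT f -> rint m2 setT g ->
  (forall x y, f x != 0 -> g y != 0 -> `|K (x, y)| <= C) ->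
  \int[m1]_x (f x * \int[m2]_y (K (x, y) * g y)) =
  \int[m2]_y (g y * \int[m1]_x (K (x, y) * f x)).
Proof.
move=> mK fi gi KC.
have mf := rint_measurable fi; have mg := rint_measurable gi.
pose F p := f p.1 * (K p * g p.2).
have mF : measurable_fun setT F.
  apply: measurable_funM; first exact: (measurableT_comp mf).
  by apply: measurable_funM => //; exact: (measurableT_comp mg).
have Fi : rint (m1 \x m2)%E setT F.
  apply: (@rint_prod_dom _ _ _ _ _ _ _ _ (fun x => `|f x| * `|C|)
    (fun y => `|g y|)) => //.
  - under eq_fun do rewrite mulrC.
    by apply: rintZ => //; exact: rint_abs.
  - exact: rint_abs.
  - move=> x y; rewrite /F /= !normrM -mulrA.
    have [->|fx] := eqVneq (f x) 0; first by rewrite normr0 !mul0r.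
    have [->|gy] := eqVneq (g y) 0; first by rewrite normr0 !mulr0.
    rewrite ler_wpM2l// ler_wpM2r//.
    by rewrite (le_trans (KC _ _ fx gy))// ler_norm.
have sec1 x : f x != 0 -> rint m2 setT (fun y => K (x, y) * g y).
  move=> fx; apply: (@rint_dom _ _ _ _ _ _ (fun y => C * `|g y|)) => //.
  - apply: measurable_funM => //; apply: (measurableT_comp mK).
    exact: pair1_measurable.
  - move=> y _; rewrite normrM.
    have [->|gy] := eqVneq (g y) 0; first by rewrite normr0 !mulr0.
    by rewrite ler_wpM2r// KC.
  - by apply: rintZ => //; exact: rint_abs.
have sec2 y : g y != 0 -> rint m1 setT (fun x => K (x, y) * f x).
  move=> gy; apply: (@rint_dom _ _ _ _ _ _ (fun y => C * `|f y|)) => //.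
  - apply: measurable_funM => //; apply: (measurableT_comp mK).
    exact: pair2_measurable.
  - move=> x _; rewrite normrM.
    have [->|fx] := eqVneq (f x) 0; first by rewrite normr0 !mulr0.
    by rewrite ler_wpM2r// KC.
  - by apply: rintZ => //; exact: rint_abs.
transitivity (\int[m1]_x \int[m2]_y F (x, y)).
  apply: eq_Rintegral => x _; rewrite /F /=.
  have [->|fx] := eqVneq (f x) 0.
    under [RHS]eq_Rintegral do rewrite mul0r.
    by rewrite mul0r Rintegral_cst// mul0r.
  by rewrite RintegralZl//; exact: sec1.
rewrite Rintegral_swap//.
apply: eq_Rintegral => y _; rewrite /F /=.
have [->|gy] := eqVneq (g y) 0.
  under eq_Rintegral do rewrite !mulr0.
  by rewrite mul0r Rintegral_cst// mul0r.
rewrite -RintegralZl//; last exact: sec2.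
by apply: eq_Rintegral => x _; rewrite mulrCA mulrA mulrC.
Qed.

(** * Causal functions of time: primitives and backward difference quotients *)

Section time_calculus.
Context {R : realType}.
Local Notation leb := (@lebesgue_measure R).
Implicit Types (f g F w W : R -> R) (r s t d : R).

(** For [r <= 0] the domain is empty or a point, so [J f] is causal whatever [f] is, and the values
    of [f] at negative times are ignored. *)
Definition J f r : R := \int[leb]_(s in `[0, r]) f s.

Definition locint f := forall T, rint leb `[0, T] f.

Definition causal f := forall s, s <= 0 -> f s = 0.

(** Backward rather than forward: causality is preserved, and a relation known up to time [T] can be
    differenced without leaving its range. *)
Definition Dq d f r : R := d^-1 * (f r - f (r - d)).

Lemma J_le0 f : causal (J f).
Proof.
move=> r; rewrite le_eqVlt => /predU1P[->|r0].
  by rewrite /J set_itv1 Rintegral_set1.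
by rewrite /J set_itv_ge ?Rintegral_set0// bnd_simp -ltNge.
Qed.

(** Moves the lower limit to the left of the point of interest, so that continuity and the
    fundamental theorem apply at 0 and at negative times as anywhere else. *)
Lemma J_left_extension (M : R) f s : 0 <= M ->
  J f s = \int[leb]_(t in `[- M, s]) (f \_ `[0, +oo[) t.
Proof.
move=> M0; rewrite /J [LHS]Rintegral_mkcond [RHS]Rintegral_mkcond.
congr (Rintegral _ _ _); apply/funext => t; rewrite !patchE !mem_setE !in_itv/=.
rewrite andbT; have [t0|t0] := leP 0 t; last by rewrite if_same.
by rewrite (le_trans _ t0)// lerNl oppr0.
Qed.

Lemma locint_left_extension f (a b : R) : locint f ->
  rint leb `[a, b] (f \_ `[0, +oo[).
Proof.
move=> fi; apply: rint_unpatch => //.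
have -> : (f \_ `[0, +oo[) \_ `[a, b] = (f \_ `[0, b]) \_ `[a, b].
  apply/funext => t; rewrite !patchE !mem_setE !in_itv/= andbT.
  by case: (a <= t) => //=; case: (t <= b); rewrite ?andbF// andbT.
apply: rint_patch => //; apply: (@rintS _ _ _ _ setT) => //.
exact: rint_patch.
Qed.

Lemma J_continuous f : locint f -> continuous (J f).
Proof.
move=> fi r; pose M := `|r| + 1.
have M0 : 0 <= M by rewrite addr_ge0.
have rM : r \in `]- M, M[%R.
  by rewrite in_itv/= -ltr_norml /M ltrDl.
have /andP[Mr rM'] : - M < r < M by move: rM; rewrite in_itv.
have MM : - M <= M by rewrite ge0_cp.
have := parameterized_integral_continuous MM (locint_left_extension (-M) M fi).
move/(continuous_within_itvP _ _) => h.
have {h}[h _ _] := h (lt_trans Mr rM').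
have -> : J f = (fun s => parameterized_integral leb (- M) s (f \_ `[0, +oo[)).
  by apply/funext => s; rewrite (J_left_extension _ _ M0).
exact: h.
Qed.

Lemma continuous_locint f : continuous f -> locint f.
Proof.
move=> cf T; apply: continuous_compact_integrable; first exact: segment_compact.
exact: continuous_subspaceT.
Qed.

Lemma causal_left_extension f : causal f -> f \_ `[0, +oo[ = f.
Proof.
move=> cf; apply/funext => t; rewrite patchE mem_setE in_itv/= andbT.
by case: leP => // /ltW/cf.
Qed.

Lemma is_derive_J f : continuous f -> causal f -> forall r, is_derive r 1 (J f) (f r).
Proof.
move=> cf f0 r; pose M := `|r| + 1.
have M0 : 0 <= M by rewrite addr_ge0.
have rM : r \in `]- M, M[%R.
  by rewrite in_itv/= -ltr_norml /M ltrDl.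
have /andP[Mr rM'] : - M < r < M by move: rM; rewrite in_itv.
have fi := locint_left_extension (-M) M (continuous_locint cf).
rewrite causal_left_extension// in fi.
have /= := @continuous_FTC1 R f (BLeft (- M)) r M rM' fi.
have -> : (fun x => \int[leb]_(t in `[- M, x]) f t) = J f.
  apply/funext => s; rewrite (J_left_extension _ _ M0).
  by rewrite causal_left_extension.
rewrite lte_fin Mr => /(_ isT (cf r))[d1 d2].
by split; [exact: d1|rewrite -derive1E; exact: d2].
Qed.

(** Uniqueness of the causal primitive; identities between [J] and [Dq] are then checked by
    differentiation. *)
Lemma J_primitive F f : continuous f -> causal F ->
  (forall r, is_derive r 1 F (f r)) -> J f = F.
Proof.
move=> cf F0 dF; apply/funext => r.
have [r0|r0] := leP r 0; first by rewrite J_le0// F0.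
have cF : continuous F.
  by move=> s; apply/differentiable_continuous/derivable1_diffP; have [] := dF s.
rewrite /J /Rintegral (@continuous_FTC2 _ f F)//.
- by rewrite (F0 0)// sube0.
- exact: continuous_subspaceT.
- split.
  + by move=> x _; have [] := dF x.
  + by apply: cvg_at_right_filter; exact: cF.
  + by apply: cvg_at_left_filter; exact: cF.
- by move=> x _; rewrite derive1E; have [_ ->] := dF x.
Qed.

Lemma Dq_causal d f : 0 <= d -> causal f -> causal (Dq d f).
Proof.
move=> d0 f0 s s0; rewrite /Dq !f0 ?subr0 ?mulr0//.
by rewrite subr_le0 (le_trans s0).
Qed.

Lemma is_derive_Dq d F f : (forall r, is_derive r 1 F (f r)) ->
  forall r, is_derive r 1 (Dq d F) (Dq d f r).
Proof.
move=> dF r; rewrite /Dq.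
have h : is_derive r 1 (fun r => F (r - d)) (f (r - d) * 1).
  apply: (@is_derive1_comp _ F (fun r => r - d)).
  have := @is_deriveB _ _ _ id (cst d) r 1 1 0 _ _.
  by rewrite subr0; apply.
rewrite mulr1 in h.
have hB := is_deriveB (dF r) h.
exact: (is_deriveZ d^-1 hB).
Qed.

Lemma Dq_continuous d f : continuous f -> continuous (Dq d f).
Proof.
move=> cf r; rewrite /Dq; apply: cvgM; first exact: cvg_cst.
apply: cvgB; first exact: cf.
apply: (@continuous_comp _ _ _ (fun r => r - d) f); last exact: cf.
by apply: cvgB; [exact: cvg_id|exact: cvg_cst].
Qed.

Lemma Dq_J d f : 0 <= d -> continuous f -> causal f -> Dq d (J f) = J (Dq d f).
Proof.
move=> d0 cf f0; apply/esym/J_primitive.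
- exact: Dq_continuous.
- by apply: Dq_causal => //; exact: J_le0.
- by apply: is_derive_Dq; exact: is_derive_J.
Qed.

Lemma J_linear (a : R) f g : locint f -> locint g ->
  J (fun s => a * f s + g s) = (fun r => a * J f r + J g r).
Proof.
move=> fi gi; apply/funext => r; rewrite /J RintegralD//.
- by rewrite RintegralZl//; exact: fi.
- by apply: rintZ => //; exact: fi.
- exact: gi.
Qed.

Lemma locintZ (a : R) f : locint f -> locint (fun s => a * f s).
Proof. by move=> fi T; apply: rintZ => //; exact: fi. Qed.

Lemma locintD f g : locint f -> locint g -> locint (fun s => f s + g s).
Proof. by move=> fi gi T; apply: rintD. Qed.

Lemma rint_bounded (a b C : R) f : measurable_fun `[a, b] f ->
  (forall s, `[a, b] s -> `|f s| <= C) -> rint leb `[a, b] f.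
Proof.
move=> mf fC; apply: measurable_bounded_integrable => //.
  by rewrite /= lebesgue_measure_itv; case: ifP => _ /=; rewrite ?ltry.
exists C; split; first exact: num_real.
by move=> M CM x abx /=; rewrite (le_trans (fC x abx))// ltW.
Qed.

Lemma Rintegral_itv_cst (a b c : R) : a <= b -> \int[leb]_(s in `[a, b]) c = c * (b - a).
Proof.
move=> ab; rewrite Rintegral_cst//= lebesgue_measure_itv/= lte_fin.
by move: ab; rewrite le_eqVlt => /predU1P[->|->]; rewrite ?ltxx ?subrr.
Qed.

(* Integration by parts against a weight, by Fubini because [f] is only
   locally integrable. *)
Lemma J_weight f w W r : locint f -> continuous w ->
  (forall s, 0 <= s <= r -> \int[leb]_(x in `[s, r]) w x = W s) ->
  \int[leb]_(s in `[0, r]) (f s * W s) = \int[leb]_(x in `[0, r]) (w x * J f x).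
Proof.
move=> fi cw wW.
pose K (p : R * R) : R := (p.1 <= p.2)%R%:R.
have mK : measurable_fun setT K.
  apply: (@measurableT_comp _ _ _ _ _ _ (fun b : bool => b%:R : R)) => //.
  exact: measurable_fun_ler.
rewrite [LHS]Rintegral_mkcond [RHS]Rintegral_mkcond.
transitivity (\int[leb]_x ((f \_ `[0, r]) x *
                \int[leb]_y (K (x, y) * (w \_ `[0, r]) y))).
  apply: eq_Rintegral => s _; rewrite !patchE.
  case: ifPn => [|_]; last by rewrite mul0r.
  rewrite mem_setE in_itv/= => /andP[s0 sr]; congr (_ * _).
  rewrite -wW ?s0// Rintegral_mkcond; apply: eq_Rintegral => y _.
  rewrite !patchE !mem_setE !in_itv/= /K/=.
  case: leP => sy; rewrite ?mul0r// mul1r (le_trans s0 sy)//.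
rewrite (@Rintegral_kernel_swap _ _ _ _ R leb leb K (f \_ `[0, r]) (w \_ `[0, r]) 1 mK).
- apply: eq_Rintegral => s _; rewrite !patchE.
  case: ifPn => [|_]; last by rewrite mul0r.
  rewrite mem_setE in_itv/= => /andP[s0 sr]; congr (_ * _).
  rewrite /J [RHS]Rintegral_mkcond; apply: eq_Rintegral => y _.
  rewrite !patchE !mem_setE !in_itv/= /K/=.
  case: (leP y s) => sy; rewrite ?mul0r ?andbF// mul1r (le_trans sy sr)//.
- exact: rint_patch.
- by apply: rint_patch => //; exact: continuous_locint.
- by move=> x y _ _; rewrite /K/=; case: (x <= y); rewrite ?normr1 ?normr0.
Qed.

(** Cauchy's formula for the double primitive: integration by parts against the weight 1. *)
Lemma J2E f r : locint f -> \int[leb]_(s in `[0, r]) (f s * (r - s)) = J (J f) r.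
Proof.
move=> fi; rewrite (@J_weight f (cst 1) (fun s => r - s))//.
- by apply: eq_Rintegral => s _; rewrite mul1r.
- by move=> x; exact: cvg_cst.
- by move=> s /andP[_ sr]; rewrite Rintegral_itv_cst// mul1r.
Qed.

End time_calculus.

(** * Backward means in time and Lebesgue differentiation *)

Section averages.
Context {R : realType}.
Local Notation leb := (@lebesgue_measure R).
Implicit Types (f g : R -> R) (r s t d c B : R) (m : nat).

Definition avg d f : R -> R := Dq d (J f).

Lemma rint_itv_oc (a b : R) f : rint leb `[a, b] f -> rint leb `]a, b] f.
Proof. by apply: integrableS => //; exact: subset_itv_oc_cc. Qed.

Lemma avg_continuous d f : locint f -> continuous (avg d f).
Proof. by move=> fi; exact/Dq_continuous/J_continuous. Qed.

Lemma avg_causal d f : 0 <= d -> causal (avg d f).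
Proof. by move=> d0; apply: Dq_causal => //; exact: J_le0. Qed.

Lemma iter_Dq_continuous d m f : continuous f -> continuous (iter m (Dq d) f).
Proof. by move=> cf; elim: m => //= m IH; exact: Dq_continuous. Qed.

Lemma iter_Dq_causal d m f : 0 <= d -> causal f -> causal (iter m (Dq d) f).
Proof. by move=> d0 cf; elim: m => //= m IH; exact: Dq_causal. Qed.

Lemma iter_Dq_J d m f : 0 <= d -> continuous f -> causal f ->
  iter m (Dq d) (J f) = J (iter m (Dq d) f).
Proof.
move=> d0 cf f0; elim: m => //= m ->; apply: Dq_J => //.
- exact: iter_Dq_continuous.
- exact: iter_Dq_causal.
Qed.

Lemma iter_J_continuous m f : locint f -> continuous (iter m.+1 J f).
Proof.
move=> fi; elim: m => [|m IH]; first exact: J_continuous.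
by apply: J_continuous; exact: continuous_locint.
Qed.

Lemma iter_avg_locint d m f : locint f -> locint (iter m (avg d) f).
Proof.
by move=> fi; elim: m => //= m IH; apply: continuous_locint; exact: avg_continuous.
Qed.

(** Turns identities between m-fold primitives, valid at every time, into identities between m-fold
    means. Commuting [Dq] with the outer [J] takes a continuous causal integrand, which any
    primitive of [f] is; [f] itself may be irregular, whence the separate case of no inner
    primitive. *)
Lemma iter_DqJ_avg d m f : 0 <= d -> locint f ->
  iter m (Dq d) (iter m J f) = iter m (avg d) f.
Proof.
move=> d0 fi; elim: m => // m IH.
rewrite [RHS]/= -IH /avg [LHS]/=; congr (Dq d _).
case: m {IH} => // m; rewrite iter_Dq_J//; first exact: iter_J_continuous.
exact: J_le0.
Qed.

Lemma avgE d f r : 0 <= d -> locint f ->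
  avg d f r = d^-1 * \int[leb]_(s in `]r - d, r]) (f \_ `[0, +oo[) s.
Proof.
move=> d0 fi; rewrite /avg /Dq; congr (_ * _).
pose M : R := `|r - d|.
have M0 : 0 <= M by exact: normr_ge0.
rewrite !(J_left_extension _ _ M0) Rintegral_itvB//.
- exact: locint_left_extension.
- by rewrite bnd_simp /M lerNl -normrN ler_norm.
- by rewrite bnd_simp gerBl.
Qed.

Lemma avg_le d f r : 0 < d -> locint f ->
  `|avg d f r| <= d^-1 * \int[leb]_(s in `]r - d, r]) `|(f \_ `[0, +oo[) s|.
Proof.
move=> d0 fi; rewrite (avgE _ (ltW d0))// normrM gtr0_norm ?invr_gt0// ler_wpM2l//.
  by rewrite invr_ge0 ltW.
apply: le_normr_Rintegral => //.
apply: rint_itv_oc.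
exact: locint_left_extension.
Qed.

Lemma avg_le_cst d f r B : 0 < d -> locint f ->
  (forall s, r - d < s <= r -> `|f s| <= B) -> `|avg d f r| <= B.
Proof.
move=> d0 fi fB; apply: (le_trans (avg_le _ d0 fi)).
have B0 : 0 <= B by apply: le_trans (fB r _) => //; rewrite lexx gtrBl d0.
have rB : rint leb `]r - d, r] (fun=> B).
  apply: rint_itv_oc.
  by apply: (@rint_bounded _ _ _ `|B|).
have h : \int[leb]_(s in `]r - d, r]) `|(f \_ `[0, +oo[) s| <= B * d.
  have -> : B * d = \int[leb]_(s in `]r - d, r]) B.
    rewrite Rintegral_cst//= lebesgue_measure_itv/= lte_fin gtrBl d0/=.
    by rewrite opprB addrCA subrr addr0.
  apply: le_Rintegral => //.
    apply: rint_abs.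
    apply: rint_itv_oc.
    exact: locint_left_extension.
  move=> s /=; rewrite in_itv/= => sd; rewrite patchE; case: ifP => _.
    exact: fB.
  by rewrite normr0.
have d'0 : 0 <= d^-1 by rewrite invr_ge0 ltW.
apply: (le_trans (ler_wpM2l d'0 h)).
by rewrite mulrCA mulVf ?mulr1// gt_eqF.
Qed.

(** Only the innermost mean is estimated by an integral; each outer mean is bounded by a supremum
    and widens the window by [d]. *)
Lemma iter_avg_le d m f r : 0 < d -> locint f ->
  `|iter m.+1 (avg d) f r| <=
  d^-1 * \int[leb]_(s in `]r - m.+1%:R * d, r]) `|(f \_ `[0, +oo[) s|.
Proof.
move=> d0 fi; elim: m r => [|m IH] r; first by rewrite mul1r; exact: avg_le.
rewrite [X in `|X|]/= -/(iter m.+1 (avg d) f); apply: avg_le_cst => //.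
  exact: iter_avg_locint.
move=> s /andP[rs sr]; apply: (le_trans (IH s)).
have ii a b : rint leb `]a, b] (fun s => `|(f \_ `[0, +oo[) s|).
  apply: rint_abs.
  apply: rint_itv_oc.
  exact: locint_left_extension.
have d'0 : 0 <= d^-1 by rewrite invr_ge0 ltW.
apply: (ler_wpM2l d'0).
rewrite -lee_fin !EFin_Rintegral//.
apply: ge0_subset_integral => //=.
- by apply: measurable_int; exact: ii.
- move=> x /=; rewrite !in_itv/= => /andP[sx xs]; rewrite (le_trans xs sr) andbT.
  apply: le_lt_trans sx; rewrite -(natr1 m.+1) mulrDl mul1r opprD addrA addrAC.
  by rewrite lerD2r ltW.
Qed.

Lemma avgD d f g : locint f -> locint g ->
  avg d (fun s => f s + g s) = (fun r => avg d f r + avg d g r).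
Proof.
move=> fi gi; apply/funext => r; rewrite /avg /Dq.
have := J_linear 1 fi gi.
under [X in J X]funext do rewrite mul1r.
by move=> ->; rewrite !mul1r -mulrDr; congr (_ * _); ring.
Qed.

Lemma avgZ d (a : R) f : locint f ->
  avg d (fun s => a * f s) = (fun r => a * avg d f r).
Proof.
move=> fi; apply/funext => r; rewrite /avg /Dq.
have := J_linear a fi (continuous_locint (@cst_continuous _ _ (0 : R))).
under [X in J X]funext do rewrite addr0.
have -> : J (cst 0) = cst (0 : R).
  by apply/funext => x; rewrite /J Rintegral_cst// mul0r.
by move=> ->; rewrite !addr0 mulrCA -mulrBr.
Qed.

Lemma iter_avg_linear d m (a : R) f g : locint f -> locint g ->
  iter m (avg d) (fun s => f s + a * g s) =
  (fun r => iter m (avg d) f r + a * iter m (avg d) g r).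
Proof.
move=> fi gi; elim: m => //= m ->; rewrite avgD ?avgZ//.
- exact: iter_avg_locint.
- exact: iter_avg_locint.
- by apply: locintZ; exact: iter_avg_locint.
Qed.

(** Before time [m%:R * d] the means still see the cut at time 0; from then on a constant is
    reproduced exactly. *)
Lemma iter_avg1 d m r : 0 < d -> m%:R * d <= r ->
  iter m (avg d) (cst 1) r = 1.
Proof.
move=> d0; elim: m r => // m IH r mr /=.
have fi : locint (iter m (avg d) (cst 1)).
  by apply/iter_avg_locint/continuous_locint; exact: cst_continuous.
rewrite (avgE _ (ltW d0))// (_ : \int[_]_(_ in _) _ = d) ?mulVf ?gt_eqF//.
transitivity (\int[leb]_(s in `]r - d, r]) (1 : R)); last first.
  rewrite Rintegral_cst//= lebesgue_measure_itv/= lte_fin gtrBl d0/=.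
  by rewrite mul1r opprB addrCA subrr addr0.
apply: eq_Rintegral => s; rewrite inE/= in_itv/= => /andP[rs sr].
have ms : m%:R * d <= s.
  by rewrite ltW// (le_lt_trans _ rs)// lerBrDr -{2}(mul1r d) -mulrDl natr1.
rewrite patchE mem_setE in_itv/= andbT (le_trans _ ms) ?IH//.
by rewrite mulr_ge0// ltW.
Qed.

Lemma lebesgue_pt_avg m f t : locint f -> 0 < t ->
  lebesgue_pt (f \_ `[0, +oo[) t ->
  iter m.+1 (avg n.+1%:R^-1) f t @[n --> \oo] --> f t.
Proof.
move=> fi t0 ft; set f0 := f \_ _ in ft.
have f0t : f0 t = f t by rewrite /f0 patchE mem_setE in_itv/= andbT ltW.
pose M : R := m.+1%:R.
have M0 : 0 < M by rewrite ltr0n.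
(* The window of length [M * d] lies in the ball of radius [2 * M * d], whose length is [4 * M * d]:
   the factor [4 * M] converts the mean over the ball into [d^-1] times the integral. *)
have key d : 0 < d -> M * d < t ->
    (`|iter m.+1 (avg d) f t - f t|%:E <= (4 * M)%:E * davg f0 t (2 * M * d))%E.
  move=> d0 Mdt.
  have ci : locint (cst (1 : R)) by apply: continuous_locint; exact: cst_continuous.
  (* The value [f t] is carried inside the means as a constant, which is exact because
     [M * d < t]. *)
  have -> : iter m.+1 (avg d) f t - f t =
      iter m.+1 (avg d) (fun s => f s + (- f t) * cst 1 s) t.
    by rewrite iter_avg_linear// iter_avg1 ?mulr1// ltW.
  have gi : locint (fun s => f s + - f t * cst 1 s).
    by apply: locintD => //; exact: locintZ.
  have := iter_avg_le m t d0 gi; rewrite -lee_fin => /le_trans; apply.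
  have ii : rint leb `]t - M * d, t] (fun s => `|f0 s - f0 t|).
    apply: rint_abs; apply: rint_itv_oc.
    apply: rintB => //; first exact: locint_left_extension.
    by apply: (@rint_bounded _ _ _ `|f0 t|).
  have -> : \int[leb]_(s in `]t - m.+1%:R * d, t])
      `|((fun s => f s + - f t * cst 1 s) \_ `[0, +oo[) s| =
      \int[leb]_(s in `]t - M * d, t]) `|f0 s - f0 t|.
    apply: eq_Rintegral => s; rewrite inE/= in_itv/= => /andP[ts st].
    rewrite f0t /f0 !patchE !mem_setE !in_itv/= !andbT.
    rewrite (_ : 0 <= s) ?mulr1//.
    by rewrite ltW// (lt_trans _ ts)// subr_gt0.
  rewrite EFinM EFin_Rintegral// /davg /iavg.
  have r0 : 0 < 2 * M * d by rewrite !mulr_gt0.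
  rewrite (lebesgue_measure_ball _ (ltW r0)) inver mulrn_eq0/= gt_eqF//.
  rewrite muleA -EFinM.
  have -> : 4 * M * (2 * M * d *+ 2)^-1 = d^-1.
    have dE (N : R) : 0 < N -> 4 * N * (2 * N * d *+ 2)^-1 = d^-1.
      move=> N0; rewrite -mulr_natr; have d1 := lt0r_neq0 d0; have N1 := lt0r_neq0 N0.
      by field; rewrite d1 N1.
    exact: dE.
  rewrite lee_pmul2l ?lte_fin ?invr_gt0//.
  apply: ge0_subset_integral => //=.
  - exact: measurable_ball.
  - apply/measurable_EFinP; apply: measurableT_comp => //.
    apply: measurable_funB => //; apply: (@measurable_funS _ _ _ _ `[t - 2 * M * d, t + 2 * M * d]) => //.
      rewrite ball_itv; exact: subset_itv_oo_cc.
    exact: (rint_measurable (locint_left_extension _ _ fi)).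
  - rewrite ball_itv => x /=; rewrite !in_itv/= => /andP[tx xt].
    apply/andP; split.
      apply: le_lt_trans tx; rewrite lerB// ler_pM2r// ler_peMl ?ler1n// ltW//.
    by rewrite (le_lt_trans xt)// ltrDl.
move/cvge_at_rightP : ft => /(_ (fun n => 2 * M * n.+1%:R^-1)) ft.
have {}ft : davg f0 t (2 * M * n.+1%:R^-1) @[n --> \oo] --> 0%E.
  apply: ft; split.
    by move=> n; rewrite !mulr_gt0// invr_gt0.
  rewrite -[X in _ --> X](mulr0 (2 * M)).
  by apply: cvgM; [exact: cvg_cst|exact: cvg_harmonic].
have {}ft : ((4 * M)%:E * davg f0 t (2 * M * n.+1%:R^-1))%E @[n --> \oo] --> 0%E.
  by rewrite -[X in _ --> X](mule0 (4 * M)%:E); apply: cvgeM => //; exact: cvg_cst.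
apply/cvgrPdist_le => e e0.
have e0' : (0 < e%:E)%E by [].
move/fine_cvgP : ft => [ffin /cvgrPdist_le/(_ e e0) fc].
near=> n.
rewrite distrC -lee_fin; apply: (le_trans (key n.+1%:R^-1 _ _)).
- by rewrite invr_gt0.
- rewrite ltr_pdivrMr// -ltr_pdivrMl//.
  near: n; exists (Num.truncn (t^-1 * M)) => // n /= hn.
  rewrite (lt_le_trans (truncnS_gt _))// ler_nat ltnS.
  exact: hn.
have nfin : ((4 * M)%:E * davg f0 t (2 * M * n.+1%:R^-1))%E \is a fin_num.
  by near: n; exact: ffin.
rewrite -(fineK nfin) lee_fin.
have : `|0 - fine ((4 * M)%:E * davg f0 t (2 * M * n.+1%:R^-1))%E| <= e.
  by near: n; exact: fc.
by rewrite sub0r normrN; apply: le_trans; exact: ler_norm.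
Unshelve. all: by end_near. Qed.

Lemma ae_avg_cvg m f : locint f ->
  {ae leb, forall t, 0 < t ->
    iter m.+1 (avg n.+1%:R^-1) f t @[n --> \oo] --> f t}.
Proof.
move=> fi.
have : locally_integrable [set: R] (f \_ `[0, +oo[).
  split.
  - have h n : measurable_fun `[- (n%:R : R), n%:R] (f \_ `[0, +oo[).
      exact: rint_measurable (locint_left_extension (- n%:R) n%:R fi).
    have -> : [set: R] = \bigcup_n `[- (n%:R : R), n%:R].
      apply/esym; rewrite -subTset => x _; exists (Num.truncn `|x|).+1 => //=.
      by rewrite in_itv/= -ler_norml ltW// truncnS_gt.
    by apply/measurable_fun_bigcup => // n; exact: h.
  - exact: openT.
  - move=> K _ cK.
    have [M [_ KM]] := compact_bounded cK.
    have {}KM : K `<=` `[- (M + 1), M + 1].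
      move=> x /(KM (M + 1)); rewrite /= in_itv/= -ler_norml; apply.
      by rewrite ltrDl.
    have /integrableP[_] := @integrableS _ _ _ leb _ _ _ (measurable_itv _)
      (compact_measurable cK) KM (locint_left_extension _ _ fi).
    by [].
move/lebesgue_differentiation; apply: filterS; first exact: (ae_filter_ringOfSetsType leb).
by move=> t ft t0; exact: lebesgue_pt_avg.
Qed.

End averages.

(** * Almost-everywhere statements and null sections *)

Section ae_lebesgue.
Context {R : realType}.
Local Notation leb := (@lebesgue_measure R).
Implicit Types P : R -> Prop.

Lemma ae_imp P1 P2 : {ae leb, forall s, P1 s} -> (forall s, P1 s -> P2 s) ->
  {ae leb, forall s, P2 s}.
Proof.
by move=> h1 h; apply: (@filterS _ _ (ae_filter_ringOfSetsType leb) _ _ _ h1).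
Qed.

Lemma ae_imp2 P1 P2 P3 : {ae leb, forall s, P1 s} -> {ae leb, forall s, P2 s} ->
  (forall s, P1 s -> P2 s -> P3 s) -> {ae leb, forall s, P3 s}.
Proof.
move=> h1 h2 h.
exact: (@filterS2 _ _ (ae_filter_ringOfSetsType leb) _ _ _ h h1 h2).
Qed.

End ae_lebesgue.

Section null_sections.
Context d1 d2 (T1 : measurableType d1) (T2 : measurableType d2) (R : realType).
Variable m1 : {sigma_finite_measure set T1 -> \bar R}.
Variable m2 : {sigma_finite_measure set T2 -> \bar R}.

(** Both statements say that [B] is null for the product measure, by Tonelli for its indicator. This
    converts exceptional times at a fixed point into exceptional points at a fixed time. *)
Lemma ae_swap (B : set (T1 * T2)) : measurable B ->
  {ae m2, forall y, {ae m1, forall x, ~ B (x, y)}} ->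
  {ae m1, forall x, {ae m2, forall y, ~ B (x, y)}}.
Proof.
move=> mB hB; pose chi p : \bar R := (\1_B p)%:E.
have mchi : measurable_fun setT chi.
  by apply/measurable_EFinP; exact: measurable_indic.
have chi0 p : (0 <= chi p)%E by rewrite lee_fin.
have := fubini_tonelli (m1 := m1) (m2 := m2) _ mchi chi0.
have mG := measurable_fun_fubini_tonelli_G (m1 := m1) _ mchi chi0.
have mF := measurable_fun_fubini_tonelli_F (m2 := m2) _ mchi chi0.
have msec1 y : measurable_fun setT (fun x => chi (x, y)).
  by apply: (measurableT_comp mchi); exact: pair2_measurable.
have msec2 x : measurable_fun setT (fun y => chi (x, y)).
  by apply: (measurableT_comp mchi); exact: pair1_measurable.
rewrite [X in _ = X -> _](_ : _ = 0)%E; last first.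
  transitivity (\int[m2]_y (cst 0 y : \bar R))%E; last by rewrite integral_cst// mul0e.
  apply: ge0_ae_eq_integral => //.
    by move=> y _; exact: integral_ge0.
  apply: filterS hB => y By _.
  transitivity (\int[m1]_x (cst 0 x : \bar R))%E; last by rewrite integral_cst// mul0e.
  apply: ge0_ae_eq_integral => //.
  apply: filterS By => x /= nB _.
  by rewrite /chi indicE memNset.
move=> h0.
have : ae_eq m1 setT (fubini_F m2 chi) (cst 0%E).
  apply/ae_eq_integral_abs => //; rewrite -[RHS]h0.
  by apply: eq_integral => x _; rewrite gee0_abs//; exact: integral_ge0.
apply: filterS => x /(_ I) hx.
have : ae_eq m2 setT (fun y => chi (x, y)) (cst 0%E).
  apply/ae_eq_integral_abs => //; rewrite -[RHS]hx.
  by apply: eq_integral => y _; rewrite gee0_abs.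
apply: filterS => y /(_ I) /= hy By.
by move: hy; rewrite /chi indicE mem_set//= => -[] /eqP; rewrite oner_eq0.
Qed.

End null_sections.

(** * Time-dependent fields and their square norms in space *)

Section fields.
Context d (Y : measurableType d) (R : realType).
Variable nu : {sigma_finite_measure set Y -> \bar R}.
Local Notation leb := (@lebesgue_measure R).
Implicit Types (f g a : Y -> R -> R) (r s t c : R).

(* Time-dependent fields take the space variable first, so that the time
   operators apply to [f y]. *)
Definition jm f := measurable_fun setT (fun p : R * Y => f p.2 p.1).

(** The squared L2 norm, kept in the extended reals so that bounds can be stated before
    integrability is known. *)
Definition Q (g : Y -> R) : \bar R := (\int[nu]_y (g y ^+ 2)%:E)%E.

Lemma Q_ge0 (g : Y -> R) : (0 <= Q g)%E.
Proof. by apply: integral_ge0 => y _; rewrite lee_fin sqr_ge0. Qed.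

Lemma jm_slice f t : jm f -> measurable_fun setT (f^~ t).
Proof.
move=> jf; apply: (@measurableT_comp _ _ _ _ _ _ _ _ (fun y => (t, y)) jf).
exact: pair1_measurable.
Qed.

Lemma jm_line f y : jm f -> measurable_fun setT (f y).
Proof.
move=> jf; apply: (@measurableT_comp _ _ _ _ _ _ _ _ (fun t => (t, y)) jf).
exact: pair2_measurable.
Qed.

Lemma jm_comp f (h : R -> R) : jm f -> measurable_fun setT h ->
  jm (fun y t => f y (h t)).
Proof.
move=> jf mh.
apply: (@measurableT_comp _ _ _ _ _ _ _ _ (fun p : R * Y => (h p.1, p.2)) jf).
by apply: measurable_fun_pair => //; exact: measurableT_comp.
Qed.

Lemma jmB f g : jm f -> jm g -> jm (fun y t => f y t - g y t).
Proof. exact: measurable_funB. Qed.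

Lemma jmM f g : jm f -> jm g -> jm (fun y t => f y t * g y t).
Proof. exact: measurable_funM. Qed.

Lemma jm_cst c : jm (fun _ _ => c).
Proof. exact: measurable_cst. Qed.

Lemma jm_Dq (e : R) f : jm f -> jm (fun y => Dq e (f y)).
Proof.
move=> jf; apply: jmM; first exact: jm_cst.
by apply: jmB => //; apply: (@jm_comp f (fun t => t - e)) => //; exact: measurable_funB.
Qed.

Lemma jm_J f : jm f -> jm (fun y => J (f y)).
Proof.
move=> jf; rewrite /jm /J.
pose F (p : (R * Y) * R) := if (0 <= p.2 <= p.1.1) then f p.1.2 p.2 else 0.
rewrite (_ : (fun _ => _) = (fun p => \int[leb]_s F (p, s))); last first.
  apply/funext => -[t y]/=; rewrite Rintegral_mkcond; apply: eq_Rintegral => s _.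
  by rewrite patchE mem_setE in_itv.
have := @measurable_Rintegral2 _ _ (R * Y)%type (measurableTypeR R) R leb F; apply.
apply: measurable_fun_ifT.
- apply: measurable_and; apply: measurable_fun_ler => //.
  by do 2 apply: measurableT_comp => //.
- apply: (@measurableT_comp _ _ _ _ _ _ _ _ (fun p : (R * Y) * R => (p.2, p.1.2)) jf).
  by apply: measurable_fun_pair => //; exact: measurableT_comp.
- exact: measurable_cst.
Qed.

Lemma jm_iter_avg (e : R) m f : jm f -> jm (fun y => iter m (avg e) (f y)).
Proof. by move=> jf; elim: m => //= m IH; apply: jm_Dq; exact: jm_J. Qed.

(** Cauchy-Schwarz on an interval, from the nonnegativity of [(h s - c) ^+ 2] with [c] the mean of
    [h]; the case where [h] is not square integrable is trivial. *)
Lemma Rintegral_itv_sqr (h : R -> R) (u v : R) : u < v -> rint leb `]u, v] h ->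
  (((\int[leb]_(s in `]u, v]) h s) ^+ 2)%:E <=
  (v - u)%:E * \int[leb]_(s in `]u, v]) (h s ^+ 2)%:E)%E.
Proof.
move=> uv hi; have uv0 : 0 < v - u by rewrite subr_gt0.
have mh : measurable_fun `]u, v] h := rint_measurable hi.
have mh2 : measurable_fun `]u, v] (fun s => (h s ^+ 2)%:E).
  by apply/measurable_EFinP; exact: measurable_funX.
set m := \int[leb]_(s in _) h s.
have [hoo|] := eqVneq (\int[leb]_(s in `]u, v]) (h s ^+ 2)%:E)%E +oo%E.
  by rewrite hoo gt0_muley ?lte_fin// leey.
rewrite -ltey => h2.
have h2i : rint leb `]u, v] (fun s => h s ^+ 2).
  apply/integrableP; split => //.
  by under eq_integral do rewrite gee0_abs ?lee_fin ?sqr_ge0//.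
pose c := m / (v - u).
have ci : rint leb `]u, v] (fun=> c ^+ 2).
  by apply: rint_itv_oc; apply: (@rint_bounded _ _ _ `|c ^+ 2|).
have li : rint leb `]u, v] (fun s => (2 * c) * h s) by exact: rintZ.
have : \int[leb]_(s in `]u, v]) ((2 * c) * h s - c ^+ 2) <=
    \int[leb]_(s in `]u, v]) (h s ^+ 2).
  apply: le_Rintegral => //; first exact: rintB.
  by move=> s _; rewrite -subr_ge0; have := sqr_ge0 (h s - c); lra.
rewrite RintegralB// RintegralZl// -/m Rintegral_cst//= lebesgue_measure_itv/=.
rewrite lte_fin uv/= -EFin_Rintegral// -EFinM lee_fin => hle.
have -> : m ^+ 2 = (v - u) * (2 * c * m - c ^+ 2 * (v - u)).
  by rewrite /c; field; rewrite gt_eqF.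
by rewrite ler_pM2l.
Qed.

(** Cauchy-Schwarz in time for each [y], then Tonelli: Minkowski's integral inequality for a bound
    uniform in time. *)
Lemma Q_itv f (u v c : R) : jm f -> (forall y, rint leb `]u, v] (f y)) -> u < v ->
  0 <= c -> {ae leb, forall s, u < s <= v -> (Q (f^~ s) <= c%:E)%E} ->
  (Q (fun y => \int[leb]_(s in `]u, v]) f y s)%R <= ((v - u) ^+ 2 * c)%:E)%E.
Proof.
move=> jf fi uv c0 fc; have uv0 : 0 < v - u by rewrite subr_gt0.
pose g (p : R * Y) : \bar R := (((f p.2 \_ `]u, v]) p.1) ^+ 2)%:E.
have mg0 : measurable_fun setT (fun p : R * Y => (f p.2 \_ `]u, v]) p.1).
  rewrite (_ : (fun _ => _) =
    (fun p : R * Y => if u < p.1 <= v then f p.2 p.1 else 0)); last first.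
    by apply/funext => p; rewrite patchE mem_setE in_itv.
  apply: measurable_fun_ifT => //.
  by apply: measurable_and; [exact: measurable_fun_ltr|exact: measurable_fun_ler].
have mg : measurable_fun setT g.
  by apply/measurable_EFinP; exact: measurable_funX.
have g0 p : (0 <= g p)%E by rewrite lee_fin sqr_ge0.
have gE y : (\int[leb]_(s in `]u, v]) (f y s ^+ 2)%:E = \int[leb]_s g (s, y))%E.
  rewrite integral_mkcond; apply: eq_integral => s _; rewrite /g/= !patchE.
  by case: ifP => // _; rewrite expr0n.
have mint : measurable_fun setT (fun y => \int[leb]_(s in `]u, v]) f y s).
  rewrite (_ : (fun _ => _) =
      (fun y => \int[leb]_s ((f y \_ `]u, v]) s))); last first.
    by apply/funext => y; rewrite Rintegral_mkcond.
  exact: (@measurable_Rintegral1 _ _ (measurableTypeR R) Y R leb _ mg0).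
have mG : measurable_fun setT (fun y => \int[leb]_s g (s, y))%E.
  exact: (measurable_fun_fubini_tonelli_G (m1 := leb) _ mg g0).
apply: (@le_trans _ _ (\int[nu]_y ((v - u)%:E * \int[leb]_s g (s, y)))%E).
  apply: ge0_le_integral => //.
  - by move=> y _; rewrite lee_fin sqr_ge0.
  - by apply/measurable_EFinP; exact: measurable_funX.
  - by apply: emeasurable_funM.
  - by move=> y _; rewrite -gE; exact: Rintegral_itv_sqr.
have vu : (0 <= (v - u)%:E)%E by rewrite lee_fin ltW.
rewrite ge0_integralZl//; last by move=> y _; exact: integral_ge0.
rewrite -(fubini_tonelli (m1 := leb) (m2 := nu) _ mg g0) expr2 -mulrA EFinM.
rewrite lee_pmul2l ?lte_fin//.
apply: (@le_trans _ _ (\int[leb]_(s in `]u, v]) c%:E)%E); last first.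
  rewrite integral_cst//= lebesgue_measure_itv/= lte_fin uv -EFinD -EFinM.
  by rewrite mulrC.
rewrite [leRHS]integral_mkcond.
apply: ae_ge0_le_integral => //.
- by move=> s _; exact: integral_ge0.
- exact: (measurable_fun_fubini_tonelli_F (m2 := nu) _ mg g0).
- by move=> s _; rewrite patchE; case: ifP => _ //; rewrite lee_fin.
- by apply/(measurable_restrictT _ _).1 => //; exact: measurable_cst.
- apply: (ae_imp fc) => s hs _; rewrite patchE mem_setE in_itv/=.
  rewrite /g/=; case: ifPn => [us|us].
    have := hs us; rewrite /Q; apply: le_trans.
    by under eq_integral do rewrite patchE mem_setE in_itv/= us.
  under eq_integral do rewrite patchE mem_setE in_itv/= (negbTE us) expr0n/=.
  by rewrite integral_cst// mul0e.
Qed.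

Lemma Q_avg (e : R) f r c : 0 < e -> 0 <= c -> jm f -> (forall y, locint (f y)) ->
  (forall y, causal (f y)) ->
  {ae leb, forall s, s <= r -> (Q (f^~ s) <= c%:E)%E} ->
  (Q (fun y => avg e (f y) r) <= c%:E)%E.
Proof.
move=> e0 c0 jf fi f0 fc.
have -> : (fun y => avg e (f y) r) =
    (fun y => \int[leb]_(s in `]r - e, r]) (e^-1 * f y s)).
  apply/funext => y; rewrite (avgE _ (ltW e0))// causal_left_extension//.
  rewrite RintegralZl//; apply: rint_itv_oc.
  by have := locint_left_extension (r - e) r (fi y); rewrite causal_left_extension.
have -> : c = (r - (r - e)) ^+ 2 * (e ^- 2 * c).
  by rewrite opprB addrCA subrr addr0 mulrA mulfV ?mul1r// expf_neq0// gt_eqF.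
apply: Q_itv => //.
- by apply: jmM => //; exact: jm_cst.
- move=> y; apply: rintZ => //; apply: rint_itv_oc.
  by have := locint_left_extension (r - e) r (fi y); rewrite causal_left_extension.
- by rewrite gtrBl.
- by rewrite mulr_ge0// invr_ge0 exprn_ge0// ltW.
- apply: (ae_imp fc) => s hs /andP[_ sr]; have := hs sr.
  rewrite /Q; under [X in _ -> (X <= _)%E]eq_integral do rewrite exprMn EFinM.
  rewrite ge0_integralZl//.
  + rewrite exprVn EFinM => h; apply: lee_wpmul2l => //.
    by rewrite lee_fin invr_ge0 exprn_ge0// ltW.
  + by apply/measurable_EFinP; apply: measurable_funX; exact: jm_slice.
  + by move=> y _; rewrite lee_fin sqr_ge0.
  + by rewrite lee_fin sqr_ge0.
Qed.

Lemma Q_iter_avg (e : R) m f r c : 0 < e -> 0 <= c -> jm f ->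
  (forall y, locint (f y)) -> (forall y, causal (f y)) ->
  {ae leb, forall s, s <= r -> (Q (f^~ s) <= c%:E)%E} ->
  {ae leb, forall s, s <= r -> (Q (fun y => iter m (avg e) (f y) s) <= c%:E)%E}.
Proof.
move=> e0 c0 jf fi f0 fc; elim: m => // m IH.
apply: aeW => s sr; apply: (@Q_avg e (fun y => iter m (avg e) (f y))) => //.
- exact: jm_iter_avg.
- by move=> y; exact: iter_avg_locint.
- by case: m {IH} => // m y; exact: avg_causal (ltW e0).
- by apply: (ae_imp IH) => x hx xs; apply: hx; exact: le_trans sr.
Qed.

(** The last mean turns a bound for almost every time into a bound at the given time [r], since a
    mean ignores null sets of times. *)
Lemma Q_iter_avgS (e : R) m f r c : 0 < e -> 0 <= c -> jm f ->
  (forall y, locint (f y)) -> (forall y, causal (f y)) ->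
  {ae leb, forall s, s <= r -> (Q (f^~ s) <= c%:E)%E} ->
  (Q (fun y => iter m.+1 (avg e) (f y) r) <= c%:E)%E.
Proof.
move=> e0 c0 jf fi f0 fc.
apply: (@Q_avg e (fun y => iter m (avg e) (f y))) => //.
- exact: jm_iter_avg.
- by move=> y; exact: iter_avg_locint.
- by case: m => // m y; exact: avg_causal (ltW e0).
- exact: Q_iter_avg.
Qed.

Lemma Q_scale (g : Y -> R) (k : R) : measurable_fun setT g ->
  Q (fun y => k * g y) = ((k ^+ 2)%:E * Q g)%E.
Proof.
move=> mg; rewrite /Q; under eq_integral do rewrite exprMn EFinM.
rewrite ge0_integralZl// ?lee_fin ?sqr_ge0//.
- by apply/measurable_EFinP; exact: measurable_funX.
- by move=> y _; rewrite lee_fin sqr_ge0.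
Qed.

Lemma Q_J f t c : 0 <= t -> 0 <= c -> jm f ->
  (forall y, locint (f y)) -> (forall y, causal (f y)) ->
  {ae leb, forall s, s <= t -> (Q (f^~ s) <= c%:E)%E} ->
  (Q (fun y => J (f y) t) <= (t ^+ 2 * c)%:E)%E.
Proof.
rewrite le_eqVlt => /predU1P[<- c0 _ _ _ _|t0 c0 jf fi f0 fc].
  rewrite /Q; under eq_integral do rewrite J_le0// expr0n/=.
  by rewrite integral_cst// mul0e lee_fin expr0n mul0r.
(* The primitive at time [t] is [t] times the mean of step [t], so the bound on means applies. *)
have -> : (fun y => J (f y) t) = (fun y => t * avg t (f y) t).
  apply/funext => y; rewrite /avg /Dq subrr [J _ 0]J_le0// subr0 mulrA mulfV ?mul1r//.
  by rewrite gt_eqF.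
rewrite Q_scale; last exact: (jm_slice t (jm_iter_avg t 1 jf)).
rewrite [(t ^+ 2 * c)%:E]EFinM; apply: lee_wpmul2l; first by rewrite lee_fin sqr_ge0.
exact: Q_avg.
Qed.

End fields.

(** * Square-integrable functions and Young's inequality *)

Section square_integrable.
Context d (Y : measurableType d) (R : realType).
Variable nu : {sigma_finite_measure set Y -> \bar R}.
Implicit Types (f g : Y -> R).

Definition sqi g := measurable_fun setT g /\ (Q nu g < +oo)%E.

Lemma sqi_sqr g : sqi g -> rint nu setT (fun y => g y ^+ 2).
Proof.
move=> [mg gf]; apply/integrableP; split.
  by apply/measurable_EFinP; exact: measurable_funX.
by under eq_integral do rewrite gee0_abs ?lee_fin ?sqr_ge0//.
Qed.

Lemma sqi_Q g : sqi g -> Q nu g = (\int[nu]_y (g y ^+ 2))%:E.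
Proof. by move=> hg; rewrite EFin_Rintegral//; exact: sqi_sqr. Qed.

Lemma sqi_mul f g : sqi f -> sqi g -> rint nu setT (fun y => f y * g y).
Proof.
move=> hf hg; apply: (@rint_dom _ _ _ _ _ _ (fun y => f y ^+ 2 + g y ^+ 2)) => //.
- by apply: measurable_funM; [exact: hf.1|exact: hg.1].
- move=> y _; rewrite normrM -(real_normK (num_real (f y))) -(real_normK (num_real (g y))).
  have := sqr_ge0 (`|f y| - `|g y|); have := normr_ge0 (f y); have := normr_ge0 (g y).
  nra.
- by apply: rintD => //; exact: sqi_sqr.
Qed.

Lemma sqi_le g (c : R) : measurable_fun setT g -> (Q nu g <= c%:E)%E -> sqi g.
Proof. by move=> mg gc; split => //; rewrite (le_lt_trans gc)// ltry. Qed.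

Lemma sqi_lin f g (a b : R) : sqi f -> sqi g -> sqi (fun y => a * f y + b * g y).
Proof.
move=> hf hg; have m : measurable_fun setT (fun y => a * f y + b * g y).
  by apply: measurable_funD; apply: measurable_funM => //; [exact: hf.1|exact: hg.1].
split => //; have h : rint nu setT (fun y => (2 * a ^+ 2) * f y ^+ 2 + (2 * b ^+ 2) * g y ^+ 2).
  by apply: rintD => //; apply: rintZ => //; exact: sqi_sqr.
have /integrableP[_] : rint nu setT (fun y => (a * f y + b * g y) ^+ 2).
  apply: rint_dom h => //; first exact: measurable_funX.
  move=> y _; rewrite ger0_norm ?sqr_ge0//.
  by have := sqr_ge0 (a * f y - b * g y); nra.
by rewrite /Q; under eq_integral do rewrite /= ger0_norm ?sqr_ge0//.
Qed.

Lemma Young_Rintegral f g (a : R) : 0 < a -> sqi f -> sqi g ->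
  2 * `|\int[nu]_y (f y * g y)| <=
  a^-1 * \int[nu]_y (f y ^+ 2) + a * \int[nu]_y (g y ^+ 2).
Proof.
move=> a0 hf hg; have a'0 : 0 < a^-1 by rewrite invr_gt0.
rewrite -!RintegralZl//; [|exact: sqi_sqr|exact: sqi_sqr].
rewrite -RintegralD//; [|by apply: rintZ => //; exact: sqi_sqr
  |by apply: rintZ => //; exact: sqi_sqr].
have hfg := sqi_mul hf hg.
have := le_normr_Rintegral measurableT hfg.
rewrite -(ler_pM2l (ltr0Sn R 1)) => /le_trans; apply.
rewrite -RintegralZl//; last exact: rint_abs.
apply: le_Rintegral => //.
- by apply: rintZ => //; exact: rint_abs.
- by apply: rintD => //; apply: rintZ => //; exact: sqi_sqr.
move=> y _; rewrite normrM -(real_normK (num_real (f y))) -(real_normK (num_real (g y))).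
set p := `|f y|; set q := `|g y|.
have -> : a^-1 * p ^+ 2 + a * q ^+ 2 = a^-1 * (p - a * q) ^+ 2 + 2 * (p * q).
  by field; rewrite gt_eqF.
by rewrite lerDr mulr_ge0 ?sqr_ge0// ltW.
Qed.

Lemma Q_fin_le g (c : R) : measurable_fun setT g -> (Q nu g <= c%:E)%E ->
  \int[nu]_y (g y ^+ 2) <= c.
Proof. by move=> mg gc; rewrite -lee_fin -sqi_Q//; exact: sqi_le gc. Qed.

Lemma Q_le_fin g (c : R) : sqi g -> \int[nu]_y (g y ^+ 2) <= c -> (Q nu g <= c%:E)%E.
Proof. by move=> hg; rewrite sqi_Q// lee_fin. Qed.

End square_integrable.

(** * Energy identity, and recovery of a field from its means *)

Section energy_identity.
Context d (Y : measurableType d) (R : realType).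
Variable nu : {sigma_finite_measure set Y -> \bar R}.
Local Notation leb := (@lebesgue_measure R).
Implicit Types (f a : Y -> R -> R) (t c : R).

Lemma J_sqr (b : R -> R) t : continuous b -> causal b ->
  (J b t) ^+ 2 = \int[leb]_(s in `[0, t]) (2 * (b s * J b s)).
Proof.
move=> cb b0; rewrite -[RHS]/(J (fun s => 2 * (b s * J b s)) t).
have cf : continuous (fun s => 2 * (b s * J b s)).
  move=> s; apply: cvgM; first exact: cvg_cst.
  by apply: cvgM; [exact: cb|apply: J_continuous; exact: continuous_locint].
have F0 : causal (fun s => J b s ^+ 2).
  by move=> s s0; rewrite J_le0// expr0n.
have dF (s : R) : is_derive s 1 (fun s : R => J b s ^+ 2) (2 * (b s * J b s)).
  have dJ := is_derive_J cb b0 s.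
  have -> : (fun s : R => J b s ^+ 2) = J b * J b by apply/funext => z; rewrite expr2.
  apply: (is_derive_eq (is_deriveM dJ dJ)).
  by rewrite -[LHS]/(_ * _ + _ * _); ring.
by rewrite (J_primitive cf F0 dF).
Qed.

(** For each [y] the derivative of the square of [J (a y)] is twice [a y] times [J (a y)], by
    continuity of [a y] in time; the bound on [a], uniform in time, makes this product integrable in
    both variables, and Fubini concludes. *)
Lemma energy_identity a t c : 0 <= t -> 0 <= c -> jm a ->
  (forall y, continuous (a y)) -> (forall y, causal (a y)) ->
  (forall s, s <= t -> (Q nu (a^~ s) <= c%:E)%E) ->
  rint leb `[0, t] (fun s => \int[nu]_y (a y s * J (a y) s)) /\
  \int[nu]_y (J (a y) t ^+ 2) =
    2 * \int[leb]_(s in `[0, t]) \int[nu]_y (a y s * J (a y) s).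
Proof.
move=> t0 c0 ja ca a0 Qa.
have fi y : locint (a y) by apply: continuous_locint; exact: ca.
have jS : jm (fun y => J (a y)) by exact: jm_J.
pose F (p : R * Y) := if 0 <= p.1 <= t then 2 * (a p.2 p.1 * J (a p.2) p.1) else 0.
have QS s : 0 <= s -> s <= t -> (Q nu (fun y => J (a y) s) <= (t ^+ 2 * c)%:E)%E.
  move=> s0 st; apply: (@le_trans _ _ (s ^+ 2 * c)%:E).
    by apply: Q_J => //; apply: aeW => x xs; apply: Qa; exact: le_trans st.
  by rewrite lee_fin ler_wpM2r// ler_pXn2r// nnegrE.
have sa s : s <= t -> sqi nu (a^~ s).
  by move=> st; apply: sqi_le (Qa s st); exact: jm_slice.
have sS s : 0 <= s -> s <= t -> sqi nu (fun y => J (a y) s).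
  by move=> s0 st; apply: sqi_le (QS s s0 st); exact: (jm_slice s jS).
have mF : measurable_fun setT F.
  apply: measurable_fun_ifT => //.
  - by apply: measurable_and; exact: measurable_fun_ler.
  - by apply: measurable_funM => //; exact: (jmM ja jS).
have Fi : rint (leb \x nu)%E setT F.
  apply/(integrable12ltyP leb nu); first exact/measurable_EFinP.
  (* The product is dominated by the sum of the two squares: [c] for [a] and [t ^+ 2 * c] for its
     primitive. *)
  apply: (@le_lt_trans _ _ (\int[leb]_(s in `[0%R, t]) (c + t ^+ 2 * c)%:E)%E).
    rewrite [leRHS]integral_mkcond; apply: ge0_le_integral => //.
    - by move=> s _; exact: integral_ge0.
    - apply: (measurable_fun_fubini_tonelli_F (m2 := nu) (fun p => `|(F p)%:E|)%E).
        by apply: measurableT_comp => //; exact/measurable_EFinP.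
      by move=> p; exact: abse_ge0.
    - by apply/(measurable_restrictT _ _).1 => //; exact: measurable_cst.
    move=> s _; rewrite patchE mem_setE in_itv/= /F/=; case: ifPn => [/andP[s0 st]|_].
      have ha := sa s st; have hS := sS s s0 st.
      have hi := sqi_mul ha hS.
      apply: (@le_trans _ _ (\int[nu]_y (a y s ^+ 2 + J (a y) s ^+ 2)%:E)%E).
        apply: ge0_le_integral => //.
        - apply/measurable_EFinP; apply: measurableT_comp => //.
          by apply: measurable_funM => //; exact: (rint_measurable hi).
        - apply/measurable_EFinP; apply: measurable_funD; apply: measurable_funX.
            exact: ha.1.
          exact: hS.1.
        move=> y _; rewrite lee_fin ler_norml.
        have := sqr_ge0 (a y s - J (a y) s); have := sqr_ge0 (a y s + J (a y) s).
        by move=> h1 h2; apply/andP; split; nra.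
      under eq_integral do rewrite EFinD.
      rewrite ge0_integralD//.
      - by rewrite EFinD leeD//; [exact: Qa|exact: QS].
      - by move=> y _; rewrite lee_fin sqr_ge0.
      - by apply/measurable_EFinP; apply: measurable_funX; exact: ha.1.
      - by move=> y _; rewrite lee_fin sqr_ge0.
      - by apply/measurable_EFinP; apply: measurable_funX; exact: hS.1.
    under eq_integral do rewrite normr0.
    by rewrite integral_cst// mul0e.
  rewrite integral_cst//= lebesgue_measure_itv/= lte_fin.
  by case: ifP => _; rewrite -?EFinD -?EFinM ?mule0 ?ltry.
have inner s : \int[nu]_y F (s, y) =
    ((fun s => 2 * \int[nu]_y (a y s * J (a y) s)) \_ `[0, t]) s.
  rewrite patchE mem_setE in_itv/= /F/=; case: ifPn => [/andP[s0 st]|_].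
    by rewrite RintegralZl//; exact: sqi_mul (sa s st) (sS s s0 st).
  by rewrite Rintegral_cst// mul0r.
have hi : rint leb `[0, t] (fun s => 2 * \int[nu]_y (a y s * J (a y) s)).
  apply: rint_unpatch => //.
  by have := rint_fubini1 Fi; under eq_fun do rewrite inner.
have hi' : rint leb `[0, t] (fun s => \int[nu]_y (a y s * J (a y) s)).
  apply: (@eq_rint _ _ _ leb _ (fun s => 2^-1 * (2 * \int[nu]_y (a y s * J (a y) s)))) => //.
  - by move=> s _; rewrite mulrA mulVf ?mul1r.
  - exact: rintZ.
split => //.
rewrite -RintegralZl// [RHS]Rintegral_mkcond.
under [RHS]eq_Rintegral do rewrite -inner.
rewrite (Rintegral_swap Fi); apply: eq_Rintegral => y _.
rewrite J_sqr// Rintegral_mkcond; apply: eq_Rintegral => s _.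
by rewrite patchE mem_setE in_itv.
Qed.

(* Lebesgue differentiation in time recovers bounds on a field from bounds on
   its time averages. *)
Lemma Q_of_averages m f : jm f -> (forall y, locint (f y)) ->
  {ae leb, forall t, 0 < t -> forall c : R,
    (forall n, (Q nu (fun y => iter m.+1 (avg n.+1%:R^-1) (f y) t) <= c%:E)%E) ->
    (Q nu (f^~ t) <= c%:E)%E}.
Proof.
move=> jf fi.
pose A n (p : R * Y) : R := iter m.+1 (avg n.+1%:R^-1) (f p.2) p.1.
have mA n : measurable_fun setT (A n) by exact: jm_iter_avg.
pose e n (p : R * Y) : \bar R := `|(A n p)%:E - (f p.2 p.1)%:E|%E.
have me n : measurable_fun setT (e n).
  by apply: measurableT_comp => //; apply: emeasurable_funB; exact/measurable_EFinP.
(* The points where the means fail to converge, described by an upper limit so that measurability is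
   immediate. *)
pose B := [set p : R * Y | (0 < p.1) && (limn_esup (e^~ p) != 0%E)].
have mlim : measurable_fun setT (fun p => limn_esup (e^~ p)).
  exact: measurable_fun_limn_esup.
have mB : measurable B.
  have -> : B = [set p : R * Y | 0 < p.1] `&` ~` [set p | limn_esup (e^~ p) = 0%E].
    apply/seteqP; split => p /=; first by move=> /andP[p0 /eqP h]; split.
    by move=> [p0 h]; apply/andP; split => //; exact/eqP.
  apply: measurableI.
    rewrite (_ : [set p : R * Y | _] = setT `&` (fst @^-1` `]0%R, +oo[)).
      exact: measurable_fst.
    by apply/seteqP; split => p /=; rewrite in_itv/= andbT// => -[].
  apply: measurableC.
  have := mlim measurableT [set 0%E] (emeasurable_set1 _).
  by rewrite setTI.
have cvgB (p : R * Y) : 0 < p.1 -> ~ B p -> A n p @[n --> \oo] --> f p.2 p.1.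
  move=> p0 nB; have h0 : limn_esup (e^~ p) = 0%E.
    by apply/eqP/negPn/negP => h; apply: nB; rewrite /B/= p0.
  have := @limn_esup_le_cvg _ (e^~ p) 0%E; rewrite h0 lexx => /(_ isT).
  move=> /(_ (fun n => abse_ge0 _)) h.
  apply/cvgrPdist_le => eps eps0.
  move/fine_cvgP : h => [_ /cvgrPdist_le/(_ eps eps0)].
  by apply: filterS => n; rewrite /e /= sub0r normrN normr_id distrC.
have hB : {ae nu, forall y, {ae leb, forall t, ~ B (t, y)}}.
  apply: aeW => y; apply: (ae_imp (ae_avg_cvg m (fi y))) => t ht /andP[/= t0].
  have {}ht := ht t0; apply/negP; rewrite negbK; apply/eqP.
  have he : e n (t, y) @[n --> \oo] --> 0%E.
    apply/fine_cvgP; split; first by apply: nearW.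
    apply/cvgrPdist_le => eps eps0; move/cvgrPdist_le : ht => /(_ eps eps0).
    by apply: filterS => n; rewrite /e /A /= sub0r normrN normr_id distrC.
  by rewrite is_cvg_limn_esupE; [exact/cvg_lim|apply/cvg_ex; exists 0%E].
have hsw := @ae_swap _ _ (measurableTypeR R) Y R leb nu B mB hB.
apply: (ae_imp hsw) => t ht t0 c hc.
have mf : measurable_fun setT (f^~ t) by exact: jm_slice.
have mAt n : measurable_fun setT (fun y => ((A n (t, y)) ^+ 2)%:E).
  apply/measurable_EFinP; apply: measurable_funX.
  exact: (@jm_slice _ _ _ (fun y => iter m.+1 (avg n.+1%:R^-1) (f y)) t (mA n)).
have lim y : ~ B (t, y) -> limn_einf (fun n => ((A n (t, y)) ^+ 2)%:E) = ((f y t) ^+ 2)%:E.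
  move=> nB; have h : ((A n (t, y)) ^+ 2)%:E @[n --> \oo] --> ((f y t) ^+ 2)%:E.
    apply: cvg_EFin; first exact: nearW.
    by have := cvgB (t, y) t0 nB => /= h; apply: cvgM; exact: h.
  by rewrite is_cvg_limn_einfE; [exact/cvg_lim|apply/cvg_ex; eexists; exact: h].
have mle : measurable_fun setT (fun y => limn_einf (fun n => ((A n (t, y)) ^+ 2)%:E)).
  apply: measurableT_comp => //.
  by apply: measurable_fun_limn_esup => n; exact: measurableT_comp.
(* At almost every point the square of the field is the lower limit of the squares of its means, so
   Fatou's lemma passes the bounds to the limit. *)
apply: (@le_trans _ _ (\int[nu]_y limn_einf (fun n => ((A n (t, y)) ^+ 2)%:E))%E).
  rewrite le_eqVlt; apply/orP; left; apply/eqP; apply: ae_eq_integral => //.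
    by apply/measurable_EFinP; exact: measurable_funX.
  by apply: filterS ht => y nB _; rewrite lim.
apply: le_trans (fatou nu measurableT mAt _) _.
  by move=> n y _; rewrite lee_fin sqr_ge0.
rewrite limn_einf_lim; apply: lime_le; first exact: is_cvg_einfs.
apply: nearW => n; apply: le_trans (hc n).
by apply: ereal_inf_lbound => /=; exists n => /=.
Qed.

End energy_identity.

(** * Space variable: moments, double primitives and duality *)

Section spatial.
Context {R : realType}.
Variable L : R.
Local Notation leb := (@lebesgue_measure R).
Implicit Types (F f g E S z : R -> R) (a b : R).

Lemma Rintegral_FTC F f a b : a <= b -> continuous f ->
  (forall x : R, is_derive x 1 F (f x)) -> \int[leb]_(x in `[a, b]) f x = F b - F a.
Proof.
rewrite le_eqVlt => /predU1P[->|ab] cf dF.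
  by rewrite set_itv1 Rintegral_set1 subrr.
have cF : continuous F.
  by move=> s; apply/differentiable_continuous/derivable1_diffP; have [] := dF s.
rewrite /Rintegral (@continuous_FTC2 _ f F)//.
- exact: continuous_subspaceT.
- split.
  + by move=> x _; have [] := dF x.
  + by apply: cvg_at_right_filter; exact: cF.
  + by apply: cvg_at_left_filter; exact: cF.
- by move=> x _; rewrite derive1E; have [_ ->] := dF x.
Qed.

Lemma J_lin a b f g : locint f -> locint g ->
  J (fun s => a * f s + b * g s) = (fun r => a * J f r + b * J g r).
Proof.
move=> fi gi; apply/funext => r; rewrite /J RintegralD//.
- by rewrite !RintegralZl//; [exact: gi|exact: fi].
- by apply: rintZ => //; exact: fi.
- by apply: rintZ => //; exact: gi.
Qed.

Lemma JJ_lin a b f g : locint f -> locint g ->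
  J (J (fun s => a * f s + b * g s)) = (fun r => a * J (J f) r + b * J (J g) r).
Proof.
by move=> fi gi; rewrite J_lin// J_lin//; apply: continuous_locint; exact: J_continuous.
Qed.

(** Extension by zero from the open interval: integrals run over the whole line, and such functions
    are causal, so that [J] also serves as the primitive in space. *)
Definition vanish g := forall x, ~~ (0 < x < L) -> g x = 0.

Definition xf g := sqi leb g /\ vanish g.

Lemma vanish_causal g : vanish g -> causal g.
Proof. by move=> vg x x0; rewrite vg// ltNge x0. Qed.

Lemma xf_lin a b f g : xf f -> xf g -> xf (fun x => a * f x + b * g x).
Proof.
move=> [f2 fv] [g2 gv]; split; first exact: sqi_lin.
by move=> x xL; rewrite fv// gv// !mulr0 addr0.
Qed.

Lemma rint_mul_sqi g f : xf g -> measurable_fun setT f ->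
  rint leb `[0, L] (fun x => f x ^+ 2) -> rint leb setT (fun x => f x * g x).
Proof.
move=> [g2 gv] mf f2; have mg := g2.1.
have {}f2 : rint leb setT ((fun x => f x ^+ 2) \_ `[0, L]) by exact: rint_patch.
have h : rint leb setT (fun x => ((fun x => f x ^+ 2) \_ `[0, L]) x + g x ^+ 2).
  by apply: rintD => //; exact: sqi_sqr.
apply: rint_dom h => //; first exact: measurable_funM.
move=> x _; rewrite patchE mem_setE in_itv/=.
have [/andP[x0 xL]|xL] := boolP (0 < x < L); last first.
  by rewrite gv// mulr0 normr0 expr0n addr0; case: ifP => // _; exact: sqr_ge0.
rewrite (ltW x0) (ltW xL) /= normrM -(real_normK (num_real (f x))) -(real_normK (num_real (g x))).
have := sqr_ge0 (`|f x| - `|g x|); have := normr_ge0 (f x); have := normr_ge0 (g x).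
nra.
Qed.

Lemma rint_mul_continuous g f : xf g -> continuous f ->
  rint leb setT (fun x => f x * g x).
Proof.
move=> xg cf; apply: rint_mul_sqi => //; first exact: continuous_measurable_fun.
apply: continuous_locint => x; apply: cvgM; exact: cf.
Qed.

Lemma xf_rint g : xf g -> rint leb setT g.
Proof.
move=> xg; have := rint_mul_continuous xg (@cst_continuous _ _ (1 : R)).
by apply: eq_rint => // x _; rewrite mul1r.
Qed.

Lemma xf_locint g : xf g -> locint g.
Proof. by move=> xg T; apply: (rintS _ _ _ (xf_rint xg)). Qed.

Lemma Rintegral_vanish f : vanish f -> \int[leb]_x f x = \int[leb]_(x in `[0, L]) f x.
Proof.
move=> vf; rewrite [RHS]Rintegral_mkcond; apply: eq_Rintegral => x _.
rewrite patchE mem_setE in_itv/=; case: ifPn => // xL.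
by apply: vf; apply: contra xL => /andP[/ltW -> /ltW ->].
Qed.

Definition moment0 g := \int[leb]_x g x.
Definition moment1 g := \int[leb]_x (x * g x).

Lemma moment0_J g : vanish g -> moment0 g = J g L.
Proof. by move=> vg; rewrite /moment0 Rintegral_vanish. Qed.

Lemma moment1_J g : xf g -> moment1 g = L * moment0 g - J (J g) L.
Proof.
move=> xg; have vg := xg.2; rewrite -J2E; last exact: xf_locint.
rewrite moment0_J// /moment1 Rintegral_vanish; last first.
  by move=> x xL; rewrite vg// mulr0.
have gi : rint leb `[0, L] g by exact: xf_locint.
have hi : rint leb `[0, L] (fun x => g x * (L - x)).
  apply: (rintS measurableT) => //.
  have := rint_mul_continuous xg (f := fun x => L - x).
  move=> /(_ _)h; apply: eq_rint (h _) => //; first by move=> x _; rewrite mulrC.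
  by move=> x; apply: cvgB; [exact: cvg_cst|exact: cvg_id].
rewrite /J -RintegralZl// -RintegralB//; last exact: rintZ.
by apply: eq_Rintegral => x _; ring.
Qed.

(** Solved form of S'' = z without boundary conditions: the affine part is free. *)
Definition rel1 S z := exists a b : R,
  {ae leb, forall x, 0 < x < L -> S x = a + b * x + J (J z) x}.

Lemma rel1_lin a b S1 z1 S2 z2 : xf z1 -> xf z2 -> rel1 S1 z1 -> rel1 S2 z2 ->
  rel1 (fun x => a * S1 x + b * S2 x) (fun x => a * z1 x + b * z2 x).
Proof.
move=> /xf_locint l1 /xf_locint l2 [a1 [b1 h1]] [a2 [b2 h2]].
exists (a * a1 + b * a2), (a * b1 + b * b2).
apply: (ae_imp2 h1 h2) => x {}h1 {}h2 xL; rewrite h1// h2//.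
by rewrite JJ_lin//; ring.
Qed.

(* Two integrations by parts; the moment conditions are the natural boundary
   conditions. *)
Lemma orthogonal_Rintegral E S z : xf E -> xf z -> xf S ->
  moment0 E = 0 -> moment1 E = 0 -> rel1 S z ->
  \int[leb]_x (E x * S x) = \int[leb]_x (z x * J (J E) x).
Proof.
move=> xE xz xS E0 E1 [a [b hS]].
have lE := xf_locint xE; have lz := xf_locint xz.
have cJz := J_continuous lz; have cJE := J_continuous lE.
have cJJz := J_continuous (continuous_locint cJz).
have cJJE := J_continuous (continuous_locint cJE).
have dJJz := is_derive_J cJz (J_le0 z).
have dJJE := is_derive_J cJE (J_le0 E).
(* The two moment conditions amount to [J E] and [J (J E)] vanishing at [L]; no boundary term is
   left there. *)
have JJE0 : J (J E) L = 0 by have := moment1_J xE; rewrite E0 E1; lra.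
(* Subtracting this constant makes the double primitive of [z] vanish at [L]; the affine part
   absorbs it, and [E] does not see affine functions. *)
pose c := J (J z) L.
have Ei (f : R -> R) : continuous f -> rint leb setT (fun x => f x * E x).
  exact: rint_mul_continuous.
have mE := xE.1.1.
transitivity (\int[leb]_x ((a + c) * E x + b * (x * E x) + (J (J z) x - c) * E x)).
  apply: ae_eq_Rintegral => //.
  - by apply: measurable_funM => //; exact: xS.1.1.
  - apply: measurable_funD.
      apply: measurable_funD; first exact: measurable_funM.
      by apply: measurable_funM => //; exact: measurable_funM.
    apply: measurable_funM => //; apply: continuous_measurable_fun => x.
    by apply: cvgB; [exact: cJJz|exact: cvg_cst].
  - apply: (ae_imp hS) => x h _; have [xL|xL] := boolP (0 < x < L).
      by rewrite h//; ring.
    by rewrite xE.2//; ring.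
rewrite RintegralD//; last 2 first.
- apply: rintD => //; apply: rintZ => //; [exact: xf_rint|].
  by apply: Ei => x; exact: cvg_id.
- by apply: Ei => x; apply: cvgB; [exact: cJJz|exact: cvg_cst].
rewrite RintegralD//; last 2 first.
- by apply: rintZ => //; exact: xf_rint.
- by apply: rintZ => //; apply: Ei => x; exact: cvg_id.
rewrite RintegralZl//; last exact: xf_rint.
rewrite RintegralZl//; last by apply: Ei => x; exact: cvg_id.
rewrite -/(moment0 E) -/(moment1 E) E0 E1 !mulr0 !add0r.
rewrite Rintegral_vanish; last by move=> x xL; rewrite xE.2// mulr0.
rewrite [RHS]Rintegral_vanish; last by move=> x xL; rewrite xz.2// mul0r.
transitivity (\int[leb]_(x in `[0, L]) (E x * (J (J z) x - c))).
  by apply: eq_Rintegral => x _; rewrite mulrC.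
have cN (h : R -> R) : continuous h -> continuous (fun x => - h x).
  by move=> ch x; apply: cvgN; exact: ch.
have dN (h h' : R -> R) : (forall x : R, is_derive x 1 h (h' x)) ->
    forall x : R, is_derive x 1 (fun x : R => - h x) (- h' x).
  by move=> dh x; exact: is_deriveN.
have W1 s : 0 <= s <= L -> \int[leb]_(x in `[s, L]) (- J z x) = J (J z) s - c.
  move=> /andP[s0 sL].
  by rewrite (Rintegral_FTC sL (cN _ cJz) (dN _ _ dJJz)) opprK addrC.
have W2 s : 0 <= s <= L -> \int[leb]_(x in `[s, L]) (- J E x) = J (J E) s.
  move=> /andP[s0 sL].
  by rewrite (Rintegral_FTC sL (cN _ cJE) (dN _ _ dJJE)) JJE0 oppr0 add0r opprK.
rewrite (J_weight lE (cN _ cJz) W1) (J_weight lz (cN _ cJE) W2).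
by apply: eq_Rintegral => x _; rewrite mulrC mulrN mulNr.
Qed.

End spatial.

(** * Smooth functions of one variable and flat bumps *)

Section smooth_functions.
Context {R : realType}.
Implicit Types (f g h : R -> R) (n m : nat) (a b c x y : R).

Definition is_derivative f f' := forall x : R, is_derive x 1 f (f' x).

(** The derivative is given existentially, so that stability under sums, products and affine changes
    of variable is a plain induction on the order. *)
Fixpoint Cn n f := if n is n'.+1 then
  exists2 f', is_derivative f f' & Cn n' f' else continuous f.

Definition smooth1 f := forall n, Cn n f.

Lemma is_derivative_continuous f f' : is_derivative f f' -> continuous f.
Proof.
by move=> df x; apply/differentiable_continuous/derivable1_diffP; have [] := df x.
Qed.

Lemma is_derivative_derive1 f f' : is_derivative f f' -> f^`() = f'.
Proof. by move=> df; apply/funext => x; rewrite derive1E; have [_ ->] := df x. Qed.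

Lemma Cn_continuous n f : Cn n f -> continuous f.
Proof. by case: n => // n [f' df _]; exact: is_derivative_continuous df. Qed.

Lemma CnW n f : Cn n.+1 f -> Cn n f.
Proof.
elim: n f => [|n IH] f; first exact: Cn_continuous.
by move=> [f' df cf']; exists f' => //; exact: IH.
Qed.

Lemma Cn_cst n c : Cn n (cst c).
Proof.
elim: n c => [|n IH] c /=; first exact: cst_continuous.
by exists (cst 0) => // x; exact: is_derive_cst.
Qed.

Lemma CnD n f g : Cn n f -> Cn n g -> Cn n (fun x => f x + g x).
Proof.
elim: n f g => [|n IH] f g /=.
  by move=> cf cg x; apply: cvgD; [exact: cf|exact: cg].
move=> [f' df cf] [g' dg cg]; exists (fun x => f' x + g' x); last exact: IH.
by move=> x; exact: is_deriveD.
Qed.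

Lemma CnM n f g : Cn n f -> Cn n g -> Cn n (fun x => f x * g x).
Proof.
elim: n f g => [|n IH] f g.
  by move=> cf cg x; apply: cvgM; [exact: cf|exact: cg].
move=> cnf cng; have nf := CnW cnf; have ng := CnW cng.
case: cnf cng => [f' df cf] [g' dg cg].
exists (fun x => f x * g' x + g x * f' x).
  by move=> x; exact: (is_deriveM (df x) (dg x)).
by apply: CnD; exact: IH.
Qed.

Lemma Cn_affine n f a b : Cn n f -> Cn n (fun x => f (a * x + b)).
Proof.
elim: n f => [|n IH] f /=.
  move=> cf x; apply: (@continuous_comp _ _ _ (fun x => a * x + b) f); last exact: cf.
  by apply: cvgD; [apply: cvgM; [exact: cvg_cst|exact: cvg_id]|exact: cvg_cst].
move=> [f' df cf]; exists (fun x => f' (a * x + b) * a).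
  move=> x; apply: (@is_derive1_comp _ f (fun x => a * x + b) x _ _ (df _)).
  by apply: is_derive_eq; rewrite /GRing.scale/=; ring.
by apply: CnM; [exact: IH|exact: Cn_cst].
Qed.

Lemma smooth1_cst c : smooth1 (cst c). Proof. by move=> n; exact: Cn_cst. Qed.

Lemma smooth1D f g : smooth1 f -> smooth1 g -> smooth1 (fun x => f x + g x).
Proof. by move=> sf sg n; exact: CnD. Qed.

Lemma smooth1M f g : smooth1 f -> smooth1 g -> smooth1 (fun x => f x * g x).
Proof. by move=> sf sg n; exact: CnM. Qed.

Lemma smooth1Z c f : smooth1 f -> smooth1 (fun x => c * f x).
Proof. by move=> sf; apply: (smooth1M (smooth1_cst c)). Qed.

Lemma smooth1B f g : smooth1 f -> smooth1 g -> smooth1 (fun x => f x - g x).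
Proof.
move=> sf sg; have := smooth1D sf (smooth1Z (-1) sg).
by under eq_fun do rewrite mulN1r.
Qed.

Lemma smooth1_affine f a b : smooth1 f -> smooth1 (fun x => f (a * x + b)).
Proof. by move=> sf n; exact: Cn_affine. Qed.

Lemma smooth1_continuous f : smooth1 f -> continuous f.
Proof. by move=> sf; exact: (sf 0). Qed.

Lemma smooth1_derive f : smooth1 f -> exists2 f', is_derivative f f' & smooth1 f'.
Proof.
move=> sf; have [f' df _] := sf 1; exists f' => // n.
have [g dg cg] := sf n.+1.
by rewrite -(is_derivative_derive1 df) (is_derivative_derive1 dg).
Qed.

Lemma smooth1_primitive f f' : is_derivative f f' -> smooth1 f' -> smooth1 f.
Proof.
move=> df sf; case=> [|n]; first exact: is_derivative_continuous df.
by exists f' => //; exact: sf.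
Qed.

(* The classical flat function is [flat 0]; the family [flat m] is closed under
   derivation up to linear combinations. *)
Definition flat m y : R := if 0 < y then y^-1 ^+ m * expR (- y^-1) else 0.

Lemma flat_ge0 m y : 0 <= flat m y.
Proof.
rewrite /flat; case: ifP => // y0.
by rewrite mulr_ge0 ?expR_ge0// exprn_ge0// invr_ge0 ltW.
Qed.

(** Keeps a single term of the exponential series, of degree [m.+2] in [y^-1]. The remaining factor
    [y ^+ 2] gives each [flat m] a null derivative at 0. *)
Lemma flat_le m y : flat m y <= (m.+2)`!%:R * y ^+ 2.
Proof.
rewrite /flat; case: ifP => y0; last by rewrite mulr_ge0 ?sqr_ge0.
have y'0 : 0 < y^-1 by rewrite invr_gt0.
rewrite expRN ler_pdivrMr ?expR_gt0//.
have := expR_ge1Dxn m.+1 (ltW y'0).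
set F : R := (m.+2)`!%:R; have F0 : 0 < F by rewrite ltr0n fact_gt0.
move=> h; have {}h : y^-1 ^+ m.+2 / F <= expR y^-1.
  by apply: le_trans h; rewrite lerDr.
have : F * y ^+ 2 * (y^-1 ^+ m.+2 / F) <= F * y ^+ 2 * expR y^-1.
  by rewrite ler_wpM2l// mulr_ge0 ?sqr_ge0// ltW.
apply: le_trans; rewrite le_eqVlt; apply/orP; left; apply/eqP.
rewrite -(addn2 m) exprD; set q := y^-1 ^+ m.
by rewrite exprVn; field; rewrite !gt_eqF.
Qed.

Lemma is_derive_flat m y :
  is_derive y 1 (flat m) (flat m.+2 y - m%:R * flat m.+1 y).
Proof.
have [y0|y0|->] := ltgtP y 0.
- rewrite /flat !ltNge (ltW y0)/= mulr0 subr0.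
  apply: (@near_eq_is_derive _ _ _ (cst 0)).
  near=> z; rewrite /flat/= ltNge ifF//; apply/negbTE; rewrite negbK.
  by apply: ltW; near: z; exact: lt_nbhsl.
- have y0' : y != 0 by rewrite gt_eqF.
  apply: (@near_eq_is_derive _ _ _
      (fun z : R => z^-1 ^+ m * expR (- z^-1))).
    near=> z; rewrite /flat ifT//.
    by near: z; exact: lt_nbhsr.
  have dV : is_derive y 1 (fun z : R => z^-1) (- y ^- 2).
    have := @is_deriveV _ id y 1 1 y0' _.
    by rewrite /GRing.scale/= mulr1; apply.
  have dX := is_deriveX m dV.
  have dE : is_derive y 1 (fun z : R => expR (- z^-1)) (expR (- y^-1) * y ^- 2).
    apply: (@is_derive1_comp _ expR (fun z => - z^-1)).
    by have := is_deriveN dV; rewrite opprK.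
  have dM := is_deriveM dX dE.
  have -> : (fun z : R => z^-1 ^+ m * expR (- z^-1)) =
      ((fun z : R => z^-1) ^+ m) * (fun z : R => expR (- z^-1)).
    apply/funext => z; rewrite /GRing.mul/=; congr (_ * _).
    by elim: (m) => [|k IH]; rewrite ?expr0// !exprS IH.
  apply: (is_derive_eq dM); rewrite /GRing.scale/= /flat y0.
  have -> : ((fun z : R => z^-1) ^+ m) y = y^-1 ^+ m.
    by elim: (m) => [|k IH]; rewrite ?expr0// !exprS -IH.
  rewrite -exprVn; set E := expR _; set q := y^-1.
  case: m {dX dM} => [|m] /=; first by rewrite expr1 expr0; ring.
  by rewrite !exprS; set p := q ^+ m; ring.
- have fl0 k : flat k 0 = 0 by rewrite /flat ltxx.
  rewrite !fl0 mulr0 subr0.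
  have h : h^-1 *: ((flat m \o shift 0) (h *: 1) - flat m 0) @[h --> 0^'] --> (0 : R).
    apply/cvgrPdist_le => e e0; pose C : R := (m.+2)`!%:R.
    have C0 : 0 < C by rewrite ltr0n fact_gt0.
    near=> h.
    have h0 : h != 0 by near: h; exact: nbhs_dnbhs_neq.
    rewrite fl0 subr0 sub0r normrN /= /GRing.scale/= mulr1 addr0 normrM normfV.
    rewrite ler_pdivrMl ?normr_gt0// ger0_norm ?flat_ge0//.
    apply: (le_trans (flat_le m h)); rewrite -/C -(real_normK (num_real h)) expr2.
    rewrite mulrA [leRHS]mulrC ler_wpM2r// mulrC -ler_pdivlMr// ltW//.
    near: h; apply: dnbhs0_lt; exact: divr_gt0.
  split; first by apply/cvg_ex; exists 0.
  by apply/cvg_lim.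
Unshelve. all: by end_near. Qed.

Lemma smooth1_flat m : smooth1 (flat m).
Proof.
move=> n; elim: n m => [|n IH] m.
  exact: is_derivative_continuous (is_derive_flat m).
exists (fun y => flat m.+2 y - m%:R * flat m.+1 y); first exact: is_derive_flat.
under eq_fun do rewrite -mulNr.
by apply: CnD => //; apply: CnM => //; exact: Cn_cst.
Qed.

Lemma flat0_le1 y : flat 0 y <= 1.
Proof.
rewrite /flat expr0 mul1r; case: ifP => // y0.
by rewrite expR_le1 lerNl oppr0 invr_ge0 ltW.
Qed.

Lemma flat0_cvg y : 0 < y -> flat 0 (n.+1%:R * y) @[n --> \oo] --> (1 : R).
Proof.
move=> y0; rewrite (_ : (fun _ => _) = (fun n : nat => expR (- (n.+1%:R^-1 * y^-1)))).
  rewrite -[X in _ --> X]expR0; apply: continuous_cvg.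
    exact: continuous_expR.
  rewrite -[X in _ --> X]oppr0; apply: cvgN.
  have h : (fun n : nat => n.+1%:R^-1 * y^-1 : R) @ \oo --> (0 * y^-1 : R).
    by apply: cvgM; [exact: cvg_harmonic|exact: cvg_cst].
  by rewrite -[X in _ --> X](mul0r y^-1).
by apply/funext => n; rewrite /flat mulr_gt0// expr0 mul1r invfM.
Qed.

(** Smooth, with values in [0, 1], null outside the open interval and converging pointwise to its
    indicator: by dominated convergence, testing against all [n] recovers integrals over
    intervals. *)
Definition flat_bump a b n x : R := flat 0 (n.+1%:R * (x - a)) * flat 0 (n.+1%:R * (b - x)).

Lemma smooth1_flat_bump a b n : smooth1 (flat_bump a b n).
Proof.
rewrite /flat_bump; apply: smooth1M.
- have := smooth1_affine n.+1%:R (- n.+1%:R * a) (smooth1_flat 0).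
  by under eq_fun do rewrite mulNr -mulrBr.
- have := smooth1_affine (- n.+1%:R) (n.+1%:R * b) (smooth1_flat 0).
  by under eq_fun do rewrite mulNr addrC -mulrBr.
Qed.

Lemma flat_bump_ge0 a b n x : 0 <= flat_bump a b n x.
Proof. by apply: mulr_ge0; exact: flat_ge0. Qed.

Lemma flat_bump_le1 a b n x : flat_bump a b n x <= 1.
Proof. by apply: mulr_ile1; (exact: flat_ge0 || exact: flat0_le1). Qed.

Lemma flat_bump_out a b n x : ~~ (a < x < b) -> flat_bump a b n x = 0.
Proof.
rewrite negb_and -!leNgt => /orP[xa|bx]; rewrite /flat_bump.
- by rewrite {1}/flat ifF ?mul0r//; apply/negbTE; rewrite -leNgt pmulr_rle0// subr_le0.
- by rewrite mulrC {1}/flat ifF ?mul0r//; apply/negbTE; rewrite -leNgt pmulr_rle0// subr_le0.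
Qed.

Lemma flat_bump_cvg a b x : flat_bump a b n x @[n --> \oo] --> ((a < x < b)%R%:R : R).
Proof.
have [/andP[ax xb]|xab] := boolP (a < x < b).
  rewrite /= -[X in _ --> X]mulr1; apply: cvgM; apply: flat0_cvg; by rewrite subr_gt0.
under eq_fun do rewrite flat_bump_out//.
exact: cvg_cst.
Qed.

End smooth_functions.

(** * Du Bois-Reymond lemmas in space and in time *)

Section du_Bois_Reymond.
Context {R : realType}.
Local Notation leb := (@lebesgue_measure R).
Implicit Types (f g h p q : R -> R) (n : nat) (a b A B c x y : R).

(** The interval is open, so [f] also vanishes at [a] and [b]; this provides the null boundary
    values in integrations by parts. *)
Definition supp a b f := forall x, ~~ (a < x < b) -> f x = 0.

Lemma suppW a b A B f : A <= a -> b <= B -> supp a b f -> supp A B f.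
Proof.
move=> Aa bB sf x xAB; apply: sf; apply: contra xAB => /andP[ax xb].
by rewrite (le_lt_trans Aa ax) (lt_le_trans xb bB).
Qed.

Lemma continuous_rint_itv a b f : continuous f -> rint leb `[a, b] f.
Proof.
move=> cf; apply: continuous_compact_integrable; first exact: segment_compact.
exact: continuous_subspaceT.
Qed.

Lemma supp_patch a b f : supp a b f -> f \_ `[a, b] = f.
Proof.
move=> sf; apply/funext => x; rewrite patchE mem_setE in_itv/=; case: ifPn => // xab.
by rewrite sf//; apply: contra xab => /andP[/ltW -> /ltW ->].
Qed.

Lemma supp_rint a b f : continuous f -> supp a b f -> rint leb setT f.
Proof.
move=> cf sf; rewrite -(supp_patch sf); apply: rint_patch => //.
exact: continuous_rint_itv.
Qed.

Lemma supp_Rintegral a b f : supp a b f -> \int[leb]_x f x = \int[leb]_(x in `[a, b]) f x.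
Proof. by move=> sf; rewrite [RHS]Rintegral_mkcond supp_patch. Qed.

Lemma rint_mul_continuous_supp a b f h : continuous f -> supp a b f ->
  rint leb setT h -> rint leb setT (fun x => h x * f x).
Proof.
move=> cf sf hi.
have [M fM] : exists M : R, forall x, `|f x| <= M.
  have [ab|ba] := leP a b.
    have cnf : {within `[a, b], continuous (fun x => `|f x|)}.
      apply: continuous_subspaceT => x.
      by apply: (@continuous_comp _ _ _ f (fun z => `|z|)); [exact: cf|exact: norm_continuous].
    have [c _ hc] := EVT_max ab cnf; exists `|f c| => x.
    have [xab|xab] := boolP (a < x < b); last by rewrite sf// normr0.
    by apply: hc; rewrite in_itv/=; move/andP: xab => [/ltW -> /ltW ->].
  exists 0 => x; rewrite sf ?normr0//; apply/negP => /andP[ax xb].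
  by have := lt_trans ax (lt_trans xb ba); rewrite ltxx.
have hMi : rint leb setT (fun x => M * `|h x|) by apply: rintZ => //; exact: rint_abs.
apply: (rint_dom _ _ _ hMi) => //.
- apply: measurable_funM; first exact: rint_measurable hi.
  exact: continuous_measurable_fun.
- by move=> x _; rewrite normrM mulrC ler_wpM2r.
Qed.

Lemma flat_bump_continuous a b n : continuous (flat_bump a b n : R -> R).
Proof. exact/smooth1_continuous/smooth1_flat_bump. Qed.

Lemma Rintegral_flat_bump_cvg a b h : rint leb setT h ->
  \int[leb]_x (h x * flat_bump a b n x) @[n --> \oo] --> \int[leb]_(x in `]a, b[) h x.
Proof.
move=> hi; have mh : measurable_fun setT h := rint_measurable hi.
rewrite [X in _ --> X]Rintegral_mkcond.
have hai : leb.-integrable setT (fun x => `|h x|%:E) by exact: rint_abs.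
have mb n : measurable_fun setT (fun x => (h x * flat_bump a b n x)%:E).
  apply/measurable_EFinP; apply: measurable_funM => //.
  by apply: continuous_measurable_fun; exact: flat_bump_continuous.
have ml : measurable_fun setT (fun x => ((h \_ `]a, b[) x)%:E).
  apply/measurable_EFinP; apply/(measurable_restrictT _ _).1 => //.
  exact: measurable_funTS.
have := @dominated_convergence _ _ _ leb setT measurableT
  (fun n x => (h x * flat_bump a b n x)%:E) (fun x => ((h \_ `]a, b[) x)%:E)
  (fun x => `|h x|%:E) mb ml _ hai _.
case=> [||fi _ fc].
- apply: aeW => x _; apply: cvg_EFin; first exact: nearW.
  rewrite patchE mem_setE in_itv/=.
  have -> : (if a < x < b then h x else point) = h x * ((a < x < b)%R%:R : R).
    by case: ifP => _; rewrite ?mulr1 ?mulr0.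
  by apply: cvgM; [exact: cvg_cst|exact: flat_bump_cvg].
- apply: aeW => x n _; rewrite lee_fin normrM ler_piMr//.
  by rewrite ger0_norm ?flat_bump_ge0// flat_bump_le1.
- apply: fine_cvg; rewrite fineK//.
  exact: (integrable_fin_num measurableT fi).
Qed.

(** Letting the bumps tend to indicators, the integral of [h] over any interval inside []A, B[] is
    0; hence the backward means at an interior point eventually vanish, and they converge to [h]
    almost everywhere. [0 <= A] because the means ignore negative arguments. *)
Lemma flat_bump_orthogonal A B h : 0 <= A -> rint leb setT h ->
  (forall a b n, A < a -> a < b -> b < B -> \int[leb]_x (h x * flat_bump a b n x) = 0) ->
  {ae leb, forall x, A < x < B -> h x = 0}.
Proof.
move=> A0 hi hb.
have hab a b : A < a -> a < b -> b < B -> \int[leb]_(x in `]a, b]) h x = 0.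
  move=> Aa ab bB; have := @Rintegral_flat_bump_cvg a b h hi.
  under eq_fun do rewrite hb//.
  move=> h0; rewrite -Rintegral_itv_bndo_bndc; last exact: (rintS measurableT).
  exact: (cvg_unique (@Rhausdorff R) h0 (cvg_cst (0 : R))).
have lh : locint h by move=> T; exact: (rintS measurableT).
apply: (ae_imp (ae_avg_cvg 0 lh)) => t ht /andP[At tB].
have {}ht := ht (le_lt_trans A0 At).
suff h0 : (iter 1 (avg n.+1%:R^-1) h t) @[n --> \oo] --> 0.
  exact: (cvg_unique _ ht h0).
apply: cvg_near_cst; near=> n.
have d0 : 0 < n.+1%:R^-1 :> R by rewrite invr_gt0.
have dA : A < t - n.+1%:R^-1.
  rewrite ltrBrDr -ltrBrDl; near: n.
  have tA : 0 < t - A by rewrite subr_gt0.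
  have := @cvg_harmonic R; move/cvgrPdist_lt => /(_ _ tA).
  by apply: filterS => n; rewrite sub0r normrN gtr0_norm ?invr_gt0.
rewrite /= (avgE _ (ltW d0))//.
rewrite (@eq_Rintegral _ _ _ leb _ h); last first.
  move=> x; rewrite inE/= in_itv/= => /andP[tx _].
  by rewrite patchE mem_setE in_itv/= andbT (le_trans A0)// ltW// (lt_trans dA).
by rewrite hab ?mulr0// gtrBl.
Unshelve. all: by end_near. Qed.

(** The integrals of the bumps tend to [b - a], so one of them is nonzero and can be normalised. *)
Lemma unit_bump a b : a < b ->
  exists eta : R -> R, [/\ smooth1 eta, supp a b eta & \int[leb]_x eta x = 1].
Proof.
move=> ab.
pose h : R -> R := ((cst 1 : R -> R^o)) \_ `[a, b].
have hi : rint leb setT h.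
  by apply: rint_patch => //; apply: continuous_rint_itv; exact: cst_continuous.
have hE n : \int[leb]_x (h x * flat_bump a b n x) = \int[leb]_x flat_bump a b n x.
  apply: eq_Rintegral => x _; rewrite /h patchE mem_setE in_itv/=.
  case: ifPn => xab; first by rewrite mul1r.
  by rewrite mul0r flat_bump_out//; apply: contra xab => /andP[/ltW -> /ltW ->].
have := @Rintegral_flat_bump_cvg a b h hi.
under eq_fun do rewrite hE.
have -> : \int[leb]_(x in `]a, b[) h x = b - a.
  transitivity (\int[leb]_(x in `]a, b[) (1 : R)).
    apply: eq_Rintegral => x; rewrite inE/= in_itv/= => /andP[/ltW ax /ltW xb].
    by rewrite /h patchE mem_setE in_itv/= ax xb.
  by rewrite Rintegral_cst//= lebesgue_measure_itv/= lte_fin ab mul1r.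
have ba0 : 0 < b - a by rewrite subr_gt0.
move/cvgrPdist_lt => /(_ _ ba0)[n _ /(_ n (leqnn n))] /= hn.
set I := \int[leb]_x flat_bump a b n x in hn.
have I0 : I != 0.
  by apply/negP => /eqP I0; move: hn; rewrite I0 subr0 gtr0_norm ?ltxx.
exists (fun x => I^-1 * flat_bump a b n x); split.
- by apply: smooth1Z; exact: smooth1_flat_bump.
- by move=> x xab; rewrite flat_bump_out// mulr0.
- rewrite RintegralZl//; first by rewrite -/I mulVf.
  apply: (@supp_rint a b); first exact: flat_bump_continuous.
  exact: flat_bump_out.
Qed.

Lemma supp_primitive A B f : smooth1 f -> supp A B f -> \int[leb]_x f x = 0 ->
  exists F, [/\ is_derivative F f, smooth1 F & supp A B F].
Proof.
move=> sf sAB f0; have cf := smooth1_continuous sf.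
have fi := supp_rint cf sAB.
pose F x := \int[leb]_(t in `]-oo, x]) f t.
have dF : is_derivative F f.
  move=> x; have fx : rint leb `]-oo, x + 1] f by exact: (rintS measurableT).
  have xx1 : x < x + 1 by rewrite ltrDl.
  have [d1 d2] := @continuous_FTC1 R f -oo%O x (x + 1) xx1 fx (ltNyr _) (cf x).
  by split; [exact: d1|rewrite -derive1E; exact: d2].
exists F; split => //; first exact: smooth1_primitive dF sf.
move=> x; rewrite negb_and -!leNgt => /orP[xA|Bx].
  rewrite /F (@eq_Rintegral _ _ _ leb _ (cst 0)); last first.
    move=> t; rewrite inE/= in_itv/= => tx.
    by rewrite sAB// negb_and -leNgt (le_trans tx xA).
  by rewrite Rintegral_cst// mul0r.
rewrite -[RHS]f0 /F Rintegral_mkcond; apply: eq_Rintegral => t _.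
rewrite patchE mem_setE in_itv/=; case: leP => // xt.
by rewrite sAB// negb_and orbC -leNgt (le_trans Bx (ltW xt)).
Qed.

(** A primitive is compactly supported only for a null integral, which subtracting the right
    multiple of [eta] ensures. *)
Lemma supp_corrected_primitive A B eta f : smooth1 f -> supp A B f ->
  smooth1 eta -> supp A B eta -> \int[leb]_x eta x = 1 ->
  exists F, [/\ is_derivative F (fun x => f x - (\int[leb]_y f y) * eta x),
    smooth1 F & supp A B F].
Proof.
move=> sf suf se sue e1; set c := \int[leb]_y f y.
apply: supp_primitive.
- by apply: smooth1B => //; exact: smooth1Z.
- by move=> x xAB; rewrite suf// sue// mulr0 subr0.
have fi := supp_rint (smooth1_continuous sf) suf.
have ei := supp_rint (smooth1_continuous se) sue.
by rewrite RintegralB//; [rewrite RintegralZl// e1 mulr1 subrr|exact: rintZ].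
Qed.

Lemma J_weight_derivative f F F' r : locint f -> is_derivative F F' -> continuous F' ->
  F r = 0 -> \int[leb]_(x in `[0, r]) (f x * F x) =
    - \int[leb]_(x in `[0, r]) (F' x * J f x).
Proof.
move=> lf dF cF' Fr.
have cN : continuous (fun x => - F' x) by move=> x; apply: cvgN; exact: cF'.
rewrite (@J_weight _ f (fun x => - F' x) F r)//.
- rewrite -mulN1r -RintegralZl//.
    by apply: eq_Rintegral => x _; rewrite mulN1r mulNr.
  apply: continuous_rint_itv => x; apply: cvgM; first exact: cF'.
  exact: J_continuous.
- move=> s /andP[s0 sr].
  have dN (x : R) : is_derive x 1 (fun x : R => - F x) (- F' x).
    by have dFx := dF x; exact: is_deriveN.
  by rewrite (Rintegral_FTC sr cN dN) Fr oppr0 add0r opprK.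
Qed.

(* Test functions with a prescribed second derivative on the half-line: the
   correction making them compactly supported lives at negative arguments. *)
Lemma half_line_test a b B n : 0 < a -> a < b -> b < B ->
  exists F F1 F2 : R -> R, [/\ is_derivative F F1, is_derivative F1 F2,
    smooth1 F /\ supp (-3) B F,
    F1 B = 0 &
    forall x, 0 <= x -> F2 x = flat_bump a b n x].
Proof.
move=> a0 ab bB.
have N32 : -3 < -2 :> R by rewrite ltrN2 ltr_nat.
have B0 : 0 < B := lt_trans a0 (lt_trans ab bB).
have [eta [se sue e1]] := unit_bump N32.
have sue' : supp (-3) B eta.
  by apply: suppW sue => //; rewrite (le_trans _ (ltW B0))// lerNl oppr0.
have sub : supp (-3) B (flat_bump a b n).
  apply: (@suppW a b) (@flat_bump_out _ a b n); last exact: ltW.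
  by rewrite (le_trans _ (ltW a0))// lerNl oppr0.
have [th [dth sth suth]] := supp_corrected_primitive (smooth1_flat_bump a b n) sub se sue' e1.
have [F [dF sF suF]] := supp_corrected_primitive sth suth se sue' e1.
set c := \int[leb]_y _ in dth; set c' := \int[leb]_y _ in dF.
have [eta' de _] := smooth1_derive se.
exists F, (fun x => th x - c' * eta x), (fun x => flat_bump a b n x - c * eta x - c' * eta' x).
split => //.
- move=> x; have h := is_deriveZ c' (de x).
  exact: (is_deriveB (dth x) h).
- by rewrite suth ?sue' ?mulr0 ?subr0// ltxx andbF.
- move=> x x0; have eta0 y : -2 < y -> eta y = 0.
    by move=> y2; rewrite sue// negb_and orbC -leNgt ltW.
  have x2 : -2 < x by rewrite (lt_le_trans _ x0)// ltrNl oppr0.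
  have -> : eta' x = 0.
    have hn : \forall z \near x, cst 0 z = eta z.
      by near=> z; rewrite eta0//; near: z; exact: lt_nbhsr.
    have [_ <-] := de x.
    by have [_ ->] := @near_eq_is_derive _ _ _ (cst 0) eta x 1 0 hn (is_derive_cst _ _ _).
  by rewrite eta0// !mulr0 !subr0.
Unshelve. all: by end_near. Qed.

(** Two integrations by parts: the boundary terms vanish at [B] because of [F] and [F1], and at 0
    because of the causal primitives of [f]. *)
Lemma half_line_test_Rintegral f F F1 F2 B a b n : 0 < B -> locint f ->
  is_derivative F F1 -> is_derivative F1 F2 -> smooth1 F -> F B = 0 -> F1 B = 0 ->
  (forall x, 0 <= x -> F2 x = flat_bump a b n x) ->
  \int[leb]_(x in `[0, B]) (f x * F x) =
  \int[leb]_(x in `[0, B]) (J (J f) x * flat_bump a b n x).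
Proof.
move=> B0 lf dF dF1 sF FB F1B F2E.
have cF1 := is_derivative_continuous dF1.
have cF2 : continuous F2.
  have [g dg sg] := smooth1_derive sF; have E1 : F1 = g.
    by rewrite -(is_derivative_derive1 dF) (is_derivative_derive1 dg).
  have [g' dg' sg'] := smooth1_derive sg.
  suff -> : F2 = g' by exact: smooth1_continuous.
  by rewrite -(is_derivative_derive1 dF1) E1 (is_derivative_derive1 dg').
have lJ : locint (J f) by apply: continuous_locint; exact: J_continuous.
rewrite (J_weight_derivative lf dF cF1 FB).
have := J_weight_derivative lJ dF1 cF2 F1B.
under eq_Rintegral do rewrite mulrC.
move=> ->; rewrite opprK; apply: eq_Rintegral => x.
by rewrite inE/= in_itv/= => /andP[x0 _]; rewrite F2E// mulrC.
Qed.

(** The hypothesis makes [q - J p] orthogonal to derivatives of test functions. Any bump is such a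
    derivative up to a multiple of one fixed [eta], so [q - J p] acts on bumps like a constant. *)
Lemma du_Bois_Reymond1 T p q : 0 < T -> rint leb setT p -> rint leb setT q ->
  (forall F F' a b, 0 < a -> b < T -> is_derivative F F' -> smooth1 F -> supp a b F ->
     \int[leb]_x (q x * F' x) = - \int[leb]_x (p x * F x)) ->
  exists c, {ae leb, forall x, 0 < x < T -> q x = c + J p x}.
Proof.
move=> T0 pi qi H.
have T34 : T / 4 < T / 2 by rewrite ltr_pM2l// ltf_pV2// ?posrE// ltr_nat.
have [eta [se sue e1]] := unit_bump T34.
have lp : locint p by move=> x; exact: (rintS measurableT).
pose JT := (J p) \_ `[0, T].
have JTi : rint leb setT JT.
  by apply: rint_patch => //; apply: continuous_rint_itv; exact: J_continuous.
pose h x := q x - JT x.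
have hi : rint leb setT h by exact: rintB.
(* The value of the constant is read off on [eta], whose integral is 1. *)
pose c := \int[leb]_x (h x * eta x).
have Ti : rint leb setT ((cst c) \_ `[0, T]).
  by apply: rint_patch => //; apply: continuous_rint_itv; exact: cst_continuous.
exists c.
have gi : rint leb setT (fun x => h x - ((cst c) \_ `[0, T]) x) by exact: rintB.
have key : {ae leb, forall x, 0 < x < T -> h x - ((cst c) \_ `[0, T]) x = 0}.
  apply: flat_bump_orthogonal gi _ => // a b n a0 ab bT.
  pose A := Num.min a (T / 4); pose B := Num.max b (T / 2).
  have A0 : 0 < A by rewrite lt_min a0 divr_gt0.
  have BT : B < T by rewrite gt_max bT ltr_pdivrMr// ltr_pMr// ltr1n.
  have sub : supp A B (flat_bump a b n).
    by apply: suppW (@flat_bump_out _ a b n); rewrite ?ge_min ?le_max lexx.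
  have sue' : supp A B eta.
    by apply: suppW sue; rewrite ?ge_min ?le_max lexx orbT.
  have [F [dF sF suF]] := supp_corrected_primitive (smooth1_flat_bump a b n) sub se sue' e1.
  set cb := \int[leb]_y _ in dF.
  have := H F _ A B A0 BT dF sF suF.
  have cF' : continuous (fun x => flat_bump a b n x - cb * eta x).
    apply: smooth1_continuous; apply: smooth1B; first exact: smooth1_flat_bump.
    exact: smooth1Z.
  have suT g : supp A B g -> supp 0 T g by apply: suppW; exact: ltW.
  have suT' : supp 0 T (fun x => flat_bump a b n x - cb * eta x).
    by move=> x xT; rewrite (suT _ sub)// (suT _ sue')// mulr0 subr0.
  have -> : \int[leb]_x (p x * F x) = \int[leb]_(x in `[0, T]) (p x * F x).
    by apply: supp_Rintegral => x xT; rewrite (suT _ suF)// mulr0.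
  have FT : F T = 0 by rewrite (suT _ suF)// ltxx andbF.
  rewrite (J_weight_derivative lp dF cF' FT) opprK.
  have -> : \int[leb]_(x in `[0, T]) ((flat_bump a b n x - cb * eta x) * J p x) =
      \int[leb]_x (JT x * (flat_bump a b n x - cb * eta x)).
    rewrite Rintegral_mkcond; apply: eq_Rintegral => x _; rewrite /JT !patchE.
    by case: ifP => _; [rewrite mulrC|rewrite mul0r].
  move=> Hq.
  have cbump := @flat_bump_continuous a b n; have ceta := smooth1_continuous se.
  have hb := rint_mul_continuous_supp cbump sub hi.
  have he := rint_mul_continuous_supp ceta sue' hi.
  have Hh : \int[leb]_x (h x * (flat_bump a b n x - cb * eta x)) = 0.
    under eq_Rintegral do rewrite mulrBl.
    rewrite RintegralB//; first by rewrite Hq subrr.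
    - exact: (rint_mul_continuous_supp cF' suT').
    - exact: (rint_mul_continuous_supp cF' suT').
  have cbE : \int[leb]_x (h x * flat_bump a b n x) = c * cb.
    apply/eqP; rewrite -subr_eq0 -[X in _ == X]Hh; apply/eqP.
    under [RHS]eq_Rintegral do rewrite mulrBr (mulrCA _ cb).
    by rewrite RintegralB//; [rewrite RintegralZl// mulrC|exact: rintZ].
  under eq_Rintegral do rewrite mulrBl.
  rewrite RintegralB//; last exact: (rint_mul_continuous_supp cbump sub Ti).
  rewrite cbE; apply/eqP; rewrite subr_eq0; apply/eqP.
  rewrite -RintegralZl//; last exact: (supp_rint cbump sub).
  apply: eq_Rintegral => x _; rewrite patchE mem_setE in_itv/=; case: ifPn => // xT.
  rewrite (suT _ sub) ?mulr0 ?mul0r//; apply: contra xT => /andP[/ltW -> /ltW ->] //.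
apply: (ae_imp key) => x hx xT; have := hx xT.
rewrite /h /JT !patchE !mem_setE !in_itv/=.
by move/andP: xT => [/ltW -> /ltW ->] /=; lra.
Qed.

(** Reduced to the first-order lemma, applied to [q] and to [J p] shifted by a constant [K]; one
    more primitive then yields the affine part of [rel1]. *)
Lemma du_Bois_Reymond2 T p q : 0 < T -> rint leb setT p -> rint leb setT q ->
  (forall F F1 F2 a b, 0 < a -> b < T -> is_derivative F F1 -> is_derivative F1 F2 ->
     smooth1 F -> supp a b F ->
     \int[leb]_x (q x * F2 x) = \int[leb]_x (p x * F x)) ->
  rel1 T q p.
Proof.
have alg (x1 x2 x3 x4 c : R) : x1 - c * x2 = - (x3 - c * x4) ->
    x1 = - (x3 - (x2 + x4) * c) by lra.
move=> T0 pi qi H.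
have T34 : T / 4 < T / 2 by rewrite ltr_pM2l// ltf_pV2// ?posrE// ltr_nat.
have [eta [se sue e1]] := unit_bump T34.
have lp : locint p by move=> x; exact: (rintS measurableT).
have [eta' deta seta'] := smooth1_derive se.
pose JT := (J p) \_ `[0, T].
have JTi : rint leb setT JT.
  by apply: rint_patch => //; apply: continuous_rint_itv; exact: J_continuous.
(* A test function [th] is a derivative only after subtracting its integral times [eta]; [K]
   collects what this correction adds, per unit of that integral. *)
pose K := \int[leb]_x (q x * eta' x) + \int[leb]_x (JT x * eta x).
have KTi : rint leb setT ((cst K) \_ `[0, T]).
  by apply: rint_patch => //; apply: continuous_rint_itv; exact: cst_continuous.
pose p1 x := JT x - ((cst K) \_ `[0, T]) x.
have p1i : rint leb setT p1 by exact: rintB.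
have ceta := smooth1_continuous se; have ceta' := smooth1_continuous seta'.
have sueT : supp 0 T eta.
  by apply: suppW sue; rewrite ?divr_ge0// ?ler_pdivrMr ?ler_peMr ?ler1n// ltW.
have supp_der A B f f' : supp A B f -> is_derivative f f' ->
    forall x, ~~ (A <= x <= B) -> f' x = 0.
  move=> sf df x; rewrite negb_and -!ltNge => h.
  have hn : \forall z \near x, cst 0 z = f z.
    case/orP: h => [xA|Bx].
    - near=> z; rewrite sf// negb_and -leNgt; apply/orP; left.
      by apply: ltW; near: z; exact: lt_nbhsl.
    - near=> z; rewrite sf// negb_and orbC -leNgt; apply/orP; left.
      by apply: ltW; near: z; exact: lt_nbhsr.
  have [_ <-] := df x.
  by have [_ ->] := @near_eq_is_derive _ _ _ (cst 0) f x 1 0 hn (is_derive_cst _ _ _).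
have rint_mul_der A B f f' h : smooth1 f -> supp A B f -> is_derivative f f' ->
    continuous f' -> rint leb setT h -> rint leb setT (fun x => h x * f' x).
  move=> sf suf df cf' hi.
  have suf' : supp (A - 1) (B + 1) f'.
    move=> x xAB; apply: (supp_der _ _ _ _ suf df); apply: contra xAB.
    move=> /andP[Ax xB]; apply/andP; split.
      by rewrite (lt_le_trans _ Ax)// gtrBl.
    by rewrite (le_lt_trans xB)// ltrDl.
  exact: rint_mul_continuous_supp cf' suf' hi.
have [c hc] : exists c, {ae leb, forall x, 0 < x < T -> q x = c + J p1 x}.
  apply: du_Bois_Reymond1 => // th th' a b a0 bT dth sth suth.
  pose A := Num.min a (T / 4); pose B := Num.max b (T / 2).
  have A0 : 0 < A by rewrite lt_min a0 divr_gt0.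
  have BT : B < T by rewrite gt_max bT ltr_pdivrMr// ltr_pMr// ltr1n.
  have suth1 : supp A B th.
    by apply: suppW suth; rewrite ?ge_min ?le_max lexx.
  have sue1 : supp A B eta.
    by apply: suppW sue; rewrite ?ge_min ?le_max lexx orbT.
  have suT g : supp A B g -> supp 0 T g by apply: suppW; exact: ltW.
  have [F [dF sF suF]] := supp_corrected_primitive sth suth1 se sue1 e1.
  set ct := \int[leb]_y _ in dF.
  have cth := smooth1_continuous sth.
  have cth' : continuous th'.
    have [g dg sg] := smooth1_derive sth.
    rewrite -(is_derivative_derive1 dth) (is_derivative_derive1 dg).
    exact: smooth1_continuous.
  have dF1 : is_derivative (fun x => th x - ct * eta x) (fun x => th' x - ct * eta' x).
    move=> x; have h1 := is_deriveZ ct (deta x).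
    exact: (is_deriveB (dth x) h1).
  have := H F _ _ A B A0 BT dF dF1 sF suF.
  have -> : \int[leb]_x (p x * F x) = \int[leb]_(x in `[0, T]) (p x * F x).
    by apply: supp_Rintegral => x xT; rewrite (suT _ suF)// mulr0.
  have FT : F T = 0 by rewrite (suT _ suF)// ltxx andbF.
  have cF1 : continuous (fun x => th x - ct * eta x) by exact: is_derivative_continuous dF1.
  rewrite (J_weight_derivative lp dF cF1 FT).
  have -> : \int[leb]_(x in `[0, T]) ((th x - ct * eta x) * J p x) =
      \int[leb]_x (JT x * th x - ct * (JT x * eta x)).
    rewrite Rintegral_mkcond; apply: eq_Rintegral => x _; rewrite /JT !patchE.
    by case: ifP => _; [ring|rewrite !mul0r mulr0 subr0].
  have i1 := rint_mul_continuous_supp cth suth1 JTi.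
  have i2 := rint_mul_continuous_supp ceta sue1 JTi.
  have i3 := rint_mul_der _ _ _ _ _ sth suth1 dth cth' qi.
  have i4 := rint_mul_der _ _ _ _ _ se sue1 deta ceta' qi.
  rewrite RintegralB//; last exact: rintZ.
  rewrite RintegralZl//.
  under eq_Rintegral do rewrite mulrBr (mulrCA _ ct).
  rewrite RintegralB//; last exact: rintZ.
  rewrite RintegralZl// => Hq.
  have -> : \int[leb]_x (p1 x * th x) = \int[leb]_x (JT x * th x - K * th x).
    apply: eq_Rintegral => x _; rewrite /p1 mulrBl; congr (_ - _).
    rewrite patchE mem_setE in_itv/=; case: ifPn => // xT.
    rewrite (suT _ suth1) ?mulr0//; apply: contra xT => /andP[/ltW -> /ltW ->] //.
  have i5 := supp_rint cth suth1.
  rewrite RintegralB//; last exact: rintZ.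
  by rewrite RintegralZl// -/ct /K; exact: alg.
exists c, (- K); apply: (ae_imp hc) => x hx xT; rewrite hx//.
have [x0 xT'] : 0 <= x /\ x <= T by move/andP: xT => [/ltW ? /ltW ?].
suff -> : J p1 x = J (J p) x - K * x by rewrite mulNr addrA addrAC.
have -> : J p1 x = \int[leb]_(s in `[0, x]) (J p s - K).
  apply: eq_Rintegral => s; rewrite inE/= in_itv/= => /andP[s0 sx].
  by rewrite /p1 /JT !patchE mem_setE in_itv/= s0 (le_trans sx xT').
rewrite RintegralB//.
- by rewrite Rintegral_itv_cst// subr0.
- by apply: continuous_rint_itv; exact: J_continuous.
- by apply: continuous_rint_itv; exact: cst_continuous.
Unshelve. all: by end_near. Qed.

Lemma ae_point (P : R -> Prop) a b : a < b -> {ae leb, forall x, P x} ->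
  exists2 x, a < x < b & P x.
Proof.
move=> ab [N [mN N0 PN]]; apply: contrapT => h.
have abN : `]a, b[ `<=` N.
  move=> x /=; rewrite in_itv/= => xab; apply: PN => /= Px.
  by apply: h; exists x.
have : (leb `]a, b[ <= 0)%E by rewrite -N0; apply: le_measure; rewrite ?inE.
by rewrite /= lebesgue_measure_itv/= lte_fin ab -EFinD lee_fin subr_le0 leNgt ab.
Qed.

(** Solved form of mu g'' = - f with g and g' null at both ends: at 0 through the double primitive,
    at [L] through the moments. *)
Definition rel2 (L mu : R) f g := [/\ moment0 f = 0, moment1 f = 0 &
  {ae leb, forall x, 0 < x < L -> mu * g x = - J (J f) x}].

(* Test functions that do not vanish at the ends of the interval carry the
   natural boundary conditions, here as vanishing moments. *)
Lemma natural_boundary (L mu : R) f g : 0 < L -> xf L f -> xf L g ->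
  (forall F F1 F2 B, is_derivative F F1 -> is_derivative F1 F2 ->
     smooth1 F -> supp (-3) B F ->
     \int[leb]_x (f x * F x) + mu * \int[leb]_x (g x * F2 x) = 0) ->
  rel2 L mu f g.
Proof.
(* The extra unit leaves room beyond [L], where [g] vanishes while test functions still act: this is
   where the conditions at [L] are detected. *)
move=> L0 xf1 xg H; pose B := L + 1.
have B0 : 0 < B by rewrite addr_gt0.
have LB : L < B by rewrite ltrDl.
have lf := xf_locint xf1.
have fi := xf_rint xf1; have gi := xf_rint xg.
have cJ := J_continuous lf; have cJJ := J_continuous (continuous_locint cJ).
have dJJ := is_derive_J cJ (J_le0 f).
pose h x := ((J (J f)) \_ `[0, B]) x + mu * g x.
have JJi : rint leb setT ((J (J f)) \_ `[0, B]).
  by apply: rint_patch => //; exact: continuous_rint_itv.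
have hi : rint leb setT h by apply: rintD => //; exact: rintZ.
have vB (u : R -> R) : vanish L u -> supp 0 B u.
  move=> vu x xB; apply: vu; apply: contra xB => /andP[-> xL] /=.
  exact: lt_trans LB.
have key : {ae leb, forall x, 0 < x < B -> h x = 0}.
  apply: flat_bump_orthogonal hi _ => // a b n a0 ab bB.
  have [F [F1 [F2 [dF dF1 [sF suF] F1B F2E]]]] := @half_line_test a b B n a0 ab bB.
  have FB : F B = 0 by rewrite suF// ltxx andbF.
  have := H F F1 F2 B dF dF1 sF suF.
  have -> : \int[leb]_x (f x * F x) = \int[leb]_(x in `[0, B]) (f x * F x).
    by apply: supp_Rintegral => x xB; rewrite (vB _ xf1.2)// mul0r.
  rewrite (half_line_test_Rintegral B0 lf dF dF1 sF FB F1B F2E).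
  have -> : \int[leb]_x (g x * F2 x) = \int[leb]_x (g x * flat_bump a b n x).
    apply: eq_Rintegral => x _; have [xB|xB] := boolP (0 < x < B).
      by rewrite F2E// ltW//; move/andP: xB => [].
    by rewrite (vB _ xg.2)// !mul0r.
  have cb := @flat_bump_continuous a b n; have sub := @flat_bump_out R a b n.
  rewrite -RintegralZl//; last exact: (rint_mul_continuous_supp cb sub gi).
  rewrite Rintegral_mkcond -RintegralD//.
  - move=> <-; apply: eq_Rintegral => x _; rewrite /h !patchE.
    by case: ifP => _; [ring|rewrite add0r mulrA add0r].
  - have := rint_mul_continuous_supp cb sub JJi.
    by apply: eq_rint => // x _; rewrite !patchE; case: ifP => // _; rewrite mul0r.
  - by apply: rintZ => //; exact: (rint_mul_continuous_supp cb sub gi).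
have hJJ x : L <= x <= B -> h x = J (J f) x.
  move=> /andP[Lx xB]; rewrite /h xg.2; last by rewrite negb_and orbC -leNgt Lx.
  by rewrite patchE mem_setE in_itv/= xB (le_trans (ltW L0) Lx) mulr0 addr0.
have JfL x : L <= x -> J f x = J f L.
  move=> Lx; rewrite /J [LHS]Rintegral_mkcond [RHS]Rintegral_mkcond.
  apply: eq_Rintegral => y _; rewrite !patchE !mem_setE !in_itv/=.
  have [y0|//] := leP 0 y; have [yL|Ly] := leP y L; first by rewrite (le_trans yL Lx).
  by rewrite /= xf1.2 ?if_same// negb_and orbC -leNgt ltW.
have aff x y : L <= x -> x <= y -> J (J f) y - J (J f) x = J f L * (y - x).
  move=> Lx xy; rewrite -(Rintegral_FTC xy cJ dJJ) -(Rintegral_itv_cst _ xy).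
  apply: eq_Rintegral => z; rewrite inE/= in_itv/= => /andP[xz _].
  by rewrite JfL// (le_trans Lx).
have LM : L < L + 1 / 2 by rewrite ltrDl divr_gt0.
have MB : L + 1 / 2 < B by rewrite ltrD2l ltr_pdivrMr// mul1r ltr1n.
(* Beyond [L] the double primitive of [f] is affine with slope [J f L]; two zeros there annihilate
   both the slope and the value at [L]. *)
have [x1 /andP[Lx1 x1M] h1] := ae_point LM key.
have [x2 /andP[Mx2 x2B] h2] := ae_point MB key.
have x12 : x1 < x2 by exact: lt_trans Mx2.
have J1 : J (J f) x1 = 0.
  rewrite -hJJ ?(ltW Lx1) ?(ltW (lt_trans x12 x2B))//.
  by apply: h1; rewrite (lt_trans L0 Lx1) (lt_trans x12 x2B).
have J2 : J (J f) x2 = 0.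
  rewrite -hJJ ?(ltW (lt_trans Lx1 x12)) ?(ltW x2B)//.
  by apply: h2; rewrite (lt_trans L0 (lt_trans Lx1 x12)) x2B.
have JL : J f L = 0.
  have := aff _ _ (ltW Lx1) (ltW x12); rewrite J1 J2 subrr => /esym/eqP.
  by rewrite mulf_eq0 subr_eq0 (gt_eqF x12) orbF => /eqP.
have JJL : J (J f) L = 0.
  have := aff _ _ (lexx L) (ltW Lx1); rewrite J1 JL mul0r => /eqP.
  by rewrite sub0r oppr_eq0 => /eqP.
have m0 : moment0 f = 0 by rewrite (moment0_J xf1.2).
split => //; first by rewrite (moment1_J xf1) m0 JJL mulr0 subrr.
apply: (ae_imp key) => x hx /andP[x0 xL]; have xB := lt_trans xL LB.
have := hx; rewrite x0 xB => /(_ isT); rewrite /h patchE mem_setE in_itv/=.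
by rewrite (ltW x0) (ltW xB) /=; lra.
Qed.

(** Test functions are free at time 0: for a second derivative equal to a bump, [F 0] and [F1 0]
    are, up to sign, its first and zeroth moments on [[0, T]], so the data reappear as the affine
    function [c1 * t + c0]. *)
Lemma half_line_equation (T c0 c1 : R) p q : 0 < T -> rint leb setT p -> rint leb setT q ->
  causal p -> causal q -> (forall x, T <= x -> p x = 0) -> (forall x, T <= x -> q x = 0) ->
  (forall F F1 F2, is_derivative F F1 -> is_derivative F1 F2 ->
     smooth1 F -> supp (-3) T F ->
     \int[leb]_x (q x * F2 x) + \int[leb]_x (p x * F x) - c1 * F 0 + c0 * F1 0 = 0) ->
  {ae leb, forall t, 0 < t < T -> q t + J (J p) t = c1 * t + c0}.
Proof.
move=> T0 pi qi p0 q0 pT qT H.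
have lp : locint p by move=> x; exact: (rintS measurableT).
have cJ := J_continuous lp; have cJJ := J_continuous (continuous_locint cJ).
pose w x := J (J p) x - c1 * x - c0.
have cw : continuous w.
  move=> x; apply: cvgB; last exact: cvg_cst.
  apply: cvgB; first exact: cJJ.
  by apply: cvgM; [exact: cvg_cst|exact: cvg_id].
have wi : rint leb setT (w \_ `[0, T]).
  by apply: rint_patch => //; exact: continuous_rint_itv.
have suppT (u : R -> R) : causal u -> (forall x, T <= x -> u x = 0) -> supp 0 T u.
  by move=> u0 uT x; rewrite negb_and -!leNgt => /orP[/u0|/uT].
have hi : rint leb setT (fun x => q x + (w \_ `[0, T]) x) by exact: rintD.
have key : {ae leb, forall x, 0 < x < T -> q x + (w \_ `[0, T]) x = 0}.
  apply: flat_bump_orthogonal hi _ => // a b n a0 ab bT.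
  have [F [F1 [F2 [dF dF1 [sF suF] F1T F2E]]]] := @half_line_test a b T n a0 ab bT.
  have FT : F T = 0 by rewrite suF// ltxx andbF.
  have := H F F1 F2 dF dF1 sF suF.
  have -> : \int[leb]_x (p x * F x) = \int[leb]_(x in `[0, T]) (p x * F x).
    by apply: supp_Rintegral => x xT; rewrite (suppT _ p0 pT)// mul0r.
  rewrite (half_line_test_Rintegral T0 lp dF dF1 sF FT F1T F2E).
  have cb := @flat_bump_continuous a b n; have sub := @flat_bump_out R a b n.
  have -> : \int[leb]_x (q x * F2 x) = \int[leb]_x (q x * flat_bump a b n x).
    apply: eq_Rintegral => x _; have [x0|x0] := leP 0 x; first by rewrite F2E.
    by rewrite (q0 _ (ltW x0)) !mul0r.
  have cF2 : continuous F2.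
    have [g dg sg] := smooth1_derive sF; have E1 : F1 = g.
      by rewrite -(is_derivative_derive1 dF) (is_derivative_derive1 dg).
    have [g' dg' sg'] := smooth1_derive sg.
    suff -> : F2 = g' by exact: smooth1_continuous.
    by rewrite -(is_derivative_derive1 dF1) E1 (is_derivative_derive1 dg').
  have cF1 := is_derivative_continuous dF1.
  have F10 : F1 0 = - \int[leb]_(x in `[0, T]) flat_bump a b n x.
    have := Rintegral_FTC (ltW T0) cF2 dF1; rewrite F1T sub0r => h.
    rewrite -[LHS]opprK -h; congr (- _); apply: eq_Rintegral => x.
    by rewrite inE/= in_itv/= => /andP[x0 _]; rewrite F2E.
  have F0 : F 0 = \int[leb]_(x in `[0, T]) (x * flat_bump a b n x).
    have l1 : locint (cst (1 : R)) by apply: continuous_locint; exact: cst_continuous.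
    have := J_weight_derivative l1 dF1 cF2 F1T.
    under eq_Rintegral do rewrite mul1r.
    rewrite (Rintegral_FTC (ltW T0) cF1 dF) FT sub0r => /oppr_inj ->.
    apply: eq_Rintegral => x; rewrite inE/= in_itv/= => /andP[x0 _].
    by rewrite F2E// /J Rintegral_itv_cst// subr0 mul1r mulrC.
  have cxb : continuous (fun x => x * flat_bump a b n x).
    by move=> x; apply: cvgM; [exact: cvg_id|exact: cb].
  have cJb : continuous (fun x => J (J p) x * flat_bump a b n x).
    by move=> x; apply: cvgM; [exact: cJJ|exact: cb].
  have ib := continuous_rint_itv 0 T cb; have ixb := continuous_rint_itv 0 T cxb.
  have iJb := continuous_rint_itv 0 T cJb.
  rewrite F10 F0 mulrN -!RintegralZl// -addrA -opprD -RintegralD//; last 2 first.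
  - exact: rintZ.
  - exact: rintZ.
  rewrite -addrA -RintegralB//; last by apply: rintD => //; exact: rintZ.
  move=> Hq; under eq_Rintegral do rewrite mulrDl.
  rewrite RintegralD//.
  - rewrite -[RHS]Hq; congr (_ + _); rewrite [RHS]Rintegral_mkcond.
    apply: eq_Rintegral => x _; rewrite !patchE; case: ifP => _; last by rewrite mul0r.
    by rewrite /w; ring.
  - exact: (rint_mul_continuous_supp cb sub qi).
  - exact: (rint_mul_continuous_supp cb sub wi).
apply: (ae_imp key) => x hx xT; have := hx xT; rewrite patchE mem_setE in_itv/=.
by move/andP: xT => [/ltW -> /ltW ->]; rewrite /w /=; lra.
Qed.

End du_Bois_Reymond.

(** * Fields paired with functions of space *)

Section fields_in_duality.
Context {R : realType}.
Variables T L : R.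
Hypotheses (T0 : 0 < T) (L0 : 0 < L).
Local Notation leb := (@lebesgue_measure R).
Local Notation leb2 := (leb \x leb)%E.
Implicit Types (f g h k u w : R -> R -> R) (psi th : R -> R) (t r c x : R).

Lemma continuous_itv_bounded psi (a b : R) : continuous psi ->
  exists2 M : R, 0 <= M & forall x, a <= x <= b -> `|psi x| <= M.
Proof.
move=> cpsi; have [ab|ba] := leP a b; last first.
  by exists 0 => // x /andP[ax xb]; have := le_lt_trans (le_trans ax xb) ba; rewrite ltxx.
have cn : {within `[a, b], continuous (fun x => `|psi x|)}.
  apply: continuous_subspaceT => x.
  by apply: (@continuous_comp _ _ _ psi (fun z => `|z|)); [exact: cpsi|exact: norm_continuous].
have [c _ hc] := EVT_max ab cn.
by exists `|psi c| => // x xab; apply: hc; rewrite in_itv.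
Qed.

(** Local integrability and causality hold for every [x], not almost every one, so that the time
    operators act on each [f x]; the bounds in space hold for almost every time only. *)
Definition field f := [/\ jm f, (forall t, vanish L (f^~ t)),
  (forall x, locint (f x)), (forall x, causal (f x)) &
  forall M : R, exists2 c, 0 <= c &
    {ae leb, forall t, t <= M -> (Q leb (f^~ t) <= c%:E)%E}].

Definition pair f psi t := \int[leb]_x (f x t * psi x).

Lemma jm_patch f (M : R) : jm f -> jm (fun x => f x \_ `[0, M]).
Proof.
move=> jf; rewrite /jm (_ : (fun _ => _) =
  (fun p : R * R => if 0 <= p.1 <= M then f p.2 p.1 else 0)); last first.
  by apply/funext => p; rewrite patchE mem_setE in_itv.
apply: measurable_fun_ifT => //.
by apply: measurable_and; exact: measurable_fun_ler.
Qed.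

Lemma bounded_Q_rint f (M c : R) : jm f -> (forall t, vanish L (f^~ t)) -> 0 <= c ->
  {ae leb, forall t, 0 <= t <= M -> (Q leb (f^~ t) <= c%:E)%E} ->
  rint leb2 setT (fun p => (f p.2 \_ `[0, M]) p.1).
Proof.
move=> jf vf c0 hc.
pose F (p : R * R) := (f p.2 \_ `[0, M]) p.1.
have mF : measurable_fun setT F by exact: (jm_patch M jf).
apply/(integrable12ltyP leb leb); first exact/measurable_EFinP.
have mFF : measurable_fun setT (fun t => \int[leb]_x `|(F (t, x))%:E|)%E.
  apply: (measurable_fun_fubini_tonelli_F (m2 := leb) (fun p => `|(F p)%:E|)%E) => //.
  by apply: measurableT_comp => //; exact/measurable_EFinP.
(* On the space interval the absolute value is at most 1 plus the square, whence the constant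
   [L + c]. *)
apply: (@le_lt_trans _ _ (\int[leb]_(t in `[0%R, M]) (L + c)%:E)%E); last first.
  rewrite integral_cst//= lebesgue_measure_itv/= lte_fin.
  by case: ifP => _; rewrite -?EFinD -?EFinM ?mule0 ?ltry.
rewrite [leRHS]integral_mkcond; apply: ae_ge0_le_integral => //.
- by move=> t _; exact: integral_ge0.
- by move=> t _; rewrite patchE; case: ifP => _ //; rewrite lee_fin addr_ge0// ltW.
- by apply/(measurable_restrictT _ _).1 => //; exact: measurable_cst.
apply: (ae_imp hc) => t /[swap] _ ht; rewrite patchE mem_setE in_itv/= /F/=.
case: ifPn => tM; last first.
  under eq_integral do rewrite patchE mem_setE in_itv/= (negbTE tM) normr0.
  by rewrite integral_cst// mul0e.
have {}ht := ht tM.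
have mft : measurable_fun setT (f^~ t) by exact: jm_slice.
have L1 : rint leb setT ((cst (1 : R)) \_ `[0, L]).
  by apply: rint_patch => //; apply: continuous_rint_itv; exact: cst_continuous.
apply: (@le_trans _ _ (\int[leb]_x (((cst (1 : R)) \_ `[0%R, L]) x + f x t ^+ 2)%:E)%E).
  apply: ge0_le_integral => //.
  - apply/measurable_EFinP; apply: measurableT_comp => //.
    under eq_fun do rewrite patchE mem_setE in_itv/= tM.
    exact: mft.
  - apply/measurable_EFinP; apply: measurable_funD; first exact: rint_measurable L1.
    exact: measurable_funX.
  move=> x _; rewrite lee_fin !patchE !mem_setE !in_itv/= tM.
  have [xL|xL] := boolP (0 < x < L); last first.
    rewrite (vf t x xL) normr0 expr0n addr0; by case: ifP.
  rewrite ifT; last by move/andP: xL => [/ltW -> /ltW ->].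
  rewrite -(real_normK (num_real (f x t))); have := sqr_ge0 (`|f x t| - 1); nra.
under eq_integral do rewrite EFinD.
rewrite ge0_integralD//.
- rewrite EFinD leeD//.
  rewrite (_ : (\int[leb]_x _)%E = \int[leb]_(x in `[0%R, L]) 1%:E)%E; last first.
    by rewrite [RHS]integral_mkcond; apply: eq_integral => x _; rewrite !patchE; case: ifP.
  by rewrite integral_cst//= lebesgue_measure_itv/= lte_fin L0 -EFinD mul1e subr0.
- by move=> x _; rewrite patchE; case: ifP => _; rewrite lee_fin.
- by apply/measurable_EFinP; exact: rint_measurable L1.
- by move=> x _; rewrite lee_fin sqr_ge0.
- by apply/measurable_EFinP; exact: measurable_funX.
Qed.

Lemma field_rint f M : field f -> rint leb2 setT (fun p => (f p.2 \_ `[0, M]) p.1).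
Proof.
move=> [jf vf _ _ hf]; have [c c0 hc] := hf M; apply: (bounded_Q_rint jf vf c0).
by apply: (ae_imp hc) => t ht /andP[_ tM]; exact: ht.
Qed.

(** One primitive in time suffices to pass from almost every time to every time. *)
Lemma field_Q_J f (M : R) : field f ->
  exists2 c, 0 <= c & forall t, t <= M -> (Q leb (fun x => J (f x) t) <= c%:E)%E.
Proof.
move=> [jf vf lf cf hf]; have [c c0 hc] := hf M.
exists (M ^+ 2 * c) => [|t tM]; first by rewrite mulr_ge0// sqr_ge0.
have [t0|t0] := leP t 0.
  rewrite /Q; under eq_integral do rewrite J_le0// expr0n.
  by rewrite integral_cst//= mul0e lee_fin mulr_ge0// sqr_ge0.
apply: le_trans (_ : ((t ^+ 2 * c)%:E <= _)%E); last first.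
  by rewrite lee_fin ler_wpM2r// ler_sqr ?nnegrE// ?(ltW t0)// (le_trans (ltW t0)).
apply: (@Q_J _ (measurableTypeR R) R leb _ _ _ (ltW t0) c0 jf lf cf).
by apply: (ae_imp hc) => s hs st; apply: hs; exact: le_trans st tM.
Qed.

Lemma field_J f : field f -> field (fun x => J (f x)).
Proof.
move=> Ff; have [jf vf lf cf hf] := Ff; split.
- exact: jm_J.
- move=> t x xL; rewrite /J (@eq_Rintegral _ _ _ leb _ (cst 0)).
    by rewrite Rintegral_cst// mul0r.
  by move=> s _; exact: vf.
- by move=> x; apply: continuous_locint; exact: J_continuous.
- by move=> x; exact: J_le0.
by move=> M; have [c c0 hc] := field_Q_J M Ff; exists c => //; apply: aeW.
Qed.

Lemma field_xf_J f t : field f -> xf L (fun x => J (f x) t).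
Proof.
move=> Ff; have [c c0 hc] := field_Q_J t Ff; have [jJ vJ _ _ _] := field_J Ff.
by split; [apply: sqi_le (hc t (lexx t)); exact: (jm_slice t jJ)|exact: vJ].
Qed.

Lemma field_sqi f : field f -> {ae leb, forall t, t <= T -> sqi leb (f^~ t)}.
Proof.
move=> [jf _ _ _ hf]; have [c _ hc] := hf T; apply: (ae_imp hc) => t ht tT.
by apply: sqi_le (ht tT); exact: jm_slice.
Qed.

Lemma field_prod f psi th (M : R) : field f -> continuous psi -> continuous th ->
  rint leb2 setT (fun p => (f p.2 \_ `[0, M]) p.1 * (th p.1 * psi p.2)).
Proof.
move=> Ff cpsi cth; have [jf vf lf _ _] := Ff.
have [A A0 hA] := continuous_itv_bounded 0 L cpsi.
have [B B0 hB] := continuous_itv_bounded 0 M cth.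
have hi : rint leb2 setT (fun p => (B * A) * `|(f p.2 \_ `[0, M]) p.1|).
  by apply: rintZ => //; apply: rint_abs; exact: field_rint.
apply: (rint_dom _ _ _ hi) => //.
- apply: measurable_funM; first exact: (jm_patch M jf).
  by apply: measurable_funM; apply: measurableT_comp => //;
    exact: continuous_measurable_fun.
- move=> [t x] _ /=; rewrite normrM mulrC patchE mem_setE in_itv/=.
  case: ifPn => tM; last by rewrite normr0 !mulr0.
  have [xL|xL] := boolP (0 < x < L); last by rewrite (vf t)// normr0 !mulr0.
  rewrite ler_wpM2r// normrM ler_pM// ?hB// hA//.
  by move/andP: xL => [/ltW -> /ltW ->].
Qed.

Lemma pair_J f psi r : field f -> continuous psi ->
  J (pair f psi) r = pair (fun x => J (f x)) psi r.
Proof.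
move=> nf cpsi; have [jf vf lf _ _] := nf.
have h := field_prod r nf cpsi (@cst_continuous _ _ (1 : R)).
rewrite /J Rintegral_mkcond.
transitivity (\int[leb]_t \int[leb]_x ((f x \_ `[0, r]) t * (1 * psi x))).
  apply: eq_Rintegral => t _; rewrite /pair patchE; case: ifPn => tr.
    by apply: eq_Rintegral => x _; rewrite patchE tr mul1r.
  under eq_Rintegral do rewrite patchE (negbTE tr) mul0r.
  by rewrite Rintegral_cst// mul0r.
rewrite (Rintegral_swap h) /pair; apply: eq_Rintegral => x _ /=.
rewrite [in RHS]Rintegral_mkcond -RintegralZr//; last first.
  by apply: rint_patch => //; exact: lf.
by apply: eq_Rintegral => t _; rewrite mul1r.
Qed.

Lemma pair_locint f psi : field f -> continuous psi -> locint (pair f psi).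
Proof.
move=> nf cpsi M; apply: rint_unpatch => //.
have := rint_fubini1 (field_prod M nf cpsi (@cst_continuous _ _ (1 : R))).
apply: eq_rint => // t _; rewrite patchE; case: ifPn => tr.
  by rewrite /pair; apply: eq_Rintegral => x _; rewrite patchE tr mul1r.
under eq_Rintegral do rewrite patchE (negbTE tr) mul0r.
by rewrite Rintegral_cst// mul0r.
Qed.

(** Vanishing from time [T] on makes the pairings integrable over all times, and lets them be tested
    against functions that are not compactly supported. *)
Definition fld f := field f /\ forall x t, T <= t -> f x t = 0.

Lemma fld_patchT f x : fld f -> f x \_ `[0, T] = f x.
Proof.
move=> [[_ _ _ cf _] fT]; apply/funext => t; rewrite patchE mem_setE in_itv/=.
case: ifPn => //; rewrite negb_and -!ltNge => /orP[t0|/ltW Tt].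
  by rewrite cf// ltW.
by rewrite fT.
Qed.

Lemma fld_prod f psi th : fld f -> continuous psi -> continuous th ->
  rint leb2 setT (fun p => f p.2 p.1 * (th p.1 * psi p.2)).
Proof.
move=> Ff cpsi cth; have := field_prod T Ff.1 cpsi cth.
by under eq_fun do rewrite (fld_patchT _ Ff).
Qed.

Lemma pair_out f psi t : fld f -> ~~ (0 < t < T) -> pair f psi t = 0.
Proof.
move=> [[_ _ _ cf _] fT] tT; rewrite /pair (@eq_Rintegral _ _ _ leb _ (cst 0)).
  by rewrite Rintegral_cst// mul0r.
move=> x _; move: tT; rewrite negb_and -!leNgt => /orP[t0|Tt].
  by rewrite cf// mul0r.
by rewrite fT// mul0r.
Qed.

Lemma pair_rint f psi : fld f -> continuous psi -> rint leb setT (pair f psi).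
Proof.
move=> Ff cpsi; have := rint_fubini1 (fld_prod Ff cpsi (@cst_continuous _ _ (1 : R))).
apply: eq_rint => // t _; apply: eq_Rintegral => x _ /=.
by rewrite mul1r.
Qed.

Lemma fld_Rintegral f psi th : fld f -> continuous psi -> continuous th ->
  \int[leb2]_p (f p.2 p.1 * (th p.1 * psi p.2)) = \int[leb]_t (pair f psi t * th t).
Proof.
move=> Ff cpsi cth; have Fi := fld_prod Ff cpsi cth.
rewrite (Rintegral_prod1 Fi); apply: ae_eq_Rintegral => //.
- exact: rint_measurable (rint_fubini1 Fi).
- apply: measurable_funM; first exact: rint_measurable (pair_rint Ff cpsi).
  exact: continuous_measurable_fun.
apply: (ae_imp (field_sqi Ff.1)) => t ht _ /=.
have [tT|/ltW Tt] := leP t T; last first.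
  rewrite pair_out ?negb_and -?leNgt ?Tt ?orbT// mul0r.
  under eq_Rintegral do rewrite Ff.2// mul0r.
  by rewrite Rintegral_cst// mul0r.
have {}ht := ht tT; have vf : vanish L (f^~ t) by case: Ff => -[].
rewrite /pair mulrC -RintegralZl//.
  by apply: eq_Rintegral => x _; rewrite mulrCA.
have := rint_mul_continuous (conj ht vf) cpsi.
by apply: eq_rint => // x _; rewrite mulrC.
Qed.

End fields_in_duality.

(** * From weak formulations to relations valid at every time *)

Section weak_relations.
Context {R : realType}.
Variables T L : R.
Hypotheses (T0 : 0 < T) (L0 : 0 < L).
Local Notation leb := (@lebesgue_measure R).
Implicit Types (f g h k u w : R -> R -> R) (psi th : R -> R) (t r c x : R).

Lemma smooth1_derivative (f f' : R -> R) : is_derivative f f' -> smooth1 f -> smooth1 f'.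
Proof.
move=> df sf; have [g dg sg] := smooth1_derive sf.
by rewrite -(is_derivative_derive1 df) (is_derivative_derive1 dg).
Qed.

Lemma ae_neq c : {ae leb, forall t, t != c}.
Proof.
exists [set c]; split => //; first exact: lebesgue_measure_set1.
by move=> t /= /negP; rewrite negbK => /eqP.
Qed.

Lemma ae_eq_J (f g : R -> R) r : (forall s, rint leb `[0, s] f) -> (forall s, rint leb `[0, s] g) ->
  {ae leb, forall t, 0 < t < r -> f t = g t} -> J f r = J g r.
Proof.
move=> fi gi fg; apply: ae_eq_Rintegral => //.
- exact: rint_measurable (fi r).
- exact: rint_measurable (gi r).
apply: (ae_imp2 (ae_imp2 fg (ae_neq 0) (fun t P1 P2 => conj P1 P2)) (ae_neq r)) => t [h t0] tr.
rewrite /= in_itv/= => /andP[t0' tr']; apply: h.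
by rewrite !lt_neqAle t0' tr' eq_sym t0 tr.
Qed.

Lemma J_pair f psi : field L f -> continuous psi ->
  J (pair f psi) = pair (fun x => J (f x)) psi.
Proof. by move=> Ff cpsi; apply/funext => r; exact: (pair_J L0). Qed.

Lemma J_pair2 f psi : field L f -> continuous psi ->
  J (J (pair f psi)) = pair (fun x => J (J (f x))) psi.
Proof. by move=> Ff cpsi; rewrite (J_pair Ff cpsi) (J_pair (field_J Ff) cpsi). Qed.

(** The weak form of u_xx = k on products of a time bump and a space test function: tensor tests are
    all that the time-then-space argument uses. *)
Definition space_weak u k := forall (a b a' b' : R) n (psi psi1 psi2 : R -> R),
  0 < a -> a < b -> b < T -> 0 < a' -> b' < L ->
  is_derivative psi psi1 -> is_derivative psi1 psi2 -> smooth1 psi -> supp a' b' psi ->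
  \int[leb]_t (pair u psi2 t * flat_bump a b n t) =
  \int[leb]_t (pair k psi t * flat_bump a b n t).

(** For a fixed space test the two pairings agree for almost every time, with an exceptional set
    depending on the test. After primitives in time they agree at the given [r] for all tests at
    once, and the du Bois-Reymond lemma applies in space. *)
Lemma space_weak_rel1 u k r : fld T L u -> fld T L k -> space_weak u k ->
  rel1 L (fun x => J (J (u x)) r) (fun x => J (J (k x)) r).
Proof.
move=> Fu Fk W; have Ju := field_J Fu.1; have Jk := field_J Fk.1.
apply: du_Bois_Reymond2 => //.
- exact: xf_rint (field_xf_J r Jk).
- exact: xf_rint (field_xf_J r Ju).
move=> F F1 F2 a b a0 bL dF dF1 sF sup.
have cF := smooth1_continuous sF.
have cF2 := smooth1_continuous (smooth1_derivative dF1 (smooth1_derivative dF sF)).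
have ui := pair_rint L0 Fu cF2; have ki := pair_rint L0 Fk cF.
have E : J (pair u F2) = J (pair k F).
  have h : {ae leb, forall t, 0 < t < T -> pair u F2 t - pair k F t = 0}.
    apply: (flat_bump_orthogonal (lexx 0) (rintB measurableT ui ki)) => a' b' n a'0 ab b'T.
    under eq_Rintegral do rewrite mulrBl.
    rewrite RintegralB//.
    - by apply/eqP; rewrite subr_eq0; apply/eqP; exact: (W a' b' a b n F F1 F2).
    - apply: (@rint_mul_continuous_supp _ a' b') => //; first exact: flat_bump_continuous.
      by move=> x; exact: flat_bump_out.
    - apply: (@rint_mul_continuous_supp _ a' b') => //; first exact: flat_bump_continuous.
      by move=> x; exact: flat_bump_out.
  apply/funext => s; apply: ae_eq_Rintegral => //.
  - by apply: measurable_funTS; exact: rint_measurable ui.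
  - by apply: measurable_funTS; exact: rint_measurable ki.
  apply: (ae_imp h) => t ht _; have [/ht/eqP|tT] := boolP (0 < t < T).
    by rewrite subr_eq0 => /eqP.
  by rewrite (pair_out _ Fu tT) (pair_out _ Fk tT).
have : J (J (pair u F2)) r = J (J (pair k F)) r by rewrite E.
by rewrite (J_pair2 Fu.1 cF2) (J_pair2 Fk.1 cF).
Qed.

Definition time_weak w g := forall (a b a' b' : R) n (th th' : R -> R),
  0 < a -> b < T -> is_derivative th th' -> smooth1 th -> supp a b th ->
  0 < a' -> a' < b' -> b' < L ->
  \int[leb]_t (pair w (flat_bump a' b' n) t * th' t) =
  - \int[leb]_t (pair g (flat_bump a' b' n) t * th t).

(** The supports start at -3, so the tests are unconstrained at time 0 and at both ends of the space
    interval; initial data and natural boundary conditions are encoded there. The interval []-3,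
    -2[] hosts the corrections of [half_line_test]. *)
Definition weak_beam (rho mu : R) u k h (u0 u1 : R -> R) :=
  forall (th th1 th2 psi psi1 psi2 : R -> R) (B : R),
  is_derivative th th1 -> is_derivative th1 th2 -> smooth1 th -> supp (-3) T th ->
  is_derivative psi psi1 -> is_derivative psi1 psi2 -> smooth1 psi -> supp (-3) B psi ->
  \int[leb]_t (rho * pair u psi t * th2 t) +
  \int[leb]_t ((mu * pair k psi2 t + pair h psi t) * th t)
  - rho * (\int[leb]_x (u1 x * psi x)) * th 0
  + rho * (\int[leb]_x (u0 x * psi x)) * th1 0 = 0.

Lemma beam_balance (rho mu r pu pk ph a0 a1 : R) :
  rho * pu + 1 * (mu * pk + 1 * ph) = rho * a1 * (r ^+ 2 / 2) + rho * a0 * r ->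
  rho * pu + ph - rho * r * a0 - rho * (r ^+ 2 / 2) * a1 + mu * pk = 0.
Proof. lra. Qed.

Section beam.
Variables (rho mu : R) (u k h : R -> R -> R) (u0 u1 : R -> R).
Hypotheses (Fu : fld T L u) (Fk : fld T L k) (Fh : fld T L h).
Hypothesis W : weak_beam rho mu u k h u0 u1.

Let Jk := field_J Fk.1.
Let Jh := field_J Fh.1.
Let JJk := field_J Jk.
Let JJh := field_J Jh.

(** With [psi] frozen the equation is an ordinary differential equation in time for pairings, solved
    by [half_line_equation]. *)
Lemma weak_beam_pair psi psi1 psi2 B :
  is_derivative psi psi1 -> is_derivative psi1 psi2 -> smooth1 psi -> supp (-3) B psi ->
  {ae leb, forall t, 0 < t < T -> rho * pair u psi t +
    (mu * pair (fun x => J (J (k x))) psi2 t + 1 * pair (fun x => J (J (h x))) psi t) =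
    rho * (\int[leb]_x (u1 x * psi x)) * t + rho * (\int[leb]_x (u0 x * psi x))}.
Proof.
move=> dpsi dpsi1 spsi sup.
have c0 := smooth1_continuous spsi.
have c2 := smooth1_continuous (smooth1_derivative dpsi1 (smooth1_derivative dpsi spsi)).
have ui := pair_rint L0 Fu c0; have ki := pair_rint L0 Fk c2; have hi := pair_rint L0 Fh c0.
have out f phi t : fld T L f -> t <= 0 \/ T <= t -> pair f phi t = 0.
  move=> Ff tT; rewrite (pair_out _ Ff)// negb_and -!leNgt.
  by case: tT => ->; rewrite ?orbT.
have lk := pair_locint L0 Fk.1 c2; have lh := pair_locint L0 Fh.1 c0.
have hp : rint leb setT (fun t => mu * pair k psi2 t + 1 * pair h psi t).
  by apply: rintD => //; apply: rintZ.
have := @half_line_equation R T (rho * \int[leb]_x (u0 x * psi x))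
  (rho * \int[leb]_x (u1 x * psi x)) (fun t => mu * pair k psi2 t + 1 * pair h psi t)
  (fun t => rho * pair u psi t) T0 hp (rintZ rho measurableT ui).
rewrite JJ_lin// (J_pair2 Fk.1 c2) (J_pair2 Fh.1 c0); apply.
- by move=> t t0; rewrite !out// ?mulr0 ?addr0//; left.
- by move=> t t0; rewrite out// ?mulr0//; left.
- by move=> t t0; rewrite !out// ?mulr0 ?addr0//; right.
- by move=> t t0; rewrite out// ?mulr0//; right.
move=> F F1 F2 dF dF1 sF supF.
rewrite -[RHS](W dF dF1 sF supF dpsi dpsi1 spsi sup).
congr (_ + _ - _ + _).
by apply: eq_Rintegral => t _; rewrite mul1r.
Qed.

Lemma J_affine (c1 c0 r : R) : 0 <= r ->
  J (fun t => c1 * t + c0) r = c1 * (r ^+ 2 / 2) + c0 * r.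
Proof.
move=> r0; pose F := fun t : R => c1 * (t ^+ 2 / 2) + c0 * t.
have dF (t : R) : is_derive t 1 F (c1 * t + c0).
  by rewrite /F; apply: is_derive_eq; rewrite -?[_ *: _]/(_ * _)/=; lra.
have cf : continuous (fun t : R => c1 * t + c0).
  move=> t; apply: cvgD; last exact: cvg_cst.
  by apply: cvgM; [exact: cvg_cst|exact: cvg_id].
by rewrite /J (Rintegral_FTC r0 cf dF) /F expr0n mul0r !mulr0 addr0 subr0.
Qed.

(** The preceding identity holds for almost every time; one more primitive makes it hold at every
    [r], the data then carrying the coefficients [r] and [r ^+ 2 / 2]. Since [F] is arbitrary at the
    ends, [natural_boundary] applies. *)
Lemma weak_beam_rel2 r : 0 <= r -> r <= T -> xf L u0 -> xf L u1 ->
  rel2 L mu (fun x => rho * (J (u x) r - r * u0 x - r ^+ 2 / 2 * u1 x)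
                      + J (J (J (h x))) r)
            (fun x => J (J (J (k x))) r).
Proof.
move=> r0 rT xu0 xu1.
have xu := field_xf_J r Fu.1; have xh := field_xf_J r JJh.
have xk := field_xf_J r JJk.
have E1 : (fun x => rho * (J (u x) r - r * u0 x - r ^+ 2 / 2 * u1 x) + J (J (J (h x))) r) =
  (fun x => 1 * (rho * J (u x) r + 1 * J (J (J (h x))) r) +
    (- rho) * (r * u0 x + r ^+ 2 / 2 * u1 x)) by apply/funext => x; ring.
apply: natural_boundary => //.
  by rewrite E1; do 3! apply: xf_lin => //.
move=> F F1 F2 B dF dF1 sF sup.
have c0 := smooth1_continuous sF.
have c2 := smooth1_continuous (smooth1_derivative dF1 (smooth1_derivative dF sF)).
have ri (q psi : R -> R) : xf L q -> continuous psi -> rint leb setT (fun x => q x * psi x).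
  move=> xff cpsi; have := rint_mul_continuous xff cpsi.
  by apply: eq_rint => // x _; rewrite mulrC.
have hA := weak_beam_pair dF dF1 sF sup.
pose A t := rho * pair u F t +
  (mu * pair (fun x => J (J (k x))) F2 t + 1 * pair (fun x => J (J (h x))) F t).
have lu := pair_locint L0 Fu.1 c0.
have lk := pair_locint L0 JJk c2; have lh := pair_locint L0 JJh c0.
have l2 : locint (fun t => mu * pair (fun x => J (J (k x))) F2 t +
    1 * pair (fun x => J (J (h x))) F t).
  by apply: locintD; exact: locintZ.
have lA : locint A by apply: locintD => //; exact: locintZ.
have EA : A = (fun t => rho * pair u F t + 1 * (mu * pair (fun x => J (J (k x))) F2 t +
    1 * pair (fun x => J (J (h x))) F t)) by apply/funext => t; rewrite mul1r.
have laff : locint (fun t => rho * (\int[leb]_x (u1 x * F x)) * t + rho * (\int[leb]_x (u0 x * F x))).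
  apply: continuous_locint => t; apply: cvgD; last exact: cvg_cst.
  by apply: cvgM; [exact: cvg_cst|exact: cvg_id].
have JA : J A r = rho * pair (fun x => J (u x)) F r +
    1 * (mu * pair (fun x => J (J (J (k x)))) F2 r + 1 * pair (fun x => J (J (J (h x)))) F r).
  by rewrite EA (J_lin _ _ lu l2) (J_lin _ _ lk lh) (J_pair Fu.1 c0) (J_pair JJk c2) (J_pair JJh c0).
have E : J A r = J (fun t => rho * (\int[leb]_x (u1 x * F x)) * t + rho * (\int[leb]_x (u0 x * F x))) r.
  apply: ae_eq_J => //; apply: (ae_imp hA) => t ht /andP[t0 tr].
  by apply: ht; rewrite t0 (lt_le_trans tr rT).
rewrite JA J_affine// in E.
have iu := ri _ _ xu c0; have ih := ri _ _ xh c0; have ik := ri _ _ xk c2.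
have i0 := ri _ _ xu0 c0; have i1 := ri _ _ xu1 c0.
rewrite (_ : \int[leb]_x _ = rho * pair (fun x => J (u x)) F r
   + pair (fun x => J (J (J (h x)))) F r - rho * r * (\int[leb]_x (u0 x * F x))
   - rho * (r ^+ 2 / 2) * (\int[leb]_x (u1 x * F x))).
  exact: beam_balance E.
rewrite /pair -!RintegralZl// -RintegralD//; last exact: rintZ.
rewrite -RintegralB//; [|by apply: rintD => //; exact: rintZ|exact: rintZ].
rewrite -RintegralB//; last exact: rintZ.
- by apply: eq_Rintegral => x _; ring.
- by apply: rintB; [|apply: rintD|] => //; exact: rintZ.
Qed.

End beam.

Lemma continuous_near0 (H : R -> R) (e : R) : continuous H -> H 0 = 0 -> 0 < e ->
  exists2 d, 0 < d & forall t, 0 < t < d -> `|H t| < e.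
Proof.
move=> cH H0 e0; have /cvgrPdist_lt/(_ e e0)[d /= d0 hd] := cH 0.
exists d => // t /andP[t0 td]; by have := hd t; rewrite /= H0 !sub0r !normrN gtr0_norm// => /(_ td).
Qed.

Section beam_from_rest.
Variables (rho mu : R) (w g k h : R -> R -> R).
Hypotheses (rho0 : 0 < rho) (Fw : fld T L w) (Fg : fld T L g) (Fk : fld T L k) (Fh : fld T L h).
Hypothesis W : weak_beam rho mu w k h (cst 0) (cst 0).
Hypothesis Wt : time_weak w g.

(** Weak differentiation in time determines [w] up to its initial value; the beam equation, which
    encodes a start from rest, shows that value to be 0. *)
Lemma time_weak_pair (a b : R) n : 0 < a -> a < b -> b < L ->
  {ae leb, forall t, 0 < t < T -> pair w (flat_bump a b n) t =
     pair (fun x => J (g x)) (flat_bump a b n) t}.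
Proof.
move=> a0 ab bL; set psi := flat_bump a b n.
have spsi : smooth1 psi by exact: smooth1_flat_bump.
have c0 : continuous psi by exact: smooth1_continuous.
have [psi1 dpsi spsi1] := smooth1_derive spsi.
have [psi2 dpsi1 spsi2] := smooth1_derive spsi1.
have sup : supp (-3) b psi.
  by apply: (@suppW _ a b) => //; [lra|move=> x; exact: flat_bump_out].
have wi := pair_rint L0 Fw c0; have gi := pair_rint L0 Fg c0.
have [|c hc] := du_Bois_Reymond1 T0 gi wi.
  by move=> F F' a' b' a'0 b'T dF sF supF; exact: (Wt n a'0 b'T dF sF supF a0 ab bL).
have hb := weak_beam_pair Fw Fk Fh W dpsi dpsi1 spsi sup.
pose G t := rho * J (pair g psi) t +
  (mu * J (J (pair k psi2)) t + 1 * J (J (pair h psi)) t).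
have c2 := smooth1_continuous spsi2.
have lk := pair_locint L0 Fk.1 c2; have lh := pair_locint L0 Fh.1 c0.
have lg := pair_locint L0 Fg.1 c0.
have cG : continuous G.
  have cJJ (q : R -> R) : locint q -> continuous (J (J q)).
    by move=> lq; apply: J_continuous; apply: continuous_locint; exact: J_continuous.
  have c1 := J_continuous lg; have c3 := cJJ _ lk; have c4 := cJJ _ lh.
  move=> t; apply: cvgD; first by apply: cvgM; [exact: cvg_cst|exact: c1].
  by apply: cvgD; apply: cvgM; [exact: cvg_cst|exact: c3|exact: cvg_cst|exact: c4].
have G0 : G 0 = 0 by rewrite /G !J_le0// !mulr0 !addr0.
(* The equation reads [G t = - (rho * c)] for almost every [t], while the continuous [G] vanishes at
   0; a nonzero [c] is contradicted at small times. *)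
have c00 : c = 0.
  apply/eqP; apply: contrapT => /negP cn0.
  have e0 : 0 < `|rho * c| by rewrite normr_gt0 mulf_neq0// gt_eqF.
  have [d d0 hd] := continuous_near0 cG G0 e0.
  have dT : 0 < Num.min d T by rewrite lt_min d0.
  have [t] := ae_point dT (ae_imp2 hc hb (fun t P1 P2 => conj P1 P2)).
  rewrite lt_min => /andP[t0 /andP[td tT]] []; rewrite t0 tT => /(_ isT) E1 /(_ isT).
  rewrite E1; under eq_Rintegral do rewrite mul0r.
  rewrite Rintegral_cst// mul0r !mulr0 mul0r addr0 => E2.
  have := hd t; rewrite t0 td => /(_ isT); apply/negP; rewrite -leNgt.
  rewrite (_ : G t = - (rho * c)) ?normrN//.
  move: E2; rewrite /G (J_pair2 Fk.1 c2) (J_pair2 Fh.1 c0).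
  lra.
apply: (ae_imp hc) => t ht /ht ->.
by rewrite c00 add0r (J_pair Fg.1 c0).
Qed.

Lemma time_weak_J_pair (a b : R) n r : r <= T -> 0 < a -> a < b -> b < L ->
  pair (fun x => J (w x)) (flat_bump a b n) r =
  pair (fun x => J (J (g x))) (flat_bump a b n) r.
Proof.
move=> rT a0 ab bL; have c0 := @flat_bump_continuous R a b n.
rewrite -(J_pair Fw.1 c0) -(J_pair (field_J Fg.1) c0).
apply: ae_eq_J.
- exact: (pair_locint L0 Fw.1).
- exact: (pair_locint L0 (field_J Fg.1)).
apply: (ae_imp (time_weak_pair n a0 ab bL)) => t ht /andP[t0 tr].
by apply: ht; rewrite t0 (lt_le_trans tr).
Qed.

Lemma pair_inj (f1 f2 : R -> R -> R) r : xf L (f1^~ r) -> xf L (f2^~ r) ->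
  (forall a b n, 0 < a -> a < b -> b < L ->
    pair f1 (flat_bump a b n) r = pair f2 (flat_bump a b n) r) ->
  {ae leb, forall x, 0 < x < L -> f1 x r = f2 x r}.
Proof.
move=> x1 x2 E; have i1 := xf_rint x1; have i2 := xf_rint x2.
have H : {ae leb, forall x, 0 < x < L -> f1 x r - f2 x r = 0}; last first.
  by apply: (ae_imp H) => x hx /hx /eqP; rewrite subr_eq0 => /eqP.
apply: (flat_bump_orthogonal (lexx 0) (rintB measurableT i1 i2)) => a b n a0 ab bL.
under eq_Rintegral do rewrite mulrBl.
have bo : supp a b (flat_bump a b n : R -> R) by move=> x; exact: flat_bump_out.
rewrite RintegralB//; try by apply: (rint_mul_continuous_supp _ bo) => //; exact: flat_bump_continuous.
by have := E a b n a0 ab bL; rewrite /pair => ->; rewrite subrr.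
Qed.

Lemma time_weak_J r : r <= T ->
  {ae leb, forall x, 0 < x < L -> J (w x) r = J (J (g x)) r}.
Proof.
move=> rT; apply: (@pair_inj (fun x => J (w x)) (fun x => J (J (g x)))).
- exact: field_xf_J Fw.1.
- exact: field_xf_J (field_J Fg.1).
by move=> a b n a0 ab bL; exact: time_weak_J_pair.
Qed.

Lemma time_weak_JJ r : r <= T ->
  {ae leb, forall x, 0 < x < L -> J (J (w x)) r = J (J (J (g x))) r}.
Proof.
move=> rT; apply: (@pair_inj (fun x => J (J (w x))) (fun x => J (J (J (g x))))).
- exact: field_xf_J (field_J Fw.1).
- exact: field_xf_J (field_J (field_J Fg.1)).
move=> a b n a0 ab bL; have c0 := @flat_bump_continuous R a b n.
rewrite -(J_pair (field_J Fw.1) c0) -(J_pair (field_J (field_J Fg.1)) c0).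
apply: eq_Rintegral => t; rewrite inE/= in_itv/= => /andP[t0 tr].
by apply: time_weak_J_pair => //; exact: le_trans tr rT.
Qed.

End beam_from_rest.

End weak_relations.

Lemma Rintegral_lin d (X : measurableType d) (R : realType)
    (m : {measure set X -> \bar R}) (D : set X) (f g : X -> R) (a b : R) :
  measurable D -> rint m D f -> rint m D g ->
  \int[m]_(x in D) (a * f x + b * g x) =
  a * (\int[m]_(x in D) f x) + b * (\int[m]_(x in D) g x).
Proof.
move=> mD fi gi; rewrite RintegralD//; [|exact: rintZ|exact: rintZ].
by rewrite !RintegralZl.
Qed.

(** * Energy inequality for differenced fields *)

Section energy_method.
Context {R : realType}.
Variables T L : R.
Hypotheses (T0 : 0 < T) (L0 : 0 < L).
Local Notation leb := (@lebesgue_measure R).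
Implicit Types (f g h k u w a z E : R -> R -> R) (r s t c : R).

Lemma Q_lin_le (p q : R -> R) (a b cp cq : R) : measurable_fun setT p -> measurable_fun setT q ->
  (Q leb p <= cp%:E)%E -> (Q leb q <= cq%:E)%E ->
  (Q leb (fun x => a * p x + b * q x)%R <= (2 * a ^+ 2 * cp + 2 * b ^+ 2 * cq)%:E)%E.
Proof.
move=> mp mq hp hq.
have msq (p' : R -> R) : measurable_fun setT p' ->
    measurable_fun setT (fun x => (p' x ^+ 2)%:E).
  by move=> mp'; apply/measurable_EFinP; exact: measurable_funX.
have mlin : measurable_fun setT (fun x => a * p x + b * q x).
  by apply: measurable_funD; apply: measurable_funM.
apply: (@le_trans _ _ (\int[leb]_x ((2 * a ^+ 2)%:E * (p x ^+ 2)%:E + (2 * b ^+ 2)%:E * (q x ^+ 2)%:E))%E).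
  apply: ge0_le_integral => //.
  - by move=> x _; rewrite lee_fin sqr_ge0.
  - exact: msq.
  - by apply: emeasurable_funD; apply: emeasurable_funM => //; exact: msq.
  move=> x _; rewrite -!EFinM -EFinD lee_fin.
  by have := sqr_ge0 (a * p x - b * q x); nra.
have e0 (y : R) : 0 <= 2 * y ^+ 2 by rewrite mulr_ge0// sqr_ge0.
rewrite ge0_integralD//; last 4 first.
- by move=> x _; rewrite -EFinM lee_fin mulr_ge0// sqr_ge0.
- by apply: emeasurable_funM => //; exact: msq.
- by move=> x _; rewrite -EFinM lee_fin mulr_ge0// sqr_ge0.
- by apply: emeasurable_funM => //; exact: msq.
rewrite !ge0_integralZl//; try exact: msq; try (by move=> x _; rewrite lee_fin sqr_ge0); try by rewrite lee_fin.
rewrite EFinD (EFinM (2 * a ^+ 2)) (EFinM (2 * b ^+ 2)).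
by apply: leeD; apply: lee_wpmul2l => //; rewrite lee_fin.
Qed.

(** A [field] with continuity in time and bounds at every time, as for primitives and their
    difference quotients. *)
Definition cfield f := [/\ jm f, (forall t, vanish L (f^~ t)),
  (forall x, continuous (f x)), (forall x, causal (f x)) &
  forall M : R, exists2 c, 0 <= c & forall t, t <= M -> (Q leb (f^~ t) <= c%:E)%E].

Lemma cfield_field f : cfield f -> field L f.
Proof.
move=> [jf vf cf zf hf]; split => //; first by move=> x; exact: continuous_locint.
by move=> M; have [c c0 hc] := hf M; exists c => //; apply: aeW.
Qed.

Lemma cfield_J f : field L f -> cfield (fun x => J (f x)).
Proof.
move=> Ff; have [jJ vJ _ cJ _] := field_J Ff; split => //.
- by case: Ff => _ _ lf _ _ x; exact: J_continuous.
- by move=> M; exact: (field_Q_J M Ff).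
Qed.

Lemma cfield_xf f t : cfield f -> xf L (f^~ t).
Proof.
move=> [jf vf _ _ hf]; have [c _ hc] := hf t.
by split => //; apply: sqi_le (hc t (lexx t)); exact: jm_slice.
Qed.

Lemma DqE (e : R) f r : (fun x => Dq e (f x) r) = (fun x => e^-1 * f x r + (- e^-1) * f x (r - e)).
Proof. by apply/funext => x; rewrite /Dq mulrBr mulNr. Qed.

Lemma cfield_Dq (e : R) m f : 0 <= e -> cfield f -> cfield (fun x => iter m (Dq e) (f x)).
Proof.
move=> e0 Cf; elim: m => // m [jf vf cf zf hf] /=; split.
- by apply: (jm_Dq e jf).
- by move=> t x xL; rewrite /Dq (vf t)// (vf (t - e))// subrr mulr0.
- by move=> x; apply: Dq_continuous.
- by move=> x; apply: Dq_causal.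
move=> M; have [c c0 hc] := hf M.
exists (2 * e^-1 ^+ 2 * c + 2 * (- e^-1) ^+ 2 * c).
  by rewrite addr_ge0// mulr_ge0// mulr_ge0// sqr_ge0.
move=> t tM; rewrite (DqE e (fun x => iter m (Dq e) (f x))).
apply: Q_lin_le.
- exact: (jm_slice t jf).
- exact: (jm_slice (t - e) jf).
- exact: hc.
- by apply: hc; rewrite lerBlDr (le_trans tM)// lerDl.
Qed.

(** Imposed at all times up to [T], negative ones included, because backward differences at small
    times reach below 0. *)
Definition fam1 f z := forall r, r <= T ->
  [/\ xf L (f^~ r), xf L (z^~ r) & rel1 L (f^~ r) (z^~ r)].

Definition fam2 (mu : R) f z := forall r, r <= T ->
  [/\ xf L (f^~ r), xf L (z^~ r) & rel2 L mu (f^~ r) (z^~ r)].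

Lemma rel2_lin (mu a b : R) (f1 f2 g1 g2 : R -> R) : xf L f1 -> xf L f2 ->
  rel2 L mu f1 g1 -> rel2 L mu f2 g2 ->
  rel2 L mu (fun x => a * f1 x + b * f2 x) (fun x => a * g1 x + b * g2 x).
Proof.
move=> x1 x2 [m01 m11 h1] [m02 m12 h2].
have i1 := xf_rint x1; have i2 := xf_rint x2.
have id1 := @rint_mul_continuous _ _ _ id x1 (fun=> cvg_id).
have id2 := @rint_mul_continuous _ _ _ id x2 (fun=> cvg_id).
split.
- rewrite /moment0 (Rintegral_lin a b measurableT i1 i2).
  by rewrite -[X in a * X]/(moment0 f1) -[X in b * X]/(moment0 f2) m01 m02 !mulr0 addr0.
- rewrite /moment1; under eq_Rintegral do rewrite mulrDr (mulrCA _ a) (mulrCA _ b).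
  rewrite (Rintegral_lin a b measurableT id1 id2).
  by move: m11 m12; rewrite /moment1 => -> ->; rewrite !mulr0 addr0.
apply: (ae_imp2 h1 h2) => x e1 e2 xL.
rewrite (JJ_lin _ _ (xf_locint x1) (xf_locint x2)) mulrDr !(mulrCA mu) e1// e2//; ring.
Qed.

Lemma fam1_Dq (e : R) m f z : 0 <= e -> fam1 f z ->
  fam1 (fun x => iter m (Dq e) (f x)) (fun x => iter m (Dq e) (z x)).
Proof.
move=> e0 fz; elim: m => [|m IH] r rT; first exact: (fz r rT).
have [x1 z1 h1] := IH r rT.
have [|x2 z2 h2] := IH (r - e); first by rewrite lerBlDr (le_trans rT)// lerDl.
rewrite (DqE e (fun x => iter m (Dq e) (f x))) (DqE e (fun x => iter m (Dq e) (z x))).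
by split; [exact: xf_lin|exact: xf_lin|exact: rel1_lin].
Qed.

Lemma fam2_Dq (mu e : R) m f z : 0 <= e -> fam2 mu f z ->
  fam2 mu (fun x => iter m (Dq e) (f x)) (fun x => iter m (Dq e) (z x)).
Proof.
move=> e0 fz; elim: m => [|m IH] r rT; first exact: (fz r rT).
have [x1 z1 h1] := IH r rT.
have [|x2 z2 h2] := IH (r - e); first by rewrite lerBlDr (le_trans rT)// lerDl.
rewrite (DqE e (fun x => iter m (Dq e) (f x))) (DqE e (fun x => iter m (Dq e) (z x))).
by split; [exact: xf_lin|exact: xf_lin|exact: rel2_lin].
Qed.

(** [fam1] says that the second space derivative of [J a] is [z], and [fam2] that the double
    primitive of [E] is [- mu] times [J z]. By [orthogonal_Rintegral] the pairing of [E] with [J a]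
    is then [- mu] times that of [z] with [J z], so the bound on [rho a - E] against [J a] controls
    the growth of the whole energy. *)
Lemma energy_le (rho mu : R) a z E t (B : R -> R) : 0 <= t -> t <= T ->
  cfield a -> cfield z -> fam1 (fun x => J (a x)) z -> fam2 mu E (fun x => J (z x)) ->
  continuous B ->
  (forall s, 0 <= s <= t -> \int[leb]_x ((rho * a x s - E x s) * J (a x) s) <= B s) ->
  rho * (\int[leb]_x (J (a x) t ^+ 2)) + mu * (\int[leb]_x (J (z x) t ^+ 2)) <=
  2 * \int[leb]_(s in `[0, t]) B s.
Proof.
move=> t0 tT Ca Cz F1 F2 cB hB.
have [ja va ca za hQa] := Ca; have [jz vz cz zz hQz] := Cz.
have [c1 c10 Qa] := hQa t; have [c2 c20 Qz] := hQz t.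
have [ia ea] := @energy_identity _ (measurableTypeR R) R leb a t c1 t0 c10 ja ca za Qa.
have [iz ez] := @energy_identity _ (measurableTypeR R) R leb z t c2 t0 c20 jz cz zz Qz.
rewrite ea ez !(mulrCA _ 2) -mulrDr ler_wpM2l//.
have Il := Rintegral_lin rho mu _ ia iz.
rewrite -Il; last by [].
apply: le_Rintegral => //.
- by apply: rintD; [|exact: rintZ|exact: rintZ].
- exact: continuous_rint_itv.
move=> s /=; rewrite in_itv/= => st; have /andP[s0 s1] := st.
apply: le_trans (hB s st).
have [xS xz r1] := F1 s (le_trans s1 tT).
have [xE xY [m0 m1 hY]] := F2 s (le_trans s1 tT).
have xa := cfield_xf s Ca.
have iaS := sqi_mul xa.1 xS.1; have iES := sqi_mul xE.1 xS.1.
rewrite [leRHS](_ : _ = rho * (\int[leb]_x (a x s * J (a x) s)) - \int[leb]_x (E x s * J (a x) s)); last first.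
  rewrite -[X in _ - X]mul1r -mulNr -(Rintegral_lin rho (-1) measurableT iaS iES).
  by apply: eq_Rintegral => x _; rewrite mulN1r mulrBl mulrA.
have izY := sqi_mul xz.1 xY.1.
rewrite (orthogonal_Rintegral xE xz xS m0 m1 r1).
rewrite (_ : \int[leb]_x (z x s * J (J (E^~ s)) x) = (- mu) * \int[leb]_x (z x s * J (z x) s)).
  by rewrite mulNr opprK.
have cJE : continuous (J (J (E^~ s))).
  by apply: J_continuous; apply: continuous_locint; apply: J_continuous; exact: (xf_locint xE).
rewrite -RintegralZl//; apply: ae_eq_Rintegral => //.
- apply: measurable_funM; first exact: xz.1.1.
  exact: continuous_measurable_fun.
- by apply: measurable_funM => //; exact: rint_measurable izY.
apply: (ae_imp hY) => x hx _; have [xL|xL] := boolP (0 < x < L).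
  by rewrite -[J (J _) x]opprK -hx//; ring.
by rewrite (xz.2 x xL); ring.
Qed.

End energy_method.

(** * Gronwall argument in exponentially weighted norms *)

Section gronwall.
Context {R : realType}.
Variables T L : R.
Hypotheses (T0 : 0 < T) (L0 : 0 < L).
Local Notation leb := (@lebesgue_measure R).
Implicit Types (f g h k u w a z E : R -> R -> R) (r s t c B lam e : R).

Definition Q_bounded f (b : R -> R) :=
  {ae leb, forall t, 0 < t < T -> (Q leb (f^~ t) <= (b t)%:E)%E}.

Lemma Q_zero (p : R -> R) : (forall x, p x = 0) -> Q leb p = 0%E.
Proof.
move=> p0; rewrite /Q; under eq_integral do rewrite p0 expr0n.
by rewrite integral_cst//= mul0e.
Qed.

Lemma fld_Q_le f r c : fld T L f -> 0 <= c ->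
  {ae leb, forall t, 0 < t < T -> t <= r -> (Q leb (f^~ t) <= c%:E)%E} ->
  {ae leb, forall t, t <= r -> (Q leb (f^~ t) <= c%:E)%E}.
Proof.
move=> [[_ _ _ cf _] fT] c0 h; apply: (ae_imp h) => t ht tr.
have [t0|t0] := leP t 0; first by rewrite Q_zero// => x; exact: cf.
have [Tt|tT] := leP T t; first by rewrite Q_zero// => x; exact: fT.
by apply: ht => //; rewrite t0.
Qed.

Lemma Q_exp_le f B lam r : fld T L f -> 0 <= B -> 0 <= lam ->
  Q_bounded f (fun t => B * expR (lam * t)) ->
  {ae leb, forall t, t <= r -> (Q leb (f^~ t) <= (B * expR (lam * r))%:E)%E}.
Proof.
move=> Ff B0 lam0 h; apply: fld_Q_le => //; first by rewrite mulr_ge0// expR_ge0.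
apply: (ae_imp h) => t ht tT tr; apply: le_trans (ht tT) _.
by rewrite lee_fin ler_wpM2l// ler_expR ler_wpM2l.
Qed.

Lemma Q_iter_avg_exp f B lam r e m : fld T L f -> 0 <= B -> 0 <= lam -> 0 < e ->
  Q_bounded f (fun t => B * expR (lam * t)) ->
  (Q leb (fun x => iter m.+1 (avg e) (f x) r) <= (B * expR (lam * r))%:E)%E.
Proof.
move=> Ff B0 lam0 e0 h; have [[jf _ lf cf _] _] := Ff.
apply: (@Q_iter_avgS _ (measurableTypeR R) R leb e m f r _ e0) => //.
  by rewrite mulr_ge0// expR_ge0.
exact: Q_exp_le.
Qed.

(** The weighted bound obeys B -> B / 2 + c, whose fixed point is [2 * c]: the crude initial bound
    is halved at each round. The step bounds the means for all [n], and [Q_of_averages] transfers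
    the bound to [f]. *)
Lemma gronwall_iteration m f (B0 c lam : R) : fld T L f -> 0 <= B0 -> 0 <= c -> 0 <= lam ->
  Q_bounded f (fun=> B0) ->
  (forall B, 0 <= B -> Q_bounded f (fun t => B * expR (lam * t)) ->
    forall n t, 0 < t < T ->
    (Q leb (fun x => iter m.+1 (avg n.+1%:R^-1) (f x) t) <= ((B / 2 + c) * expR (lam * t))%:E)%E) ->
  forall j, Q_bounded f (fun t => (B0 / 2 ^+ j + 2 * c) * expR (lam * t)).
Proof.
move=> Ff B00 c0 lam0 h0 step; elim=> [|j IH].
  apply: (ae_imp h0) => t ht tT; apply: le_trans (ht tT) _.
  rewrite lee_fin expr0 divr1; have t0 : 0 < t by case/andP: tT.
  have : 1 <= expR (lam * t) by rewrite -expR0 ler_expR mulr_ge0// ltW.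
  by have := mulr_ge0 (ler0n R 2) c0; nra.
have [[jf _ lf _ _] _] := Ff.
have fin := @Q_of_averages _ (measurableTypeR R) R leb m f jf lf.
have Bj : 0 <= B0 / 2 ^+ j + 2 * c.
  by rewrite addr_ge0 ?mulr_ge0 ?invr_ge0 ?exprn_ge0.
have := step _ Bj IH; set B' := _ / 2 + c => hB.
apply: (ae_imp fin) => t ht tT; have /andP[t0 _] := tT.
apply: (ht t0) => n; apply: le_trans (hB n t tT) _.
rewrite lee_fin ler_wpM2r ?expR_ge0// /B' exprS invfM.
by rewrite le_eqVlt; apply/orP; left; apply/eqP; field; rewrite expf_neq0.
Qed.

Lemma iter_Dq_lin e m (p q : R -> R) (a b : R) : iter m (Dq e) (fun r => a * p r + b * q r) =
  (fun r => a * iter m (Dq e) p r + b * iter m (Dq e) q r).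
Proof.
elim: m => //= m ->; apply/funext => r; rewrite /Dq; ring.
Qed.

Lemma J1E r : J (cst (1 : R)) r = Num.max 0 r.
Proof.
have [r0|r0] := leP r 0; first by rewrite J_le0.
rewrite /J Rintegral_itv_cst ?(ltW r0)//; lra.
Qed.

(** A second difference of the convex function max(0, s). *)
Lemma Dq2_J1_ge0 e s : 0 < e -> 0 <= iter 2 (Dq e) (J (cst 1)) s.
Proof.
move=> e0 /=; rewrite /Dq -mulrBr !mulr_ge0 ?invr_ge0 ?(ltW e0)// !J1E.
by rewrite !maxEle; do 3! case: ifPn; rewrite -?ltNge => *; lra.
Qed.

Lemma locint1 : locint (cst (1 : R)).
Proof. by apply: continuous_locint; exact: cst_continuous. Qed.

Lemma iter_avg1_le e m s : 0 < e -> `|iter m.+1 (avg e) (cst 1) s| <= 1.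
Proof.
move=> e0; elim: m s => [|m IH] s /=.
  by apply: avg_le_cst => // [|r _]; [exact: locint1|rewrite normr1].
by apply: avg_le_cst => //; [exact: (iter_avg_locint e m.+1 locint1)|move=> r _; exact: IH].
Qed.

Lemma Rintegral_expR lam t : 0 < lam -> 0 <= t ->
  \int[leb]_(s in `[0, t]) expR (lam * s) <= expR (lam * t) / lam.
Proof.
move=> lam0 t0; pose F := fun s : R => lam^-1 * expR (lam * s).
have lamN : lam != 0 by rewrite gt_eqF.
have dF (s : R) : is_derive s 1 F (expR (lam * s)).
  rewrite /F; apply: is_derive_eq; rewrite -?[_ *: _]/(_ * _)/=.
  by rewrite mulr1 mulrCA mulVf// mulr1.
have cf : continuous (fun s : R => expR (lam * s)).
  move=> s; apply: (@continuous_comp _ _ _ (fun s : R => lam * s) expR).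
    by apply: cvgM; [exact: cvg_cst|exact: cvg_id].
  exact: continuous_expR.
rewrite (Rintegral_FTC t0 cf dF) /F mulr0 expR0 mulr1 mulrC.
by rewrite lerBlDr lerDl invr_ge0 ltW.
Qed.

Lemma cfield_avg_source e m f : 0 <= e -> field L f ->
  cfield L (fun x => iter m (Dq e) (J (f x))).
Proof. by move=> e0 Ff; apply: (cfield_Dq m e0); exact: cfield_J. Qed.

Lemma J_iter_Dq e m f : 0 <= e -> field L f ->
  (fun x => J (iter m (Dq e) (J (f x)))) = (fun x => iter m (Dq e) (J (J (f x)))).
Proof.
move=> e0 [_ _ lf _ _]; apply/funext => x; rewrite -iter_Dq_J//; first exact: (J_continuous (lf x)).
exact: J_le0.
Qed.

(** [J (cst 1)] and [J (J (cst 1))] equal [r] and [r ^+ 2 / 2] at positive times and vanish before,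
    so the relation extends to negative times and can be differenced across time 0. *)
Lemma weak_beam_fam2 (rho mu : R) u k h (u0 u1 : R -> R) : fld T L u -> fld T L k -> fld T L h ->
  xf L u0 -> xf L u1 -> weak_beam T rho mu u k h u0 u1 ->
  fam2 T L mu (fun x r => 1 * (rho * J (u x) r + 1 * J (J (J (h x))) r) +
      (- rho) * (u0 x * J (cst 1) r + u1 x * J (J (cst 1)) r))
    (fun x r => J (J (J (k x))) r).
Proof.
move=> Fu Fk Fh xu0 xu1 W r rT.
have xu := field_xf_J r Fu.1; have xh := field_xf_J r (field_J (field_J Fh.1)).
have xk := field_xf_J r (field_J (field_J Fk.1)).
have E (x : R) : u0 x * J (cst 1) r + u1 x * J (J (cst 1)) r =
    J (cst 1) r * u0 x + J (J (cst 1)) r * u1 x by ring.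
split => //; first by under eq_fun do rewrite E; do 3! apply: xf_lin => //.
have [r0|r0] := leP 0 r; last first.
  have z (p : R -> R) : J p r = 0 by apply: J_le0; exact: ltW.
  under eq_fun do rewrite !z !(mulr0, addr0).
  under [X in rel2 _ _ _ X]eq_fun do rewrite z.
  split.
  - by rewrite /moment0 Rintegral_cst// mul0r.
  - by rewrite /moment1; under eq_Rintegral do rewrite mulr0; rewrite Rintegral_cst// mul0r.
  have J0 : J (fun=> (0 : R)) = (fun=> 0).
    by apply/funext => s; rewrite /J Rintegral_cst// mul0r.
  by apply: aeW => x _; rewrite !J0 mulr0 oppr0.
have := weak_beam_rel2 T0 L0 Fu Fk Fh W r0 rT xu0 xu1.
congr (rel2 _ _ _ _); apply/funext => x.
have -> : J (cst 1) r = r by rewrite J1E; exact/max_idPr.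
have -> : J (J (cst 1)) r = r ^+ 2 / 2.
  rewrite (_ : J (J (cst 1)) r = J (fun s => 1 * s + 0) r).
    by rewrite J_affine// mul1r mul0r addr0.
  apply: eq_Rintegral => s; rewrite inE/= in_itv/= => /andP[s0 _].
  by rewrite J1E mul1r addr0; exact/max_idPr.
by ring.
Qed.

(** Smallness of [p] in the dual of the functions S with S and S'' square integrable, stated with
    squares rather than a norm so that it adds directly to the energy estimates. *)
Definition osc (eps : R) (p : R -> R) := forall S z : R -> R,
  xf L S -> xf L z -> rel1 L S z ->
  `|\int[leb]_x (p x * S x)| <=
  eps * (2 + \int[leb]_x (S x ^+ 2) + \int[leb]_x (z x ^+ 2)).

Lemma small_half_power (b d : R) : 0 <= b -> 0 < d -> exists j : nat, b / 2 ^+ j <= d.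
Proof.
move=> b0 d0; exists (Num.truncn (b / d)).+1.
rewrite ler_pdivrMr ?exprn_gt0// mulrC -ler_pdivrMr//.
have := truncnS_gt (b / d); set n := (Num.truncn _).+1 => /ltW/le_trans; apply.
by rewrite -natrX ler_nat ltnW// ltn_expl.
Qed.

Lemma Q_boundedW f (b b' : R -> R) : (forall t, 0 < t < T -> b t <= b' t) ->
  Q_bounded f b -> Q_bounded f b'.
Proof.
move=> bb h; apply: (ae_imp h) => t ht tT; apply: le_trans (ht tT) _.
by rewrite lee_fin bb.
Qed.

Lemma source_le (rho c p q I0 I1 I2 B e Lam : R) : 0 <= rho -> `|I0| <= c -> `|I1| <= c ->
  2 * `|I2| <= T ^+ 2 * (Lam ^+ 2 * B * e) + B * e -> 0 <= p -> `|q| <= 1 ->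
  1 * (rho * p * I0 + rho * q * I1) + (-1) * I2 <=
  rho * c * p + (rho * c * 1 + (T ^+ 2 * Lam ^+ 2 + 1) / 2 * B * e).
Proof.
move=> rho0 h0 h1 h2 p0 hq.
have c0 : 0 <= c by exact: le_trans (normr_ge0 _) h0.
have e0 : p * I0 <= p * c by rewrite ler_wpM2l// (le_trans (ler_norm _)).
have e1 : q * I1 <= c.
  by rewrite (le_trans (ler_norm _))// normrM -[leRHS]mul1r ler_pM.
have e2 : - I2 <= `|I2| by rewrite -normrN ler_norm.
have {}e0 := ler_wpM2l rho0 e0; have {}e1 := ler_wpM2l rho0 e1.
lra.
Qed.

Lemma gronwall_arith (rho mu kap lam c t B P I X Y e G : R) : 0 < rho -> 0 < mu -> 0 < kap ->
  lam = 4 * kap / rho -> 0 <= B -> 0 <= c -> 0 <= t -> t <= T -> 0 <= Y -> 1 <= e ->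
  rho * X + mu * Y <= 2 * G ->
  G = rho * c * P + 1 * (rho * c * t + kap / 2 * B * I) -> P <= 1 -> I <= e / lam ->
  X <= B / 4 * e + 2 * c * (1 + T).
Proof.
move=> rho0 mu0 kap0 lamE B0 c0 t0 tT Y0 e1 H GE P1 I1.
have E : kap * (e / lam) = rho * e / 4.
  by rewrite lamE; field; rewrite !gt_eqF.
have h1 : kap * B * I <= B * (rho * e / 4).
  by have := ler_wpM2l B0 (ler_wpM2l (ltW kap0) I1); rewrite E mulrA (mulrC B kap).
have h2 : rho * c * P <= rho * c by rewrite ler_piMr// mulr_ge0// ltW.
have h3 : rho * c * t <= rho * c * T by rewrite ler_wpM2l// mulr_ge0// ltW.
have h5 : 0 <= mu * Y by rewrite mulr_ge0// ltW.
rewrite -(ler_pM2l rho0); rewrite GE in H; lra.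
Qed.

(** The data term contains [B] itself, through the size of the multiplier; the condition on [eps]
    makes that part at most a quarter of the weighted bound, for a total of one half. *)
Lemma absorb_arith (eps B e CE X : R) : 0 <= eps -> 0 <= B -> 0 <= CE -> 1 <= e ->
  8 * eps * (1 + T) <= 1 -> X <= B / 4 * e + 2 * (eps * (2 + B * e + CE)) * (1 + T) ->
  X <= (B / 2 + 2 * eps * (2 + CE) * (1 + T)) * e.
Proof.
move=> eps0 B0 CE0 e1 h8 hX.
have Be : 0 <= B * e by rewrite mulr_ge0// (le_trans _ e1).
have h1 := ler_wpM2r Be h8.
have h2 : 2 * eps * (2 + CE) * (1 + T) <= 2 * eps * (2 + CE) * (1 + T) * e.
  by rewrite ler_peMr// !mulr_ge0// addr_ge0// ltW.
lra.
Qed.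

Section small_solutions.
Variables (rho mu Lam : R).
Hypotheses (rho0 : 0 < rho) (mu0 : 0 < mu).

(** Young's inequality on the source leaves this coefficient: [T ^+ 2 * Lam ^+ 2] from the primitive
    of [h] and 1 from the solution. The rate [lam] makes [kap * B] times the time integral of the
    weight at most [rho * B / 4] times the weight. *)
Let kap := T ^+ 2 * Lam ^+ 2 + 1.
Let lam := 4 * kap / rho.

Let kap0 : 0 < kap.
Proof. by rewrite ltr_wpDl// mulr_ge0// sqr_ge0. Qed.

Let lam0 : 0 < lam.
Proof. by rewrite divr_gt0// mulr_gt0. Qed.

Variables (u k h : R -> R -> R) (u0 u1 : R -> R) (CE eps : R).
Hypotheses (Fu : fld T L u) (Fk : fld T L k) (Fh : fld T L h).
Hypotheses (xu0 : xf L u0) (xu1 : xf L u1).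
Hypothesis W : weak_beam T rho mu u k h u0 u1.
Hypothesis Ws : space_weak T L u k.
Hypotheses (CE0 : 0 <= CE) (eps0 : 0 <= eps) (eps8 : 8 * eps * (1 + T) <= 1).
Hypothesis Qk : Q_bounded k (fun=> CE).
Hypothesis Qh : {ae leb, forall t, 0 < t < T ->
  (Q leb (h^~ t) <= (Lam ^+ 2)%:E * Q leb (u^~ t))%E}.
Hypotheses (o0 : osc eps u0) (o1 : osc eps u1).

(** The multiplier is [S], the twofold mean of [u], whose second space derivative [z] is the twofold
    mean of [k] and is bounded by [CE]: the data are met through [osc] only, the source through
    Young's inequality. Only the part of the energy in [S] is kept at the end. *)
Lemma small_solution_step B : 0 <= B ->
  Q_bounded u (fun t => B * expR (lam * t)) ->
  forall n t, 0 < t < T ->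
    (Q leb (fun x => iter 2 (avg n.+1%:R^-1) (u x) t) <=
     ((B / 2 + 2 * eps * (2 + CE) * (1 + T)) * expR (lam * t))%:E)%E.
Proof.
move=> B0 hB n t /andP[t0 tT].
pose K := 2 + B * expR (lam * t) + CE.
have K0 : 0 <= K by rewrite !addr_ge0// mulr_ge0// expR_ge0.
set e := n.+1%:R^-1; have e0 : 0 < e by rewrite invr_gt0.
have e0' := ltW e0.
have Fu1 := field_J Fu.1.
pose S x := iter 2 (Dq e) (J (J (u x))).
pose a x := iter 2 (Dq e) (J (u x)).
pose z x := iter 2 (Dq e) (J (J (k x))).
pose H x := iter 2 (Dq e) (J (J (J (h x)))).
(* An approximate Dirac mass at time 0: of size up to [e^-1], but nonnegative and with time integral
   [q t <= 1]. Positivity keeps the contribution of the initial position bounded uniformly in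
   [n]. *)
pose p := iter 2 (Dq e) (J (cst (1 : R))).
pose q := iter 2 (Dq e) (J (J (cst (1 : R)))).
have Ja : (fun x => J (a x)) = S by exact: (J_iter_Dq 2 e0' Fu.1).
have Jz : (fun x => J (z x)) = (fun x => iter 2 (Dq e) (J (J (J (k x))))).
  exact: (J_iter_Dq 2 e0' (field_J Fk.1)).
have f1 : fam1 T L (fun x => J (a x)) z.
  rewrite Ja; apply: (fam1_Dq 2 e0') => r rT; split.
  - exact: (field_xf_J r Fu1).
  - exact: (field_xf_J r (field_J Fk.1)).
  - exact: (space_weak_rel1 L0 r Fu Fk Ws).
pose E x s := 1 * (rho * a x s + 1 * H x s) + (- rho) * (u0 x * p s + u1 x * q s).
have f2 : fam2 T L mu E (fun x => J (z x)).
  rewrite Jz; have := fam2_Dq 2 e0' (weak_beam_fam2 Fu Fk Fh xu0 xu1 W).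
  congr (fam2 _ _ _ _ _); apply/funext => x.
  by rewrite (iter_Dq_lin e 2) (iter_Dq_lin e 2) (iter_Dq_lin e 2).
have Sa x : S x = iter 2 (avg e) (u x).
  by rewrite /S (iter_DqJ_avg 2 e0')//; case: Fu => -[].
have za x : z x = iter 2 (avg e) (k x).
  by rewrite /z (iter_DqJ_avg 2 e0')//; case: Fk => -[].
have Ha x : H x = iter 2 (avg e) (J (h x)).
  rewrite /H -(iter_DqJ_avg 2 e0')//; apply: continuous_locint; apply: J_continuous.
  by case: Fh => -[].
have qa : q = iter 2 (avg e) (cst 1) by rewrite /q (iter_DqJ_avg 2 e0')//; exact: locint1.
have Ca : cfield L a := cfield_avg_source 2 e0' Fu.1.
have Cz : cfield L z := cfield_avg_source 2 e0' (field_J Fk.1).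
have CH : cfield L H := cfield_avg_source 2 e0' (field_J (field_J Fh.1)).
have ex s : s <= t -> expR (lam * s) <= expR (lam * t).
  by move=> st; rewrite ler_expR ler_wpM2l// ltW.
have QS s : s <= T -> (Q leb (S^~ s) <= (B * expR (lam * s))%:E)%E.
  move=> sT; under eq_fun do rewrite Sa.
  exact: (Q_iter_avg_exp s 1 Fu B0 (ltW lam0) e0 hB).
have Qz s : (Q leb (z^~ s) <= CE%:E)%E.
  under eq_fun do rewrite za.
  have h0 : Q_bounded k (fun t => CE * expR (0 * t)).
    by apply: (ae_imp Qk) => r hr rT; rewrite mul0r expR0 mulr1; exact: hr.
  by have := Q_iter_avg_exp s 1 Fk CE0 (lexx 0) e0 h0; rewrite mul0r expR0 mulr1.
have Qhb : Q_bounded h (fun t => Lam ^+ 2 * B * expR (lam * t)).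
  apply: (ae_imp2 Qh hB) => r h1 h2 rT; apply: le_trans (h1 rT) _.
  by rewrite -mulrA (EFinM (Lam ^+ 2)); apply: lee_wpmul2l; [rewrite lee_fin sqr_ge0|exact: h2].
have LB0 : 0 <= Lam ^+ 2 * B by rewrite mulr_ge0// sqr_ge0.
have [[jh vh lh ch _] _] := Fh.
have QH s : 0 <= s -> s <= T -> (Q leb (H^~ s) <= (T ^+ 2 * (Lam ^+ 2 * B * expR (lam * s)))%:E)%E.
  move=> s0 sT; under eq_fun do rewrite Ha.
  have c0 : 0 <= Lam ^+ 2 * B * expR (lam * s) by rewrite mulr_ge0// expR_ge0.
  have TC0 : 0 <= T ^+ 2 * (Lam ^+ 2 * B * expR (lam * s)) by rewrite mulr_ge0// sqr_ge0.
  have [jJ vJ _ cJ _] := field_J Fh.1.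
  apply: (@Q_iter_avgS _ (measurableTypeR R) R leb e 1 (fun x => J (h x)) s _ e0) => //.
  - by move=> x; apply: continuous_locint; exact: J_continuous.
  apply: aeW => r rs; have [r0|r0] := leP r 0.
    by rewrite Q_zero ?lee_fin// => x; exact: J_le0.
  apply: (@le_trans _ _ ((r ^+ 2 * (Lam ^+ 2 * B * expR (lam * s)))%:E)).
    apply: (@Q_J _ (measurableTypeR R) R leb h r _ (ltW r0) c0) => //.
    have := Q_exp_le s Fh LB0 (ltW lam0) Qhb => hh.
    by apply: (ae_imp hh) => r' hr' r'r; apply: hr'; exact: le_trans r'r rs.
  by rewrite lee_fin ler_wpM2r// ler_sqr ?nnegrE ?(ltW r0) ?(ltW T0)// (le_trans rs).
pose G s := rho * (eps * K) * p s + (rho * (eps * K) * 1 + kap / 2 * B * expR (lam * s)).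
have p0 s : 0 <= p s by exact: Dq2_J1_ge0.
have q1 s : `|q s| <= 1 by rewrite qa; exact: iter_avg1_le.
have cp : continuous p.
  by apply: iter_Dq_continuous; apply: J_continuous; exact: locint1.
have cexp : continuous (fun s : R => expR (lam * s)).
  move=> s; apply: (@continuous_comp _ _ _ (fun s : R => lam * s) expR).
    by apply: cvgM; [exact: cvg_cst|exact: cvg_id].
  exact: continuous_expR.
have cG : continuous G.
  move=> s; apply: cvgD; first by apply: cvgM; [exact: cvg_cst|exact: cp].
  by apply: cvgD; [exact: cvg_cst|apply: cvgM; [exact: cvg_cst|exact: cexp]].
have bound s : 0 <= s <= t ->
    \int[leb]_x ((rho * a x s - E x s) * J (a x) s) <= G s.
  move=> /andP[s0 st]; have sT : s <= T := le_trans st (ltW tT).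
  have [xS xz r1] := f1 s sT.
  have Q1 : \int[leb]_x (J (a x) s ^+ 2) <= B * expR (lam * s).
    apply: (Q_fin_le xS.1.1); rewrite -[X in Q leb X]/((fun x => J (a x))^~ s) Ja; exact: QS.
  have Q2 := Q_fin_le xz.1.1 (Qz s).
  have xH := cfield_xf s CH.
  have Q3 := Q_fin_le xH.1.1 (QH s s0 sT).
  have BK : 2 + \int[leb]_x (J (a x) s ^+ 2) + \int[leb]_x (z x s ^+ 2) <= K.
    by rewrite /K lerD// lerD2l (le_trans Q1)// ler_wpM2l//; exact: ex.
  have A0 := le_trans (o0 xS xz r1) (ler_wpM2l eps0 BK).
  have A1 := le_trans (o1 xS xz r1) (ler_wpM2l eps0 BK).
  have A2 := Young_Rintegral ltr01 xH.1 xS.1; rewrite invr1 !mul1r in A2.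
  have i0 := sqi_mul xu0.1 xS.1; have i1 := sqi_mul xu1.1 xS.1; have iH := sqi_mul xH.1 xS.1.
  rewrite (_ : \int[leb]_x _ = 1 * (rho * p s * (\int[leb]_x (u0 x * J (a x) s)) +
      rho * q s * (\int[leb]_x (u1 x * J (a x) s))) +
      (-1) * (\int[leb]_x (H x s * J (a x) s))); last first.
    rewrite -(Rintegral_lin _ _ measurableT i0 i1) -Rintegral_lin//; last first.
      by apply: rintD => //; exact: rintZ.
    by apply: eq_Rintegral => x _; rewrite /E; ring.
  exact: (source_le (ltW rho0) A0 A1 (le_trans A2 (lerD Q3 Q1)) (p0 s) (q1 s)).
have H1 := energy_le (ltW t0) (ltW tT) Ca Cz f1 f2 cG bound.
have ip : rint leb `[0, t] p by exact: continuous_rint_itv.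
have iexp : rint leb `[0, t] (fun s => expR (lam * s)) by exact: continuous_rint_itv.
have i1 : rint leb `[0, t] (cst (1 : R)) by apply: continuous_rint_itv; exact: cst_continuous.
have IG : \int[leb]_(s in `[0, t]) G s = rho * (eps * K) * (\int[leb]_(s in `[0, t]) p s) +
    1 * (rho * (eps * K) * t + kap / 2 * B * \int[leb]_(s in `[0, t]) expR (lam * s)).
  have mI : measurable (`[0, t] : set (measurableTypeR R)) by [].
  have i2 := rintD mI (rintZ (rho * (eps * K)) mI i1) (rintZ (kap / 2 * B) mI iexp).
  have I2 := Rintegral_lin (rho * (eps * K)) (kap / 2 * B) mI i1 iexp.
  have I3 := Rintegral_lin (rho * (eps * K)) 1 mI ip i2.
  have I1 : \int[leb]_(s in `[0, t]) cst (1 : R) s = t.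
    by have := Rintegral_itv_cst (1 : R) (ltW t0); rewrite mul1r subr0.
  rewrite -[X in rho * _ * X + kap / 2 * B * _]I1 -I2 -I3.
  by apply: eq_Rintegral => s _; rewrite mul1r.
have Jp : \int[leb]_(s in `[0, t]) p s = q t.
  rewrite /q iter_Dq_J//; first by apply: J_continuous; exact: locint1.
  exact: J_le0.
have xS := (field_xf_J t (cfield_field Ca)).1.
have Y0 : 0 <= \int[leb]_x (J (z x) t ^+ 2) by apply: Rintegral_ge0 => x _; exact: sqr_ge0.
have tT' := ltW tT.
have e1 : 1 <= expR (lam * t) by rewrite -expR0 ler_expR mulr_ge0// ltW.
have q1' : q t <= 1 := le_trans (ler_norm _) (q1 t).
have X := gronwall_arith rho0 mu0 kap0 erefl B0 (mulr_ge0 eps0 K0) (ltW t0) tT' Y0 e1 H1 IG.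
rewrite Jp in X; have {}X := absorb_arith eps0 B0 CE0 e1 eps8 (X q1' (Rintegral_expR lam0 (ltW t0))).
have Sa' : (fun x => iter 2 (avg e) (u x) t) = (fun x => J (a x) t).
  by apply/funext => x; rewrite -Sa; have := congr1 (fun F => F x t) Ja.
by rewrite Sa'; apply: Q_le_fin.
Qed.

End small_solutions.
Lemma gronwall_final (lam B0 c d : R) m f : fld T L f -> 0 <= B0 -> 0 <= c -> 0 <= lam ->
  0 < d -> 2 * c * expR (lam * T) <= d / 2 -> Q_bounded f (fun=> B0) ->
  (forall B, 0 <= B -> Q_bounded f (fun t => B * expR (lam * t)) ->
    forall n t, 0 < t < T ->
    (Q leb (fun x => iter m.+1 (avg n.+1%:R^-1) (f x) t) <= ((B / 2 + c) * expR (lam * t))%:E)%E) ->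
  exists B, [/\ 0 <= B, B * expR (lam * T) <= d & Q_bounded f (fun t => B * expR (lam * t))].
Proof.
move=> Ff B00 c0 lam0 d0 cd h0 step.
have e0 : 0 < expR (lam * T) by exact: expR_gt0.
have [|j hj] := @small_half_power B0 (d / 2 / expR (lam * T)) B00; first by rewrite !divr_gt0.
exists (B0 / 2 ^+ j + 2 * c); split.
- by rewrite addr_ge0 ?mulr_ge0 ?invr_ge0 ?exprn_ge0.
- rewrite mulrDl; move: hj; rewrite ler_pdivlMr//; lra.
exact: (gronwall_iteration Ff B00 c0 lam0 h0 step).
Qed.

Lemma Q_bounded_exp_cst f (B lam d : R) : 0 <= B -> 0 <= lam -> B * expR (lam * T) <= d ->
  Q_bounded f (fun t => B * expR (lam * t)) -> Q_bounded f (fun=> d).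
Proof.
move=> B0 lam0 Bd; apply: Q_boundedW => t /andP[_ tT]; apply: le_trans Bd.
by rewrite ler_wpM2l// ler_expR ler_wpM2l// ltW.
Qed.

(** The threshold [eps] is chosen before [B0]: the iteration forgets the bound of the individual
    solution, so the result is uniform along a sequence. *)
Lemma small_solution (rho mu Lam CE d : R) :
  0 < rho -> 0 < mu -> 0 <= CE -> 0 < d ->
  exists2 eps : R, 0 < eps & forall u k h (u0 u1 : R -> R) (B0 : R),
    fld T L u -> fld T L k -> fld T L h -> xf L u0 -> xf L u1 ->
    weak_beam T rho mu u k h u0 u1 -> space_weak T L u k ->
    0 <= B0 -> Q_bounded u (fun=> B0) -> Q_bounded k (fun=> CE) ->
    {ae leb, forall t, 0 < t < T ->
      (Q leb (h^~ t) <= (Lam ^+ 2)%:E * Q leb (u^~ t))%E} ->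
    osc eps u0 -> osc eps u1 -> Q_bounded u (fun=> d).
Proof.
move=> rho0 mu0 CE0 d0.
pose lam := 4 * (T ^+ 2 * Lam ^+ 2 + 1) / rho.
have kap0 : 0 < T ^+ 2 * Lam ^+ 2 + 1 by rewrite ltr_wpDl// mulr_ge0// sqr_ge0.
have lam0 : 0 < lam by rewrite divr_gt0// mulr_gt0.
have T1 : 0 < 1 + T by rewrite addr_gt0.
have K0 : 0 < 2 + CE by rewrite ltr_wpDr.
have e0 : 0 < expR (lam * T) by exact: expR_gt0.
pose A := 4 * (2 + CE) * (1 + T) * expR (lam * T).
have A0 : 0 < A by rewrite !mulr_gt0.
(* The first entry is the absorption condition; with the second, [2 * c * expR (lam * T)] equals
   [eps * A] and is at most [d / 2]. *)
pose eps := Num.min (8 * (1 + T))^-1 (d / 2 / A).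
have eps0 : 0 < eps by rewrite lt_min; apply/andP; split; rewrite ?invr_gt0 ?divr_gt0// mulr_gt0.
exists eps => // u k h u0 u1 B0 Fu Fk Fh xu0 xu1 W Ws B00 Qu Qk Qh o0 o1.
pose c := 2 * eps * (2 + CE) * (1 + T).
have c0 : 0 <= c by rewrite !mulr_ge0// ltW.
have eps8 : 8 * eps * (1 + T) <= 1.
  have : eps <= (8 * (1 + T))^-1 by rewrite /eps ge_min lexx.
  by rewrite -[X in _ <= X -> _]div1r ler_pdivlMr ?mulr_gt0// mulrA (mulrC eps).
have cd : 2 * c * expR (lam * T) <= d / 2.
  have : eps <= d / 2 / A by rewrite /eps ge_min lexx orbT.
  by rewrite ler_pdivlMr//; apply: le_trans; rewrite /c /A le_eqVlt; apply/orP; left; apply/eqP; ring.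
have step := small_solution_step rho0 mu0 Fu Fk Fh xu0 xu1 W Ws CE0 (ltW eps0) eps8 Qk Qh o0 o1.
have [B [Bp Bd QB]] := gronwall_final Fu B00 c0 (ltW lam0) d0 cd Qu step.
exact: (Q_bounded_exp_cst Bp (ltW lam0) Bd QB).
Qed.

Lemma half_sum_le (I a B x : R) : 2 * `|I| <= a + B * x -> `|I| <= a / 2 * 1 + B / 2 * x.
Proof. lra. Qed.

Lemma difference_arith (rho mu X X' Y Y' G a t B I x : R) : X = X' -> Y = Y' ->
  G = a / 2 * t + B / 2 * I -> rho * X' + mu * Y' <= 2 * G -> B * I <= B * x ->
  rho * X + mu * Y <= a * t + B * x.
Proof. move=> -> -> ->; lra. Qed.

Lemma difference_arith_g (rho mu lam eta t B X Y e : R) : 0 < rho -> 0 < mu -> lam = 2 * 1 / rho ->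
  0 <= eta -> t <= T -> 0 <= Y -> 1 <= e -> rho * X + mu * Y <= eta * t + B * (e / lam) ->
  X <= (B / 2 + eta * T / rho) * e.
Proof.
move=> rho0 mu0 lamE eta0 tT Y0 e1 H.
have E : B * (e / lam) = rho * (B / 2 * e) by rewrite lamE; field; rewrite gt_eqF.
have h1 : eta * t <= eta * T * e.
  by rewrite (le_trans (ler_wpM2l eta0 tT))// ler_peMr// mulr_ge0// ltW.
have h2 : eta * T * e = rho * (eta * T / rho * e) by field; rewrite gt_eqF.
have h3 : 0 <= mu * Y by rewrite mulr_ge0// ltW.
rewrite -(ler_pM2l rho0) mulrDl mulrDr -h2 -E; lra.
Qed.

Lemma difference_arith_k (rho mu lam eta t B X Y e eT d : R) : 0 < rho -> 0 < mu -> 0 < lam ->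
  0 <= eta -> t <= T -> 0 <= B -> e <= eT -> B * eT <= mu * d * lam / 2 ->
  eta * (2 * T) <= mu * d -> 0 <= X -> rho * X + mu * Y <= eta * t + B * (e / lam) -> Y <= d.
Proof.
move=> rho0 mu0 lam0 eta0 tT B0 eT0 h1 h2 X0 H.
have h3 : B * (e / lam) <= mu * d / 2.
  rewrite mulrA ler_pdivrMr// (le_trans (ler_wpM2l B0 eT0))//; lra.
have h4 := ler_wpM2l eta0 tT.
have h5 : 0 <= rho * X by rewrite mulr_ge0// ltW.
rewrite -(ler_pM2l mu0); lra.
Qed.

Section small_differences.
Variables (rho mu : R).
Hypotheses (rho0 : 0 < rho) (mu0 : 0 < mu).

(** With this rate [B * (expR (lam * t) / lam)] is [rho * B / 2] times the weight, whence the
    contraction factor one half. *)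
Let lam := 2 * 1 / rho.

Let lam0 : 0 < lam.
Proof. by rewrite divr_gt0// mulr_gt0. Qed.

Variables (w g k h : R -> R -> R) (eta : R).
Hypotheses (Fw : fld T L w) (Fg : fld T L g) (Fk : fld T L k) (Fh : fld T L h).
Hypothesis W : weak_beam T rho mu w k h (cst 0) (cst 0).
Hypotheses (Ws : space_weak T L w k) (Wt : time_weak T L w g).
Hypotheses (eta0 : 0 <= eta) (Qh : Q_bounded h (fun=> eta)).

Lemma J_vanish f t x : field L f -> ~~ (0 < x < L) -> J (f x) t = 0.
Proof. by move=> Ff xL; have [_ vJ _ _ _] := field_J Ff; exact: vJ. Qed.

(** Starting from rest, [w] is the time primitive of [g], so the relation between [w] and [k]
    becomes one between the velocity and [k]. *)
Lemma difference_fam1 : fam1 T L (fun x => J (J (J (g x)))) (fun x => J (J (k x))).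
Proof.
move=> r rT; split.
- exact: (field_xf_J r (field_J (field_J Fg.1))).
- exact: (field_xf_J r (field_J Fk.1)).
have [a [b h1]] := space_weak_rel1 L0 r Fw Fk Ws.
have h2 := time_weak_JJ T0 L0 rho0 Fw Fg Fk Fh W Wt rT.
by exists a, b; apply: (ae_imp2 h1 h2) => x e1 e2 xL; rewrite -e2// e1.
Qed.

(** Replacing [J w] by [J (J g)] changes the field on a null set of points, which neither moments
    nor double primitives see. *)
Lemma difference_fam2 : fam2 T L mu
  (fun x r => rho * J (J (g x)) r + 1 * J (J (J (h x))) r) (fun x r => J (J (J (k x))) r).
Proof.
move=> r rT.
have xg := field_xf_J r (field_J Fg.1); have xh := field_xf_J r (field_J (field_J Fh.1)).
have xk := field_xf_J r (field_J (field_J Fk.1)).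
split => //; first exact: xf_lin.
have x0 : xf L (cst (0 : R)).
  split; last by move=> x.
  by split => //; rewrite Q_zero// ltry.
have [_ _] := weak_beam_fam2 Fw Fk Fh x0 x0 W rT.
set f1 := fun x => 1 * _ + _; set f2 := fun x => rho * _ + _.
have h2 := time_weak_J T0 L0 rho0 Fw Fg Fk Fh W Wt rT.
have E : {ae leb, forall x, f1 x = f2 x}.
  apply: (ae_imp h2) => x hx; rewrite /f1 /f2 /cst !mul0r addr0 mulr0 addr0 mul1r.
  have [xL|xL] := boolP (0 < x < L); first by rewrite hx.
  by rewrite (J_vanish r Fw.1 xL) (J_vanish r (field_J Fg.1) xL).
have xw := field_xf_J r Fw.1.
have m1 : measurable_fun setT f1.
  rewrite (_ : f1 = fun x => rho * J (w x) r + 1 * J (J (J (h x))) r).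
    by have [] := (xf_lin rho 1 xw xh).1.
  by apply/funext => x; rewrite /f1 /cst !mul0r addr0 mulr0 addr0 mul1r.
have m2 : measurable_fun setT f2 by have [] := (xf_lin rho 1 xg xh).1.
have i1 (D : set (measurableTypeR R)) (p : R -> R) : measurable D -> measurable_fun setT p ->
    \int[leb]_(x in D) (p x * f1 x) = \int[leb]_(x in D) (p x * f2 x).
  move=> mD mp; apply: ae_eq_Rintegral => //.
  - by apply: measurable_funTS; apply: measurable_funM.
  - by apply: measurable_funTS; apply: measurable_funM.
  by apply: (ae_imp E) => x -> _.
have i2 (D : set (measurableTypeR R)) : measurable D ->
    \int[leb]_(x in D) f1 x = \int[leb]_(x in D) f2 x.
  by move=> mD; apply: ae_eq_Rintegral => //; try exact: measurable_funTS; apply: (ae_imp E) => x -> _.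
have EJ : J f1 = J f2 by apply/funext => s; exact: i2.
move=> [e0 e1 hY]; split; [rewrite -e0|rewrite -e1|by rewrite -EJ].
- by symmetry; exact: (i2 setT measurableT).
- by symmetry; exact: (i1 setT id measurableT (@measurable_id _ _ setT)).
Qed.

(** The energy of [small_solution_step] one time derivative higher: [J a] and [J z] are the
    threefold means of [g] and [k], both controlled at once, and with null data only the source is
    left. *)
Lemma small_difference_step B : 0 <= B -> Q_bounded g (fun t => B * expR (lam * t)) ->
  forall n t, 0 < t < T ->
    rho * (\int[leb]_x (iter 3 (avg n.+1%:R^-1) (g x) t ^+ 2)) +
    mu * (\int[leb]_x (iter 3 (avg n.+1%:R^-1) (k x) t ^+ 2)) <=
    eta * t + B * (expR (lam * t) / lam).
Proof.
move=> B0 hB n t /andP[t0 tT].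
set e := n.+1%:R^-1; have e0 : 0 < e by rewrite invr_gt0.
have e0' := ltW e0.
pose a x := iter 3 (Dq e) (J (J (g x))).
pose z x := iter 3 (Dq e) (J (J (k x))).
pose H x := iter 3 (Dq e) (J (J (J (h x)))).
pose E x s := rho * a x s + 1 * H x s.
have Ja : (fun x => J (a x)) = (fun x => iter 3 (Dq e) (J (J (J (g x))))).
  exact: (J_iter_Dq 3 e0' (field_J Fg.1)).
have Jz : (fun x => J (z x)) = (fun x => iter 3 (Dq e) (J (J (J (k x))))).
  exact: (J_iter_Dq 3 e0' (field_J Fk.1)).
have f1 : fam1 T L (fun x => J (a x)) z by rewrite Ja; exact: (fam1_Dq 3 e0' difference_fam1).
have f2 : fam2 T L mu E (fun x => J (z x)).
  rewrite Jz; have := fam2_Dq 3 e0' difference_fam2.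
  by congr (fam2 _ _ _ _ _); apply/funext => x; rewrite (iter_Dq_lin e 3).
have la f : fld T L f -> (fun x => iter 3 (Dq e) (J (J (J (f x))))) =
    (fun x => iter 3 (avg e) (f x)).
  by move=> [[_ _ lf _ _] _]; apply/funext => x; exact: (iter_DqJ_avg 3 e0' (lf x)).
have Ga : (fun x => J (a x)) = (fun x => iter 3 (avg e) (g x)).
  exact: etrans Ja (la g Fg).
have Ka : (fun x => J (z x)) = (fun x => iter 3 (avg e) (k x)).
  exact: etrans Jz (la k Fk).
have Ha : H = (fun x => iter 3 (avg e) (h x)) by exact: (la h Fh).
have Ca : cfield L a := cfield_avg_source 3 e0' (field_J Fg.1).
have Cz : cfield L z := cfield_avg_source 3 e0' (field_J Fk.1).
have CH : cfield L H := cfield_avg_source 3 e0' (field_J (field_J Fh.1)).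
have QS s : (Q leb (fun x => J (a x) s) <= (B * expR (lam * s))%:E)%E.
  rewrite (_ : (fun x => J (a x) s) = (fun x => iter 3 (avg e) (g x) s)).
    exact: (Q_iter_avg_exp s 2 Fg B0 (ltW lam0) e0 hB).
  by apply/funext => x; have := congr1 (fun F => F x s) Ga.
have QH s : (Q leb (H^~ s) <= eta%:E)%E.
  rewrite Ha; have h0 : Q_bounded h (fun t => eta * expR (0 * t)).
    by apply: (ae_imp Qh) => r hr rT; rewrite mul0r expR0 mulr1; exact: hr.
  by have := Q_iter_avg_exp s 2 Fh eta0 (lexx 0) e0 h0; rewrite mul0r expR0 mulr1.
pose G s := eta / 2 * 1 + B / 2 * expR (lam * s).
have cexp : continuous (fun s : R => expR (lam * s)).
  move=> s; apply: (@continuous_comp _ _ _ (fun s : R => lam * s) expR).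
    by apply: cvgM; [exact: cvg_cst|exact: cvg_id].
  exact: continuous_expR.
have cG : continuous G.
  by move=> s; apply: cvgD; [exact: cvg_cst|apply: cvgM; [exact: cvg_cst|exact: cexp]].
have bound s : 0 <= s <= t ->
    \int[leb]_x ((rho * a x s - E x s) * J (a x) s) <= G s.
  move=> /andP[s0 st]; have sT : s <= T := le_trans st (ltW tT).
  have [xS xz r1] := f1 s sT.
  have Q1 := Q_fin_le xS.1.1 (QS s).
  have xH := cfield_xf s CH.
  have Q3 := Q_fin_le xH.1.1 (QH s).
  have A2 := Young_Rintegral ltr01 xH.1 xS.1; rewrite invr1 !mul1r in A2.
  have iH := sqi_mul xH.1 xS.1.
  rewrite (_ : \int[leb]_x _ = - (\int[leb]_x (H x s * J (a x) s))); last first.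
    rewrite -mulN1r -(RintegralZl (-1) measurableT iH).
    by apply: eq_Rintegral => x _; rewrite /E; ring.
  have A3 := le_trans A2 (lerD Q3 Q1).
  by apply: le_trans (ler_norm _) _; rewrite normrN; exact: half_sum_le A3.
have H1 := energy_le (ltW t0) (ltW tT) Ca Cz f1 f2 cG bound.
have iexp : rint leb `[0, t] (fun s => expR (lam * s)) by exact: continuous_rint_itv.
have i1 : rint leb `[0, t] (cst (1 : R)) by apply: continuous_rint_itv; exact: cst_continuous.
have IG : \int[leb]_(s in `[0, t]) G s = eta / 2 * t + B / 2 * \int[leb]_(s in `[0, t]) expR (lam * s).
  have mI : measurable (`[0, t] : set (measurableTypeR R)) by [].
  have I2 := Rintegral_lin (eta / 2) (B / 2) mI i1 iexp.
  have I1 : \int[leb]_(s in `[0, t]) cst (1 : R) s = t.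
    by have := Rintegral_itv_cst (1 : R) (ltW t0); rewrite mul1r subr0.
  by rewrite -[X in eta / 2 * X + _]I1 -I2.
have I3 := ler_wpM2l B0 (Rintegral_expR lam0 (ltW t0)).
have Ga' : (fun x => iter 3 (avg e) (g x) t) = (fun x => J (a x) t).
  by apply/funext => x; have := congr1 (fun F => F x t) Ga.
have Ka' : (fun x => iter 3 (avg e) (k x) t) = (fun x => J (z x) t).
  by apply/funext => x; have := congr1 (fun F => F x t) Ka.
have IX := congr1 (fun F : R -> R => \int[leb]_x (F x ^+ 2)) Ga'.
have IY := congr1 (fun F : R -> R => \int[leb]_x (F x ^+ 2)) Ka'.
exact: difference_arith IX IY IG H1 I3.
Qed.

End small_differences.

Lemma small_difference (rho mu d : R) : 0 < rho -> 0 < mu -> 0 < d ->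
  exists2 eta : R, 0 < eta & forall w g k h (B0 : R), 0 <= B0 ->
    fld T L w -> fld T L g -> fld T L k -> fld T L h ->
    weak_beam T rho mu w k h (cst 0) (cst 0) -> space_weak T L w k -> time_weak T L w g ->
    Q_bounded g (fun=> B0) -> Q_bounded h (fun=> eta) ->
    Q_bounded g (fun=> d) /\ Q_bounded k (fun=> d).
Proof.
move=> rho0 mu0 d0.
pose lam := 2 * 1 / rho : R; have lam0 : 0 < lam by rewrite divr_gt0// mulr_gt0.
have e0 : 0 < expR (lam * T) by exact: expR_gt0.
(* [b] bounds the final size of [g], and is so small that [k] is controlled too *)
pose b := Num.min d (mu * d * lam / 2).
have b0 : 0 < b by rewrite lt_min d0/= divr_gt0// mulr_gt0// mulr_gt0.
(* The first entry brings [g] below [b] after the iteration; the second keeps the share [eta * t] of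
   the energy below [mu * d / 2]. *)
pose eta := Num.min (b * rho / (4 * T * expR (lam * T))) (mu * d / (2 * T)).
have eta0 : 0 < eta by rewrite lt_min; apply/andP; split; rewrite divr_gt0// ?mulr_gt0// mulr_gt0.
exists eta => // w g k h B0 B00 Fw Fg Fk Fh W Ws Wt Qg Qh.
pose c := eta * T / rho.
have c0 : 0 <= c by rewrite divr_ge0 ?mulr_ge0// ltW.
have cb : 2 * c * expR (lam * T) <= b / 2.
  have : eta <= b * rho / (4 * T * expR (lam * T)) by rewrite /eta ge_min lexx.
  rewrite ler_pdivlMr ?mulr_gt0// => h1.
  rewrite (_ : 2 * c * expR (lam * T) = eta * (4 * T * expR (lam * T)) / rho / 2); last first.
    by rewrite /c; field; rewrite gt_eqF.
  by rewrite ler_pM2r ?invr_gt0// ler_pdivrMr.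
have step := small_difference_step rho0 Fw Fg Fk Fh W Ws Wt (ltW eta0) Qh.
have sqm f n t : fld T L f -> measurable_fun setT (fun x => iter 3 (avg n.+1%:R^-1) (f x) t).
  move=> [[jf _ _ _ _] _].
  exact: (jm_slice t (jm_iter_avg n.+1%:R^-1 3 jf)).
have fin f B n t : fld T L f -> 0 <= B -> Q_bounded f (fun t => B * expR (lam * t)) ->
    sqi leb (fun x => iter 3 (avg n.+1%:R^-1) (f x) t).
  move=> Ff B1 hB; have n0 : 0 < n.+1%:R^-1 :> R by rewrite invr_gt0.
  apply: sqi_le (Q_iter_avg_exp t 2 Ff B1 (ltW lam0) n0 hB); exact: sqm.
have int0 (p : R -> R) : 0 <= \int[leb]_x (p x ^+ 2).
  by apply: Rintegral_ge0 => x _; exact: sqr_ge0.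
have stepg B : 0 <= B -> Q_bounded g (fun t => B * expR (lam * t)) ->
    forall n t, 0 < t < T ->
    (Q leb (fun x => iter 3 (avg n.+1%:R^-1) (g x) t) <= ((B / 2 + c) * expR (lam * t))%:E)%E.
  move=> B1 hB n t tT; apply: Q_le_fin; first exact: (fin g B).
  have := step B B1 hB n t tT; have /andP[t0 t1] := tT.
  have e1 : 1 <= expR (lam * t) by rewrite -expR0 ler_expR mulr_ge0// ltW.
  exact: (difference_arith_g rho0 mu0 erefl (ltW eta0) (ltW t1) (int0 _) e1).
have [B [Bp Bd QB]] :=
  gronwall_final Fg B00 c0 (ltW lam0) b0 cb Qg stepg.
have bd : b <= d by rewrite /b ge_min lexx.
split; first exact: (Q_bounded_exp_cst Bp (ltW lam0) (le_trans Bd bd) QB).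
have [[jk _ lk _ _] _] := Fk.
(* This bound depends on the solution and serves only to know that the integrals of squares are
   finite. *)
have [ck ck0 hk] : exists2 ck, 0 <= ck & {ae leb, forall t, t <= T -> (Q leb (k^~ t) <= ck%:E)%E}.
  by have [[_ _ _ _ hk] _] := Fk; exact: hk.
have Qk : Q_bounded k (fun t => ck * expR (lam * t)).
  apply: (ae_imp hk) => t ht /andP[t0 tT]; apply: le_trans (ht (ltW tT)) _.
  by rewrite lee_fin ler_peMr// -expR0 ler_expR mulr_ge0// ltW.
apply: (ae_imp (@Q_of_averages _ (measurableTypeR R) R leb 2 k jk lk)) => t ht tT.
have /andP[t0 t1] := tT; apply: ht => // n; apply: Q_le_fin; first exact: (fin k ck).
have := step B Bp QB n t tT.
have et : expR (lam * t) <= expR (lam * T) by rewrite ler_expR ler_wpM2l// ltW.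
have b2 : b <= mu * d * lam / 2 by rewrite /b ge_min lexx orbT.
have eta2 : eta * (2 * T) <= mu * d.
  by rewrite -ler_pdivlMr ?mulr_gt0// /eta ge_min lexx orbT.
exact: (difference_arith_k rho0 mu0 lam0 (ltW eta0) (ltW t1) Bp et (le_trans Bd b2) eta2 (int0 _)).
Qed.

End gronwall.

(** * Test functions of one and two variables *)

Section line_derivatives.
Context {R : realType} {V : normedModType R}.

Lemma is_derive_line (phi : V -> R) (p v : V) (d : R) :
  is_derive (0 : R) 1 (fun h : R => phi (h *: v + p)) d -> is_derive p v phi d.
Proof.
have E : (fun h : R => h^-1 *: (phi (h *: v + p) - phi p)) =
    (fun h : R => h^-1 *: (((fun h : R => phi (h *: v + p)) \o shift 0) (h *: (1 : R)) -
       phi ((0 : R) *: v + p))).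
  apply/funext => h /=; rewrite scale0r add0r addr0.
  by rewrite -[h *: (1 : R)]/(h * 1) mulr1.
move=> [d1 d2]; split.
  by move: d1; rewrite /derivable -E.
by move: d2; rewrite /derive -E.
Qed.

End line_derivatives.

Section test_functions_1D.
Context {R : realType}.
Implicit Types (f g F : R -> R) (a b : R).

Lemma affine_derive f f' (v x : R) : is_derivative f f' ->
  is_derive (0 : R) 1 (fun h : R => f (h * v + x)) (v * f' x).
Proof.
move=> df; pose a h : R := h * v + x.
have d1 : is_derive (0 : R) 1 a v.
  by apply: is_derive_eq; rewrite -?[_ *: _]/(_ * _)/=; ring.
have d2 : is_derive (a 0) 1 f (f' x) by rewrite /a mul0r add0r; exact: df.
by have := @is_derive1_comp _ f a 0 _ _ d2 d1; rewrite mulrC.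
Qed.

Lemma smooth1_derive_line f f' (v : R) : is_derivative f f' -> 'D_v f = (fun x => v * f' x).
Proof.
move=> df; apply/funext => x; have [_ <-] : is_derive x v f (v * f' x); last by [].
apply: is_derive_line.
exact: affine_derive.
Qed.

Lemma smooth1_derivable f (x v : R) : smooth1 f -> derivable f x v.
Proof.
move=> /smooth1_derive[f' df _].
by have [] := is_derive_line (affine_derive v x df).
Qed.

Lemma smooth1_smooth f : smooth1 f -> smooth f.
Proof.
move=> sf w; have : smooth1 (iter_derive w f).
  elim: w => // v w IH /=; have [g dg sg] := smooth1_derive IH.
  by rewrite (smooth1_derive_line v dg); exact: smooth1Z.
by move=> s; split; [exact: smooth1_continuous|move=> p v; exact: smooth1_derivable].
Qed.

Lemma supp_tsupport a b f : supp a b f -> tsupport f `<=` `[a, b].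
Proof.
move=> sup; rewrite /tsupport (closure_id `[a, b]).1; last exact: itv_closed.
apply: closure_subset => x /= fx; rewrite in_itv/=; apply: contrapT => /negP h.
by move: fx; rewrite sup ?eqxx//; apply: contra h => /andP[/ltW -> /ltW ->].
Qed.

Lemma supp_test_function a b (D : set R) f : smooth1 f -> supp a b f -> `[a, b] `<=` D ->
  test_function D f.
Proof.
move=> sf sup abD; have h := supp_tsupport sup; split; first exact: smooth1_smooth.
- apply: (subclosed_compact _ (@segment_compact _ a b) h); exact: closed_closure.
- exact: subset_trans h abD.
Qed.

Lemma derive1n2E f f1 f2 : is_derivative f f1 -> is_derivative f1 f2 -> derive1n 2 f = f2.
Proof.
by move=> d1 d2; rewrite /derive1n/= (is_derivative_derive1 d1) (is_derivative_derive1 d2).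
Qed.

End test_functions_1D.

Section test_functions_2D.
Context {R : realType}.
Implicit Types (f g : R -> R) (phi : R * R -> R).

(** Finite sums of products: a derivative of a product in an oblique direction is a sum of two
    products, so this class, unlike the products themselves, is stable under all directional
    derivatives. *)
Inductive tens : (R * R -> R) -> Prop :=
| tens0 : tens (fun=> 0)
| tensD f g phi : smooth1 f -> smooth1 g -> tens phi ->
    tens (fun p => f p.1 * g p.2 + phi p).

Lemma is_derive_tens f f' g g' phi (p v : R * R) d : is_derivative f f' -> is_derivative g g' ->
  is_derive p v phi d ->
  is_derive p v (fun p => f p.1 * g p.2 + phi p)
    (v.1 * f' p.1 * g p.2 + (v.2 * f p.1 * g' p.2 + d)).
Proof.
move=> df dg dphi.
have h1 : is_derive p v (fun p => f p.1 * g p.2) (v.1 * f' p.1 * g p.2 + v.2 * f p.1 * g' p.2).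
  apply: is_derive_line.
  have d1 := affine_derive v.1 p.1 df; have d2 := affine_derive v.2 p.2 dg.
  have d3 := is_deriveM d1 d2.
  rewrite (_ : v.1 * f' p.1 * g p.2 + v.2 * f p.1 * g' p.2 =
    f (0 * v.1 + p.1) *: (v.2 * g' p.2) + g (0 * v.2 + p.2) *: (v.1 * f' p.1)); first exact: d3.
  by rewrite !mul0r !add0r; rewrite -?[_ *: _]/(_ * _)/=; ring.
by rewrite addrA; exact: is_deriveD.
Qed.

Lemma tens_derive phi (v : R * R) : tens phi -> tens ('D_v phi) /\
  forall p, derivable phi p v.
Proof.
move=> tphi; elim: tphi v => {phi} [|f g phi sf sg tphi IH] v.
  have d0 (p : R * R) : is_derive p v (fun=> (0 : R)) 0 by exact: is_derive_cst.
  split; last by move=> p; have [] := d0 p.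
  rewrite (_ : 'D_v _ = fun=> 0); first exact: tens0.
  by apply/funext => p; have [] := d0 p.
have [f' df sf'] := smooth1_derive sf; have [g' dg sg'] := smooth1_derive sg.
have [tD hD] := IH v.
have d1 (p : R * R) := is_derive_tens df dg (derivableP (hD p)).
split; last by move=> p; have [] := d1 p.
rewrite (_ : 'D_v _ = fun p => (v.1 * f' p.1) * g p.2 + ((v.2 * f p.1) * g' p.2 + 'D_v phi p)).
  apply: (@tensD (fun x => v.1 * f' x)) => //; first exact: smooth1Z.
  by apply: (@tensD (fun x => v.2 * f x)) => //; exact: smooth1Z.
by apply/funext => p; have [] := d1 p.
Qed.

Lemma tens_continuous phi : tens phi -> continuous phi.
Proof.
elim=> {phi} [|f g phi sf sg _ IH] p; first exact: cvg_cst.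
apply: cvgD; last exact: IH.
apply: cvgM.
- apply: (@continuous_comp _ _ _ fst f); first exact: cvg_fst.
  exact: smooth1_continuous.
- apply: (@continuous_comp _ _ _ snd g); first exact: cvg_snd.
  exact: smooth1_continuous.
Qed.

Lemma tens_smooth phi : tens phi -> smooth phi.
Proof.
move=> tphi w; have t : tens (iter_derive w phi).
  by elim: w => // v w IH /=; have [] := tens_derive v IH.
split; first exact: tens_continuous.
by move=> p v; have [] := tens_derive v t.
Qed.

Definition tensor f g (p : R * R) := f p.1 * g p.2.

Lemma tensor_tens f g : smooth1 f -> smooth1 g -> tens (tensor f g).
Proof.
move=> sf sg; rewrite (_ : tensor f g = fun p => f p.1 * g p.2 + 0).
  by apply: tensD => //; exact: tens0.
by apply/funext => p; rewrite addr0.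
Qed.

Lemma derive_tensor f f' g g' (v : R * R) : is_derivative f f' -> is_derivative g g' ->
  'D_v (tensor f g) = (fun p => v.1 * f' p.1 * g p.2 + v.2 * f p.1 * g' p.2).
Proof.
move=> df dg; apply/funext => p.
have d0 : is_derive p v (fun=> (0 : R)) 0 by exact: is_derive_cst.
have [_] := is_derive_tens df dg d0; rewrite addr0 => <-.
by congr ('D_v _ p); apply/funext => q; rewrite addr0.
Qed.

Lemma derive_t_tensor f f' g g' : is_derivative f f' -> is_derivative g g' ->
  'D_e_t (tensor f g) = tensor f' g.
Proof.
move=> df dg; rewrite (derive_tensor _ df dg); apply/funext => p.
by rewrite /= mul1r !mul0r addr0.
Qed.

Lemma derive_x_tensor f f' g g' : is_derivative f f' -> is_derivative g g' ->
  'D_e_x (tensor f g) = tensor f g'.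
Proof.
move=> df dg; rewrite (derive_tensor _ df dg); apply/funext => p.
by rewrite /= mul1r !mul0r add0r.
Qed.

Lemma closed_box (a b a' b' : R) : closed (`[a, b] `*` `[a', b'] : set (R * R)).
Proof.
rewrite (_ : _ `*` _ = fst @^-1` `[a, b] `&` snd @^-1` `[a', b']); last by [].
apply: closedI; apply: preimage_closed; try exact: itv_closed.
- by move=> p _; exact: cvg_fst.
- by move=> p _; exact: cvg_snd.
Qed.

Lemma tensor_test_function (a b a' b' : R) (D : set (R * R)) f g : smooth1 f -> smooth1 g ->
  supp a b f -> supp a' b' g -> `[a, b] `*` `[a', b'] `<=` D ->
  test_function D (tensor f g).
Proof.
move=> sf sg supf supg boxD.
have h : tsupport (tensor f g) `<=` `[a, b] `*` `[a', b'].
  rewrite /tsupport (closure_id (`[a, b] `*` `[a', b'])).1; last first.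
    exact: closed_box.
  apply: closure_subset => p /=; rewrite /tensor mulf_eq0 negb_or => /andP[fp gp].
  split; rewrite /= in_itv/=; apply: contrapT => /negP h.
    by move: fp; rewrite supf ?eqxx//; apply: contra h => /andP[/ltW -> /ltW ->].
  by move: gp; rewrite supg ?eqxx//; apply: contra h => /andP[/ltW -> /ltW ->].
split; first by apply: tens_smooth; exact: tensor_tens.
- apply: (subclosed_compact _ _ h); first exact: closed_closure.
  by apply: compact_setX; exact: segment_compact.
- exact: subset_trans h boxD.
Qed.

End test_functions_2D.

(** * Lebesgue norms in terms of integrals of squares *)

Section norms.
Context {R : realType}.
Local Notation leb := (@lebesgue_measure R).
Implicit Types (L C : R) (g : R -> R) (F : R * R -> R).

Lemma Lnorm2E g : ('N[leb]_2%:E[EFin \o g] = sqrte (Q leb g))%E.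
Proof.
have E : (\int[leb]_x (`|(EFin \o g) x| `^ 2) = Q leb g)%E.
  apply: eq_integral => x _; rewrite [X in (X `^ _)%E]/= poweR_EFin powR_mulrn//.
  by rewrite real_normK// num_real.
by rewrite unlock E poweR12_sqrt// Q_ge0.
Qed.

Lemma sqrte_le (x : \bar R) C : 0 <= C -> (0 <= x)%E ->
  (sqrte x <= C%:E)%E = (x <= (C ^+ 2)%:E)%E.
Proof.
move=> C0; case: x => [r| |]//=; rewrite ?lee_fin => r0.
by rewrite -[leRHS]ger0_norm// -sqrtr_sqr ler_sqrt// sqr_ge0.
Qed.

Lemma Lnorm2_le g C : 0 <= C ->
  ('N[leb]_2%:E[EFin \o g] <= C%:E)%E = (Q leb g <= (C ^+ 2)%:E)%E.
Proof. by move=> C0; rewrite Lnorm2E sqrte_le// Q_ge0. Qed.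

Lemma L2norm_sqr L g : sqi leb (g \_ `]0, L[) -> Q leb (g \_ `]0, L[) = (L2norm L g ^+ 2)%:E.
Proof.
move=> sg; rewrite /L2norm Lnorm2E (sqi_Q sg)/= sqr_sqrtr//.
by apply: Rintegral_ge0 => x _; exact: sqr_ge0.
Qed.

Lemma L2_sqi L g : L2 L g -> sqi leb (g \_ `]0, L[).
Proof.
rewrite /L2/= => /andP[mg fg]; split; first by move: mg; rewrite inE.
move: fg; rewrite inE /= /finite_norm Lnorm2E; case: (Q leb _) (Q_ge0 leb (g \_ `]0, L[)) => //.
by move=> r _ _; exact: ltry.
Qed.

(** The infinite norm is an essential supremum only on a space of positive measure, here witnessed
    by the unit interval. *)
Lemma Lnorm_pinfty (f : R -> \bar R) : Lnorm leb +oo%E f = ess_sup leb (abse \o f).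
Proof.
rewrite unlock ifT//; apply: (@lt_le_trans _ _ (leb `[0%R, 1%R])).
  by rewrite /= lebesgue_measure_itv/= lte_fin ltr01 -EFinD lte_fin subr0.
by apply: le_measure; rewrite ?inE.
Qed.

Lemma LooL2norm_le (J' : set R) L F C : 0 <= C ->
  (LooL2norm J' L F <= C%:E)%E <->
  {ae leb, forall t, J' t -> (Q leb ((fun x => F (t, x)) \_ `]0%R, L[) <= (C ^+ 2)%:E)%E}.
Proof.
move=> C0; rewrite /LooL2norm Lnorm_pinfty.
split.
  move=> /ess_supP h; apply: (ae_imp h) => t; move=> + Jt; rewrite /= patchE mem_set// gee0_abs ?Lnorm_ge0//.
  by rewrite Lnorm2_le.
move=> h; apply/ess_supP; apply: (ae_imp h) => t ht; rewrite /= patchE.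
case: ifPn => [|_]; last by rewrite abse0 lee_fin.
by rewrite inE => /ht; rewrite gee0_abs ?Lnorm_ge0// Lnorm2_le.
Qed.

End norms.

(** * Fields cut off to a bounded time interval *)

Section cut_fields.
Context {R : realType}.
Variables T L : R.
Hypotheses (T0 : 0 < T) (L0 : 0 < L).
Local Notation leb := (@lebesgue_measure R).
Local Notation leb2 := (leb \x leb)%E.
Implicit Types (f g h : R -> R -> R) (F G : R * R -> R) (th psi : R -> R) (t x c : R).

Definition cutoff F x t := if (0 < t < T) && (0 < x < L) then F (t, x) else 0.

(** Exceptional points independent of time, so that both functions have the same square norm in
    space at each time ([repr_Q]). *)
Definition represents f F := {ae leb, forall x, forall t, f x t = cutoff F x t}.

Lemma measurable_cylinder : measurable (cylinder L).
Proof. by apply: measurableX. Qed.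

Lemma jm_cut F : measurable_fun (cylinder L) F -> jm (cutoff F).
Proof.
move=> mF; pose B : set (R * R) := `]0, T[ `*` `]0, L[.
have mB : measurable B by apply: measurableX.
have : measurable_fun B F.
  apply: (measurable_funS measurable_cylinder _ mF) => p [/=]; rewrite !in_itv/= => /andP[p1 _] ?.
  by split; rewrite //= in_itv/= p1.
move=> /(measurable_restrictT F mB).1; apply: eq_measurable_fun => p _.
rewrite patchE /cutoff; case: p => t x; case: ifPn.
  by rewrite inE => -[/=]; rewrite !in_itv/= => -> ->.
by case: ifPn => // /andP[h1 h2] /negP[]; rewrite inE; split; rewrite /= in_itv/=.
Qed.

Lemma cut_vanish F t : vanish L ((cutoff F)^~ t).
Proof. by move=> x /negbTE xL; rewrite /cutoff xL andbF. Qed.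

Lemma cut_out F x t : ~~ (0 < t < T) -> cutoff F x t = 0.
Proof. by move=> /negbTE h; rewrite /cutoff h. Qed.

Lemma cut_patch F t : 0 < t < T -> (cutoff F)^~ t = (fun x => F (t, x)) \_ `]0, L[.
Proof.
by move=> tT; apply/funext => x; rewrite patchE mem_setE in_itv/= /cutoff tT.
Qed.

Lemma cut_rint F c : measurable_fun (cylinder L) F -> 0 <= c ->
  Q_bounded T (cutoff F) (fun=> c) -> rint leb2 setT (fun p => cutoff F p.2 p.1).
Proof.
move=> mF c0 hc; have jF := jm_cut mF.
have h : {ae leb, forall t, 0 <= t <= T -> (Q leb ((cutoff F)^~ t) <= c%:E)%E}.
  apply: (ae_imp hc) => t ht _; have [/ht//|tT] := boolP (0 < t < T).
  by rewrite Q_zero ?lee_fin// => x; exact: cut_out.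
have := bounded_Q_rint L0 jF (cut_vanish F) c0 h; apply: eq_rint => // -[t x] _ /=.
rewrite patchE mem_setE in_itv/=; case: ifPn => // tT; rewrite cut_out//.
by apply: contra tT => /andP[/ltW -> /ltW ->].
Qed.

Lemma repr_Q f F t : jm f -> jm (cutoff F) -> represents f F -> Q leb (f^~ t) = Q leb ((cutoff F)^~ t).
Proof.
move=> jf jF fF; apply: ae_eq_integral => //.
- by apply/measurable_EFinP; apply: measurable_funX; exact: (jm_slice t jf).
- by apply/measurable_EFinP; apply: measurable_funX; exact: (jm_slice t jF).
by apply: (ae_imp fF) => x hx _; rewrite hx.
Qed.

(** By Fubini, almost every point has an integrable line in time; setting the field to 0 at the
    other points gives the integrability at every point that [field] demands. *)
Lemma fld_of F c : measurable_fun (cylinder L) F -> 0 <= c ->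
  Q_bounded T (cutoff F) (fun=> c) -> exists f, fld T L f /\ represents f F.
Proof.
move=> mF c0 hc; have jF := jm_cut mF; have Fi := cut_rint mF c0 hc.
pose G (p : measurableTypeR R * measurableTypeR R) := cutoff F p.2 p.1.
have mG : measurable_fun setT G by exact: jF.
pose g x := (\int[leb]_t `|(G (t, x))%:E|)%E.
have mg : measurable_fun setT g.
  apply: (measurable_fun_fubini_tonelli_G (m1 := leb) (fun p => `|(G p)%:E|)%E) => //.
  by apply: measurableT_comp => //; exact/measurable_EFinP.
pose D := [set x : measurableTypeR R | (g x < +oo)%E].
have mD : measurable D.
  rewrite (_ : D = setT `&` g @^-1` `]-oo, (+oo)%E[%classic); last first.
    by apply/seteqP; split => x; rewrite /D/= in_itv/=; [move=> -> //|case].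
  by apply: mg => //; exact: emeasurable_itv.
pose f x t := \1_D x * cutoff F x t.
have fE x t : f x t = if x \in D then cutoff F x t else 0.
  by rewrite /f indicE; case: (x \in D); rewrite ?mul1r ?mul0r.
have jf : jm f.
  apply: measurable_funM; last exact: jF.
  have m1 : measurable_fun setT (\1_D : measurableTypeR R -> R) by exact: measurable_indic.
  have m2 := measurableT_comp m1 (@measurable_snd _ _ (measurableTypeR R) (measurableTypeR R)).
  exact: m2.
have fF : represents f F.
  have h := ae_integrable2 Fi; apply: (ae_imp h) => x hx t; rewrite fE ifT//.
  by rewrite inE /D /= /g; case/integrableP : hx.
exists f; split => //; split; last first.
  by move=> x t Tt; rewrite fE cut_out ?if_same// negb_and -!leNgt Tt orbT.
split => //.
- by move=> t x xL; rewrite fE (cut_vanish F t xL) if_same.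
- move=> x M; suff h : rint leb setT (f x) by exact: (rintS measurableT _ _ h).
  case: (boolP (x \in D)) => xD; last first.
    rewrite (_ : f x = cst 0); last by apply/funext => t; rewrite fE (negbTE xD).
    rewrite /rint; exact: integrable0.
  rewrite (_ : f x = cutoff F x); last by apply/funext => t; rewrite fE xD.
  apply/integrableP; split; last by move: xD; rewrite inE.
  by apply/measurable_EFinP; exact: (jm_line x jF).
- by move=> x t t0; rewrite fE cut_out ?if_same// negb_and -!leNgt t0.
move=> M; exists c => //; apply: (ae_imp hc) => t ht _; rewrite (repr_Q t jf jF fF).
have [/ht//|tT] := boolP (0 < t < T).
by rewrite Q_zero ?lee_fin// => x; exact: cut_out.
Qed.

Definition tint f psi th := \int[leb]_t (pair f psi t * th t).

Lemma pair_mul_rint f psi th : fld T L f -> continuous psi -> continuous th ->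
  rint leb setT (fun t => pair f psi t * th t).
Proof.
move=> Ff cpsi cth; have [B B0 hB] := continuous_itv_bounded 0 T cth.
have pi := pair_rint L0 Ff cpsi.
have hi : rint leb setT (fun t => B * `|pair f psi t|) by apply: rintZ => //; exact: rint_abs.
apply: (rint_dom _ _ _ hi) => //.
- apply: measurable_funM; first exact: rint_measurable pi.
  exact: continuous_measurable_fun.
- move=> t _; rewrite normrM mulrC.
  have [tT|tT] := boolP (0 < t < T); last by rewrite (pair_out _ Ff tT) normr0 !mulr0.
  by rewrite ler_wpM2r// hB//; move/andP: tT => [/ltW -> /ltW ->].
Qed.

Lemma repr_ae2 f F : represents f F ->
  {ae leb2, forall p, f p.2 p.1 = cutoff F p.2 p.1}.
Proof.
move=> [N [mN N0 h]]; exists (setT `*` N); split.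
- exact: measurableX.
- by rewrite product_measure1E//; move: N0 => /= ->; rewrite mule0.
move=> [t x] /= hp; split => //; apply: h => /= hx; exact: hp.
Qed.

Lemma cyl_tensor f F psi th : measurable_fun (cylinder L) F -> fld T L f -> represents f F ->
  continuous psi -> continuous th -> (forall t, T <= t -> th t = 0) ->
  rint leb2 (cylinder L) (fun p => F p * tensor th psi p) /\
  \int[leb2]_(p in cylinder L) (F p * tensor th psi p) = tint f psi th.
Proof.
move=> mF Ff fF cpsi cth hth; have jF := jm_cut mF.
have mC := measurable_cylinder.
have Fi := fld_prod L0 Ff cpsi cth.
have E : (fun p => F p * tensor th psi p) \_ (cylinder L) =
    (fun p => cutoff F p.2 p.1 * (th p.1 * psi p.2)).
  apply/funext => -[t x]; rewrite patchE /tensor /cutoff /=; case: ifPn.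
    rewrite inE => -[/=]; rewrite !in_itv/= andbT => t0 xL; rewrite t0 xL andbT.
    by case: ltP => //= tT; rewrite hth// !mul0r mulr0.
  case: ifPn; last by rewrite mul0r.
  by move=> /andP[/andP[t0 _] xL] /negP[]; rewrite inE; split; rewrite /= in_itv/= ?t0.
have mth : measurable_fun setT (fun p : R * R => th p.1 * psi p.2).
  by apply: measurable_funM; apply: measurableT_comp => //; exact: continuous_measurable_fun.
have mc : measurable_fun setT (fun p : measurableTypeR R * measurableTypeR R => cutoff F p.2 p.1 * (th p.1 * psi p.2)).
  by apply: measurable_funM; [exact: jF|exact: mth].
have ae2 := repr_ae2 fF.
have ci : rint leb2 setT (fun p => cutoff F p.2 p.1 * (th p.1 * psi p.2)).
  apply: (ae_eq_rint measurableT mc _ Fi).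
  by case: ae2 => N [mN N0 h]; exists N; split => // p /= hp; apply: h => /= hh; apply: hp => _; rewrite hh.
split; first by apply: rint_unpatch => //; rewrite E.
rewrite Rintegral_mkcond E /tint -(fld_Rintegral L0 Ff cpsi cth).
apply: ae_eq_Rintegral => //.
- exact: rint_measurable Fi.
by case: ae2 => N [mN N0 h]; exists N; split => // p /= hp; apply: h => /= hh; apply: hp => _; rewrite hh.
Qed.

End cut_fields.

(** * Measurability and integrability for compactly supported tests *)

Section compact_tests.
Context {R : realType}.
Variable L : R.
Hypothesis L0 : 0 < L.
Local Notation leb := (@lebesgue_measure R).
Local Notation leb2 := (leb \x leb)%E.
Implicit Types (F G phi : R * R -> R) (w : seq (R * R)).

Lemma measurable_box (a b a' b' : R) : measurable (`[a, b] `*` `[a', b'] : set (R * R)).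
Proof. by apply: measurableX. Qed.

Lemma compact_box (a b a' b' : R) : compact (`[a, b] `*` `[a', b'] : set (R * R)).
Proof. by apply: compact_setX; exact: segment_compact. Qed.

Lemma measurable_truncn_cell n k :
  measurable ([set t | Num.truncn (n.+1%:R * t) = k] : set R).
Proof.
rewrite (_ : [set t | _] = (fun t => n.+1%:R * t) @^-1` [set t : R | Num.truncn t = k]); last by [].
rewrite -[X in measurable X]setTI; apply: (measurable_funM (@measurable_cst _ _ R R setT n.+1%:R) (@measurable_id _ R setT)) => //.
case: k => [|k].
  rewrite (_ : [set t | _] = `]-oo, 1[%classic)//.
  apply/seteqP; split => t /=; rewrite in_itv/= -[1]/(0.+1%:R) -truncn_le_nat leqn0.
    by move=> ->.
  by move=> /eqP.
rewrite (_ : [set t | _] = `[k.+1%:R, k.+2%:R[%classic)//.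
apply/seteqP; split => t /=; rewrite in_itv/= leNgt -!truncn_le_nat -ltnNge.
  by move=> ->; rewrite ltnSn /=.
by move=> h; apply/eqP; rewrite eqn_leq andbC.
Qed.

(* Freezing the first variable at [k / n] turns a continuous function into a
   countable union of measurable pieces. *)
Lemma continuous_measurable_cylinder (g : R * R -> R) : continuous g ->
  measurable_fun (cylinder L) g.
Proof.
move=> cg; have mC := measurable_cylinder L.
pose gn n (p : R * R) := g ((Num.truncn (n.+1%:R * p.1))%:R / n.+1%:R, p.2).
apply: (@measurable_fun_cvg _ _ _ _ gn).
  move=> n; apply: measurable_funTS => _ B mB; rewrite setTI.
  rewrite (_ : gn n @^-1` B = \bigcup_k ([set t | Num.truncn (n.+1%:R * t) = k] `*`
      ((fun x => g (k%:R / n.+1%:R, x)) @^-1` B))); last first.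
    apply/seteqP; split => [[t x] /= h|[t x] [k _ [/= <-]]//].
    by exists (Num.truncn (n.+1%:R * t)).
  apply: bigcupT_measurable => k; apply: measurableX.
    exact: measurable_truncn_cell.
  have cx : continuous (fun x => g (k%:R / n.+1%:R, x)).
    pose q (y : R) : R * R := (k%:R / n.+1%:R, y).
    move=> x; have h : q y @[y --> x] --> q x.
      apply: (@cvg_pair _ _ _ _ (nbhs (k%:R / n.+1%:R : R)) (nbhs x)) => //; exact: cvg_cst.
    exact: (cvg_comp _ _ h (cg (q x))).
  by rewrite -[X in measurable X]setTI; apply: (continuous_measurable_fun cx).
move=> [t x] [/=]; rewrite in_itv/= andbT => t0 _.
suff h : (Num.truncn (n.+1%:R * t))%:R / n.+1%:R @[n --> \oo] --> t.
  have h2 : ((Num.truncn (n.+1%:R * t))%:R / n.+1%:R, x) @[n --> \oo] --> (t, x).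
    by apply: (@cvg_pair _ _ _ _ (nbhs t) (nbhs x)) => //; exact: cvg_cst.
  exact: (cvg_comp _ _ h2 (cg (t, x))).
apply/cvgrPdist_lt => e e0; near=> n.
have n0 : 0 < n.+1%:R :> R by [].
have nt : 0 <= n.+1%:R * t by rewrite mulr_ge0// ltW.
have /andP[h1 h2] := truncn_itv nt; set m := Num.truncn _ in h1 h2 *.
have ne : n.+1%:R^-1 < e.
  by near: n; exact: (near_infty_natSinv_lt (PosNum e0)).
have h3 : m%:R / n.+1%:R <= t by rewrite ler_pdivrMr// mulrC.
have h4 : t < m%:R / n.+1%:R + n.+1%:R^-1.
  by rewrite -[X in _ + X]mul1r -mulrDl ltr_pdivlMr// mulrC natr1.
by rewrite ger0_norm ?subr_ge0// ltrBlDl (lt_trans h4)// ltrD2l.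
Unshelve. all: by end_near. Qed.

Lemma truncn_cell_dist n (s t : R) : 0 <= s -> 0 <= t ->
  Num.truncn (n.+1%:R * s) = Num.truncn (n.+1%:R * t) -> `|s - t| <= n.+1%:R^-1.
Proof.
move=> s0 t0 E; have n0 : 0 < n.+1%:R :> R by [].
have ns : 0 <= n.+1%:R * s by rewrite mulr_ge0.
have nt : 0 <= n.+1%:R * t by rewrite mulr_ge0.
have /andP[h1 h2] := truncn_itv ns; have /andP[h3 h4] := truncn_itv nt.
rewrite E in h1 h2; set m := Num.truncn _ in h1 h2 h3 h4; rewrite -(natr1 m) in h2 h4.
rewrite -(ler_pM2l n0) mulfV ?gt_eqF// -{1}(ger0_norm (ltW n0)) -normrM mulrBr ler_norml.
by apply/andP; split; lra.
Qed.

(** Measurability refers to the product of the two sigma-algebras: within the cylinder, [K] is the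
    intersection over [n] of the unions of those grid cells of side 1 / (n + 1) that meet it. *)
Lemma closed_cylinder_measurable (K : set (R * R)) : closed K -> K `<=` cylinder L ->
  measurable K.
Proof.
move=> clK KL; have mC := measurable_cylinder L.
pose cell n i j : set (R * R) := [set t | Num.truncn (n.+1%:R * t) = i] `*`
  [set x | Num.truncn (n.+1%:R * x) = j].
pose U n := \bigcup_i \bigcup_j [set p | cell n i j p /\ (cell n i j `&` K) !=set0].
have mU n : measurable (U n).
  apply: bigcupT_measurable => i; apply: bigcupT_measurable => j.
  have [h|h] := pselect ((cell n i j `&` K) !=set0).
    rewrite (_ : [set p | _] = cell n i j); last by apply/seteqP; split => [p []|p hp].
    by apply: measurableX; exact: measurable_truncn_cell.
  by rewrite (_ : [set p | _] = set0)//; apply/seteqP; split => [p [_ /h]|p []].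
rewrite (_ : K = cylinder L `&` \bigcap_n U n).
  by apply: measurableI => //; apply: bigcapT_measurable.
apply/seteqP; split => p.
  move=> Kp; split; first exact: KL.
  move=> n _; exists (Num.truncn (n.+1%:R * p.1)) => //; exists (Num.truncn (n.+1%:R * p.2)) => //.
  by split => //; exists p.
move=> [pL hp]; rewrite (closure_id K).1// => V [[V1 V2] [/= hV1 hV2] hV].
have /nbhs_ballP[e1 /= e10 b1] := hV1; have /nbhs_ballP[e2 /= e20 b2] := hV2.
have m0 : 0 < Num.min e1 e2 by rewrite lt_min e10.
have [n hn] : exists n, n.+1%:R^-1 < Num.min e1 e2.
  exists (Num.truncn (Num.min e1 e2)^-1).
  by rewrite -[X in _ < X]invrK ltf_pV2 ?posrE ?invr_gt0// truncnS_gt.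
move: hn; rewrite lt_min => /andP[n1 n2].
have [i _ [j _ [[c1 c2] [q [[d1 d2] Kq]]]]] := hp n I.
have [q1 q2] := KL q Kq; move: q1 q2 pL => /=; rewrite /cylinder /= !in_itv/= !andbT.
move=> q1 /andP[q2 _] [p1 /andP[p2 _]].
exists q; split => //; apply: hV; split => /=.
  apply: b1; rewrite /ball/=; apply: le_lt_trans n1.
  by apply: truncn_cell_dist; [exact: ltW|exact: ltW|exact: etrans c1 (esym d1)].
apply: b2; rewrite /ball/=; apply: le_lt_trans n2.
by apply: truncn_cell_dist; [exact: ltW|exact: ltW|exact: etrans c2 (esym d2)].
Qed.

Lemma compact_cylinder_box (K : set (R * R)) : compact K -> K `<=` cylinder L ->
  exists a b a' b' : R, [/\ 0 < a, 0 < a', b' < L & K `<=` `[a, b] `*` `[a', b']].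
Proof.
move=> cK KL; have [->|/set0P K0] := eqVneq K set0.
  by exists 1, 1, (L / 2), (L / 2); split => //; [rewrite divr_gt0|rewrite ltr_pdivrMr// ltr_pMr ?ltr1n].
have cfst : {within K, continuous (fst : R * R -> R)}.
  by apply: continuous_subspaceT => p; exact: cvg_fst.
have csnd : {within K, continuous (snd : R * R -> R)}.
  by apply: continuous_subspaceT => p; exact: cvg_snd.
have [p1 /set_mem/KL K1 h1] := compact_EVT_min K0 cK cfst.
have [p2 /set_mem/KL K2 h2] := compact_EVT_max K0 cK cfst.
have [p3 /set_mem/KL K3 h3] := compact_EVT_min K0 cK csnd.
have [p4 /set_mem/KL K4 h4] := compact_EVT_max K0 cK csnd.
exists p1.1, p2.1, p3.2, p4.2; split.
- by case: K1 => /=; rewrite in_itv/= andbT.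
- by case: K3 => _ /=; rewrite in_itv/= => /andP[].
- by case: K4 => _ /=; rewrite in_itv/= => /andP[].
by move=> q /mem_set Kq; split; rewrite /= in_itv/= ?h1 ?h2 ?h3 ?h4.
Qed.

Lemma iter_derive_out w phi (p : R * R) : ~ tsupport phi p -> iter_derive w phi p = 0.
Proof.
elim: w p => [|v w IH] p hp /=.
  by apply: contrapT => /eqP h; apply: hp; exact: subset_closure.
rewrite (@near_eq_derive _ _ _ _ (fun=> 0)); last first.
  have : open (~` tsupport phi) by rewrite openC; exact: closed_closure.
  by rewrite openE => /(_ p hp); apply: filterS => q hq; exact: IH.
by have [] : is_derive p v (fun=> (0 : R)) 0 by exact: is_derive_cst.
Qed.

(** The support sits in a closed box inside the cylinder; there [F] is integrable and the
    derivatives are bounded. *)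
Lemma test_rint w F phi : locally_integrable2 (cylinder L) F -> test_function (cylinder L) phi ->
  rint leb2 (cylinder L) (fun p => F p * iter_derive w phi p).
Proof.
move=> [mF iF] [sphi cphi pL].
have [a [b [a' [b' [a0 a'0 b'L KB]]]]] := compact_cylinder_box cphi pL.
pose B : set (R * R) := `[a, b] `*` `[a', b'].
have BL : B `<=` cylinder L.
  move=> p [/=]; rewrite !in_itv/= => /andP[h1 _] /andP[h3 h4].
  by split; rewrite /= in_itv/= ?(lt_le_trans a0 h1)// (lt_le_trans a'0 h3) (le_lt_trans h4).
have [cw _] := sphi w.
have FB : rint leb2 B F := iF _ (@compact_box a b a' b') BL.
have cB := @compact_box a b a' b'.
have [C hC] : exists C, forall p, B p -> `|iter_derive w phi p| <= C.
  have [B0|/set0P B0] := eqVneq B set0.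
    by exists 0 => p; rewrite B0.
  have cn : {within B, continuous (fun p => `|iter_derive w phi p|)}.
    apply: continuous_subspaceT => p; apply: (@continuous_comp _ _ _ (iter_derive w phi) (fun z => `|z|)).
      exact: cw.
    exact: norm_continuous.
  have [q _ hq] := compact_EVT_max B0 cB cn.
  by exists `|iter_derive w phi q| => p /mem_set; exact: hq.
have mB : measurable B by exact: measurable_box.
have mC := measurable_cylinder L.
have BI : rint leb2 B (fun p => F p * iter_derive w phi p).
  have hi : rint leb2 B (fun p => C * `|F p|) by apply: rintZ => //; exact: rint_abs.
  apply: (rint_dom _ _ _ hi) => //.
    apply: measurable_funM; first exact: (measurable_funS mC BL mF).
    exact: (measurable_funS mC BL (continuous_measurable_cylinder cw)).
  by move=> p Bp; rewrite normrM mulrC ler_wpM2r// hC.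
have mB' : measurable (B : set (measurableTypeR R * measurableTypeR R)) by exact: mB.
apply: rint_unpatch => //; have := rint_patch mB' BI; apply: eq_rint => // p _.
rewrite !patchE; case: ifPn => pB; first by rewrite mem_set//; apply: BL; exact: set_mem.
case: ifPn => // _; rewrite iter_derive_out ?mulr0// => /KB h; move: pB; by rewrite mem_set.
Qed.

End compact_tests.

(** * Linear operations on fields, and the beam equation against tensor tests *)

Section solution_fields.
Context {R : realType}.
Variables T L : R.
Hypotheses (T0 : 0 < T) (L0 : 0 < L).
Local Notation leb := (@lebesgue_measure R).
Local Notation leb2 := (leb \x leb)%E.
Implicit Types (f g h k u w : R -> R -> R) (F G : R * R -> R) (th psi : R -> R) (t x c : R).

Lemma fld_lin f g (a b : R) : fld T L f -> fld T L g ->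
  fld T L (fun x t => a * f x t + b * g x t).
Proof.
move=> [[jf vf lf cf hf] fT] [[jg vg lg cg hg] gT]; split; last first.
  by move=> x t tT; rewrite fT// gT// !mulr0 addr0.
split.
- by rewrite /jm; apply: measurable_funD; apply: measurable_funM.
- by move=> t x xL; rewrite (vf t x xL) (vg t x xL) !mulr0 addr0.
- by move=> x; apply: locintD; exact: locintZ.
- by move=> x t t0; rewrite cf// cg// !mulr0 addr0.
move=> M; have [c c0 hc] := hf M; have [d d0 hd] := hg M.
exists (2 * a ^+ 2 * c + 2 * b ^+ 2 * d).
  by rewrite addr_ge0// mulr_ge0// mulr_ge0// sqr_ge0.
apply: (ae_imp2 hc hd) => t h1 h2 tM; apply: Q_lin_le.
- exact: (jm_slice t jf).
- exact: (jm_slice t jg).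
- exact: h1.
- exact: h2.
Qed.

Lemma tint_lin f g (a b : R) psi th : fld T L f -> fld T L g ->
  continuous psi -> continuous th ->
  tint (fun x t => a * f x t + b * g x t) psi th = a * tint f psi th + b * tint g psi th.
Proof.
move=> Ff Fg cpsi cth; rewrite /tint.
rewrite -(fld_Rintegral L0 (fld_lin a b Ff Fg) cpsi cth).
rewrite -(fld_Rintegral L0 Ff cpsi cth) -(fld_Rintegral L0 Fg cpsi cth).
rewrite -(Rintegral_lin a b measurableT (fld_prod L0 Ff cpsi cth) (fld_prod L0 Fg cpsi cth)).
by apply: eq_Rintegral => p _; ring.
Qed.

(** The identity of [weak_beam] with the constants outside the pairings, a form in which two
    solutions can be subtracted. *)
Definition beam_eq (rho mu : R) u k h (u0 u1 : R -> R) :=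
  forall (th th1 th2 psi psi1 psi2 : R -> R) (B : R),
  is_derivative th th1 -> is_derivative th1 th2 -> smooth1 th -> supp (-3) T th ->
  is_derivative psi psi1 -> is_derivative psi1 psi2 -> smooth1 psi -> supp (-3) B psi ->
  rho * tint u psi th2 + (mu * tint k psi2 th + tint h psi th)
  - rho * (\int[leb]_x (u1 x * psi x)) * th 0
  + rho * (\int[leb]_x (u0 x * psi x)) * th1 0 = 0.

Lemma beam_eq_weak (rho mu : R) u k h (u0 u1 : R -> R) : fld T L u -> fld T L k -> fld T L h ->
  beam_eq rho mu u k h u0 u1 -> weak_beam T rho mu u k h u0 u1.
Proof.
move=> Fu Fk Fh W th th1 th2 psi psi1 psi2 B d1 d2 sth supth d3 d4 spsi suppsi.
have cth := smooth1_continuous sth; have cpsi := smooth1_continuous spsi.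
have cth2 := smooth1_continuous (smooth1_derivative d2 (smooth1_derivative d1 sth)).
have cpsi2 := smooth1_continuous (smooth1_derivative d4 (smooth1_derivative d3 spsi)).
rewrite -[RHS](W th th1 th2 psi psi1 psi2 B d1 d2 sth supth d3 d4 spsi suppsi).
have iu := pair_mul_rint L0 Fu cpsi cth2.
have ik := pair_mul_rint L0 Fk cpsi2 cth; have ih := pair_mul_rint L0 Fh cpsi cth.
have E1 : \int[leb]_t (rho * pair u psi t * th2 t) = rho * tint u psi th2.
  by rewrite /tint -(RintegralZl rho measurableT iu); apply: eq_Rintegral => t _; rewrite mulrA.
have E2 : \int[leb]_t ((mu * pair k psi2 t + pair h psi t) * th t) =
    mu * tint k psi2 th + tint h psi th.
  rewrite -[X in _ + X]mul1r /tint -(Rintegral_lin mu 1 measurableT ik ih).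
  by apply: eq_Rintegral => t _; ring.
by rewrite E1 E2.
Qed.

Lemma beam_eq_sub_arith (rho mu a a' b b' c c' p q s t : R) :
  rho * a + (mu * b + c) - p + q = 0 -> rho * a' + (mu * b' + c') - p + q = 0 ->
  rho * (1 * a + (-1) * a') + (mu * (1 * b + (-1) * b') + (1 * c + (-1) * c'))
    - rho * 0 * s + rho * 0 * t = 0.
Proof. by move=> e1 e2; lra. Qed.

Lemma beam_eq_sub (rho mu : R) u k h u' k' h' (u0 u1 : R -> R) :
  fld T L u -> fld T L k -> fld T L h -> fld T L u' -> fld T L k' -> fld T L h' ->
  beam_eq rho mu u k h u0 u1 -> beam_eq rho mu u' k' h' u0 u1 ->
  beam_eq rho mu (fun x t => 1 * u x t + (-1) * u' x t) (fun x t => 1 * k x t + (-1) * k' x t)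
    (fun x t => 1 * h x t + (-1) * h' x t) (cst 0) (cst 0).
Proof.
move=> Fu Fk Fh Fu' Fk' Fh' W W' th th1 th2 psi psi1 psi2 B d1 d2 sth supth d3 d4 spsi suppsi.
have cth := smooth1_continuous sth; have cpsi := smooth1_continuous spsi.
have cth2 := smooth1_continuous (smooth1_derivative d2 (smooth1_derivative d1 sth)).
have cpsi2 := smooth1_continuous (smooth1_derivative d4 (smooth1_derivative d3 spsi)).
have E := W th th1 th2 psi psi1 psi2 B d1 d2 sth supth d3 d4 spsi suppsi.
have E' := W' th th1 th2 psi psi1 psi2 B d1 d2 sth supth d3 d4 spsi suppsi.
rewrite (tint_lin _ _ Fu Fu')// (tint_lin _ _ Fk Fk')// (tint_lin _ _ Fh Fh')//.
have z : \int[leb]_x (cst (0 : R) x * psi x) = 0.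
  under eq_Rintegral do rewrite mul0r.
  by rewrite Rintegral_cst// mul0r.
rewrite !z; exact: beam_eq_sub_arith E E'.
Qed.

(** Outside the closed interval [f1] is locally null; the endpoints follow by continuity of [f2],
    approached from outside. *)
Lemma supp_derivative (a b : R) (f1 f2 : R -> R) : is_derivative f1 f2 -> continuous f2 ->
  supp a b f1 -> supp a b f2.
Proof.
move=> d cf2 sup.
have loc x : x < a \/ b < x -> f2 x = 0.
  move=> hx; have [_ <-] := d x.
  rewrite (@near_eq_derive _ _ _ _ (fun=> 0)).
    by have [] : is_derive x (1 : R) (fun=> (0 : R)) 0 by exact: is_derive_cst.
  case: hx => hx.
    near=> y; apply: sup; rewrite negb_and -leNgt; apply/orP; left; apply: ltW.
    by near: y; exact: lt_nbhsl.
  near=> y; apply: sup; rewrite negb_and -!leNgt; apply/orP; right; apply: ltW.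
  by near: y; exact: lt_nbhsr.
have lim0 (x : R) (u : nat -> R) : u n @[n --> \oo] --> x -> (forall n, f2 (u n) = 0) -> f2 x = 0.
  move=> hu u0; have h1 : f2 (u n) @[n --> \oo] --> f2 x by exact: (cvg_comp _ _ hu (cf2 x)).
  have h2 : f2 (u n) @[n --> \oo] --> (0 : R) by under eq_fun do rewrite u0; exact: cvg_cst.
  exact: (cvg_unique (@Rhausdorff R) h1 h2).
have inv0 : n.+1%:R^-1 @[n --> \oo] --> (0 : R) by exact: cvg_harmonic.
move=> x; rewrite negb_and -!leNgt => /orP[xa|bx].
  apply: (lim0 x (fun n => x - n.+1%:R^-1)).
    by rewrite -[X in _ --> X]subr0; apply: cvgB; [exact: cvg_cst|exact: inv0].
  by move=> n; apply: loc; left; rewrite ltrBlDr (le_lt_trans xa)// ltrDl.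
apply: (lim0 x (fun n => x + n.+1%:R^-1)).
  by rewrite -[X in _ --> X]addr0; apply: cvgD; [exact: cvg_cst|exact: inv0].
by move=> n; apply: loc; right; rewrite (le_lt_trans bx)// ltrDl.
Unshelve. all: by end_near. Qed.

Lemma bounded_Q_cut F (C : R) : 0 <= C -> measurable_fun (cylinder L) F ->
  (forall t x, 0 < t < T -> 0 < x < L -> `|F (t, x)| <= C) ->
  Q_bounded T (cutoff T L F) (fun=> C ^+ 2 * L).
Proof.
move=> C0 mF hC; apply: aeW => t tT; have jF := jm_cut T mF.
apply: (@le_trans _ _ (\int[leb]_x ((cst (C ^+ 2) \_ `]0, L[) x)%:E)%E).
  apply: ge0_le_integral => //.
  - by move=> x _; rewrite lee_fin sqr_ge0.
  - by apply/measurable_EFinP; apply: measurable_funX; exact: (jm_slice t jF).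
  - apply/measurable_EFinP; apply/(measurable_restrictT _ _).1 => //.
  move=> x _; rewrite lee_fin patchE mem_setE in_itv/= /cutoff tT/=.
  case: ifPn => xL; last by rewrite expr0n.
  by rewrite -(real_normK (num_real (F (t, x)))) ler_sqr ?nnegrE// hC.
rewrite (_ : (\int[leb]_x _)%E = \int[leb]_(x in `]0%R, L[) (C ^+ 2)%:E)%E; last first.
  by rewrite [RHS]integral_mkcond; apply: eq_integral => x _; rewrite !patchE; case: ifP.
by rewrite integral_cst//= lebesgue_measure_itv/= lte_fin L0 -EFinD -EFinM subr0.
Qed.

Lemma LooL2_Q_cut F : LooL2 L F -> exists2 c, 0 <= c & Q_bounded T (cutoff T L F) (fun=> c).
Proof.
move=> [mF]; have h0 : (0 <= LooL2norm `]0%R, +oo[ L F)%E by exact: Lnorm_ge0.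
case E : (LooL2norm _ L F) h0 => [r| |] // _ _.
have [h _] := @LooL2norm_le R `]0, +oo[%classic L F `|r| (normr_ge0 r).
exists (`|r| ^+ 2); first exact: sqr_ge0.
have {}h := h _; rewrite E lee_fin ler_norm in h.
apply: (ae_imp (h isT)) => t ht tT; have /andP[t0 _] := tT.
by rewrite (@cut_patch R T L F t tT); apply: ht; rewrite /= in_itv/= t0.
Qed.

Lemma continuous_bounded_cut F : {within closed_cylinder L, continuous F} ->
  exists2 C : R, 0 <= C & forall t x, 0 < t < T -> 0 < x < L -> `|F (t, x)| <= C.
Proof.
move=> cF; pose B : set (R * R) := `[0, T] `*` `[0, L].
have cB : compact B by exact: compact_box.
have BC : B `<=` closed_cylinder L.
  by move=> p [/=]; rewrite !in_itv/= => /andP[h1 _] h2; split; rewrite /= in_itv/= ?h1.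
have B0 : B !=set0 by exists (0, 0); split; rewrite /= in_itv/= lexx ltW.
have cF' := continuous_subspaceW BC cF.
have cn : {within B, continuous (fun p => `|F p|)}.
  move=> p; apply: (@continuous_comp _ _ _ (F : subspace B -> R) (fun z => `|z|)); first exact: cF'.
  exact: norm_continuous.
have [q _ hq] := compact_EVT_max B0 cB cn.
exists `|F q| => // t x /andP[t0 tT] /andP[x0 xL]; apply: hq; rewrite inE; split => /=;
  by rewrite in_itv/= ?(ltW t0) ?(ltW tT) ?(ltW x0) ?(ltW xL).
Qed.

End solution_fields.

(** * Fields attached to one solution *)

Section solution_fields.
Context {R : realType}.
Variables T L : R.
Hypotheses (T0 : 0 < T) (L0 : 0 < L).
Local Notation leb := (@lebesgue_measure R).
Local Notation leb2 := (leb \x leb)%E.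
Implicit Types (f g k q : R -> R -> R) (F G u : R * R -> R) (th psi : R -> R) (t x c : R).

Lemma box_cylinder (a b a' b' : R) : 0 < a -> 0 < a' -> b' < L ->
  (`[a, b] `*` `[a', b'] : set (R * R)) `<=` cylinder L.
Proof.
move=> a0 a'0 b'L p [/=]; rewrite !in_itv/= => /andP[h1 _] /andP[h3 h4].
by split; rewrite /= in_itv/= ?(lt_le_trans a0 h1)// (lt_le_trans a'0 h3) (le_lt_trans h4).
Qed.

Section one_solution.
Variables (rho mu Lam : R) (u h : R * R -> R) (u0 u1 : R -> R).
Hypotheses (cu : {within closed_cylinder L, continuous u})
  (ut : exists G, is_wpartial L [:: e_t] u G) (ut2 : LooL2 L (wdt L u))
  (ux : exists G, is_wpartial L [:: e_x; e_x] u G) (ux2 : LooL2 L (wdxx L u))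
  (mh : measurable_fun (cylinder L) h) (Lam0 : 0 <= Lam)
  (hu : forall p, cylinder L p -> `|h p| <= Lam * `|u p|)
  (W : weak_equation rho mu L u0 u1 u h).
Hypotheses (xu0 : xf L (u0 \_ `]0, L[)) (xu1 : xf L (u1 \_ `]0, L[)).

Let Wt : is_wpartial L [:: e_t] u (wdt L u) := xgetPex _ ut.
Let Wx : is_wpartial L [:: e_x; e_x] u (wdxx L u) := xgetPex _ ux.
Let mu_ : measurable_fun (cylinder L) u. Proof. by case: Wt => -[]. Qed.

Variables (f g k q : R -> R -> R).
Hypotheses (Ff : fld T L f) (Fg : fld T L g) (Fk : fld T L k) (Fq : fld T L q).
Hypotheses (rf : represents T L f u) (rg : represents T L g (wdt L u)) (rk : represents T L k (wdxx L u))
  (rq : represents T L q h).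

Lemma supp_after (a b : R) th t : supp a b th -> b <= T -> T <= t -> th t = 0.
Proof. by move=> sth bT Tt; apply: sth; rewrite negb_and -!leNgt (le_trans bT) ?orbT. Qed.

Lemma iter_derive_t (th th' psi psi' : R -> R) : is_derivative th th' -> is_derivative psi psi' ->
  iter_derive [:: e_t] (tensor th psi) = tensor th' psi.
Proof. exact: derive_t_tensor. Qed.

Lemma iter_derive_tt (th th1 th2 psi psi' : R -> R) : is_derivative th th1 -> is_derivative th1 th2 ->
  is_derivative psi psi' -> iter_derive [:: e_t; e_t] (tensor th psi) = tensor th2 psi.
Proof.
move=> d1 d2 d3; rewrite -(derive_t_tensor d2 d3) -(derive_t_tensor d1 d3).
by [].
Qed.

Lemma iter_derive_xx (th th' psi psi1 psi2 : R -> R) : is_derivative th th' ->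
  is_derivative psi psi1 -> is_derivative psi1 psi2 ->
  iter_derive [:: e_x; e_x] (tensor th psi) = tensor th psi2.
Proof.
move=> d1 d2 d3; rewrite -(derive_x_tensor d1 d3) -(derive_x_tensor d1 d2).
by [].
Qed.

Lemma solution_time_weak : time_weak T L f g.
Proof.
move=> a b a' b' n th th' a0 bT dth sth supth a'0 ab' b'L.
have sb := @smooth1_flat_bump R a' b' n; have cb := smooth1_continuous sb.
have supb : supp a' b' (flat_bump a' b' n : R -> R) by move=> x; exact: flat_bump_out.
have cth := smooth1_continuous sth.
have cth' := smooth1_continuous (smooth1_derivative dth sth).
have [psi1 dpsi _] := smooth1_derive sb.
have tf : test_function (cylinder L) (tensor th (flat_bump a' b' n)).
  by apply: (tensor_test_function sth sb supth supb); exact: box_cylinder.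
case: Wt => -[mU _] [mG _] /(_ _ tf); rewrite (iter_derive_t dth dpsi) expr1.
have [_ ->] := cyl_tensor L0 mU Ff rf cb cth' (fun t => @supp_after a b th' t (supp_derivative dth cth' supth) (ltW bT)).
have [_ ->] := cyl_tensor L0 mG Fg rg cb cth (fun t => @supp_after a b th t supth (ltW bT)).
by rewrite mulN1r.
Qed.

Lemma solution_space_weak : space_weak T L f k.
Proof.
move=> a b a' b' n psi psi1 psi2 a0 ab bT a'0 b'L d1 d2 spsi suppsi.
have sb := @smooth1_flat_bump R a b n; have cb := smooth1_continuous sb.
have supb : supp a b (flat_bump a b n : R -> R) by move=> x; exact: flat_bump_out.
have cpsi := smooth1_continuous spsi.
have cpsi2 := smooth1_continuous (smooth1_derivative d2 (smooth1_derivative d1 spsi)).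
have [th1 dth _] := smooth1_derive sb.
have tf : test_function (cylinder L) (tensor (flat_bump a b n) psi).
  by apply: (tensor_test_function sb spsi supb suppsi); exact: box_cylinder.
have hb := fun t => @supp_after a b (flat_bump a b n) t supb (ltW bT).
case: Wx => -[mU _] [mK _] /(_ _ tf).
rewrite (iter_derive_xx dth d1 d2) sqrrN expr1n mul1r.
have [_ ->] := cyl_tensor L0 mU Ff rf cpsi2 cb hb.
by have [_ ->] := cyl_tensor L0 mK Fk rk cpsi cb hb.
Qed.

Lemma patch_Rintegral (p psi : R -> R) (c : R) : xf L (p \_ `]0, L[) -> continuous psi ->
  \int[leb]_(x in `]0, L[) (rho * p x * (c * psi x)) =
  rho * (\int[leb]_x ((p \_ `]0, L[) x * psi x)) * c.
Proof.
move=> xp cpsi.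
have ip : rint leb setT (fun x => (p \_ `]0, L[) x * psi x).
  have := rint_mul_continuous xp cpsi; apply: eq_rint => // x _; exact: mulrC.
rewrite mulrAC -(RintegralZl (rho * c) measurableT ip) Rintegral_mkcond.
apply: eq_Rintegral => x _; rewrite !patchE; case: ifP => _; first ring.
by rewrite -[point]/(0 : R) mul0r mulr0.
Qed.

Lemma solution_beam_eq : beam_eq T rho mu f k q (u0 \_ `]0, L[) (u1 \_ `]0, L[).
Proof.
move=> th th1 th2 psi psi1 psi2 B d1 d2 sth supth d3 d4 spsi suppsi.
have cth := smooth1_continuous sth; have cpsi := smooth1_continuous spsi.
have sth1 := smooth1_derivative d1 sth.
have cth1 := smooth1_continuous sth1.
have cth2 := smooth1_continuous (smooth1_derivative d2 sth1).
have cpsi2 := smooth1_continuous (smooth1_derivative d4 (smooth1_derivative d3 spsi)).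
have sup2 := supp_derivative d2 cth2 (supp_derivative d1 cth1 supth).
have hth := fun t => @supp_after (-3) T th t supth (lexx T).
have hth2 := fun t => @supp_after (-3) T th2 t sup2 (lexx T).
have tf : test_function setT (tensor th psi).
  by apply: (tensor_test_function sth spsi supth suppsi) => p _.
have := W tf.
rewrite (iter_derive_tt d1 d2 d3) (iter_derive_t d1 d3) (iter_derive_xx d1 d3 d4).
have mK : measurable_fun (cylinder L) (wdxx L u) by case: Wx => _ [].
have [i1 e1] := cyl_tensor L0 mu_ Ff rf cpsi cth2 hth2.
have [i2 e2] := cyl_tensor L0 mK Fk rk cpsi2 cth hth.
have [i3 e3] := cyl_tensor L0 mh Fq rq cpsi cth hth.
have mC : measurable (cylinder L : set (measurableTypeR R * measurableTypeR R)).
  exact: measurable_cylinder.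
have E : \int[leb2]_(p in cylinder L) (rho * u p * tensor th2 psi p
    + mu * wdxx L u p * tensor th psi2 p + h p * tensor th psi p) =
    rho * tint f psi th2 + (mu * tint k psi2 th + tint q psi th).
  rewrite -e1 -e2 -e3.
  have i23 : rint leb2 (cylinder L) (fun p => mu * (wdxx L u p * tensor th psi2 p) +
      1 * (h p * tensor th psi p)) by apply: rintD => //; apply: rintZ.
  have E1 := Rintegral_lin rho 1 mC i1 i23; have E2 := Rintegral_lin mu 1 mC i2 i3.
  rewrite E2 !mul1r in E1; rewrite -E1.
  by apply: eq_Rintegral => p _; rewrite !mul1r !mulrA addrA.
rewrite E /tensor /=.
by rewrite (patch_Rintegral (th 0) xu1 cpsi) (patch_Rintegral (th1 0) xu0 cpsi).
Qed.

End one_solution.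

Lemma repr_Q_bounded f F c : measurable_fun (cylinder L) F -> fld T L f -> represents T L f F ->
  Q_bounded T (cutoff T L F) (fun=> c) -> Q_bounded T f (fun=> c).
Proof.
move=> mF [[jf _ _ _ _] _] fF hc; have jF := jm_cut T mF.
by apply: (ae_imp hc) => t ht tT; rewrite (repr_Q t jf jF fF); exact: ht.
Qed.

(** The bounds on [f] and [g] are specific to the solution. The source is measured relative to [f],
    with the factor [Lam ^+ 2] alone: this is the form that the Gronwall argument can use
    uniformly. *)
Lemma solution_fields (rho mu Lam : R) (u h : R * R -> R) (u0 u1 : R -> R) :
  {within closed_cylinder L, continuous u} ->
  (exists G, is_wpartial L [:: e_t] u G) -> LooL2 L (wdt L u) ->
  (exists G, is_wpartial L [:: e_x; e_x] u G) -> LooL2 L (wdxx L u) ->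
  measurable_fun (cylinder L) h -> 0 <= Lam ->
  (forall p, cylinder L p -> `|h p| <= Lam * `|u p|) ->
  weak_equation rho mu L u0 u1 u h ->
  xf L (u0 \_ `]0, L[) -> xf L (u1 \_ `]0, L[) ->
  exists f g k q, [/\ (fld T L f /\ exists2 c, 0 <= c & Q_bounded T f (fun=> c)),
    [/\ fld T L g, represents T L g (wdt L u) & exists2 c, 0 <= c & Q_bounded T g (fun=> c)],
    (fld T L k /\ represents T L k (wdxx L u)),
    (fld T L q /\ {ae leb, forall t, 0 < t < T ->
      (Q leb (q^~ t) <= (Lam ^+ 2)%:E * Q leb (f^~ t))%E}) &
    [/\ beam_eq T rho mu f k q (u0 \_ `]0, L[) (u1 \_ `]0, L[),
      space_weak T L f k & time_weak T L f g]].
Proof.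
move=> cu ut ut2 ux ux2 mh Lam0 hu W xu0 xu1.
have mU : measurable_fun (cylinder L) u by case: ut => G [[]].
have [C C0 hC] := continuous_bounded_cut T0 L0 cu.
have C2 : 0 <= C ^+ 2 * L by rewrite mulr_ge0 ?sqr_ge0// ltW.
have D0 : 0 <= Lam * C by rewrite mulr_ge0.
have D2 : 0 <= (Lam * C) ^+ 2 * L by rewrite mulr_ge0 ?sqr_ge0// ltW.
have bu := bounded_Q_cut L0 C0 mU hC.
have hh t x : 0 < t < T -> 0 < x < L -> `|h (t, x)| <= Lam * C.
  move=> tT xL; apply: le_trans (hu (t, x) _) _.
    by split; rewrite /= in_itv/= ?xL// andbT; case/andP: tT.
  by rewrite ler_wpM2l// hC.
have bh := bounded_Q_cut L0 D0 mh hh.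
have [cg cg0 bg] := LooL2_Q_cut T ut2; have [ck ck0 bk] := LooL2_Q_cut T ux2.
have [f [Ff rf]] := fld_of L0 mU C2 bu; have [q [Fq rq]] := fld_of L0 mh D2 bh.
have [g [Fg rg]] := fld_of L0 ut2.1 cg0 bg; have [k [Fk rk]] := fld_of L0 ux2.1 ck0 bk.
exists f, g, k, q; split.
- by split => //; exists (C ^+ 2 * L) => //; exact: (repr_Q_bounded mU Ff rf bu).
- by split => //; exists cg => //; exact: (repr_Q_bounded ut2.1 Fg rg bg).
- by split.
- split => //; apply: aeW => t tT.
  have [[jf _ _ _ _] _] := Ff; have [[jq _ _ _ _] _] := Fq.
  have jU := jm_cut T mU; have jh := jm_cut T mh.
  rewrite (repr_Q t jf jU rf) (repr_Q t jq jh rq) -(@Q_scale _ (measurableTypeR R) R leb); last exact: (jm_slice t jU).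
  apply: ge0_le_integral => //.
  + by move=> x _; rewrite lee_fin sqr_ge0.
  + by apply/measurable_EFinP; apply: measurable_funX; exact: (jm_slice t jh).
  + apply/measurable_EFinP; apply: measurable_funX; apply: measurable_funM => //.
    exact: (jm_slice t jU).
  move=> x _; rewrite lee_fin -(real_normK (num_real (cutoff T L h x t))) -(real_normK (num_real (Lam * _))).
  rewrite ler_sqr ?nnegrE// normrM (ger0_norm Lam0) /cutoff; case: ifPn => [/andP[_ xL]|_].
    by apply: hu; split; rewrite /= in_itv/= ?xL// andbT; case/andP: tT.
  by rewrite normr0 mulr0.
split.
- exact: (solution_beam_eq ut ux mh W xu0 xu1 Ff Fk Fq rf rk rq).
- exact: (solution_space_weak ux Ff Fk rf rk).
- exact: (solution_time_weak ut Ff Fg rf rg).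
Qed.

End solution_fields.

(** * Bounds on the potential and on its selections *)

Section potential.
Context {R : realType}.
Variables (kappa : R) (Phi : R -> R).
Hypothesis P : adhesion_potential kappa Phi.

Lemma potential_derive0 : derive1 Phi 0 = 0.
Proof.
have N11 : (-1 : R) <= 1 by rewrite (@le_trans _ _ 0)// lerN10.
have d0 : is_derive (0 : R) 1 Phi 0.
  apply: (@derive1_at_min R Phi (-1) 1 0) => //.
  - move=> t; rewrite in_itv/= => /andP[t1 t2].
    have tn1 : t != 1 by rewrite lt_eqF.
    have tnN1 : t != -1 by rewrite gt_eqF.
    have [dPhi _ _] := potential_C2 P tn1 tnN1; exact: dPhi.
  - by rewrite in_itv/= ltr01 ltrN10.
  move=> t; rewrite in_itv/= => /andP[t1 t2]; have [t0|t0|->//] := ltgtP t 0; have t0' := ltW t0; apply: ltW.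
    apply: (potential_decreasing P) t0; rewrite inE/= in_itv/= ?lexx ?lerN10//.
    by rewrite (ltW t1) t0'.
  apply: (potential_increasing P) t0; rewrite inE/= in_itv/= ?lexx ?ler01//.
  by rewrite (ltW t2) t0'.
by rewrite derive1E; have [] := d0.
Qed.

(** The derivative of [Phi] vanishes at its minimum 0 and is differentiable there; close to 0 its
    difference quotient is within 1 of the limit [l], whence the slope bound. *)
Lemma potential_near0 : exists2 dl : R, 0 < dl < 1 &
  exists2 K, 0 <= K & forall z, `|z| < dl -> `|derive1 Phi z| <= K * `|z|.
Proof.
have n1 : (0 : R) != 1 by rewrite eq_sym oner_eq0.
have nN1 : (0 : R) != -1 by rewrite eq_sym oppr_eq0 oner_eq0.
have [_ d2 _] := potential_C2 P n1 nN1.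
pose l := 'D_1 (derive1 Phi) 0.
have : h^-1 *: ((derive1 Phi \o shift 0) (h *: (1 : R)) - derive1 Phi 0) @[h --> 0^'] --> l by exact: d2.
move=> /cvgrPdist_lt /(_ 1 ltr01)[e /= e0 he].
exists (Num.min e (1 / 2)).
  by rewrite lt_min e0 divr_gt0//= gt_min ltr_pdivrMr// mul1r ltr1n orbT.
exists (`|l| + 1); first by rewrite addr_ge0.
move=> z; rewrite lt_min => /andP[ze _]; have [->|z0] := eqVneq z 0.
  by rewrite potential_derive0 normr0 mulr0.
have := he z; rewrite /= sub0r normrN => /(_ ze z0).
rewrite addr0 -[z *: (1 : R)]/(z * 1) mulr1 potential_derive0 subr0 => h1.
have h2 : `|z^-1 *: derive1 Phi z| <= `|l| + 1.
  rewrite -[X in `|X|](subrK l) (le_trans (ler_normD _ _))// addrC lerD2l distrC; exact: ltW.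
by rewrite -ler_pdivrMr ?normr_gt0// mulrC -normfV -normrM.
Qed.

Let M := Num.max (lim (derive1 Phi z @[z --> (1 : R)^'-])) (- lim (derive1 Phi z @[z --> (-1 : R)^'+])).

(** Close to 0 by differentiability of the derivative. Elsewhere the selection is bounded by [M],
    the larger slope at the two jumps, hence by [M / dl] times the modulus of [u]. *)
Lemma selection_linear_bound : exists2 Lam : R, 0 <= Lam & forall L u h,
  selection L Phi u h -> forall p, cylinder L p -> `|h p| <= Lam * `|u p|.
Proof.
have [dl /andP[dl0 dl1] [K K0 hK]] := potential_near0.
have M0 : 0 <= M.
  have /(potential_derive_pos P)/andP[h1 h2] : 0 < (1 / 2 : R) < 1.
    by rewrite divr_gt0//= ltr_pdivrMr// mul1r ltr1n.
  by rewrite /M le_max (le_trans (ltW h1) h2).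
exists (Num.max K (M / dl)); first by rewrite le_max K0.
move=> L u h [mh hs] p [p1 p2].
have pc : closed_cylinder L p.
  move: p1 p2; rewrite /= !in_itv/= andbT => t0 /andP[x0 xL].
  by split; rewrite /= in_itv/= ?(ltW t0) ?(ltW x0) ?(ltW xL).
have [h1 h2 h3 h4] := hs p pc.
have far : dl <= `|u p| -> `|h p| <= M -> `|h p| <= Num.max K (M / dl) * `|u p|.
  move=> du hM; apply: le_trans hM _; rewrite (@le_trans _ _ (M / dl * `|u p|))//.
    by rewrite mulrAC ler_pdivlMr// ler_wpM2l.
  by rewrite ler_wpM2r// le_max lexx orbT.
have l1 : lim (derive1 Phi z @[z --> (1 : R)^'-]) <= M by rewrite /M le_max lexx.
have l2 : - M <= lim (derive1 Phi z @[z --> (-1 : R)^'+]) by rewrite lerNl /M le_max lexx orbT.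
case: (ltgtP `|u p| 1) => [u1|u1|u1].
- rewrite h1//; have [du|du] := ltP `|u p| dl.
    by apply: le_trans (hK _ du) _; rewrite ler_wpM2r// le_max lexx.
  rewrite -h1//; apply: far => //; rewrite h1//; move: u1; rewrite ltr_norml => /andP[um up].
  case: (ltgtP (u p) 0) => [u0|u0|->]; last by rewrite potential_derive0 normr0.
    have /(potential_derive_neg P)/andP[g1 g2] : -1 < u p < 0 by rewrite um.
    by rewrite ler_norml (le_trans l2 g1)/= (le_trans (ltW g2)).
  have /(potential_derive_pos P)/andP[g1 g2] : 0 < u p < 1 by rewrite u0.
  by rewrite ler_norml (le_trans g2 l1) andbT (le_trans _ (ltW g1))// oppr_le0.
- by rewrite h2// normr0 mulr_ge0// le_max K0.
have [uE|uE] : u p = 1 \/ u p = -1.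
  by have [u0|u0] := leP 0 (u p); [left|right]; move: u1; [rewrite ger0_norm|rewrite ltr0_norm// => <-; rewrite opprK].
  have /andP[g1 g2] := h3 uE.
  apply: far; first by rewrite u1 ltW.
  by rewrite ler_norml (le_trans g2 l1) andbT (le_trans _ g1)// oppr_le0.
have /andP[g1 g2] := h4 uE.
apply: far; first by rewrite u1 ltW.
by rewrite ler_norml (le_trans l2 g1)/= (le_trans g2).
Qed.

Lemma potential_bounded : exists2 B : R, 0 <= B & forall z, Phi z <= B.
Proof.
have N11 : (-1 : R) <= 1 by rewrite (@le_trans _ _ 0)// lerN10.
have cP : {within `[(-1 : R), 1], continuous Phi}.
  by apply: continuous_subspaceT; exact: potential_continuous P.
have [c _ hc] := EVT_max N11 cP.
exists (Phi c); first exact: potential_ge0 P _.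
move=> z; have [z1|z1] := leP z (-1).
  by rewrite (potential_cst_left P z1) hc// in_itv/= lexx.
have [z2|z2] := leP 1 z.
  by rewrite (potential_cst_right P z2) hc// in_itv/= lexx andbT.
by rewrite hc// in_itv/= (ltW z1) (ltW z2).
Qed.

End potential.

(** * Square norms bounded by an energy density *)

Section energy_bounds.
Context {R : realType}.
Variables (T L rho mu : R).
Hypotheses (T0 : 0 < T) (L0 : 0 < L) (rho0 : 0 < rho) (mu0 : 0 < mu).
Local Notation leb := (@lebesgue_measure R).

Lemma measurable_patch_itv (p : R -> R) : measurable_fun setT (p \_ `]0, L[) ->
  measurable_fun (`]0, L[ : set (measurableTypeR R)) p.
Proof. by move=> h; apply/(measurable_restrictT _ _).2. Qed.

Lemma patch_Q_le (p q : R -> R) (c : R) : 0 < c ->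
  measurable_fun setT (p \_ `]0, L[) ->
  measurable_fun (`]0, L[ : set (measurableTypeR R)) q ->
  (forall x, 0 < x < L -> c * p x ^+ 2 <= q x) ->
  (c%:E * Q leb (p \_ `]0%R, L[) <= \int[leb]_(x in `]0%R, L[) (q x)%:E)%E.
Proof.
move=> c0 mp mq pq.
have mp' := measurable_patch_itv mp.
have -> : Q leb (p \_ `]0, L[) = (\int[leb]_(x in `]0%R, L[) (p x ^+ 2)%:E)%E.
  rewrite [RHS]integral_mkcond; apply: eq_integral => x _; rewrite !patchE.
  by case: ifP => // _; rewrite expr0n.
have mp2 : measurable_fun (`]0%R, L[ : set (measurableTypeR R)) (fun x => (p x ^+ 2)%:E).
  by apply/measurable_EFinP; exact: measurable_funX.
have c0' : (0 <= c%:E)%E by rewrite lee_fin ltW.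
have p0 (x : R) : `]0%R, L[ x -> (0 <= (p x ^+ 2)%:E)%E by move=> _; rewrite lee_fin sqr_ge0.
rewrite -ge0_integralZl//.
have h1 (x : R) : `]0%R, L[ x -> (0 <= c%:E * (p x ^+ 2)%:E)%E.
  by move=> _; rewrite -EFinM lee_fin mulr_ge0 ?sqr_ge0// ltW.
have h2 : measurable_fun (`]0%R, L[ : set (measurableTypeR R)) (fun x => c%:E * (p x ^+ 2)%:E)%E.
  exact: emeasurable_funM.
have h3 : measurable_fun (`]0%R, L[ : set (measurableTypeR R)) (fun x => (q x)%:E).
  exact/measurable_EFinP.
have h4 (x : R) : `]0%R, L[ x -> (c%:E * (p x ^+ 2)%:E <= (q x)%:E)%E.
  by rewrite /= in_itv/= => xL; rewrite -EFinM lee_fin pq.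
by apply: ge0_le_integral.
Qed.

End energy_bounds.

(** * Weakly null sequences are small in the dual space *)

Section weak_oscillation.
Context {R : realType}.
Variable L : R.
Hypothesis L0 : 0 < L.
Local Notation leb := (@lebesgue_measure R).
Implicit Types (f g p phi S z : R -> R) (a b c eps : R).

Lemma xf_cst_itv (q : R -> R) : continuous q -> xf L (q \_ `]0, L[).
Proof.
move=> cq; split; last by move=> x xL; rewrite patchE mem_setE in_itv/= (negbTE xL).
have mq : measurable_fun setT (q \_ `]0, L[).
  by apply/(measurable_restrictT _ _).1 => //; apply: measurable_funTS; exact: continuous_measurable_fun.
have [M M0 hM] := continuous_itv_bounded 0 L cq.
have [c Hc] : exists c : R, (Q leb (q \_ `]0%R, L[) <= c%:E)%E; last by apply: sqi_le Hc.
exists (M ^+ 2 * L).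
apply: (@le_trans _ _ (\int[leb]_x ((cst (M ^+ 2) \_ `]0%R, L[) x)%:E)%E).
  apply: ge0_le_integral => //.
  - by move=> x _; rewrite lee_fin sqr_ge0.
  - by apply/measurable_EFinP; exact: measurable_funX.
  - by apply/measurable_EFinP; apply/(measurable_restrictT _ _).1.
  move=> x _; rewrite lee_fin !patchE mem_setE in_itv/=.
  case: ifPn => [/andP[x0 xL]|_]; last by rewrite expr0n.
  by rewrite -(real_normK (num_real (q x))) ler_sqr ?nnegrE// hM// (ltW x0) (ltW xL).
rewrite (_ : (\int[leb]_x _)%E = \int[leb]_(x in `]0%R, L[) (M ^+ 2)%:E)%E; last first.
  by rewrite [RHS]integral_mkcond; apply: eq_integral => x _; rewrite !patchE; case: ifP.
by rewrite integral_cst//= lebesgue_measure_itv/= lte_fin L0 -EFinD -EFinM subr0.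
Qed.

(** Young's inequality with parameter [N]; the constant [1 + K] avoids square roots and suffices for
    the boundedness of a linear form. *)
Lemma Cauchy_Schwarz_bound f phi (N K : R) : 0 <= N -> 0 <= K -> sqi leb f -> sqi leb phi ->
  \int[leb]_x (f x ^+ 2) = N ^+ 2 -> \int[leb]_x (phi x ^+ 2) <= K ->
  `|\int[leb]_x (f x * phi x)| <= (1 + K) * N.
Proof.
move=> N0 K0 sf sp hf hp; set I := \int[leb]_x _.
have Y a : 0 < a -> 2 * `|I| <= a^-1 * N ^+ 2 + a * K.
  move=> a0; have := Young_Rintegral a0 sf sp; rewrite hf => /le_trans; apply.
  by rewrite lerD2l ler_wpM2l// ltW.
have [NE|Np] := eqVneq N 0.
  rewrite NE mulr0 leNgt; apply/negP => I0.
  have K1 : 0 < K + 1 by rewrite ltr_wpDl.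
  (* For [N = 0] the parameter is free; this value makes [a * K] smaller than the modulus of [I], a
     contradiction. *)
  have := Y (`|I| / (K + 1)) (divr_gt0 I0 K1); rewrite NE expr0n mulr0 add0r mulrAC ler_pdivlMr//.
  nra.
have N1 : 0 < N by rewrite lt_neqAle eq_sym Np.
have := Y N N1; rewrite expr2 mulKf//.
have := mulr_ge0 K0 N0; lra.
Qed.

Lemma test_form_bounded (X : set (R -> R)) (NX : (R -> R) -> R) phi : xf L phi ->
  (forall f, X f -> L2 L f /\ L2norm L f <= NX f) ->
  bounded_linear_form X NX (fun f => \int[leb]_x ((f \_ `]0, L[) x * phi x)).
Proof.
move=> xphi hX; split.
  move=> a f g Xf Xg; have sf := L2_sqi (hX f Xf).1; have sg := L2_sqi (hX g Xg).1.
  have i1 := sqi_mul sf xphi.1; have i2 := sqi_mul sg xphi.1.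
  rewrite -[X in _ + X]mul1r -(Rintegral_lin a 1 measurableT i1 i2).
  apply: eq_Rintegral => x _; rewrite !patchE; case: ifP => _; first by ring.
  by rewrite -[point]/(0 : R); ring.
pose K := \int[leb]_x (phi x ^+ 2).
have K0 : 0 <= K by apply: Rintegral_ge0 => x _; exact: sqr_ge0.
exists (1 + K) => f Xf; have [f2 fN] := hX f Xf; have sf := L2_sqi f2.
have N0 : 0 <= L2norm L f by rewrite /L2norm fine_ge0// Lnorm_ge0.
apply: (@le_trans _ _ ((1 + K) * L2norm L f)).
  apply: (Cauchy_Schwarz_bound N0 K0 sf xphi.1) => //.
  by have := L2norm_sqr sf; rewrite (sqi_Q sf) => -[].
by rewrite ler_wpM2l// addr_ge0.
Qed.

Lemma weak_cvg_test (X : set (R -> R)) (NX : (R -> R) -> R) (f_ : nat -> R -> R) phi : xf L phi ->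
  (forall f, X f -> L2 L f /\ L2norm L f <= NX f) -> weak_cvg X NX f_ (fun=> 0) ->
  \int[leb]_x ((f_ n \_ `]0, L[) x * phi x) @[n --> \oo] --> (0 : R).
Proof.
move=> xphi hX /(_ _ (test_form_bounded xphi hX)).
rewrite (_ : \int[leb]_x ((((fun=> 0) : R -> R) \_ `]0, L[) x * phi x) = 0)//.
rewrite (@eq_Rintegral _ _ _ leb _ (cst 0)); first by rewrite Rintegral_cst// mul0r.
by move=> x _; rewrite patchE; case: ifP => _; rewrite ?mul0r// -[point]/(0 : R) mul0r.
Qed.

Lemma L2_norms f : L2 L f -> L2 L f /\ L2norm L f <= L2norm L f. Proof. by []. Qed.

Lemma H2_norms f : H2 L f -> L2 L f /\ L2norm L f <= H2norm L f.
Proof.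
move=> [f2 _ _]; split => //.
have N0 : 0 <= L2norm L f by rewrite /L2norm fine_ge0// Lnorm_ge0.
rewrite /H2norm -[leLHS]ger0_norm// -sqrtr_sqr ler_sqrt.
  by rewrite -addrA lerDl addr_ge0// sqr_ge0.
by rewrite !addr_ge0// sqr_ge0.
Qed.

(* The remainder orthogonal to affine functions, whose second primitive is
   controlled by finitely many weak limits. *)
Definition aff1 p := 12 / L ^+ 3 * (moment1 p - L / 2 * moment0 p).
Definition aff0 p := moment0 p / L - aff1 p * L / 2.
Definition aff p := (fun x => aff0 p + aff1 p * x) \_ `]0, L[.
Definition rem p x := 1 * p x + (-1) * aff p x.

Lemma xf_aff p : xf L (aff p).
Proof.
apply: xf_cst_itv => x; apply: cvgD; first exact: cvg_cst.
by apply: cvgM; [exact: cvg_cst|exact: cvg_id].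
Qed.

Lemma xf_rem p : xf L p -> xf L (rem p).
Proof. by move=> xp; apply: xf_lin => //; exact: xf_aff. Qed.

Lemma affine_test (a b : R) S : xf L S ->
  \int[leb]_x (((fun x => a + b * x) \_ `]0, L[) x * S x) = a * moment0 S + b * moment1 S.
Proof.
move=> xS; have i0 := xf_rint xS.
have i1 := @rint_mul_continuous _ _ _ id xS (fun=> cvg_id).
rewrite /moment0 /moment1 -(Rintegral_lin a b measurableT i0 i1).
apply: eq_Rintegral => x _; rewrite patchE mem_setE in_itv/=; case: ifPn => xL; first ring.
by rewrite (xS.2 x xL) !mulr0 addr0.
Qed.

Lemma moments_affine (a b : R) :
  moment0 ((fun x => a + b * x) \_ `]0, L[) = a * L + b * (L ^+ 2 / 2) /\
  moment1 ((fun x => a + b * x) \_ `]0, L[) = a * (L ^+ 2 / 2) + b * (L ^+ 3 / 3).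
Proof.
have Lw := ltW L0.
have cc : continuous (fun x : R => a + b * x).
  by move=> x; apply: cvgD; [exact: cvg_cst|apply: cvgM; [exact: cvg_cst|exact: cvg_id]].
pose F (x : R) := a * x + b * (x ^+ 2 / 2).
have dF (x : R) : is_derive x 1 F (a + b * x).
  by rewrite /F; apply: is_derive_eq; rewrite -?[_ *: _]/(_ * _)/=; lra.
pose G (x : R) := a * (x ^+ 2 / 2) + b * (x ^+ 3 / 3).
have cg : continuous (fun x : R => x * (a + b * x)).
  by move=> x; apply: cvgM; [exact: cvg_id|exact: cc].
have dG (x : R) : is_derive x 1 G (x * (a + b * x)).
  by rewrite /G; apply: is_derive_eq; rewrite -?[_ *: _]/(_ * _)/=; lra.
have E (q : R -> R) : continuous q ->
    \int[leb]_x ((q \_ `]0, L[) x) = \int[leb]_(x in `[0, L]) q x.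
  move=> cq; have mq := continuous_measurable_fun cq.
  rewrite [RHS]Rintegral_mkcond; apply: ae_eq_Rintegral => //.
  - by apply/(measurable_restrictT _ _).1 => //; exact: measurable_funTS.
  - by apply/(measurable_restrictT _ _).1 => //; exact: measurable_funTS.
  apply: (ae_imp2 (@ae_neq R 0) (ae_neq L)) => x x0 xL _.
  by rewrite !patchE !mem_setE !in_itv/= !le_eqVlt (negbTE xL) eq_sym (negbTE x0).
split.
  rewrite /moment0 (E _ cc) (Rintegral_FTC Lw cc dF) /F; ring.
rewrite /moment1 (_ : \int[leb]_x _ = \int[leb]_x (((fun x => x * (a + b * x)) \_ `]0, L[) x)).
  by rewrite (E _ cg) (Rintegral_FTC Lw cg dG) /G; ring.
by apply: eq_Rintegral => x _; rewrite !patchE; case: ifP => _//; rewrite mulr0.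
Qed.

(** [aff p] is the L2 projection on affine functions: the slope divides the centred first moment by
    the integral of the square of [x - L / 2], which is [L ^+ 3 / 12]. *)
Lemma rem_moments p : xf L p -> moment0 (rem p) = 0 /\ moment1 (rem p) = 0.
Proof.
move=> xp; have xa := xf_aff p; have [e0 e1] := moments_affine (aff0 p) (aff1 p).
have LN : L != 0 by rewrite gt_eqF.
have ip := xf_rint xp; have ia := xf_rint xa.
have ip1 := @rint_mul_continuous _ _ _ id xp (fun=> cvg_id).
have ia1 := @rint_mul_continuous _ _ _ id xa (fun=> cvg_id).
have E0 : moment0 (rem p) = 1 * moment0 p + (-1) * moment0 (aff p).
  by rewrite /moment0 -(Rintegral_lin 1 (-1) measurableT ip ia).
have E1 : moment1 (rem p) = 1 * moment1 p + (-1) * moment1 (aff p).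
  rewrite /moment1 -(Rintegral_lin 1 (-1) measurableT ip1 ia1).
  by apply: eq_Rintegral => x _; rewrite /rem; ring.
by rewrite E0 E1 /aff e0 e1 /aff0 /aff1; split; field.
Qed.

Lemma rem_arith (x y : R) : 2 * x <= y + x -> x <= y.
Proof. lra. Qed.

(** [p] and [g] differ by an affine function, so [rem p] is also the remainder of [g], and an
    orthogonal projection does not increase the norm. *)
Lemma rem_le p g (a b : R) : xf L p -> xf L g ->
  {ae leb, forall x, 0 < x < L -> p x = a + b * x + g x} ->
  \int[leb]_x (rem p x ^+ 2) <= \int[leb]_x (g x ^+ 2).
Proof.
move=> xp xg hp; have xr := xf_rem xp; have [m0 m1] := rem_moments xp.
have i1 := sqi_mul xg.1 xr.1.
pose c := a - aff0 p; pose d := b - aff1 p.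
have xq : xf L ((fun x => c + d * x) \_ `]0, L[).
  apply: xf_cst_itv => x; apply: cvgD; first exact: cvg_cst.
  by apply: cvgM; [exact: cvg_cst|exact: cvg_id].
have i2 := sqi_mul xq.1 xr.1.
have E : \int[leb]_x (rem p x ^+ 2) = \int[leb]_x (g x * rem p x).
  transitivity (1 * (\int[leb]_x (((fun x => c + d * x) \_ `]0, L[) x * rem p x))
    + 1 * (\int[leb]_x (g x * rem p x))); last first.
    by rewrite (affine_test c d xr) m0 m1 !mulr0 addr0 mulr0 add0r mul1r.
  rewrite -(Rintegral_lin 1 1 measurableT i2 i1); apply: ae_eq_Rintegral => //.
  - exact: measurable_funX xr.1.1.
  - by apply: measurable_funD; apply: measurable_funM => //; [exact: rint_measurable i2|exact: rint_measurable i1].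
  apply: (ae_imp hp) => x hx _; have [xL|xL] := boolP (0 < x < L); last first.
    by rewrite (xr.2 x xL) expr0n !mulr0 addr0.
  rewrite !mul1r -mulrDl expr2; congr (_ * _).
  by rewrite /rem hx// /aff !patchE !mem_setE !in_itv/= xL /c /d; ring.
have r0 : 0 <= \int[leb]_x (rem p x ^+ 2) by apply: Rintegral_ge0 => x _; exact: sqr_ge0.
have Y := Young_Rintegral ltr01 xg.1 xr.1; rewrite invr1 !mul1r -E ger0_norm// in Y.
exact: rem_arith Y.
Qed.

Lemma half_bound (i x y C l : R) : 0 <= i -> 2 * i <= x + y -> x <= C -> y <= l -> i <= l + C.
Proof. lra. Qed.

(** A uniform bound by pairing [p] with indicators of [[0, y]]; it is the dominating constant in the
    convergence of double primitives. *)
Lemma JJ_bound p (C x : R) : xf L p -> 0 <= C -> \int[leb]_y (p y ^+ 2) <= C -> 0 < x < L ->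
  `|J (J p) x| <= L * (L + C).
Proof.
move=> xr C0 hC /andP[x0 x1].
have lr := xf_locint xr.
have B y : 0 <= y <= x -> `|J p y| <= L + C.
  move=> /andP[y0 yx]; pose q := (cst (1 : R)) \_ `[0, y].
  have mq : measurable_fun setT q by apply/(measurable_restrictT _ _).1.
  have -> : J p y = \int[leb]_s (p s * q s).
    rewrite /J Rintegral_mkcond; apply: eq_Rintegral => s _; rewrite /q !patchE.
    by case: ifP => _; rewrite ?mulr1// -[point]/(0 : R) mulr0.
  have yL : y <= L := le_trans yx (ltW x1).
  have Qq : (Q leb q <= L%:E)%E.
    rewrite (_ : Q leb q = \int[leb]_(s in `[0%R, y]) 1%:E)%E; last first.
      rewrite [RHS]integral_mkcond; apply: eq_integral => s _; rewrite /q !patchE.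
      by case: ifP => _; rewrite ?expr1n// expr0n.
    rewrite integral_cst//= lebesgue_measure_itv/= mul1e lte_fin; case: ifP => _.
      by rewrite -EFinD lee_fin subr0.
    by rewrite lee_fin ltW.
  have sq : sqi leb q by exact: sqi_le Qq.
  have Y := Young_Rintegral ltr01 xr.1 sq; rewrite invr1 !mul1r in Y.
  exact: half_bound (normr_ge0 _) Y hC (Q_fin_le sq.1 Qq).
have cJ : continuous (J p) by exact: J_continuous.
have LC : 0 <= L + C by rewrite addr_ge0// ltW.
apply: (@le_trans _ _ (\int[leb]_(y in `[0, x]) (L + C))); last first.
  by rewrite Rintegral_itv_cst ?(ltW x0)// subr0 mulrC ler_wpM2r// ltW.
apply: le_trans (le_normr_Rintegral _ (continuous_rint_itv 0 x cJ)) _ => //.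
apply: le_Rintegral => //.
- by apply: rint_abs; exact: continuous_rint_itv.
- by apply: continuous_rint_itv; exact: cst_continuous.
Qed.

Lemma osc_arith (e eps a0 a1 y m0 m1 i X Z : R) : 0 < e -> e * (1 + L) <= eps ->
  e * (1 + L ^+ 3) <= eps -> e <= eps -> `|a0| <= e -> `|a1| <= e -> `|y| <= e ^+ 2 ->
  2 * `|m0| <= L + X -> 2 * `|m1| <= L ^+ 3 + X -> 2 * `|i| <= e^-1 * y + e * Z ->
  0 <= X -> 0 <= Z -> `|a0 * m0 + a1 * m1 + i| <= eps * (2 + X + Z).
Proof.
move=> e0 g1 g2 g3 h0 h1 hy q0 q1 qi X0 Z0.
have t0 : 2 * `|a0 * m0| <= e * (L + X).
  by rewrite normrM mulrCA; apply: ler_pM => //; rewrite mulr_ge0.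
have t1 : 2 * `|a1 * m1| <= e * (L ^+ 3 + X).
  by rewrite normrM mulrCA; apply: ler_pM => //; rewrite mulr_ge0.
have t2 : e^-1 * y <= e.
  by rewrite mulrC ler_pdivrMr// -expr2 (le_trans (ler_norm _)).
have t3 := ler_normD (a0 * m0 + a1 * m1) i; have t4 := ler_normD (a0 * m0) (a1 * m1).
have t5 := ler_wpM2r X0 g3; have t6 := ler_wpM2r Z0 g3.
have t7 := mulr_ge0 (ltW e0) X0; have t8 := mulr_ge0 (ltW e0) Z0.
have eps0 : 0 < eps := lt_le_trans e0 g3.
have t9 := mulr_ge0 (ltW eps0) X0; have t10 := mulr_ge0 (ltW eps0) Z0.
lra.
Qed.

Lemma aff_cvg (p : nat -> R -> R) : moment0 (p n) @[n --> \oo] --> (0 : R) ->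
  moment1 (p n) @[n --> \oo] --> (0 : R) ->
  aff0 (p n) @[n --> \oo] --> (0 : R) /\ aff1 (p n) @[n --> \oo] --> (0 : R).
Proof.
move=> h0 h1; have ha1 : aff1 (p n) @[n --> \oo] --> (0 : R).
  have z : 12 / L ^+ 3 * (0 - L / 2 * 0) = 0 :> R by rewrite mulr0 subr0 mulr0.
  rewrite -[X in _ --> X]z.
  by apply: cvgM; [exact: cvg_cst|apply: cvgB => //; apply: cvgM => //; exact: cvg_cst].
have z : 0 * L^-1 - 0 * L / 2 = 0 :> R by rewrite !mul0r subr0.
split => //; rewrite -[X in _ --> X]z.
apply: cvgB; apply: cvgM; try exact: cvg_cst; first exact: h0.
by apply: cvgM => //; exact: cvg_cst.
Qed.

Lemma JJ_rem_cvg (p : nat -> R -> R) x : (forall n, xf L (p n)) -> 0 < x < L ->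
  moment0 (p n) @[n --> \oo] --> (0 : R) -> moment1 (p n) @[n --> \oo] --> (0 : R) ->
  J (J (p n)) x @[n --> \oo] --> (0 : R) -> J (J (rem (p n))) x @[n --> \oo] --> (0 : R).
Proof.
move=> xp xL h0 h1 h2; have [c0 c1] := aff_cvg h0 h1.
have x1 : xf L ((cst (1 : R)) \_ `]0, L[) by apply: xf_cst_itv; exact: cst_continuous.
have xi : xf L (id \_ `]0, L[) by apply: xf_cst_itv => y; exact: cvg_id.
have E n : J (J (rem (p n))) x = 1 * J (J (p n)) x + (-1) *
    (aff0 (p n) * J (J ((cst (1 : R)) \_ `]0, L[)) x + aff1 (p n) * J (J (id \_ `]0, L[)) x).
  rewrite /rem (JJ_lin _ _ (xf_locint (xp n)) (xf_locint (xf_aff (p n)))).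
  have -> : aff (p n) = (fun y => aff0 (p n) * ((cst (1 : R)) \_ `]0, L[) y + aff1 (p n) * (id \_ `]0, L[) y).
    apply/funext => y; rewrite /aff !patchE; case: ifP => _; first by rewrite mulr1.
    by rewrite -[point]/(0 : R) !mulr0 addr0.
  by rewrite (JJ_lin _ _ (xf_locint x1) (xf_locint xi)).
pose A := J (J ((cst (1 : R)) \_ `]0, L[)) x; pose B := J (J (id \_ `]0, L[)) x.
have H : 1 * J (J (p n)) x + (-1) * (aff0 (p n) * A + aff1 (p n) * B) @[n --> \oo] -->
    1 * 0 + (-1) * (0 * A + 0 * B).
  apply: cvgD; apply: cvgM; try exact: cvg_cst; first exact: h2.
  by apply: cvgD; apply: cvgM => //; exact: cvg_cst.
rewrite (_ : 1 * 0 + (-1) * (0 * A + 0 * B) = 0) in H; last by rewrite !mul0r !addr0 !mulr0 addr0.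
by apply: cvg_trans H; apply: near_eq_cvg; apply: nearW => n; rewrite E.
Qed.

(** The affine projection of [p n] is small through its two coefficients. The remainder has null
    moments, so its pairing with S is that of its double primitive with [z]; this double primitive
    tends to 0 pointwise and boundedly, hence in L2, at a rate independent of S. The role of [g] is
    the uniform L2 bound on the remainders. *)
Lemma weak_osc (p g : nat -> R -> R) (al be : nat -> R) (C : R) : 0 <= C ->
  (forall n, xf L (p n)) -> (forall n, xf L (g n)) ->
  (forall n, {ae leb, forall x, 0 < x < L -> p n x = al n + be n * x + g n x}) ->
  (forall n, \int[leb]_x (g n x ^+ 2) <= C) ->
  moment0 (p n) @[n --> \oo] --> (0 : R) -> moment1 (p n) @[n --> \oo] --> (0 : R) ->
  (forall x, 0 < x < L -> J (J (p n)) x @[n --> \oo] --> (0 : R)) ->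
  forall eps, 0 < eps -> \forall n \near \oo, osc L eps (p n).
Proof.
move=> C0 xp xg hp gC h0 h1 h2 eps eps0.
have [c0 c1] := aff_cvg h0 h1.
pose D : set (measurableTypeR R) := `]0, L[.
have mD : measurable D by exact: measurable_itv.
pose f_ n (x : measurableTypeR R) : \bar R := ((J (J (rem (p n))) x) ^+ 2)%:E.
have bR n : \int[leb]_y (rem (p n) y ^+ 2) <= C := le_trans (rem_le (xp n) (xg n) (hp n)) (gC n).
have cJJ n : continuous (J (J (rem (p n)))).
  apply: J_continuous; apply: continuous_locint; apply: J_continuous.
  exact: (xf_locint (xf_rem (xp n))).
have mf n : measurable_fun D (f_ n).
  apply/measurable_EFinP; apply: measurable_funX; apply: measurable_funTS.
  exact: continuous_measurable_fun (cJJ n).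
pose K := L * (L + C); have K0 : 0 <= K by rewrite mulr_ge0 ?addr_ge0// ltW.
have fK n x : D x -> (`|f_ n x| <= (K ^+ 2)%:E)%E.
  rewrite /D /= in_itv/= => xL; rewrite /f_ lee_fin ger0_norm ?sqr_ge0//.
  rewrite -(real_normK (num_real (J _ x))) ler_sqr ?nnegrE//.
  exact: (JJ_bound (xf_rem (xp n)) C0 (bR n) xL).
have gi : leb.-integrable D (cst (K ^+ 2)%:E).
  apply/integrableP; split; first exact: measurable_cst.
  by rewrite integral_cst//= lebesgue_measure_itv/= lte_fin L0 -EFinD -EFinM ltry.
have cf x : D x -> f_ n x @[n --> \oo] --> (0%R : R)%:E.
  rewrite /D /= in_itv/= => xL; apply: cvg_EFin; first by apply: nearW.
  have H : J (J (rem (p n))) x * J (J (rem (p n))) x @[n --> \oo] --> (0 : R) * 0.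
    have l1 := JJ_rem_cvg xp xL h0 h1 (h2 _ xL); exact: (cvgM l1 l1).
  by rewrite mulr0 in H; exact: H.
have [_ _ lim0] := @dominated_convergence _ (measurableTypeR R) R leb D mD f_ (cst (0%R : R)%:E)
  (cst (K ^+ 2)%:E) mf (measurable_cst _) (aeW leb cf) gi (aeW leb (fun x n => @fK n x)).
rewrite integral_cst//= mul0e in lim0.
have sqR n : sqi leb ((J (J (rem (p n)))) \_ `]0, L[) := (xf_cst_itv (cJJ n)).1.
pose Y n := \int[leb]_x (((J (J (rem (p n)))) \_ `]0, L[) x ^+ 2).
have YE n : (Y n)%:E = (\int[leb]_(x in D) f_ n x)%E.
  rewrite /Y -(sqi_Q (sqR n)) /Q [RHS]integral_mkcond; apply: eq_integral => x _.
  by rewrite !patchE; case: ifP => // _; rewrite expr0n.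
have Y0 : Y n @[n --> \oo] --> (0 : R).
  have /fine_cvgP[_] := lim0; apply: cvg_trans; apply: near_eq_cvg; apply: nearW => n.
  by rewrite /= -YE.
(* One denominator serves the three requirements of [osc_arith], due to the two affine coefficients
   and to the remainder. *)
have [e1 e1L] : exists2 e : R, 0 < e & [/\ e * (1 + L) <= eps, e * (1 + L ^+ 3) <= eps & e <= eps].
  exists (eps / (1 + L + L ^+ 3)).
    by rewrite divr_gt0// !addr_gt0// exprn_gt0.
  have L3 : 0 < L ^+ 3 by rewrite exprn_gt0.
  have s0 : 0 < 1 + L + L ^+ 3 by rewrite !addr_gt0.
  split; rewrite ?[_ / _ * _]mulrAC ler_pdivrMr// ?ler_wpM2l ?(ltW eps0)//; try by move: (ltW L3) (ltW L0); lra.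
  by rewrite ler_peMr ?(ltW eps0)//; move: (ltW L3) (ltW L0); lra.
move=> [g1 g2 g3].
have ee : 0 < e1 ^+ 2 by rewrite exprn_gt0.
have /cvgr0Pnorm_lt/(_ _ e1L) n0 := c0; have /cvgr0Pnorm_lt/(_ _ e1L) n1 := c1.
have /cvgr0Pnorm_lt/(_ _ ee) nY := Y0.
near=> n.
have a0 : `|aff0 (p n)| < e1 by near: n.
have a1 : `|aff1 (p n)| < e1 by near: n.
have yn : `|Y n| < e1 ^+ 2 by near: n.
move=> S z xS xz r1.
have xr := xf_rem (xp n); have [m0 m1] := rem_moments (xp n).
have xa := xf_aff (p n).
have i1 := sqi_mul xa.1 xS.1; have i2 := sqi_mul xr.1 xS.1.
have E : \int[leb]_x (p n x * S x) = aff0 (p n) * moment0 S + aff1 (p n) * moment1 S +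
    \int[leb]_x (((J (J (rem (p n)))) \_ `]0, L[) x * z x).
  rewrite -(affine_test _ _ xS) -/(aff (p n)).
  rewrite (_ : \int[leb]_x (((J (J (rem (p n)))) \_ `]0, L[) x * z x) = \int[leb]_x (rem (p n) x * S x)).
    rewrite -[X in X + _]mul1r -[X in _ + X]mul1r -(Rintegral_lin 1 1 measurableT i1 i2).
    by apply: eq_Rintegral => x _; rewrite /rem; ring.
  rewrite (orthogonal_Rintegral xr xz xS m0 m1 r1); apply: eq_Rintegral => x _.
  rewrite patchE mem_setE in_itv/= mulrC; case: ifPn => // xL; by rewrite (xz.2 x xL) !mul0r.
have [q0 [q1 qz]] : 2 * `|moment0 S| <= L + \int[leb]_x (S x ^+ 2) /\
    (2 * `|moment1 S| <= L ^+ 3 + \int[leb]_x (S x ^+ 2) /\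
     2 * `|\int[leb]_x (((J (J (rem (p n)))) \_ `]0, L[) x * z x)| <=
       e1^-1 * Y n + e1 * \int[leb]_x (z x ^+ 2)).
  have x1 : xf L ((cst (1 : R)) \_ `]0, L[) by apply: xf_cst_itv; exact: cst_continuous.
  have xi : xf L (id \_ `]0, L[) by apply: xf_cst_itv => y; exact: cvg_id.
  have [_ l2] := moments_affine 0 1.
  have s1 : \int[leb]_x (((cst (1 : R)) \_ `]0, L[) x ^+ 2) = L.
    have [E1 _] := moments_affine 1 0; rewrite mul0r mul1r addr0 in E1.
    rewrite -[RHS]E1; apply: eq_Rintegral => x _; rewrite !patchE; case: ifP => _.
      by rewrite expr1n mul0r addr0.
    by rewrite -[point]/(0 : R) expr0n.
  have s2 : \int[leb]_x ((id \_ `]0, L[) x ^+ 2) = L ^+ 3 / 3.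
    rewrite mul0r mul1r add0r in l2.
    rewrite -[RHS]l2; apply: eq_Rintegral => x _; rewrite !patchE; case: ifP => _.
      by rewrite add0r mul1r expr2.
    by rewrite -[point]/(0 : R) expr0n mulr0.
  have L3 : L ^+ 3 / 3 <= L ^+ 3.
    by rewrite ler_pdivrMr// ler_peMr ?exprn_ge0 ?(ltW L0)// ler1n.
  split; last split; last exact: (Young_Rintegral e1L (sqR n) xz.1).
    have Yg := Young_Rintegral ltr01 x1.1 xS.1; rewrite invr1 !mul1r s1 in Yg.
    have M : moment0 S = \int[leb]_x (((cst (1 : R)) \_ `]0, L[) x * S x).
      apply: eq_Rintegral => x _; rewrite patchE mem_setE in_itv/=; case: ifPn => [_|xL]; first by rewrite mul1r.
      by rewrite (xS.2 x xL) mulr0.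
    by rewrite M.
  have Yg := Young_Rintegral ltr01 xi.1 xS.1; rewrite invr1 !mul1r s2 in Yg.
  have M : moment1 S = \int[leb]_x ((id \_ `]0, L[) x * S x).
    apply: eq_Rintegral => x _; rewrite patchE mem_setE in_itv/=; case: ifPn => [_//|xL].
    by rewrite (xS.2 x xL) !mulr0.
  by rewrite M; apply: le_trans Yg _; rewrite lerD2r.
have S0 : 0 <= \int[leb]_x (S x ^+ 2) by apply: Rintegral_ge0 => x _; exact: sqr_ge0.
have z0 : 0 <= \int[leb]_x (z x ^+ 2) by apply: Rintegral_ge0 => x _; exact: sqr_ge0.
rewrite E; exact: osc_arith e1L g1 g2 g3 (ltW a0) (ltW a1) (ltW yn) q0 q1 qz S0 z0.
Unshelve. all: by end_near. Qed.

Lemma patch_Rintegral_sqr_le (p : R -> R) (K : R) : continuous p ->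
  (forall x, 0 < x < L -> `|p x| <= K) -> \int[leb]_x ((p \_ `]0, L[) x ^+ 2) <= K ^+ 2 * L.
Proof.
move=> cp hK; have [+ _] := moments_affine (K ^+ 2) 0; rewrite mul0r addr0 => <-.
have x1 : xf L ((fun x : R => K ^+ 2 + 0 * x) \_ `]0, L[).
  apply: xf_cst_itv => x; apply: cvgD; first exact: cvg_cst.
  by apply: cvgM; [exact: cvg_cst|exact: cvg_id].
apply: le_Rintegral => //.
- exact: sqi_sqr (xf_cst_itv cp).1.
- exact: xf_rint x1.
move=> x _; rewrite !patchE mem_setE in_itv/=; case: ifPn => xL; last by rewrite expr0n.
rewrite mul0r addr0 -(real_normK (num_real (p x))) ler_sqr ?nnegrE ?hK//.
exact: le_trans (normr_ge0 _) (hK x xL).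
Qed.

(** A bound on an upper limit only holds from some index on; the sequence is shifted by that index
    and shifted back. *)
Lemma weak_osc_near (p g : nat -> R -> R) (C : R) : 0 <= C ->
  (forall n, xf L (p n)) ->
  (\forall n \near \oo, [/\ xf L (g n), (exists a b : R,
      {ae leb, forall x, 0 < x < L -> p n x = a + b * x + g n x}) &
      \int[leb]_x (g n x ^+ 2) <= C]) ->
  moment0 (p n) @[n --> \oo] --> (0 : R) -> moment1 (p n) @[n --> \oo] --> (0 : R) ->
  (forall x, 0 < x < L -> J (J (p n)) x @[n --> \oo] --> (0 : R)) ->
  forall eps, 0 < eps -> \forall n \near \oo, osc L eps (p n).
Proof.
move=> C0 xp [N0 _ hg] h0 h1 h2 eps eps0.
have hN n := hg (n + N0)%N (leq_addl n N0).
have /choice[c hc] : forall n, exists c : R * R,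
    {ae leb, forall x, 0 < x < L -> p (n + N0)%N x = c.1 + c.2 * x + g (n + N0)%N x}.
  by move=> n; have [_ [a [b h]] _] := hN n; exists (a, b).
have sh (a : nat -> R) : a n @[n --> \oo] --> (0 : R) -> a (n + N0)%N @[n --> \oo] --> (0 : R).
  by move=> h; exact: (cvg_comp _ _ (cvg_addnr N0) h).
have xg n : xf L (g (n + N0)%N) by have [] := hN n.
have gC n : \int[leb]_x (g (n + N0)%N x ^+ 2) <= C by have [] := hN n.
have [N1 _ hN1] := weak_osc C0 (fun n => xp (n + N0)%N) xg hc gC (sh _ h0) (sh _ h1)
  (fun x hx => sh _ (h2 x hx)) eps0.
exists (N0 + N1)%N => // m /= hm.
have e : (m - N0 + N0)%N = m by rewrite subnK// (leq_trans (leq_addr _ _) hm).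
by rewrite -e; apply: hN1; rewrite /= -(leq_add2r N0) e addnC.
Qed.

End weak_oscillation.

(** * Uniqueness and linearity of weak derivatives *)

Section uniqueness.
Context {R : realType}.
Local Notation leb := (@lebesgue_measure R).
Local Notation leb2 := (leb \x leb)%E.
Implicit Types (F G : R * R -> R) (t x r : R).

Lemma continuous_ae0 (g : R -> R) : continuous g -> {ae leb, forall r, g r = 0} -> g = cst 0.
Proof.
move=> cg h; apply/funext => x /=; apply/eqP; apply: contrapT => /negP gx.
have gx0 : 0 < `|g x| by rewrite normr_gt0.
have /cvgrPdist_lt /(_ _ gx0)[d /= d0 hd] := cg x.
have xd : x < x + d by rewrite ltrDl.
have [y /andP[xy yd] gy] := ae_point xd h.
have := hd y; rewrite /= gy subr0 ltxx => hh.
have : false by apply: hh; rewrite distrC gtr0_norm ?subr_gt0// ltrBlDl.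
by [].
Qed.

(** For a fixed space bump, testing in time shows that the pairing vanishes for almost every time.
    Time primitives then vanish at each [r] for almost every point, hence identically in time by
    continuity, and Lebesgue differentiation returns to [F]. *)
Lemma tensor_orthogonal F (a b a' b' : R) : 0 <= a -> 0 <= a' -> rint leb2 setT F ->
  (forall t x, ~~ ((a < t < b) && (a' < x < b')) -> F (t, x) = 0) ->
  (forall c d c' d' n n', a < c -> c < d -> d < b -> a' < c' -> c' < d' -> d' < b' ->
    \int[leb2]_p (F p * (flat_bump c d n p.1 * flat_bump c' d' n' p.2)) = 0) ->
  {ae leb, forall t, {ae leb, forall x, F (t, x) = 0}}.
Proof.
move=> a0 a'0 Fi Fout Forth.
have mF : measurable_fun setT F := rint_measurable Fi.
pose f x t := F (t, x).
have jf : jm f by rewrite /jm; apply: (eq_measurable_fun F) => // -[t x].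
have bnd (K : R * R -> R) : measurable_fun setT K -> (forall p, `|K p| <= 1) ->
    rint leb2 setT (fun p => F p * K p).
  move=> mK K1; apply: (rint_dom _ _ _ (rint_abs Fi)) => //; first exact: measurable_funM.
  by move=> p _; rewrite normrM ler_piMr.
have fb1 c d n y : `|flat_bump c d n y : R| <= 1.
  by rewrite ger0_norm ?flat_bump_ge0// flat_bump_le1.
have mb c d n : measurable_fun setT (flat_bump c d n : R -> R).
  by apply: continuous_measurable_fun; exact: flat_bump_continuous.
have m1 (g : R -> R) : measurable_fun setT g -> measurable_fun setT (fun p : R * R => g p.1).
  by move=> mg; exact: (measurableT_comp mg).
have m2 (g : R -> R) : measurable_fun setT g -> measurable_fun setT (fun p : R * R => g p.2).
  by move=> mg; exact: (measurableT_comp mg).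
have aeF1 : {ae leb, forall t, rint leb setT (fun x => F (t, x))} by exact: ae_integrable1 Fi.
have sec c' d' n' : a' < c' -> c' < d' -> d' < b' ->
    {ae leb, forall t, \int[leb]_x (F (t, x) * flat_bump c' d' n' x) = 0}.
  move=> h1 h2 h3; have psii := bnd _ (m2 _ (mb c' d' n')) (fun p => fb1 c' d' n' p.2).
  have si := rint_fubini1 psii.
  have h : {ae leb, forall t, a < t < b -> \int[leb]_x (F (t, x) * flat_bump c' d' n' x) = 0}.
    apply: (flat_bump_orthogonal a0 si) => c d n h4 h5 h6.
    have KK1 (p : R * R) : `|flat_bump c d n p.1 * flat_bump c' d' n' p.2| <= 1.
      by rewrite normrM mulr_ile1.
    have Ki := bnd _ (measurable_funM (m1 _ (mb c d n)) (m2 _ (mb c' d' n'))) KK1.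
    have E := Forth c d c' d' n n' h4 h5 h6 h1 h2 h3; rewrite (Rintegral_prod1 Ki) in E.
    rewrite -[RHS]E; apply: ae_eq_Rintegral => //.
    - exact: (measurable_funM (rint_measurable si) (mb c d n)).
    - exact: rint_measurable (rint_fubini1 Ki).
    apply: (ae_imp aeF1) => t Ft _ /=.
    have it : rint leb setT (fun x => F (t, x) * flat_bump c' d' n' x).
      apply: (rint_dom _ _ _ (rint_abs Ft)) => //.
        exact: (measurable_funM (rint_measurable Ft) (mb c' d' n')).
      by move=> x _; rewrite normrM ler_piMr.
    rewrite mulrC -(RintegralZl (flat_bump c d n t) measurableT it).
    by apply: eq_Rintegral => x _; rewrite mulrCA.
  apply: (ae_imp h) => t ht; have [/ht//|tab] := boolP (a < t < b).
  rewrite (@eq_Rintegral _ _ _ leb _ (cst 0)); first by rewrite Rintegral_cst// mul0r.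
  by move=> x _; rewrite Fout ?mul0r// negb_and tab.
have chi1 r s : `|((cst (1 : R)) \_ `[0, r]) s| <= 1.
  by rewrite patchE; case: ifP => _; rewrite ?normr1// -[point]/(0 : R) normr0.
have mchi r : measurable_fun setT ((cst (1 : R)) \_ `[0, r]).
  by apply/(measurable_restrictT _ _).1.
have Jf r x : J (f x) r = \int[leb]_t (F (t, x) * ((cst (1 : R)) \_ `[0, r]) t).
  rewrite /J Rintegral_mkcond; apply: eq_Rintegral => t _; rewrite !patchE.
  by case: ifP => _; rewrite ?mulr1// -[point]/(0 : R) mulr0.
have aeF2 : {ae leb, forall x, rint leb setT (fun t => F (t, x))} by exact: ae_integrable2 Fi.
(* The exceptional times found so far depend on the space bump; integrating over [[0, r]] erases
   them, after which all bumps can be used together. *)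
have zJ r : {ae leb, forall x, J (f x) r = 0}.
  have Ji : rint leb setT (fun x => J (f x) r).
    under eq_fun do rewrite Jf.
    exact: (rint_fubini2 (bnd _ (m1 _ (mchi r)) (fun p => chi1 r p.1))).
  have h : {ae leb, forall x, a' < x < b' -> J (f x) r = 0}.
    apply: (flat_bump_orthogonal a'0 Ji) => c' d' n' h1 h2 h3.
    have KK1 (p : R * R) : `|((cst (1 : R)) \_ `[0, r]) p.1 * flat_bump c' d' n' p.2| <= 1.
      by rewrite normrM mulr_ile1.
    have Ki := bnd _ (measurable_funM (m1 _ (mchi r)) (m2 _ (mb c' d' n'))) KK1.
    transitivity (\int[leb]_x \int[leb]_t (F (t, x) * (((cst (1 : R)) \_ `[0, r]) t * flat_bump c' d' n' x))).
      apply: ae_eq_Rintegral => //.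
      - exact: (measurable_funM (rint_measurable Ji) (mb c' d' n')).
      - exact: rint_measurable (rint_fubini2 Ki).
      apply: (ae_imp aeF2) => x Fx _.
      have ix : rint leb setT (fun t => F (t, x) * ((cst (1 : R)) \_ `[0, r]) t).
        apply: (rint_dom _ _ _ (rint_abs Fx)) => //.
          exact: (measurable_funM (rint_measurable Fx) (mchi r)).
        by move=> t _; rewrite normrM ler_piMr.
      rewrite Jf mulrC -(RintegralZl (flat_bump c' d' n' x) measurableT ix).
      by apply: eq_Rintegral => t _; rewrite mulrC mulrA.
    rewrite -(Rintegral_swap Ki) -[RHS](_ : \int[leb]_t (cst (0 : R)) t = 0); last first.
      by rewrite Rintegral_cst// mul0r.
    apply: ae_eq_Rintegral => //; first exact: rint_measurable (rint_fubini1 Ki).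
    apply: (ae_imp2 aeF1 (sec c' d' n' h1 h2 h3)) => t Ft st _ /=.
    have it : rint leb setT (fun x => F (t, x) * flat_bump c' d' n' x).
      apply: (rint_dom _ _ _ (rint_abs Ft)) => //.
        exact: (measurable_funM (rint_measurable Ft) (mb c' d' n')).
      by move=> x _; rewrite normrM ler_piMr.
    rewrite -[RHS](mulr0 (((cst (1 : R)) \_ `[0, r]) t)) -st -(RintegralZl _ measurableT it).
    by apply: eq_Rintegral => x _; rewrite mulrCA.
  apply: (ae_imp h) => x hx; have [/hx//|xab] := boolP (a' < x < b').
  rewrite /J (@eq_Rintegral _ _ _ leb _ (cst 0)); first by rewrite Rintegral_cst// mul0r.
  by move=> t _; rewrite /f Fout// negb_and xab orbT.
have jJ := jm_J jf.
pose B : set (measurableTypeR R * measurableTypeR R) := [set p | J (f p.1) p.2 != 0].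
have mB : measurable B.
  have mJ : measurable_fun setT (fun p : measurableTypeR R * measurableTypeR R => J (f p.1) p.2).
    have := measurableT_comp (jJ : measurable_fun setT (fun p : measurableTypeR R * measurableTypeR R => J (f p.2) p.1)) (@measurable_swap _ _ (measurableTypeR R) (measurableTypeR R)).
    by apply: eq_measurable_fun => -[].
  rewrite (_ : B = setT `&` (fun p => J (f p.1) p.2) @^-1` (~` [set 0])).
    by apply: mJ => //; apply: measurableC.
  by apply/seteqP; split => p /=; [move=> /eqP|case=> _ /eqP].
have swJ := @ae_swap _ _ (measurableTypeR R) (measurableTypeR R) R leb leb B mB.
have aeJ : {ae leb, forall x, {ae leb, forall r, ~ B (x, r)}}.
  apply: swJ; apply: aeW => r; apply: (ae_imp (zJ r)) => x hx.
  by rewrite /B /= hx eqxx.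
pose B2 : set (measurableTypeR R * measurableTypeR R) := [set p | F p != 0].
have mB2 : measurable B2.
  rewrite (_ : B2 = setT `&` F @^-1` (~` [set 0])).
    by apply: mF => //; apply: measurableC.
  by apply/seteqP; split => p /=; [move=> /eqP|case=> _ /eqP].
have sw2 := @ae_swap _ _ (measurableTypeR R) (measurableTypeR R) R leb leb B2 mB2.
have fin : {ae leb, forall t, {ae leb, forall x, ~ B2 (t, x)}}.
  apply: sw2; apply: (ae_imp2 aeF2 aeJ) => x Fx hJ.
  have lx : locint (f x) by move=> M; exact: (rintS measurableT _ _ Fx).
  have J0 : J (f x) = cst 0.
    apply: continuous_ae0; first exact: J_continuous.
    by apply: (ae_imp hJ) => r /negP; rewrite negbK => /eqP.
  apply: (ae_imp (ae_avg_cvg 0 lx)) => t ht; apply/negP; rewrite /B2/= negbK.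
  have [t0|t0] := leP t 0.
    by rewrite Fout// !negb_and -leNgt (le_trans t0 a0).
  have h2 : iter 1 (avg n.+1%:R^-1) (f x) t @[n --> \oo] --> (0 : R).
    under eq_fun do rewrite /= /avg J0 /Dq /= subrr mulr0.
    exact: cvg_cst.
  by apply/eqP; exact: (cvg_unique (@Rhausdorff R) (ht t0) h2).
apply: (ae_imp fin) => t ht; apply: (ae_imp ht) => x /negP; rewrite /B2/= negbK.
by move=> /eqP.
Qed.

Lemma wpartial_unique (L : R) w F G1 G2 : 0 < L -> is_wpartial L w F G1 -> is_wpartial L w F G2 ->
  forall T, 0 < T -> {ae leb, forall t, {ae leb, forall x, 0 < t < T -> 0 < x < L -> G1 (t, x) = G2 (t, x)}}.
Proof.
move=> L0 [_ lG1 e1] [_ lG2 e2] T T0.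
have mC : measurable (cylinder L : set (measurableTypeR R * measurableTypeR R)).
  exact: measurable_cylinder.
have [_ iG1] := lG1; have [_ iG2] := lG2.
(* Local integrability says nothing up to the boundary: the difference is tested in boxes at
   distance [a n] from time 0 and from both ends in space, which exhaust the region. *)
pose a n : R := n.+1%:R^-1.
have an n : 0 < a n by rewrite invr_gt0.
pose Bx n : set (measurableTypeR R * measurableTypeR R) := `]a n, T[ `*` `]a n, L - a n[.
pose D p := G1 p - G2 p.
pose H n := D \_ (Bx n).
have mBx n : measurable (Bx n) by apply: measurableX.
have BC n : `[a n, T] `*` `[a n, L - a n] `<=` cylinder L.
  by apply: box_cylinder => //; rewrite ltrBlDr ltrDl.
have Di n : rint leb2 (`[a n, T] `*` `[a n, L - a n]) D.
  apply: rintB; first exact: measurable_box.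
  - exact: (iG1 _ (@compact_box R (a n) T (a n) (L - a n)) (BC n)).
  - exact: (iG2 _ (@compact_box R (a n) T (a n) (L - a n)) (BC n)).
have sB n : Bx n `<=` `[a n, T] `*` `[a n, L - a n].
  move=> p [/=]; rewrite !in_itv/= => /andP[h1 h2] /andP[h3 h4].
  by split; apply/andP; split; exact: ltW.
have Hi n : rint leb2 setT (H n).
  apply: rint_patch => //; apply: (rintS _ _ (sB n) (Di n)) => //; exact: measurable_box.
have z n : {ae leb, forall t, {ae leb, forall x, H n (t, x) = 0}}.
  apply: (@tensor_orthogonal (H n) (a n) T (a n) (L - a n)) => //; try exact: ltW.
    move=> t x hh; rewrite /H patchE; case: ifPn => //; rewrite inE => -[/=].
    by rewrite !in_itv/= => h1 h2; move: hh; rewrite h1 h2.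
  move=> c d c' d' m m' h1 h2 h3 h4 h5 h6.
  have sb := @smooth1_flat_bump R c d m; have sb' := @smooth1_flat_bump R c' d' m'.
  have supb : supp c d (flat_bump c d m : R -> R) by move=> x; exact: flat_bump_out.
  have supb' : supp c' d' (flat_bump c' d' m' : R -> R) by move=> x; exact: flat_bump_out.
  pose phi := tensor (flat_bump c d m) (flat_bump c' d' m').
  have tf : test_function (cylinder L) phi.
    apply: (tensor_test_function sb sb' supb supb'); apply: box_cylinder.
    - exact: lt_trans h1.
    - exact: lt_trans h4.
    - by rewrite (lt_trans h6)// ltrBlDr ltrDl.
  have i1 := test_rint L0 [::] lG1 tf; have i2 := test_rint L0 [::] lG2 tf.
  have E : \int[leb2]_(p in cylinder L) (G1 p * phi p) = \int[leb2]_(p in cylinder L) (G2 p * phi p).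
    have s0 : (-1 : R) ^+ size w != 0 by rewrite signr_eq0.
    by apply: (mulfI s0); rewrite -e1// -e2.
  have E2 := Rintegral_lin 1 (-1) mC i1 i2.
  rewrite /iter_derive /= in E2; rewrite E mul1r mulN1r subrr in E2.
  rewrite -[RHS]E2 [RHS]Rintegral_mkcond; apply: eq_Rintegral => p _.
  rewrite /H !patchE -/(tensor _ _ p) -/phi.
  have [pB|pB] := boolP (p \in Bx n).
    rewrite ifT; last by rewrite inE; apply: (BC n); apply: sB; exact: set_mem.
    by rewrite /D mul1r mulN1r mulrBl.
  have p0 : phi p = 0.
    rewrite /phi /tensor; have [hc|hc] := boolP (c < p.1 < d); last by rewrite flat_bump_out// mul0r.
    have [hc'|hc'] := boolP (c' < p.2 < d'); last by rewrite (flat_bump_out _ hc') mulr0.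
    move/andP: hc => [g1 g2]; move/andP: hc' => [g3 g4]; exfalso; move/negP: pB; apply.
    rewrite inE; split; rewrite /= in_itv/=.
      by rewrite (lt_trans h1 g1) (lt_trans g2 h3).
    by rewrite (lt_trans h4 g3) (lt_trans g4 h6).
  by rewrite p0 -[point]/(0 : R) mul0r; case: ifP => _ //; rewrite !mulr0 addr0.
apply: (ae_imp (ae_foralln z)) => t ht.
apply: (ae_imp (ae_foralln ht)) => x hx /andP[t0 tT] /andP[x0 xL].
have m0 : 0 < Num.min t (Num.min x (L - x)) by rewrite !lt_min t0 x0 subr_gt0.
have [n hn] : exists n, a n < Num.min t (Num.min x (L - x)).
  exists (Num.truncn (Num.min t (Num.min x (L - x)))^-1).
  by rewrite /a -[X in _ < X]invrK ltf_pV2 ?posrE ?invr_gt0// truncnS_gt.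
move: hn; rewrite !lt_min => /andP[n1 /andP[n2 n3]].
have := hx n; rewrite /H patchE ifT; last first.
  by rewrite inE; split; rewrite /= in_itv/= ?n1// n2 ltrBrDr addrC -ltrBrDr.
by move=> /eqP; rewrite /D subr_eq0 => /eqP.
Qed.

Lemma is_wpartialB (L : R) w F1 F2 G1 G2 : 0 < L -> is_wpartial L w F1 G1 -> is_wpartial L w F2 G2 ->
  is_wpartial L w (F1 \- F2) (G1 \- G2).
Proof.
move=> L0 [lF1 lG1 e1] [lF2 lG2 e2].
have mC : measurable (cylinder L : set (measurableTypeR R * measurableTypeR R)).
  exact: measurable_cylinder.
have lB (A1 A2 : R * R -> R) : locally_integrable2 (cylinder L) A1 -> locally_integrable2 (cylinder L) A2 ->
    locally_integrable2 (cylinder L) (A1 \- A2).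
  move=> [m1 i1] [m2 i2]; split; first exact: measurable_funB.
  move=> K cK KL.
  have j1 := i1 K cK KL; have j2 := i2 K cK KL.
  have mK : measurable (K : set (measurableTypeR R * measurableTypeR R)).
    exact: (closed_cylinder_measurable (compact_closed (@norm_hausdorff _ _) cK) KL).
  exact: (rintB mK j1 j2).
split; [exact: lB|exact: lB|].
move=> phi tf.
have i1 := test_rint L0 w lF1 tf; have i2 := test_rint L0 w lF2 tf.
have j1 := test_rint L0 [::] lG1 tf; have j2 := test_rint L0 [::] lG2 tf.
have E1 := Rintegral_lin 1 (-1) mC i1 i2; have E2 := Rintegral_lin 1 (-1) mC j1 j2.
rewrite (e1 phi tf) (e2 phi tf) in E1.
transitivity (1 * ((-1) ^+ size w * \int[leb2]_(p in cylinder L) (G1 p * phi p))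
  + (-1) * ((-1) ^+ size w * \int[leb2]_(p in cylinder L) (G2 p * phi p))).
  by rewrite -E1; apply: eq_Rintegral => p _ /=; rewrite mul1r mulN1r mulrBl.
rewrite (_ : \int[leb2]_(p in cylinder L) ((G1 \- G2) p * phi p) =
  1 * (\int[leb2]_(p in cylinder L) (G1 p * phi p)) + (-1) * (\int[leb2]_(p in cylinder L) (G2 p * phi p))).
  by rewrite !mul1r !mulN1r mulrBr.
by rewrite -[RHS]E2; apply: eq_Rintegral => p _ /=; rewrite mul1r mulN1r mulrBl.
Qed.

End uniqueness.

(** * From small data functionals to small differences *)

Section closeness.
Context {R : realType}.
Variables (L : R).
Hypothesis L0 : 0 < L.
Local Notation leb := (@lebesgue_measure R).
Implicit Types (f g k q : R -> R -> R) (F G u v : R * R -> R).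

Lemma cvg_sum0 (a b : nat -> \bar R) : (forall n, 0 <= a n)%E -> (forall n, 0 <= b n)%E ->
  (forall d : R, 0 < d -> \forall n \near \oo, (a n <= d%:E)%E /\ (b n <= d%:E)%E) ->
  (a n + b n)%E @[n --> \oo] --> 0%E.
Proof.
move=> a0 b0 h.
have bd (x y : \bar R) (d : R) : (0 <= x)%E -> (0 <= y)%E -> (x <= d%:E)%E -> (y <= d%:E)%E ->
    (x + y)%E \is a fin_num /\ `|fine (x + y)%E| <= d + d.
  case: x => [r| |]// ; case: y => [s| |]//; rewrite !lee_fin => r0 s0 rd sd.
  by split => //=; rewrite ger0_norm ?addr_ge0// lerD.
apply/fine_cvgP; split.
  by apply: filterS (h 1 ltr01) => n [h1 h2]; have [] := bd _ _ 1 (a0 n) (b0 n) h1 h2.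
apply/cvgr0Pnorm_le => e e0; have e2 : 0 < e / 2 by rewrite divr_gt0.
apply: filterS (h _ e2) => n [h1 h2]; have [_] := bd _ _ (e / 2) (a0 n) (b0 n) h1 h2.
by rewrite /= -splitr.
Qed.

Lemma limn_esup_lt (a : nat -> \bar R) (c : \bar R) : (limn_esup a < c)%E ->
  \forall n \near \oo, (a n < c)%E.
Proof.
rewrite /limn_esup /limf_esup => /ereal_inf_lt[_ [V hV <-] h].
apply: filterS hV => n Vn; apply: le_lt_trans h; apply: ereal_sup_ubound.
by exists n.
Qed.

Lemma L2_xf (p : R -> R) : L2 L p -> xf L (p \_ `]0, L[).
Proof.
move=> h; split; first exact: L2_sqi.
by move=> x xL; rewrite patchE mem_setE in_itv/= (negbTE xL).
Qed.

Lemma test_moments (X : set (R -> R)) (NX : (R -> R) -> R) (f_ : nat -> R -> R) :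
  (forall p : R -> R, X p -> L2 L p /\ L2norm L p <= NX p) -> (forall n, X (f_ n)) ->
  weak_cvg X NX f_ (fun=> 0) ->
  [/\ moment0 (f_ n \_ `]0, L[) @[n --> \oo] --> (0 : R),
      moment1 (f_ n \_ `]0, L[) @[n --> \oo] --> (0 : R) &
      forall x, 0 < x < L -> J (J (f_ n \_ `]0, L[)) x @[n --> \oo] --> (0 : R)].
Proof.
move=> hX Xf W.
have key (phi : R -> R) (v : nat -> R) : continuous phi ->
    (forall n, v n = \int[leb]_x ((f_ n \_ `]0, L[) x * (phi \_ `]0, L[) x)) ->
    v n @[n --> \oo] --> (0 : R).
  move=> cphi E; have := weak_cvg_test (xf_cst_itv L0 cphi) hX W.
  by apply: cvg_trans; apply: near_eq_cvg; apply: nearW => n; rewrite E.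
have patchM (p phi : R -> R) x : (p \_ `]0, L[) x * (phi \_ `]0, L[) x = (p \_ `]0, L[) x * phi x.
  by rewrite !patchE; case: ifP => // _; rewrite -[point]/(0 : R) !mul0r.
split.
- apply: (key (cst 1)); first exact: cst_continuous.
  by move=> n; apply: eq_Rintegral => x _; rewrite patchM mulr1.
- apply: (key id); first by move=> x; exact: cvg_id.
  by move=> n; apply: eq_Rintegral => x _; rewrite patchM mulrC.
(* By Cauchy's formula the double primitive at [x] is the pairing with the positive part of [x - s],
   a continuous function to which weak convergence applies. *)
move=> x /andP[x0 xL]; pose phi (s : R) := (`|x - s| + (x - s)) / 2.
have csub : continuous (fun s : R => x - s).
  by move=> s; apply: cvgB; [exact: cvg_cst|exact: cvg_id].
apply: (key phi).
  move=> s; apply: cvgM; last exact: cvg_cst.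
  apply: cvgD; last exact: csub.
  by apply: (@continuous_comp _ _ _ (fun s : R => x - s) (fun z => `|z|)); [exact: csub|exact: norm_continuous].
move=> n; have xp := L2_xf (hX _ (Xf n)).1; have lp := xf_locint xp.
rewrite -(J2E x lp) Rintegral_mkcond; apply: eq_Rintegral => s _.
rewrite patchM [in LHS]patchE mem_setE in_itv/= /phi.
have [s0|s0] := leP 0 s; last first.
  by rewrite /= (vanish_causal xp.2 (ltW s0)) mul0r.
have [sx|sx] /= := leP s x.
  by rewrite ger0_norm ?subr_ge0//; congr (_ * _); lra.
by rewrite ltr0_norm ?subr_lt0// addNr mul0r mulr0.
Qed.

Lemma slice_measurable F (t : R) : measurable_fun (cylinder L) F -> 0 < t ->
  measurable_fun setT ((fun x : R => F (t, x)) \_ `]0, L[).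
Proof.
move=> mF t0; have tT : 0 < t < t + 1 by rewrite t0 /= ltrDl ltr01.
by rewrite -(cut_patch L F tT); exact: (jm_slice t (jm_cut (t + 1) mF)).
Qed.

Section uniform_bounds.
Variables (rho mu c B : R) (Phi u0 u1 z : R -> R).
Hypotheses (rho0 : 0 < rho) (mu0 : 0 < mu) (B0 : 0 <= B).
Hypotheses (Phi0 : forall x, 0 <= Phi x) (PhiB : forall x, Phi x <= B) (cPhi : continuous Phi).
Hypotheses (m0 : measurable_fun setT (u0 \_ `]0, L[)) (m1 : measurable_fun setT (u1 \_ `]0, L[))
  (mz : measurable_fun setT (z \_ `]0, L[)).
Hypothesis small : (\int[leb]_(x in `]0%R, L[) ((rho * u1 x ^+ 2 + mu * z x ^+ 2) / 2)%:E < c%:E)%E.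

Let I : set (measurableTypeR R) := `]0, L[.
Let mI : measurable I. Proof. exact: measurable_itv. Qed.

Let mq : measurable_fun I (fun x => (rho * u1 x ^+ 2 + mu * z x ^+ 2) / 2).
Proof.
have n1 := measurable_patch_itv m1; have nz := measurable_patch_itv mz.
apply: measurable_funM => //; apply: measurable_funD; apply: measurable_funM => //;
  exact: measurable_funX.
Qed.

Lemma data_bounds : (Q leb (u1 \_ `]0%R, L[) <= (2 / rho * c)%:E)%E /\
  (Q leb (z \_ `]0%R, L[) <= (2 / mu * c)%:E)%E.
Proof.
have key (p : R -> R) (r : R) : 0 < r -> measurable_fun setT (p \_ `]0, L[) ->
    (forall x, r / 2 * p x ^+ 2 <= (rho * u1 x ^+ 2 + mu * z x ^+ 2) / 2) ->
    (Q leb (p \_ `]0%R, L[) <= (2 / r * c)%:E)%E.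
  move=> r0 mp hp; have r2 : 0 < r / 2 by rewrite divr_gt0.
  have h := le_trans (patch_Q_le r2 mp mq (fun x _ => hp x)) (ltW small).
  rewrite (_ : 2 / r * c = c / (r / 2)); last by field; rewrite gt_eqF.
  by rewrite EFinM muleC lee_pdivlMl.
split; apply: key => // x; have := mulr_ge0 (ltW rho0) (sqr_ge0 (u1 x));
  have := mulr_ge0 (ltW mu0) (sqr_ge0 (z x)); lra.
Qed.

Lemma energy0_le : (\int[leb]_(x in `]0%R, L[)
  ((rho * u1 x ^+ 2 + mu * z x ^+ 2) / 2 + Phi (u0 x))%:E <= (c + B * L)%:E)%E.
Proof.
have q0 x : 0 <= (rho * u1 x ^+ 2 + mu * z x ^+ 2) / 2.
  by rewrite divr_ge0// addr_ge0// mulr_ge0 ?sqr_ge0// ltW.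
apply: (@le_trans _ _ (\int[leb]_(x in I) (((rho * u1 x ^+ 2 + mu * z x ^+ 2) / 2)%:E + B%:E))%E).
  apply: ge0_le_integral => //.
  - by move=> x _; rewrite lee_fin addr_ge0.
  - apply/measurable_EFinP; apply: measurable_funD => //.
    apply: (measurableT_comp _ (measurable_patch_itv m0)); exact: continuous_measurable_fun.
  - by apply: emeasurable_funD => //; exact/measurable_EFinP.
  by move=> x _; rewrite -EFinD lee_fin lerD2l.
have E : (\int[leb]_(x in I) (((rho * u1 x ^+ 2 + mu * z x ^+ 2) / 2)%:E + B%:E) =
    \int[leb]_(x in I) ((rho * u1 x ^+ 2 + mu * z x ^+ 2) / 2)%:E + \int[leb]_(x in I) B%:E)%E.
  by apply: ge0_integralD => //; try (by move=> x _; rewrite lee_fin); exact/measurable_EFinP.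
rewrite E EFinD leeD//; first exact: ltW.
by rewrite integral_cst//= lebesgue_measure_itv/= lte_fin L0 -EFinD -EFinM subr0.
Qed.

Lemma energy_Q_bound (T : R) u : measurable_fun (cylinder L) u ->
  measurable_fun (cylinder L) (wdt L u) -> measurable_fun (cylinder L) (wdxx L u) ->
  {ae leb, forall t, 0 < t -> (energy rho mu L Phi u t <= (c + B * L)%:E)%E} ->
  {ae leb, forall t, 0 < t < T ->
    (Q leb ((fun x => wdxx L u (t, x)) \_ `]0%R, L[) <= (2 / mu * (c + B * L))%:E)%E}.
Proof.
move=> mU mG mK h; apply: (ae_imp h) => t ht /andP[t0 _].
have sU := slice_measurable mU t0; have sG := slice_measurable mG t0.
have sK := slice_measurable mK t0.
have r2 : 0 < mu / 2 by rewrite divr_gt0.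
pose e x := (rho * wdt L u (t, x) ^+ 2 + mu * wdxx L u (t, x) ^+ 2) / 2 + Phi (u (t, x)).
have me : measurable_fun I e.
  have nG := measurable_patch_itv sG; have nK := measurable_patch_itv sK.
  apply: measurable_funD; last first.
    apply: (measurableT_comp _ (measurable_patch_itv sU)); exact: continuous_measurable_fun.
  apply: measurable_funM => //; apply: measurable_funD; apply: measurable_funM => //;
    exact: measurable_funX.
have he x : 0 < x < L -> mu / 2 * wdxx L u (t, x) ^+ 2 <= e x.
  move=> _; rewrite /e; have := mulr_ge0 (ltW rho0) (sqr_ge0 (wdt L u (t, x))).
  have := Phi0 (u (t, x)); lra.
have hh := le_trans (patch_Q_le r2 sK me he) (ht t0).
rewrite (_ : 2 / mu * (c + B * L) = (c + B * L) / (mu / 2)); last by field; rewrite gt_eqF.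
by rewrite EFinM muleC lee_pdivlMl.
Qed.

End uniform_bounds.

Lemma wderive2_measurable (p : R -> R) : H2 L p ->
  measurable_fun setT (wderive L 2 p \_ `]0, L[).
Proof.
move=> [_ _ [z wz _]].
have [_ [mz _ _] _] : is_wderive L 2 p (wderive L 2 p) := xgetPex _ (ex_intro _ z wz).
by apply/(measurable_restrictT _ _).1 => //; exact: measurable_itv.
Qed.

Lemma wderive2_rel1 (p : R -> R) : H2 L p -> sqi leb (wderive L 2 p \_ `]0, L[) ->
  rel1 L (p \_ `]0, L[) (wderive L 2 p \_ `]0, L[).
Proof.
move=> [p2 _ [z wz _]] sz.
have [_ _ W] : is_wderive L 2 p (wderive L 2 p) := xgetPex _ (ex_intro _ z wz).
have xp := L2_xf p2.
have xz : xf L (wderive L 2 p \_ `]0, L[).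
  by split => // x xL; rewrite patchE mem_setE in_itv/= (negbTE xL).
apply: (du_Bois_Reymond2 L0 (xf_rint xz) (xf_rint xp)) => F F1 F2 a b a0 bL d1 d2 sF suF.
have tF : test_function `]0, L[ F.
  apply: (supp_test_function sF suF) => x; rewrite /= !in_itv/= => /andP[ax xb].
  by rewrite (lt_le_trans a0 ax) (le_lt_trans xb bL).
have E (r phi : R -> R) : \int[leb]_x ((r \_ `]0, L[) x * phi x) = \int[leb]_(x in `]0, L[) (r x * phi x).
  rewrite [RHS]Rintegral_mkcond; apply: eq_Rintegral => x _; rewrite !patchE.
  by case: ifP => // _; rewrite -[point]/(0 : R) mul0r.
by rewrite !E -(derive1n2E d1 d2) (W F tF) sqrrN expr1n mul1r.
Qed.

Lemma field_jm (T : R) f : fld T L f -> jm f. Proof. by case=> -[]. Qed.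

Lemma Q_bounded_sub (T : R) f g (cf cg : R) : fld T L f -> fld T L g ->
  Q_bounded T f (fun=> cf) -> Q_bounded T g (fun=> cg) ->
  Q_bounded T (fun x t => 1 * f x t + (-1) * g x t) (fun=> 2 * cf + 2 * cg).
Proof.
move=> Ff Fg hf hg; apply: (ae_imp2 hf hg) => t h1 h2 tT.
have := Q_lin_le 1 (-1) (jm_slice t (field_jm Ff)) (jm_slice t (field_jm Fg)) (h1 tT) (h2 tT).
by rewrite sqrrN !expr1n !mulr1.
Qed.

Lemma space_weak_sub (T : R) f g k q : fld T L f -> fld T L g -> fld T L k -> fld T L q ->
  space_weak T L f k -> space_weak T L g q ->
  space_weak T L (fun x t => 1 * f x t + (-1) * g x t) (fun x t => 1 * k x t + (-1) * q x t).
Proof.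
move=> Ff Fg Fk Fq h1 h2 a b a' b' n psi psi1 psi2 a0 ab bT a'0 b'L d1 d2 spsi supsi.
have cpsi := is_derivative_continuous d1.
have cpsi2 := smooth1_continuous (smooth1_derivative d2 (smooth1_derivative d1 spsi)).
have cb : continuous (flat_bump a b n) by exact: flat_bump_continuous.
have e1 := h1 _ _ _ _ n _ _ _ a0 ab bT a'0 b'L d1 d2 spsi supsi.
have e2 := h2 _ _ _ _ n _ _ _ a0 ab bT a'0 b'L d1 d2 spsi supsi.
have l1 := tint_lin L0 1 (-1) Ff Fg cpsi2 cb; have l2 := tint_lin L0 1 (-1) Fk Fq cpsi cb.
by rewrite /tint in l1 l2; rewrite l1 l2 e1 e2.
Qed.

Lemma time_weak_sub (T : R) f g k q : fld T L f -> fld T L g -> fld T L k -> fld T L q ->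
  time_weak T L f k -> time_weak T L g q ->
  time_weak T L (fun x t => 1 * f x t + (-1) * g x t) (fun x t => 1 * k x t + (-1) * q x t).
Proof.
move=> Ff Fg Fk Fq h1 h2 a b a' b' n th th' a0 bT dth sth suth a'0 ab' b'L.
have cth := is_derivative_continuous dth.
have cth' := smooth1_continuous (smooth1_derivative dth sth).
have cb : continuous (flat_bump a' b' n) by exact: flat_bump_continuous.
have e1 := h1 _ _ _ _ n _ _ a0 bT dth sth suth a'0 ab' b'L.
have e2 := h2 _ _ _ _ n _ _ a0 bT dth sth suth a'0 ab' b'L.
have l1 := tint_lin L0 1 (-1) Ff Fg cb cth'; have l2 := tint_lin L0 1 (-1) Fk Fq cb cth.
by rewrite /tint in l1 l2; rewrite l1 l2 e1 e2 !mulN1r !mul1r opprD.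
Qed.

(** [wpartial] picks an arbitrary representative, so the derivative of the difference agrees with
    the difference of the fields almost everywhere only, by uniqueness; the norm is insensitive to
    this. *)
Lemma wpartial_sub_norm_le (T delta : R) w u v f g : 0 < T -> 0 < delta ->
  (exists G, is_wpartial L w u G) -> (exists G, is_wpartial L w v G) ->
  fld T L f -> fld T L g ->
  represents T L f (wpartial L w u) -> represents T L g (wpartial L w v) ->
  Q_bounded T (fun x t => 1 * f x t + (-1) * g x t) (fun=> delta ^+ 2) ->
  (LooL2norm `]0%R, T[ L (wpartial L w (u \- v)%R) <= delta%:E)%E.
Proof.
move=> T0 de0 eu ev Ff Fg rf rg Qfg.
have Wu : is_wpartial L w u (wpartial L w u) := xgetPex _ eu.
have Wv : is_wpartial L w v (wpartial L w v) := xgetPex _ ev.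
have Wd := is_wpartialB L0 Wu Wv.
have Wd' : is_wpartial L w (u \- v) (wpartial L w (u \- v)) := xgetPex _ (ex_intro _ _ Wd).
apply/(LooL2norm_le _ L _ (ltW de0)).
have uq := wpartial_unique L0 Wd' Wd T0.
apply: (ae_imp2 uq Qfg) => t hu hQ; rewrite /= in_itv/= => tT.
have t0 : 0 < t by case/andP: tT.
have md : measurable_fun (cylinder L) (wpartial L w (u \- v)) by case: Wd' => _ [].
rewrite (_ : Q leb _ = Q leb (fun x : R => 1 * f x t + (-1) * g x t)); first exact: hQ tT.
apply: ae_eq_integral => //.
- by apply/measurable_EFinP; apply: measurable_funX; exact: slice_measurable md t0.
- apply/measurable_EFinP; apply: measurable_funX.
  exact: (jm_slice t (field_jm (fld_lin 1 (-1) Ff Fg))).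
have rfg : {ae leb, forall x, f x t = cutoff T L (wpartial L w u) x t /\
    g x t = cutoff T L (wpartial L w v) x t}.
  by apply: (ae_imp2 rf rg) => x h1 h2; split; [exact: h1|exact: h2].
apply: (ae_imp2 hu rfg) => x hx [h1 h2] _; congr (_%:E); congr (_ ^+ 2).
rewrite h1 h2 /cutoff tT patchE mem_setE in_itv/=; case: ifPn => xL /=.
  by rewrite (hx tT xL) /= mul1r mulN1r.
by rewrite !mulr0 addr0.
Qed.

Lemma source_small_arith (Lam eta : R) : 0 < eta ->
  Lam ^+ 2 * (eta / 2 / (Lam ^+ 2 + 1)) <= eta / 2.
Proof.
move=> eta0; have l1 : 0 < Lam ^+ 2 + 1 by rewrite ltr_wpDl ?sqr_ge0.
by rewrite mulrA ler_pdivrMr// mulrC ler_wpM2l ?lerDl// divr_ge0// ltW.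
Qed.

Lemma difference_bound (T rho mu Lam CE delta : R) : 0 < T -> 0 < rho -> 0 < mu ->
  0 <= Lam -> 0 <= CE -> 0 < delta -> exists2 eps, 0 < eps &
  forall (u v h : R * R -> R) (u0 u1 : R -> R), L2 L u0 -> L2 L u1 ->
    {within closed_cylinder L, continuous u} ->
    (exists G, is_wpartial L [:: e_t] u G) /\ LooL2 L (wdt L u) ->
    (exists G, is_wpartial L [:: e_x; e_x] u G) /\ LooL2 L (wdxx L u) ->
    measurable_fun (cylinder L) h -> (forall p, cylinder L p -> `|h p| <= Lam * `|u p|) ->
    weak_equation rho mu L u0 u1 u h ->
    {ae leb, forall t, 0 < t < T ->
      (Q leb ((fun x => wdxx L u (t, x)) \_ `]0%R, L[) <= CE%:E)%E} ->
    {within closed_cylinder L, continuous v} ->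
    (exists G, is_wpartial L [:: e_t] v G) /\ LooL2 L (wdt L v) ->
    (exists G, is_wpartial L [:: e_x; e_x] v G) /\ LooL2 L (wdxx L v) ->
    weak_equation rho mu L u0 u1 v (fun=> 0) ->
    osc L eps (u0 \_ `]0, L[) -> osc L eps (u1 \_ `]0, L[) ->
    (LooL2norm `]0%R, T[ L (wdt L (u \- v)%R) <= delta%:E)%E /\
    (LooL2norm `]0%R, T[ L (wdxx L (u \- v)%R) <= delta%:E)%E.
Proof.
move=> T0 rho0 mu0 Lam0 CE0 de0; have de2 : 0 < delta ^+ 2 by rewrite exprn_gt0.
have [eta eta0 close] := small_difference T0 L0 rho0 mu0 de2.
(* Such a bound on the solution makes the source at most [eta / 2] in square norm; the factor 2 lost
   on the square of a difference then gives [eta]. *)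
pose d1 := eta / 2 / (Lam ^+ 2 + 1).
have d10 : 0 < d1 by rewrite !divr_gt0// ltr_wpDl ?sqr_ge0.
have [eps eps0 sm] := small_solution T0 L0 Lam rho0 mu0 CE0 d10.
exists eps => // u v h u0 u1 H0 H1 cu [ut ut2] [ux ux2] mh hu W hE cv [vt vt2] [vx vx2] Wv o0 o1.
have x0 := L2_xf H0; have x1 := L2_xf H1.
have [f [g [k [q [[Ff [cf cf0 Qf]] [Fg rg [cg cg0 Qg]] [Fk rk] [Fq hq] [bq sw tw]]]]]] :=
  solution_fields T0 L0 cu ut ut2 ux ux2 mh Lam0 hu W x0 x1.
have mz : @measurable_fun _ _ (R * R)%type R (cylinder L) (fun=> 0) by exact: measurable_cst.
have hz p : cylinder L p -> `|(0 : R)| <= 0 * `|v p| by rewrite normr0 mul0r.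
have [f' [g' [k' [q' [[Ff' _] [Fg' rg' [cg' cg'0 Qg']] [Fk' rk'] [Fq' hq'] [bq' sw' tw']]]]]] :=
  solution_fields T0 L0 cv vt vt2 vx vx2 mz (lexx 0) hz Wv x0 x1.
have Qk : Q_bounded T k (fun=> CE).
  apply: (ae_imp hE) => t ht tT; rewrite (repr_Q t (field_jm Fk) (jm_cut T ux2.1) rk).
  by rewrite (@cut_patch R T L (wdxx L u) t tT); exact: ht tT.
have Qfd : Q_bounded T f (fun=> d1) :=
  sm f k q _ _ cf Ff Fk Fq x0 x1 (beam_eq_weak L0 Ff Fk Fq bq) sw cf0 Qf Qk hq o0 o1.
have Qq : Q_bounded T q (fun=> eta / 2).
  apply: (ae_imp2 hq Qfd) => t h1 h2 tT; apply: le_trans (h1 tT) _.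
  apply: (@le_trans _ _ ((Lam ^+ 2)%:E * d1%:E)%E).
    by apply: lee_wpmul2l; [rewrite lee_fin sqr_ge0|exact: h2 tT].
  by rewrite -EFinM lee_fin; exact: source_small_arith.
have Qq' : Q_bounded T q' (fun=> 0).
  by apply: (ae_imp hq') => t ht tT; apply: le_trans (ht tT) _; rewrite expr0n mul0e.
have Qqq : Q_bounded T (fun x t => 1 * q x t + (-1) * q' x t) (fun=> eta).
  by apply: Q_boundedW (Q_bounded_sub Fq Fq' Qq Qq') => t _; rewrite mulr0 addr0 mulrC divfK.
have B0 : 0 <= 2 * cg + 2 * cg' by rewrite addr_ge0// mulr_ge0.
have [Qgg Qkk] := close _ _ _ _ _ B0 (fld_lin 1 (-1) Ff Ff') (fld_lin 1 (-1) Fg Fg')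
  (fld_lin 1 (-1) Fk Fk') (fld_lin 1 (-1) Fq Fq')
  (beam_eq_weak L0 (fld_lin 1 (-1) Ff Ff') (fld_lin 1 (-1) Fk Fk') (fld_lin 1 (-1) Fq Fq')
    (beam_eq_sub L0 Ff Fk Fq Ff' Fk' Fq' bq bq'))
  (space_weak_sub Ff Ff' Fk Fk' sw sw') (time_weak_sub Ff Ff' Fg Fg' tw tw')
  (Q_bounded_sub Fg Fg' Qg Qg') Qqq.
by split; [exact: (wpartial_sub_norm_le T0 de0 ut vt Fg Fg' rg rg' Qgg)
  |exact: (wpartial_sub_norm_le T0 de0 ux vx Fk Fk' rk rk' Qkk)].
Qed.

End closeness.

Theorem theorem3p4 (R : realType) (L rho mu kappa : R) (Phi : R -> R)
    (u0 u1 : nat -> R -> R) (u v : nat -> R * R -> R)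
    (L_gt0 : 0 < L) (rho_gt0 : 0 < rho) (mu_gt0 : 0 < mu)
    (PhiP : adhesion_potential kappa Phi)
    (u0_H2 : forall n, H2 L (u0 n)) (u1_L2 : forall n, L2 L (u1 n))
    (u_sol : forall n,
       dissipative_solution rho mu L Phi (u0 n) (u1 n) (u n))
    (v_sol : forall n,
       linear_dissipative_solution rho mu L (u0 n) (u1 n) (v n))
    (u0_weak : weak_cvg (H2 L) (H2norm L) u0 (fun=> 0))
    (u1_weak : weak_cvg (L2 L) (L2norm L) u1 (fun=> 0))
    (small : (limn_esup (fun n => \int[@lebesgue_measure R]_(x in `]0%R, L[)
         ((rho * u1 n x ^+ 2 + mu * wderive L 2 (u0 n) x ^+ 2) / 2)%:E)
       < (4 * kappa * mu / Num.max 3 (2 * kappa))%:E)%E) :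
  forall T : R, 0 <= T ->
    (LooL2norm `]0%R, T[ L (wdt L (u n \- v n)%R) +
     LooL2norm `]0%R, T[ L (wdxx L (u n \- v n)%R))%E
      @[n --> \oo] --> 0%E.
Proof.
move=> T T_ge0; have [B B0 PhiB] := potential_bounded PhiP.
have [Lam Lam0 hLam] := selection_linear_bound PhiP.
(* A strict bound on the upper limit holds for all large indices; every use of it below is
   eventual. *)
have small' := limn_esup_lt small; move: small'; set c := _ / _ => small'.
have c0 : 0 <= c.
  have kp := ltW (potential_kappa PhiP); rewrite /c; apply: divr_ge0; last by rewrite le_max ler0n.
  by apply: mulr_ge0; [exact: mulr_ge0|exact: ltW].
(* The initial energy is at most [c + B * L], the potential being at most [B]; dividing by [mu / 2]
   bounds the second space derivative at later times. *)
pose CE := 2 / mu * (c + B * L).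
have mu2 : 0 <= 2 / mu by rewrite divr_ge0// ltW.
have rho2 : 0 <= 2 / rho by rewrite divr_ge0// ltW.
have CE0 : 0 <= CE by apply: mulr_ge0 => //; apply: addr_ge0 => //; apply: mulr_ge0 => //; exact: ltW.
have u02 n : L2 L (u0 n) := (H2_norms (u0_H2 n)).1.
have x0 n := L2_xf (u02 n); have x1 n := L2_xf (u1_L2 n).
have mz n := wderive2_measurable (u0_H2 n).
have db n : (\int[@lebesgue_measure R]_(x in `]0%R, L[)
      ((rho * u1 n x ^+ 2 + mu * wderive L 2 (u0 n) x ^+ 2) / 2)%:E < c%:E)%E ->
    (Q (@lebesgue_measure R) (u1 n \_ `]0%R, L[) <= (2 / rho * c)%:E)%E /\
    (Q (@lebesgue_measure R) (wderive L 2 (u0 n) \_ `]0%R, L[) <= (2 / mu * c)%:E)%E.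
  move=> h; have m1 := (x1 n).1.1; have mzn := mz n.
  exact: (data_bounds rho_gt0 mu_gt0 m1 mzn h).
apply: cvg_sum0; [by move=> n; exact: Lnorm_ge0|by move=> n; exact: Lnorm_ge0|].
move=> d d0; move: T_ge0; rewrite le_eqVlt => /orP[/eqP T0|T0].
  (* For [T = 0] the time interval is empty, so both norms are 0. *)
  apply: nearW => n; split; apply/(LooL2norm_le _ L _ (ltW d0)); apply: aeW => t.
    by rewrite /= in_itv/= -T0 => /andP[a b]; have := lt_trans a b; rewrite ltxx.
  by rewrite /= in_itv/= -T0 => /andP[a b]; have := lt_trans a b; rewrite ltxx.
have [eps eps0 dif] := difference_bound L_gt0 T0 rho_gt0 mu_gt0 Lam0 CE0 d0.
have cr : 0 <= 2 / rho * c by exact: mulr_ge0.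
have cm : 0 <= 2 / mu * c by exact: mulr_ge0.
have [w0 w1 w2] := test_moments L_gt0 (@H2_norms R L) u0_H2 u0_weak.
have [y0 y1 y2] := test_moments L_gt0 (@L2_norms R L) u1_L2 u1_weak.
have o1 : \forall n \near \oo, osc L eps (u1 n \_ `]0, L[).
  (* The energy bounds the velocities in L2, so [g] is the datum itself, with a null affine part. *)
  apply: (weak_osc_near L_gt0 cr x1 _ y0 y1 y2 eps0 (g := fun n => u1 n \_ `]0, L[)).
  apply: filterS small' => n /db[h _]; split; [exact: x1| |exact: Q_fin_le (x1 n).1.1 h].
  by exists 0, 0; apply: aeW => x _; rewrite mul0r !add0r.
have o0 : \forall n \near \oo, osc L eps (u0 n \_ `]0, L[).
  have K0 : 0 <= (L * (L + 2 / mu * c)) ^+ 2 * L by rewrite mulr_ge0 ?sqr_ge0// ltW.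
  (* The energy bounds the second derivatives only: up to an affine function the datum is their
     double primitive, bounded uniformly by [JJ_bound]. *)
  apply: (weak_osc_near L_gt0 K0 x0 _ w0 w1 w2 eps0
    (g := fun n => (J (J (wderive L 2 (u0 n) \_ `]0, L[))) \_ `]0, L[)).
  apply: filterS small' => n /db[_ h]; have mzn := mz n.
  have sz : sqi (@lebesgue_measure R) (wderive L 2 (u0 n) \_ `]0, L[).
    by split => //; apply: le_lt_trans h _; exact: ltry.
  have xz : xf L (wderive L 2 (u0 n) \_ `]0, L[).
    by split => // x xL; rewrite patchE mem_setE in_itv/= (negbTE xL).
  have cJJ : continuous (J (J (wderive L 2 (u0 n) \_ `]0, L[))).
    by apply: J_continuous; apply: continuous_locint; apply: J_continuous; exact: xf_locint xz.
  split; first exact: (xf_cst_itv L_gt0 cJJ).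
    have [a [b hab]] := wderive2_rel1 L_gt0 (u0_H2 n) sz; exists a, b.
    by apply: (ae_imp hab) => x hx xL; rewrite (hx xL) [in RHS]patchE mem_setE in_itv/= xL.
  apply: (patch_Rintegral_sqr_le L_gt0 cJJ) => x xL.
  exact: (JJ_bound L_gt0 xz cm (Q_fin_le sz.1 h) xL).
near=> n.
have sn : (\int[@lebesgue_measure R]_(x in `]0%R, L[)
    ((rho * u1 n x ^+ 2 + mu * wderive L 2 (u0 n) x ^+ 2) / 2)%:E < c%:E)%E by near: n.
have p0 : osc L eps (u0 n \_ `]0, L[) by near: n.
have p1 : osc L eps (u1 n \_ `]0, L[) by near: n.
have [cu wt wx [h hu W] en] := u_sol n; have [cv vt vx [z hz Wv] _] := v_sol n.
rewrite /= in hz; rewrite {}hz in Wv.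
have mU : measurable_fun (cylinder L) (u n) by case: wt => -[G [[]]].
have cPhi := potential_continuous PhiP; have Phi0 := potential_ge0 PhiP.
apply: (dif (u n) (v n) h (u0 n) (u1 n)) => //.
- apply: measurable_funS hu.1; first by apply: measurableX; exact: measurable_itv.
  by move=> [s y] [/=]; rewrite !in_itv/= !andbT => /ltW s0 /andP[/ltW y0' /ltW yL]; split; rewrite /= in_itv/= ?s0// y0'.
- exact: hLam hu.
have m0 := (x0 n).1.1; have m1 := (x1 n).1.1; have mzn := mz n.
have en' : {ae (@lebesgue_measure R), forall t, 0 < t ->
    (energy rho mu L Phi (u n) t <= (c + B * L)%:E)%E}.
  apply: (ae_imp en) => t ht t0; apply: le_trans (ht t0) _.
  by apply: energy0_le => //.
exact: (energy_Q_bound rho_gt0 mu_gt0 Phi0 cPhi T mU wt.2.1 wx.2.1 en').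
Unshelve. all: by end_near. Qed.
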